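(* Suppose that the marking strategy and the mesh refinement in the adaptive algorithm described in the context satisfy Assumptions (M) and (R1), (R2), (R3) (all stated in the context). Then the sequence of approximations $(u_\ell^{nl},\boldsymbol\sigma_\ell^{nr})\in\mathbb V_\ell\times\mathbb W_\ell$, $\ell=0,1,2,\dots$, generated by this algorithm satisfies $$\lim_{\ell\to\infty}\Big(\|u^{nl}-u_\ell^{nl}\|_1+\|\boldsymbol\sigma^{nl}-\boldsymbol\sigma_\ell^{nr}\|_{H(\mathrm{div})}+\eta_\ell^{nls}(\boldsymbol\sigma_\ell^{nr},u_\ell^{nl})\Big)=0 .$$
   Context: **PDE.** $\Omega\subset\mathbb R^d$ ($d=2,3$) is a bounded, open, connected set with Lipschitz boundary, $f\in L^2(\Omega)$. $(\cdot,\cdot)$ is the $L^2(\Omega)$ inner product; $\|\cdot\|_{0,\omega}$, $\|\cdot\|_{1,\omega}$ are the $L^2(\omega)$ and $H^1(\omega)$ norms (subscript $\omega$ omitted if $\omega=\Omega$), $\|\boldsymbol\tau\|_{H(\mathrm{div};\omega)}^2=\|\boldsymbol\tau\|_{0,\omega}^2+\|\nabla\cdot\boldsymbol\tau\|_{0,\omega}^2$, $\|\cdot\|_{H(\mathrm{div})}=\|\cdot\|_{H(\mathrm{div};\Omega)}$. Let $a_{nl}(w,v)=(\nabla w,\nabla v)+(w,v)+(w^3,v)$ for $w,v\in H_0^1(\Omega)$. $u^{nl}\in H_0^1(\Omega)$ is the unique solution of $a_{nl}(u^{nl},v)=(f,v)$ for all $v\in H_0^1(\Omega)$ (the weak form of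 $-\Delta u+u+u^3=f$, $u=0$ on $\partial\Omega$), and $\boldsymbol\sigma^{nl}=-\nabla u^{nl}\in H(\mathrm{div};\Omega)$. **Meshes.** $\mathcal T_0$ is a conforming simplicial triangulation of $\Omega$. For a mesh $\mathcal T_\bullet$, $h_\bullet\in L^\infty(\Omega)$ is defined by $h_\bullet|_T=|T|^{1/d}$. $\mathrm{refine}(\mathcal T_\bullet,\mathcal M_\bullet)$ is the newest vertex bisection refinement of $\mathcal T_\bullet$ refining at least all marked elements $\mathcal M_\bullet\subset\mathcal T_\bullet$. $\mathbb T$ is the set of all meshes obtained from $\mathcal T_0$ by finitely many refinements. (R1) With a constant $0<q<1$: for a refinement $\mathcal T_\oplus$ of $\mathcal T_\bullet$, $h_\oplus\le h_\bullet$ a.e. in $\Omega$ and $h_\oplus\le q\,h_\bullet$ on every $T\in\mathcal T_\bullet\setminus\mathcal T_\oplus$. (R2) There is $\kappa>0$ depending only on $\mathcal T_0$ with $\mathrm{diam}(T)^d\le\kappa|T|$ for all $T\in\mathcal T_\bullet$, $\mathcal T_\bullet\in\mathbb T$. (R3) $\mathcal M_\bullet\cap\mathrm{refine}(\mathcal T_\bullet,\mathcal M_\bullet)=\emptyset$ for all $\mathcal T_\bullet\in\mathbb T$ and $\mathcal M_\bullet\subset\mathcal T_\bullet$. **Finite elements.** $\mathbb V_\bullet=\{v\in H_0^1(\Omega): v|_T\in P_1(T)\ \forall T\in\mathcal T_\bullet\}$; $\mathbb W_\bullet=\{\boldsymbol\tau\in H(\mathrm{div};\Omega):\boldsymbol\tau|_T\in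 P_0(T)^d+\mathbf x P_0(T)\ \forall T\in\mathcal T_\bullet\}$, where $P_n(T)$ is the space of polynomials of degree $n$ on $T$. **Estimator.** For $T\in\mathcal T_\bullet$, $\eta_\bullet^{nls}(T;\boldsymbol\tau,v)=\big(\|\boldsymbol\tau+\nabla v\|_{0,T}^2+\|\nabla\cdot\boldsymbol\tau+v+v^3-f\|_{0,T}^2\big)^{1/2}$ and $\eta_\bullet^{nls}(\boldsymbol\tau,v)=\big(\sum_{T\in\mathcal T_\bullet}\eta_\bullet^{nls}(T;\boldsymbol\tau,v)^2\big)^{1/2}$. **Adaptive algorithm.** For $\ell=0,1,2,\dots$ (subscript $\ell$ meaning the object associated with $\mathcal T_\ell$): (i) compute the unique $u_\ell^{nl}\in\mathbb V_\ell$ with $a_{nl}(u_\ell^{nl},v)=(f,v)$ for all $v\in\mathbb V_\ell$; (ii) compute the unique $\boldsymbol\sigma_\ell^{nr}\in\mathbb W_\ell$ with $(\boldsymbol\sigma_\ell^{nr},\boldsymbol\tau)+(\nabla\cdot\boldsymbol\sigma_\ell^{nr},\nabla\cdot\boldsymbol\tau)=(-\nabla u_\ell^{nl},\boldsymbol\tau)+(f-u_\ell^{nl}-(u_\ell^{nl})^3,\nabla\cdot\boldsymbol\tau)$ for all $\boldsymbol\tau\in\mathbb W_\ell$; (iii) compute $\eta_\ell^{nls}(T;\boldsymbol\sigma_\ell^{nr},u_\ell^{nl})$ for all $T\in\mathcal T_\ell$; (iv) mark a set $\mathcal M_\ell\subset\mathcal T_\ell$ satisfying (M); (v) set $\mathcal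 T_{\ell+1}=\mathrm{refine}(\mathcal T_\ell,\mathcal M_\ell)$. **Assumption (M).** There is a fixed function $g:[0,\infty)\to[0,\infty)$, continuous at $0$, such that the set of marked elements $\mathcal M_\ell\subset\mathcal T_\ell$ (corresponding to the current approximation $(\boldsymbol\sigma_\ell^{nr},u_\ell^{nl})$) satisfies $\max_{T\in\mathcal T_\ell\setminus\mathcal M_\ell}\eta_\ell^{nls}(T;\boldsymbol\sigma_\ell^{nr},u_\ell^{nl})\le g\big(\max_{T\in\mathcal M_\ell}\eta_\ell^{nls}(T;\boldsymbol\sigma_\ell^{nr},u_\ell^{nl})\big)$.
   Formalization: Assumption (M) is stated with the additional condition g(0) = 0; without it the claim is false, since a large constant g lets the algorithm mark only one corner element (or nothing) forever, so the mesh stays coarse elsewhere and the error does not tend to 0. *)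

(* Defs.v *)
From HB Require Import structures.
From mathcomp Require Import all_boot all_order all_algebra finmap.
From mathcomp Require Import all_classical all_reals all_analysis.
Set Implicit Arguments.
Unset Strict Implicit.
Unset Printing Implicit Defensive.
Import Order.TTheory GRing.Theory Num.Theory.
Import numFieldTopology.Exports numFieldNormedType.Exports.
Local Open Scope classical_set_scope.
Local Open Scope ring_scope.

(* Functions on R^d are everywhere-defined representatives; equality of L^2
   classes is equality almost everywhere. All integrals are [Rintegral], i.e.
   real-valued and 0 when the extended-real integral is infinite. *)

(* The sigma-algebra on R^n is generated by the coordinates, as the library does
   for n-tuples; it is the Borel sigma-algebra. *)
Section MeasurableMatrix.
Context (R : realType) (n : nat).

Let coord (i : 'I_n) (x : 'rV[R]_n) : R := x ord0 i.

Let rV_set0 : g_sigma_preimage coord set0.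
Proof. exact: sigma_algebra0. Qed.

Let rV_setC A : g_sigma_preimage coord A -> g_sigma_preimage coord (~` A).
Proof. exact: sigma_algebraC. Qed.

Let rV_bigcup (F : _^nat) : (forall i, g_sigma_preimage coord (F i)) ->
  g_sigma_preimage coord (\bigcup_i (F i)).
Proof. exact: sigma_algebra_bigcup. Qed.

HB.instance Definition _ := @isMeasurable.Build default_measure_display
  'rV[R]_n (g_sigma_preimage coord) rV_set0 rV_setC rV_bigcup.

Lemma measurable_coord i : measurable_fun [set: 'rV[R]_n] (coord i).
Proof.
move=> _ Y mY; rewrite setTI; apply: sub_sigma_algebra => /=.
rewrite -bigcup_seq/=; exists i => /=; first by rewrite mem_index_enum.
by exists Y => //; rewrite setTI.
Qed.

Lemma measurable_fun_rV d (T : measurableType d) (f : T -> 'rV[R]_n) :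
  (forall i, measurable_fun [set: T] (fun x => f x ord0 i)) ->
  measurable_fun [set: T] f.
Proof.
move=> mf _ A mA; rewrite setTI.
suff : g_sigma_preimage coord `<=`
    [set A | measurable (f @^-1` A)] by exact.
apply: smallest_sub.
  split; first by rewrite /= preimage_set0.
  - by move=> B /= mB; rewrite setTD preimage_setC; exact: measurableC.
  - by move=> F /= mF; rewrite preimage_bigcup; exact: bigcupT_measurable.
rewrite -bigcup_seq; apply: bigcup_sub => i _ _ [B mB <-] /=.
rewrite setTI -[X in measurable X]setTI; exact: mf.
Qed.

End MeasurableMatrix.

Section LebesgueStep.
Context (R : realType) (n : nat).

Definition cons_rV (p : R * 'rV[R]_n) : 'rV[R]_n.+1 :=
  \row_i (if unlift ord0 i is Some j then p.2 ord0 j else p.1).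

Definition uncons_rV (z : 'rV[R]_n.+1) : R * 'rV[R]_n :=
  (z ord0 ord0, \row_j z ord0 (lift ord0 j)).

Lemma cons_rVK : cancel cons_rV uncons_rV.
Proof.
move=> [x y]; rewrite /uncons_rV mxE unlift_none; congr pair.
by apply/rowP => j; rewrite !mxE liftK.
Qed.

Lemma measurable_cons_rV : measurable_fun [set: R * 'rV[R]_n] cons_rV.
Proof.
apply: measurable_fun_rV => i; under eq_fun do rewrite mxE.
case: (unliftP ord0 i) => [j|] _; last exact: measurable_fst.
exact: (measurableT_comp (measurable_coord j) measurable_snd).
Qed.

Lemma measurable_uncons_rV : measurable_fun [set: 'rV[R]_n.+1] uncons_rV.
Proof.
apply/measurable_fun_pairP; split; first exact: (measurable_coord ord0).
apply: measurable_fun_rV => i /=; under eq_fun do rewrite mxE.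
exact: measurable_coord.
Qed.

Variable mu : {sigma_finite_measure set 'rV[R]_n -> \bar R}.

Definition lebesgue_cons : set 'rV[R]_n.+1 -> \bar R :=
  pushforward (@lebesgue_measure R \x mu)%E cons_rV.

Let m0 : lebesgue_cons set0 = 0%E.
Proof. by rewrite /lebesgue_cons /pushforward preimage_set0 measure0. Qed.

Let m_ge0 A : (0 <= lebesgue_cons A)%E.
Proof. by rewrite /lebesgue_cons /pushforward; exact: measure_ge0. Qed.

Let m_sigma_additive : semi_sigma_additive lebesgue_cons.
Proof.
exact: (@measure_semi_sigma_additive _ _ _
  (measure_function_pushforward__canonical__measure_function_Measure
     (@lebesgue_measure R \x mu)%E measurable_cons_rV)).
Qed.

HB.instance Definition _ := isMeasure.Build _ _ _
  lebesgue_cons m0 m_ge0 m_sigma_additive.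

Let m_sigma_finite : sigma_finite setT lebesgue_cons.
Proof.
have /sigma_finiteP[F [TF ndF Foo]] := sigma_finiteT (@lebesgue_measure R).
have /sigma_finiteP[G [TG ndG Goo]] := sigma_finiteT mu.
exists (fun k => uncons_rV @^-1` (F k `*` G k)).
  rewrite predeqE => z; split=> // _.
  have [k _ Fk] : (\bigcup_k F k) (uncons_rV z).1 by rewrite -TF.
  have [l _ Gl] : (\bigcup_k G k) (uncons_rV z).2 by rewrite -TG.
  exists (maxn k l) => //; split.
    by move: Fk; exact/subsetPset/ndF/leq_maxl.
  by move: Gl; exact/subsetPset/ndG/leq_maxr.
move=> k; have [mF Fk] := Foo k; have [mG Gk] := Goo k; split.
  rewrite -[X in measurable X]setTI; apply: measurable_uncons_rV => //.
  exact: measurableX.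
rewrite /lebesgue_cons /pushforward -comp_preimage.
rewrite (_ : uncons_rV \o cons_rV = id); last first.
  by apply/funext => p; exact: cons_rVK.
by rewrite preimage_id product_measure1E// lte_mul_pinfty// ge0_fin_numE.
Qed.

HB.instance Definition _ := Measure_isSigmaFinite.Build _ _ _
  lebesgue_cons m_sigma_finite.

End LebesgueStep.

Fixpoint lebesgue (R : realType) (n : nat) :
    {sigma_finite_measure set 'rV[R]_n -> \bar R} :=
  match n with
  | 0 => [the {sigma_finite_measure set _ -> \bar R} of \d_(0 : 'rV[R]_0)]
  | m.+1 => [the {sigma_finite_measure set _ -> \bar R} of
             lebesgue_cons (lebesgue R m)]
  end.

Section Sobolev.
Context (R : realType) (d : nat).
Local Notation E := 'rV[R]_d.
Local Notation mu := (lebesgue R d).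
Implicit Types (Omega w : set E) (u v f phi : E -> R) (tau sigma : E -> E).

Definition dot (x y : E) : R := \sum_(i < d) x ord0 i * y ord0 i.

Definition enorm (x : E) : R := Num.sqrt (dot x x).

(* Near each boundary point, in suitable orthonormal coordinates, Omega is the
   strict epigraph of a Lipschitz function of d - 1 variables. *)
Definition lipschitz_boundary Omega :=
  forall p, (closure Omega `\` Omega^°) p ->
  exists (A : 'M[R]_d) (i : 'I_d) (gamma : 'rV[R]_d.-1 -> R) (U : set E),
    [/\ A *m A^T = 1%:M, lipschitz gamma, nbhs p U &
      forall x, U x ->
        (Omega x <-> gamma (col' i ((x - p) *m A)) < ((x - p) *m A) ord0 i)].

Definition lipschitz_domain Omega :=
  [/\ bounded_set Omega, open Omega, connected Omega & lipschitz_boundary Omega].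

Definition pderiv (i : 'I_d) phi : E -> R := 'D_(delta_mx ord0 i) phi.

Definition smooth phi := forall s : seq 'I_d,
  continuous (foldr pderiv phi s) /\
  forall i x, derivable (foldr pderiv phi s) x (delta_mx ord0 i).

Definition test_function Omega phi := smooth phi /\
  exists K, [/\ compact K, K `<=` Omega & forall x, ~ K x -> phi x = 0].

Definition inner w u v : R := \int[mu]_(x in w) (u x * v x).
Definition vinner w sigma tau : R := \int[mu]_(x in w) dot (sigma x) (tau x).
Definition norm0 w v : R := Num.sqrt (inner w v v).
Definition vnorm0 w tau : R := Num.sqrt (vinner w tau tau).

Definition in_L2 w v :=
  measurable_fun w v /\ mu.-integrable w (fun x => ((v x) ^+ 2)%:E).
Definition in_vL2 w tau := forall i, in_L2 w (fun x => tau x ord0 i).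

Definition is_weak_grad Omega v (G : E -> E) := in_vL2 Omega G /\
  forall phi, test_function Omega phi -> forall i,
    inner Omega v (pderiv i phi) = - inner Omega (fun x => G x ord0 i) phi.

Definition is_weak_div Omega tau (D : E -> R) := in_L2 Omega D /\
  forall phi, test_function Omega phi ->
    vinner Omega tau (fun x => \row_i pderiv i phi x) = - inner Omega D phi.

(* A chosen representative on Omega (unique a.e. in Omega if there is one);
   its values outside Omega carry no information. *)
Definition wgrad Omega v : E -> E := xget (cst 0) [set G | is_weak_grad Omega v G].
Definition wdiv Omega tau : E -> R := xget (cst 0) [set D | is_weak_div Omega tau D].

Definition in_H1 Omega v := in_L2 Omega v /\ exists G, is_weak_grad Omega v G.
Definition in_Hdiv Omega tau :=
  in_vL2 Omega tau /\ exists D, is_weak_div Omega tau D.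

Definition norm1 Omega v : R :=
  Num.sqrt (norm0 Omega v ^+ 2 + vnorm0 Omega (wgrad Omega v) ^+ 2).
Definition norm_Hdiv Omega tau : R :=
  Num.sqrt (vnorm0 Omega tau ^+ 2 + norm0 Omega (wdiv Omega tau) ^+ 2).

Definition in_H10 Omega v := in_H1 Omega v /\
  forall e, 0 < e -> exists2 phi, test_function Omega phi & norm1 Omega (v \- phi) < e.

Definition a_nl Omega (w v : E -> R) : R :=
  vinner Omega (wgrad Omega w) (wgrad Omega v) + inner Omega w v
  + inner Omega (fun x => w x ^+ 3) v.

(* u solves the Galerkin problem in the subspace V of H^1_0. *)
Definition solves_nl Omega f (V : (E -> R) -> Prop) u :=
  V u /\ forall v, V v -> a_nl Omega u v = inner Omega f v.

End Sobolev.

Section Meshes.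
Context (R : realType) (d : nat).
Local Notation E := 'rV[R]_d.
Local Notation mu := (lebesgue R d).

(* Newest vertex bisection in dimension d acts on simplices
   (z_0, ..., z_d)_gamma, where the order of the vertices and the type gamma
   encode the refinement edge z_0 z_d and those of all descendants. *)
Definition simplex : Type := (seq E * 'I_d)%type.
Definition mesh : Type := {fset simplex}.
Implicit Types (Omega : set E) (K : simplex) (T M : mesh).

Definition hull (s : seq E) : set E := [set x | exists c : nat -> R,
  [/\ forall i, 0 <= c i, \sum_(i < size s) c i = 1
    & x = \sum_(i < size s) c i *: s`_i]].

Definition nondegenerate_simplex K := size K.1 = d.+1 /\
  row_free (\matrix_(i < d) (K.1`_i.+1 - K.1`_0)).

Definition conforming_triangulation Omega T :=
  [/\ forall K, K \in T -> nondegenerate_simplex K,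
     closure Omega = \bigcup_(K in [set` T]) hull K.1
   & forall K K', K \in T -> K' \in T -> K != K' ->
       ~~ perm_eq K.1 K'.1 /\
       hull K.1 `&` hull K'.1 = hull [seq z <- K.1 | z \in K'.1]].

(* The two children of (z_0, ..., z_d)_gamma, with m = (z_0 + z_d) / 2, are
     (z_0, m, z_1, ..., z_{d-1})_{gamma + 1 mod d} and
     (z_d, m, z_1, ..., z_gamma, z_{d-1}, ..., z_{gamma+1})_{gamma + 1 mod d}
   (Maubach, Traxler, Stevenson); for d = 2 this is planar newest vertex
   bisection, m being the newest vertex. *)
Definition bisect K : seq simplex :=
  let z0 := head 0 K.1 in
  let zd := last 0 K.1 in
  let mid := take d.-1 (behead K.1) in
  let m := 2^-1 *: (z0 + zd) in
  [:: (z0 :: m :: mid, ordS K.2);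
      (zd :: m :: take K.2 mid ++ rev (drop K.2 mid), ordS K.2)].

Definition bisection_step T T' :=
  exists2 K, K \in T & T' = ((T `\ K) `|` seq_fset tt (bisect K))%fset.

(* Reflexive-transitive closure; the intermediate meshes need not be conforming. *)
Inductive nvb_refines T : mesh -> Prop :=
| nvb_refl : nvb_refines T T
| nvb_step T1 T2 : nvb_refines T T1 -> bisection_step T1 T2 -> nvb_refines T T2.

(* T' is the coarsest conforming bisection refinement of T in which all elements
   of M are refined. *)
Definition nvb_refinement Omega T M T' :=
  let admissible T'' := [/\ nvb_refines T T'', conforming_triangulation Omega T''
                          & (M `&` T'' = fset0)%fset] in
  admissible T' /\ forall T'', admissible T'' -> nvb_refines T' T''.

(* Meshes obtained from T by finitely many applications of refine. *)
Inductive refinements (refine : mesh -> mesh -> mesh) T : mesh -> Prop :=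
| refinements_refl : refinements refine T T
| refinements_step T' M : refinements refine T T' -> (M `<=` T')%fset ->
    refinements refine T (refine T' M).

Definition is_nvb Omega (refine : mesh -> mesh -> mesh) T0 :=
  forall T M, refinements refine T0 T -> (M `<=` T)%fset ->
    nvb_refinement Omega T M (refine T M).

Definition volume K : R := fine (mu (hull K.1)).

Definition diam (A : set E) : R :=
  sup [set r | exists x y, [/\ A x, A y & r = enorm (x - y)]].

(* |K|^(1/d) inside each element; 0 on the skeleton, a null set. *)
Definition meshsize T (x : E) : R :=
  \sum_(K <- T) (volume K `^ (d%:R^-1)) * \1_((hull K.1)^°) x.

Definition R1 Omega refine T0 (q : R) :=
  forall T T', refinements refine T0 T -> refinements refine T T' ->
    {ae mu, forall x, Omega x -> meshsize T' x <= meshsize T x} /\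
    forall K, K \in T -> K \notin T' ->
      {ae mu, forall x, hull K.1 x -> meshsize T' x <= q * meshsize T x}.

Definition R2 refine T0 (kappa : R) :=
  forall T K, refinements refine T0 T -> K \in T ->
    diam (hull K.1) ^+ d <= kappa * volume K.

Definition R3 refine T0 :=
  forall T M, refinements refine T0 T -> (M `<=` T)%fset ->
    (M `&` refine T M = fset0)%fset.

(* An element without its boundary part on the boundary of Omega, a null set on
   which wgrad and wdiv are unspecified. *)
Definition cell Omega K : set E := hull K.1 `&` Omega.

Definition P1_space Omega T (v : E -> R) := in_H10 Omega v /\
  forall K, K \in T -> exists (a : E) (b : R),
    {ae mu, forall x, cell Omega K x -> v x = dot a x + b}.

Definition RT0_space Omega T (tau : E -> E) := in_Hdiv Omega tau /\
  forall K, K \in T -> exists (a : E) (b : R),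
    {ae mu, forall x, cell Omega K x -> tau x = a + b *: x}.

Definition eta_elem Omega (f : E -> R) K (tau : E -> E) (v : E -> R) : R :=
  Num.sqrt (vnorm0 (cell Omega K) (fun x => tau x + wgrad Omega v x) ^+ 2 +
    norm0 (cell Omega K) (fun x => wdiv Omega tau x + v x + v x ^+ 3 - f x) ^+ 2).

Definition eta Omega f T tau v : R :=
  Num.sqrt (\sum_(K <- T) eta_elem Omega f K tau v ^+ 2).

Definition solves_nr Omega f T (u : E -> R) (sigma : E -> E) :=
  RT0_space Omega T sigma /\
  forall tau, RT0_space Omega T tau ->
    vinner Omega sigma tau + inner Omega (wdiv Omega sigma) (wdiv Omega tau) =
    vinner Omega (fun x => - wgrad Omega u x) tau
    + inner Omega (fun x => f x - u x - u x ^+ 3) (wdiv Omega tau).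

(* Maxima over the empty set are 0. The condition g 0 = 0 is part of the marking
   assumption: with, say, a large constant g, empty marked sets would always be
   allowed. *)
Definition marking_function (g : R -> R) :=
  [/\ forall x, 0 <= x -> 0 <= g x,
     g x @[x --> within [set y | 0 <= y] (nbhs (0 : R))] --> g 0 & g 0 = 0].

Definition marking Omega f (g : R -> R) T M sigma u :=
  \big[Num.max/0]_(K <- (T `\` M)%fset) eta_elem Omega f K sigma u <=
  g (\big[Num.max/0]_(K <- M) eta_elem Omega f K sigma u).

End Meshes.

(* Main.v *)
Require Import Defs.
From mathcomp Require Import all_boot all_order all_algebra finmap.
From mathcomp Require Import all_classical all_reals all_analysis.
From mathcomp Require Import measurable_realfun.
From mathcomp Require Import ring lra.

(* The Galerkin solutions u_l decrease a strictly convex energy over nested spaces, so they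
   converge in H^1_0; the cubic term is controlled by the Sobolev embedding into L^6. The
   fluxes sigma_l are projections of converging data onto nested spaces, so they converge in
   H(div). Hence the residuals R_l = (sigma_l + grad u_l, div sigma_l + u_l + u_l^3 - f)
   converge in L^2 to some R, and eta_l is the L^2 norm of R_l.
   A refined element K loses at least (1 - q) |K|^(1/d + 1) of the integral of the mesh size,
   so the volumes of marked elements tend to 0, and with them the marked indicators; by (M)
   all indicators tend to 0. So R vanishes on every element that is eventually kept, while
   almost everywhere else the mesh size tends to 0.
   R_l is orthogonal to (grad v, v) and (tau, div tau) for discrete v and tau. Interpolation
   errors are O(h_l) elementwise, so R is orthogonal to (grad phi, phi) for test functions
   phi, and to (phi e_m, d_m phi) for all smooth compactly supported phi on R^d. The second
   says that the scalar part p of R has zero trace and gradient the vector part of R; the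
   first, tested with p, gives R = 0, whence the limits are u^nl and sigma^nl. *)

Set Implicit Arguments.
Unset Strict Implicit.
Unset Printing Implicit Defensive.
Import Order.TTheory GRing.Theory Num.Theory.
Import numFieldTopology.Exports numFieldNormedType.Exports.
Local Open Scope classical_set_scope.
Local Open Scope ring_scope.

(** * Lebesgue measure on R^n *)

(** RT0 functions carry no boundary condition, so the residual may be tested with [phi e_m] for
    [phi] that do not vanish on the boundary. This is what gives the limit zero trace, and the
    Lipschitz boundary turns zero trace into membership in H^1_0: translate inwards, then mollify.
    Instead of face fluxes, the Raviart-Thomas interpolation uses an algebraic identity that
    expresses [phi e_m] by [phi], the products [x_j phi] and their first derivatives. Replacing
    [phi] and [x_j phi] by continuous piecewise affine interpolants yields an RT0 field whose
    divergence is the m-th derivative of the interpolant of [phi]. All discrete approximation is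
    thus nodal affine interpolation. The meshes need not become fine everywhere, so the interpolants
    need not converge. Their errors are only ever paired with the limit residual, and the product of
    that residual with the mesh size tends to 0 almost everywhere. Gradients and divergences are
    chosen representatives, so identities between them hold almost everywhere; a function with its
    derivatives is treated as one finite tuple in L^2. *)

Section RectangleMeasure.
Context {R : realType}.

Definition rect n (A : 'I_n -> set R) : set 'rV[R]_n :=
  [set x | forall i, A i (x ord0 i)].

Lemma measurable_rect n (A : 'I_n -> set R) :
  (forall i, measurable (A i)) -> measurable (rect A).
Proof.
move=> mA; rewrite (_ : rect A =
    \bigcap_(i in [set: 'I_n]) ((fun x : 'rV[R]_n => x ord0 i) @^-1` A i)).
  apply: fin_bigcap_measurable => // i _.
  by rewrite -[X in measurable X]setTI; exact: measurable_coord.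
by apply/seteqP; split => [x Ax i _|x Ax i]; [exact: Ax|exact: (Ax i I)].
Qed.

Lemma measurable_rVE n : (measurable : set (set 'rV[R]_n)) =
  <<s [set B | exists2 A : 'I_n -> set R, (forall i, measurable (A i)) &
       B = rect A] >>.
Proof.
apply/seteqP; split; last first.
  apply: smallest_sub; first exact: sigma_algebra_measurable.
  by move=> _ [A mA ->]; exact: measurable_rect.
apply: smallest_sub; first exact: smallest_sigma_algebra.
rewrite -bigcup_seq; apply: bigcup_sub => i _ _ [Y mY <-] /=; rewrite setTI.
apply: sub_sigma_algebra.
exists (fun j => if j == i then Y else setT).
  by move=> j; case: ifP.
apply/seteqP; split => [x Yx j|x /(_ i)]; last by rewrite eqxx.
by case: eqP => // ->.
Qed.

(** [lebesgue] peels off coordinate 0 only; insertion at an arbitrary position [i] allows slicing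
    along any coordinate axis. *)
Definition ins n (i : 'I_n.+1) (p : R * 'rV[R]_n) : 'rV[R]_n.+1 :=
  \row_j (if unlift i j is Some k then p.2 ord0 k else p.1).

Lemma ins_same n (i : 'I_n.+1) p : ins i p ord0 i = p.1.
Proof. by rewrite mxE unlift_none. Qed.

Lemma ins_lift n (i : 'I_n.+1) p k : ins i p ord0 (lift i k) = p.2 ord0 k.
Proof. by rewrite mxE liftK. Qed.

Lemma measurable_ins n (i : 'I_n.+1) : measurable_fun setT (ins i).
Proof.
apply: measurable_fun_rV => j; under eq_fun do rewrite mxE.
case: (unliftP i j) => [k|] _; last exact: measurable_fst.
exact: (measurableT_comp (measurable_coord k) measurable_snd).
Qed.

Lemma preimage_ins_rect n (i : 'I_n.+1) (A : 'I_n.+1 -> set R) :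
  ins i @^-1` rect A = A i `*` rect (fun k => A (lift i k)).
Proof.
apply/seteqP; split => [[t y] Aty|[t y] [At Ay] j] /=.
  split => /=; first by have := Aty i; rewrite ins_same.
  by move=> k; have := Aty (lift i k); rewrite ins_lift.
by case: (unliftP i j) => [k|] ->; [rewrite ins_lift; exact: Ay|rewrite ins_same].
Qed.

Lemma lebesgue_rect n (A : 'I_n -> set R) : (forall i, measurable (A i)) ->
  lebesgue R n (rect A) = (\prod_(i < n) lebesgue_measure (A i))%E.
Proof.
elim: n A => [|n IH] A mA.
  rewrite big_ord0 /= diracE; case: (boolP (_ \in _)) => //; rewrite notin_setE.
  by move=> H; exfalso; apply: H => -[].
rewrite big_ord_recl -IH//= -product_measure1E//; last exact: measurable_rect.
  by rewrite /lebesgue_cons /pushforward -preimage_ins_rect.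
exact: mA.
Qed.

Definition cube n (r : R) : set 'rV[R]_n := rect (fun=> `[- r, r]%classic).
Arguments cube n r : clear implicits.

Lemma lebesgue_cube n r : (lebesgue R n (cube n r) < +oo)%E.
Proof.
rewrite lebesgue_rect// ltey_eq; apply/orP; left.
elim/big_ind: _ => //; first exact: fin_numM.
by move=> i _; rewrite lebesgue_measure_itv/=; case: ifP.
Qed.

(** Boxes form a pi-system that generates the sigma-algebra, and integer cubes exhaust the space
    with finite measure. Invariance properties of [lebesgue] are therefore checked on boxes only. *)
Lemma lebesgue_unique n (m : {measure set 'rV[R]_n -> \bar R}) :
  (forall A, (forall i, measurable (A i)) ->
     m (rect A) = (\prod_(i < n) lebesgue_measure (A i))%E) ->
  forall X, measurable X -> lebesgue R n X = m X.
Proof.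
move=> mE X mX.
apply: (measure_unique _ (fun k => cube n k%:R) (measurable_rVE n)) => //.
- move=> _ _ [A mA ->] [B mB ->]; exists (fun i => A i `&` B i).
    by move=> i; exact: measurableI.
  apply/seteqP; split => [x [Ax Bx] i|x ABx]; first by split; [exact: Ax|exact: Bx].
  by split=> i; have [] := ABx i.
- by move=> k; exists (fun=> `[- k%:R, k%:R]%classic).
- apply/seteqP; split => // x _; pose k := Num.bound `|x|.
  exists k => // i; rewrite /= in_itv/=.
  have : `|x ord0 i| <= k%:R.
    apply: (@le_trans _ _ `|x|); last exact/ltW/archi_boundP.
    rewrite /Num.Def.normr/= mx_normrE.
    exact: (le_bigmax _ (fun ij : 'I_1 * 'I_n => `|x ij.1 ij.2|) (ord0, i)).
  by rewrite ler_norml.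
- move=> _ [A mA ->]; exact: (etrans (lebesgue_rect mA) (esym (mE _ mA))).
- move=> k; exact: lebesgue_cube.
Qed.

End RectangleMeasure.
Arguments cube {R} n r.

(** * Slicing along any coordinate, translation invariance, Borel sets *)

Section Transfer.
Context {R : realType}.
Local Notation mu n := (lebesgue R n).

Definition pushm d1 d2 (T1 : measurableType d1) (T2 : measurableType d2)
    (m : {measure set T1 -> \bar R}) (phi : T1 -> T2)
    (mphi : measurable_fun setT phi) : {measure set T2 -> \bar R} :=
  measure_function_pushforward__canonical__measure_function_Measure m mphi.

Local Notation prodm n := [the measure _ _ of (@lebesgue_measure R \x mu n)%E].

(** Half-open intervals determine Lebesgue measure on the line, and a shift preserves their
    length. *)
Lemma lebesgue_measure_shift (a : R) (A : set R) : measurable A ->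
  lebesgue_measure ((fun t => t + a) @^-1` A) = lebesgue_measure A.
Proof.
move=> mA; have mf : @measurable_fun _ _ (measurableTypeR R) (measurableTypeR R)
    setT (fun t : R => t + a).
  exact: (@measurable_funD _ _ R _ id (cst a)).
suff H X : ocitv X ->
    lebesgue_measure X = pushm (@lebesgue_measure R) mf X.
  exact/esym/(lebesgue_measure_unique H).
move=> [[x y] _ <-]; rewrite /pushm/= /pushforward.
rewrite (_ : _ @^-1` _ = `]x - a, y - a]%classic); last first.
  by apply/seteqP; split => t /=; rewrite !in_itv/= ltrBlDr lerBrDr.
rewrite !lebesgue_measure_itv/= !lte_fin ltrD2r; case: ifP => // _.
by rewrite -!EFinD; congr EFin; ring.
Qed.

Lemma lebesgue_ins n (i : 'I_n.+1) (X : set 'rV[R]_n.+1) : measurable X ->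
  mu n.+1 X = (@lebesgue_measure R \x mu n)%E (ins i @^-1` X).
Proof.
move=> mX.
apply: (@lebesgue_unique R n.+1 (pushm (prodm n) (measurable_ins i)) _ X mX) => A mA.
rewrite /pushm/= /pushforward preimage_ins_rect product_measure1E//; last first.
- exact: measurable_rect.
- exact: mA.
by rewrite lebesgue_rect// (bigD1_ord i).
Qed.

Lemma measurable_shift n (z : 'rV[R]_n) : measurable_fun setT (fun x : 'rV[R]_n => x + z).
Proof.
apply: measurable_fun_rV => i; under eq_fun do rewrite mxE.
by apply: measurable_funD => //; exact: measurable_coord.
Qed.

Lemma lebesgue_shift n (z : 'rV[R]_n) (X : set 'rV[R]_n) : measurable X ->
  mu n ((fun x : 'rV[R]_n => x + z) @^-1` X) = mu n X.
Proof.
move=> mX; apply/esym.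
apply: (@lebesgue_unique R n (pushm (mu n) (measurable_shift z)) _ X mX) => A mA.
rewrite /pushm/= /pushforward.
rewrite (_ : _ @^-1` _ = rect (fun i => (fun t => t + z ord0 i) @^-1` A i)).
  rewrite lebesgue_rect.
    apply: eq_bigr => i _.
    exact: lebesgue_measure_shift.
  move=> i; rewrite -[X in measurable X]setTI.
  by apply: measurable_funD => //.
by apply/seteqP; split => x Ax i; have := Ax i; rewrite /= mxE.
Qed.

Lemma ge0_integral_ins n (i : 'I_n.+1) (f : 'rV[R]_n.+1 -> \bar R) :
  measurable_fun setT f -> (forall x, 0 <= f x)%E ->
  (\int[mu n.+1]_x f x = \int[@lebesgue_measure R \x mu n]_p f (ins i p))%E.
Proof.
move=> mf f0; transitivity
    (\int[pushforward (@lebesgue_measure R \x mu n)%E (ins i)]_x f x)%E.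
  apply: (@eq_measure_integral _ _ R setT
    (pushm (prodm n) (measurable_ins i)) (mu n.+1)) => A mA _.
  exact: lebesgue_ins.
by apply: (@ge0_integral_pushforward _ _ (measurableTypeR R * 'rV[R]_n)%type _ R
  (ins i) (measurable_ins i) (prodm n) _ _ measurableT mf).
Qed.

Lemma integral_shift n (z : 'rV[R]_n) (f : 'rV[R]_n -> \bar R) :
  measurable_fun setT f -> (\int[mu n]_x f (x + z)%R = \int[mu n]_x f x)%E.
Proof.
move=> mf.
have ge0 (g : 'rV[R]_n -> \bar R) : measurable_fun setT g ->
    (forall x, 0 <= g x)%E -> (\int[mu n]_x g (x + z)%R = \int[mu n]_x g x)%E.
  move=> mg g0; transitivity
      (\int[pushforward (mu n) (fun x : 'rV[R]_n => (x + z)%R)]_x g x)%E.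
    apply/esym.
    apply: (ge0_integral_pushforward (measurable_shift z) (mu n) measurableT mg).
    by move=> x _; exact: g0.
  apply: (@eq_measure_integral _ _ R setT (mu n)
    (pushm (mu n) (measurable_shift z))) => A mA _; exact: lebesgue_shift.
have hp := ge0 (f^\+)%E (measurable_funepos mf) (fun x => funepos_ge0 f x).
have hn := ge0 (f^\-)%E (measurable_funeneg mf) (fun x => funeneg_ge0 f x).
rewrite integralE [RHS]integralE -hp -hn.
by congr (_ - _)%E; apply: eq_integral => x _; rewrite ?funeposE ?funenegE.
Qed.

Lemma integrable_shift n (z : 'rV[R]_n) (f : 'rV[R]_n -> \bar R) :
  (mu n).-integrable setT f -> (mu n).-integrable setT (fun x => f (x + z)).
Proof.
move=> /integrableP[mf foo]; apply/integrableP; split.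
  exact: (measurableT_comp mf (measurable_shift z)).
rewrite (integral_shift z (f := fun x => `|f x|%E))//.
exact: measurableT_comp.
Qed.

Lemma coord_norm n (x : 'rV[R]_n) i : `|x ord0 i| <= `|x|.
Proof.
rewrite [leRHS]/Num.Def.normr/= mx_normrE.
exact: (le_bigmax _ (fun ij : 'I_1 * 'I_n => `|x ij.1 ij.2|) (ord0, i)).
Qed.

Lemma norm_coordP n (x : 'rV[R]_n) r : 0 <= r ->
  `|x| <= r <-> forall i, `|x ord0 i| <= r.
Proof.
move=> r0; split=> [xr i|xr]; first exact: (le_trans (coord_norm x i)).
rewrite [leLHS]/Num.Def.normr/= mx_normrE; apply: bigmax_le => //= -[a i] _ /=.
by rewrite (ord1 a).
Qed.

Lemma norm_coord_lt n (x : 'rV[R]_n) r : 0 < r ->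
  (forall i, `|x ord0 i| < r) -> `|x| < r.
Proof.
move=> r0 xr; rewrite [ltLHS]/Num.Def.normr/= mx_normrE.
by apply: bigmax_lt => //= -[a i] _ /=; rewrite (ord1 a).
Qed.

(** The sigma-algebra is generated by the coordinates, so open sets are reached through a countable
    base: boxes with rational centres and half-width 1/(m+1). *)
Lemma open_measurable_rV n (U : set 'rV[R]_n) : open U -> measurable U.
Proof.
move=> oU.
pose B (p : {ffun 'I_n -> rat} * nat) : set 'rV[R]_n :=
  rect (fun i => ball (ratr (p.1 i) : R) (p.2.+1%:R^-1)).
rewrite (_ : U = \bigcup_(p in [set p | B p `<=` U]) B p).
  rewrite bigcup_mkcond; apply: countable_bigcupT_measurable => // p.
  case: ifP => _ //; apply: measurable_rect => i; exact: measurable_ball.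
apply/seteqP; split => [x Ux|x [p] /= + Bx]; last by apply.
have /nbhs_ballP[e /= e0 xe] : nbhs x U by exact: open_nbhs_nbhs.
have e20 : 0 < e / 2 by rewrite divr_gt0.
pose k := Num.bound ((e / 2)^-1).
have ke : k.+1%:R^-1 < e / 2.
  rewrite -[ltRHS]invrK ltf_pV2 ?posrE ?invr_gt0 ?ltr0n//.
  rewrite (lt_le_trans (archi_boundP _)) ?invr_ge0 ?(ltW e20)//.
  by rewrite ler_nat.
have k0 : 0 < k.+1%:R^-1 :> R by rewrite invr_gt0.
have /choice[q qP] : forall i : 'I_n, exists q : rat,
    ball (ratr q : R) (k.+1%:R^-1) (x ord0 i).
  move=> i.
  have [] := @dense_rat R (ball (x ord0 i) (k.+1%:R^-1)).
    by exists (x ord0 i); exact: ballxx.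
    exact: ball_open.
  move=> r [xq [q _ qE]]; rewrite -qE in xq.
  by exists q; exact: ball_sym.
exists ([ffun i => q i], k) => /=; last by move=> i; rewrite ffunE.
move=> y By; apply: xe; rewrite -ball_normE/=; apply: norm_coord_lt => // i.
rewrite !mxE; have := By i; have := qP i; rewrite /ball/= ffunE => h1 h2.
rewrite (_ : x ord0 i - y ord0 i =
  (ratr (q i) - y ord0 i) - (ratr (q i) - x ord0 i)); last by ring.
rewrite (le_lt_trans (ler_normB _ _))// (splitr e) ltrD//.
- by rewrite (lt_trans h2).
- by rewrite (lt_trans h1).
Qed.

Lemma closed_measurable_rV n (U : set 'rV[R]_n) : closed U -> measurable U.
Proof.
move=> cU; rewrite -(setCK U); apply: measurableC.
by apply: open_measurable_rV; exact: closed_openC.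
Qed.

Lemma continuous_measurable_rV n (f : 'rV[R]_n -> R) :
  continuous f -> measurable_fun setT f.
Proof.
move=> cf; apply: (measurability _ (RGenOpens.measurableE R)).
move=> _ [_ [a [b ->] <-]]; rewrite setTI; apply: open_measurable_rV.
by apply: open_comp => // x _; exact: cf.
Qed.

Lemma bounded_lebesgue n (A : set 'rV[R]_n) : bounded_set A ->
  measurable A -> (mu n A < +oo)%E.
Proof.
move=> [M [Mreal bM]] mA.
apply: (le_lt_trans _ (lebesgue_cube n (`|M| + 1)%R)).
apply: le_measure; rewrite ?inE//; first exact: measurable_rect.
move=> x Ax i /=; rewrite in_itv/= -ler_norml.
apply: (le_trans (coord_norm _ _)); apply: bM => //.
by rewrite ltr_pwDr// ler_norm.
Qed.

End Transfer.

(** * Square integrable functions *)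

Section L2.
Context {R : realType} {n : nat}.
Local Notation E := 'rV[R]_n.
Local Notation mu := (lebesgue R n).
Variable w : set E.
Hypothesis mw : measurable w.
Implicit Types u v f g : E -> R.

Notation intw f := (mu.-integrable w (EFin \o f)).

Lemma integrable_le f g : measurable_fun w f -> intw g ->
  (forall x, w x -> `|f x| <= g x) -> intw f.
Proof.
move=> mf ig fg; apply: (le_integrable mw _ _ ig); first exact/measurable_EFinP.
by move=> x wx; rewrite /= lee_fin (le_trans (fg _ wx))// ler_norm.
Qed.

Lemma intwD f g : intw f -> intw g -> intw (fun x => f x + g x).
Proof. by move=> fi gi; exact: (integrableD mw fi gi). Qed.

Lemma intwZ k f : intw f -> intw (fun x => k * f x).
Proof. by move=> fi; exact: (integrableZl mw k fi). Qed.

Lemma intw_ext f g : (forall x, w x -> f x = g x) -> intw f -> intw g.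
Proof.
move=> fg; apply: eq_integrable => // x; rewrite inE => wx.
by rewrite /= fg.
Qed.

Lemma intwN f : intw f -> intw (fun x => - f x).
Proof. by move/(intwZ (-1)); apply: intw_ext => x _; rewrite mulN1r. Qed.

Lemma intwB f g : intw f -> intw g -> intw (fun x => f x - g x).
Proof. by move=> fi /intwN; exact: intwD. Qed.

Lemma intw_sum (I : Type) (s : seq I) (F : I -> E -> R) :
  (forall i, intw (F i)) -> intw (fun x => \sum_(i <- s) F i x).
Proof.
move=> Fi; elim: s => [|i s IH].
  apply: (@intw_ext (fun=> 0)); first by move=> x _; rewrite big_nil.
  exact: (integrable0 mu w).
apply: (@intw_ext (fun x => F i x + \sum_(j <- s) F j x)); last exact: intwD.
by move=> x _; rewrite big_cons.
Qed.

Lemma intw_norm f : intw f -> intw (fun x => `|f x|).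
Proof. by move=> fi; exact: (integrable_abse fi). Qed.

Lemma intw_meas f : intw f -> measurable_fun w f.
Proof. by move=> /integrableP[/measurable_EFinP]. Qed.

Lemma intw_cst (M : R) : (mu w < +oo)%E -> intw (fun=> M).
Proof.
move=> woo; apply/integrableP; split; first exact/measurable_EFinP/measurable_cst.
rewrite (eq_integral (cst `|M|%:E))// integral_cst//.
by rewrite lte_mul_pinfty// lee_fin.
Qed.

Lemma intw_bounded f M : (mu w < +oo)%E -> measurable_fun w f ->
  (forall x, w x -> `|f x| <= M) -> intw f.
Proof.
move=> woo mf fM; by apply: (@integrable_le _ (fun=> M)) => //; exact: intw_cst.
Qed.

Lemma Rint_sum (I : Type) (s : seq I) (F : I -> E -> R) :
  (forall i, intw (F i)) ->
  \int[mu]_(x in w) (\sum_(i <- s) F i x) = \sum_(i <- s) \int[mu]_(x in w) F i x.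
Proof.
move=> Fi; elim: s => [|i s IH].
  rewrite big_nil (@eq_Rintegral _ _ _ _ _ (cst 0)).
    by rewrite Rintegral_cst// mul0r.
  by move=> x _; rewrite big_nil.
rewrite big_cons -IH -RintegralD//; last exact: intw_sum.
by apply: eq_Rintegral => x _; rewrite big_cons.
Qed.

Lemma in_L2_meas u : in_L2 w u -> measurable_fun w u. Proof. by case. Qed.

Lemma in_L2_int u v : in_L2 w u -> in_L2 w v -> intw (fun x => u x * v x).
Proof.
move=> [mu_ iu] [mv iv].
apply: (@integrable_le _ (fun x => u x ^+ 2 + v x ^+ 2)).
- exact: measurable_funM.
- exact: intwD.
- move=> x _; rewrite ler_norml; apply/andP; split.
    have := sqr_ge0 (u x + v x); have := sqr_ge0 (u x); have := sqr_ge0 (v x).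
    by rewrite sqrrD; lra.
  have := sqr_ge0 (u x - v x); have := sqr_ge0 (u x); have := sqr_ge0 (v x).
  by rewrite sqrrB; lra.
Qed.

Lemma in_L2_ext u v : (forall x, w x -> u x = v x) -> in_L2 w u -> in_L2 w v.
Proof.
move=> uv [mu_ iu]; split.
  by apply: (eq_measurable_fun _ _ mu_) => x; rewrite inE; exact: uv.
by apply: intw_ext iu => x wx; rewrite uv.
Qed.

Lemma in_L2D u v : in_L2 w u -> in_L2 w v -> in_L2 w (fun x => u x + v x).
Proof.
move=> Lu Lv; split; first by apply: measurable_funD; [case: Lu|case: Lv].
apply: (@intw_ext (fun x => u x * u x + (2 * (u x * v x) + v x * v x))).
  by move=> x _; ring.
apply: intwD; first exact: in_L2_int.
by apply: intwD; [apply: intwZ|]; exact: in_L2_int.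
Qed.

Lemma in_L2Z k u : in_L2 w u -> in_L2 w (fun x => k * u x).
Proof.
move=> [mu_ iu]; split; first exact: measurable_funM.
apply: (@intw_ext (fun x => k ^+ 2 * (u x ^+ 2))); last exact: intwZ.
by move=> x _; ring.
Qed.

Lemma in_L2N u : in_L2 w u -> in_L2 w (fun x => - u x).
Proof. by move/(in_L2Z (-1)); apply: in_L2_ext => x _; rewrite mulN1r. Qed.

Lemma in_L2B u v : in_L2 w u -> in_L2 w v -> in_L2 w (fun x => u x - v x).
Proof. by move=> Lu /in_L2N; exact: in_L2D. Qed.

Lemma in_L2_sum (I : Type) (s : seq I) (F : I -> E -> R) :
  (forall i, in_L2 w (F i)) -> in_L2 w (fun x => \sum_(i <- s) F i x).
Proof.
move=> FL; elim: s => [|i s IH].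
  apply: (@in_L2_ext (fun=> 0)); first by move=> x _; rewrite big_nil.
  split; first exact: measurable_cst.
  apply: (@intw_ext (fun=> 0)); first by move=> x _; rewrite expr0n.
  exact: (integrable0 mu w).
apply: (@in_L2_ext (fun x => F i x + \sum_(j <- s) F j x)); last exact: in_L2D.
by move=> x _; rewrite big_cons.
Qed.

Lemma in_L2_le u v : measurable_fun w u -> in_L2 w v ->
  (forall x, w x -> `|u x| <= `|v x|) -> in_L2 w u.
Proof.
move=> mu_ [mv iv] uv; split => //.
apply: (@integrable_le _ (fun x => v x ^+ 2)) => //.
  exact: measurable_funX.
by move=> x wx; rewrite normrX -[leRHS]real_normK ?num_real// lerXn2r ?nnegrE// uv.
Qed.

Lemma in_L2_bounded u M : (mu w < +oo)%E -> measurable_fun w u ->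
  (forall x, w x -> `|u x| <= M) -> in_L2 w u.
Proof.
move=> woo mu_ uM; split => //.
apply: (@intw_bounded _ (M ^+ 2)) => //; first exact: measurable_funX.
move=> x wx; rewrite normrX lerXn2r ?nnegrE ?uM//.
exact: (le_trans _ (uM _ wx)).
Qed.

Lemma in_L2_mulb u v M : in_L2 w u -> measurable_fun w v ->
  (forall x, w x -> `|v x| <= M) -> in_L2 w (fun x => v x * u x).
Proof.
move=> Lu mv vM; apply: (@in_L2_le _ (fun x => M * u x)).
- by apply: measurable_funM => //; case: Lu.
- exact: in_L2Z.
move=> x wx; rewrite !normrM ler_wpM2r// (le_trans (vM _ wx))//.
exact: ler_norm.
Qed.

Lemma in_L2_int1 u : (mu w < +oo)%E -> in_L2 w u -> intw u.
Proof.
move=> woo Lu; apply: (@intw_ext (fun x => u x * 1)); first by move=> x _; rewrite mulr1.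
apply: in_L2_int => //; apply: (@in_L2_bounded _ 1) => //.
by move=> x _ /=; rewrite normr1.
Qed.

Lemma inner_ext u u' v v' : (forall x, w x -> u x = u' x) ->
  (forall x, w x -> v x = v' x) -> inner w u v = inner w u' v'.
Proof.
by move=> uu' vv'; apply: eq_Rintegral => x; rewrite inE => wx; rewrite uu' ?vv'.
Qed.

Lemma innerC u v : inner w u v = inner w v u.
Proof. by apply: eq_Rintegral => x _; rewrite mulrC. Qed.

Lemma innerDl u v f : in_L2 w u -> in_L2 w v -> in_L2 w f ->
  inner w (fun x => u x + v x) f = inner w u f + inner w v f.
Proof.
move=> Lu Lv Lf; rewrite /inner -RintegralD//; last 2 first.
- exact: in_L2_int.
- exact: in_L2_int.
by apply: eq_Rintegral => x _; rewrite mulrDl.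
Qed.

Lemma innerZl k u f : in_L2 w u -> in_L2 w f ->
  inner w (fun x => k * u x) f = k * inner w u f.
Proof.
move=> Lu Lf; rewrite /inner -RintegralZl//; last exact: in_L2_int.
by apply: eq_Rintegral => x _; rewrite mulrA.
Qed.

Lemma inner_ge0 u : 0 <= inner w u u.
Proof. by apply: Rintegral_ge0 => x _; rewrite -expr2 sqr_ge0. Qed.

Lemma norm0_ge0 u : 0 <= norm0 w u. Proof. exact: sqrtr_ge0. Qed.

Lemma norm0_sqr u : norm0 w u ^+ 2 = inner w u u.
Proof. by rewrite sqr_sqrtr// inner_ge0. Qed.

Lemma inner_ae u u' v v' : in_L2 w u -> in_L2 w u' -> in_L2 w v -> in_L2 w v' ->
  {ae mu, forall x, w x -> u x = u' x} -> {ae mu, forall x, w x -> v x = v' x} ->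
  inner w u v = inner w u' v'.
Proof.
move=> Lu Lu' Lv Lv' uu' vv'; rewrite /inner /Rintegral; congr fine.
apply: ae_eq_integral => //.
- by apply/measurable_EFinP/measurable_funM; [case: Lu|case: Lv].
- by apply/measurable_EFinP/measurable_funM; [case: Lu'|case: Lv'].
by apply: filterS2 uu' vv' => x /= uu' vv' wx; rewrite uu' ?vv'.
Qed.

Lemma norm0_eq0_ae u : in_L2 w u -> norm0 w u = 0 ->
  {ae mu, forall x, w x -> u x = 0}.
Proof.
move=> Lu u0; have : inner w u u = 0 by rewrite -norm0_sqr u0 expr0n.
rewrite /inner /Rintegral => /eqP; rewrite fine_eq0; last first.
  by apply: integrable_fin_num => //; exact: in_L2_int.
move=> /eqP u20.
have mu2 : measurable_fun w (fun x => (u x * u x)%:E).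
  by apply/measurable_EFinP/measurable_funM; case: Lu.
have /(ae_eq_integral_abs mu mw mu2) : (\int[mu]_(x in w) `|(u x * u x)%:E| = 0)%E.
  rewrite -[RHS]u20; apply: eq_integral => x _.
  by rewrite gee0_abs// lee_fin -expr2 sqr_ge0.
apply: filterS => x /= ux wx; have := ux wx.
by move=> [] /eqP; rewrite mulf_eq0 => /orP[] /eqP.
Qed.

Lemma norm0_le u v : in_L2 w u -> in_L2 w v ->
  (forall x, w x -> `|u x| <= `|v x|) -> norm0 w u <= norm0 w v.
Proof.
move=> Lu Lv uv; rewrite ler_sqrt ?inner_ge0//; apply: le_Rintegral => //.
- exact: in_L2_int.
- exact: in_L2_int.
move=> x wx; rewrite -!expr2 -[leLHS]real_normK ?num_real//.
by rewrite -[leRHS]real_normK ?num_real// lerXn2r ?nnegrE// uv.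
Qed.

End L2.

(** * Hilbert space calculus for finite tuples of L^2 functions *)

Section Tuples.
Context {R : realType} {n : nat}.
Local Notation E := 'rV[R]_n.
Local Notation mu := (lebesgue R n).
Variable w : set E.
Hypothesis mw : measurable w.
Variable I : finType.
Implicit Types F G H : I -> E -> R.

(** Finite families are treated as elements of one Hilbert space: the index type [unit] gives scalar
    functions, [option 'I_n] a function together with a vector field. *)
Definition in_tuple_L2 F := forall i, in_L2 w (F i).
Definition tuple_ip F G : R := \sum_i inner w (F i) (G i).
Definition tuple_nm F : R := Num.sqrt (tuple_ip F F).

Lemma inLtD F G : in_tuple_L2 F -> in_tuple_L2 G -> in_tuple_L2 (fun i x => F i x + G i x).
Proof. by move=> LF LG i; exact: in_L2D. Qed.

Lemma inLtB F G : in_tuple_L2 F -> in_tuple_L2 G -> in_tuple_L2 (fun i x => F i x - G i x).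
Proof. by move=> LF LG i; exact: in_L2B. Qed.

Lemma inLtZ k F : in_tuple_L2 F -> in_tuple_L2 (fun i x => k * F i x).
Proof. by move=> LF i; exact: in_L2Z. Qed.

Lemma ip_ext F F' G G' : (forall i x, w x -> F i x = F' i x) ->
  (forall i x, w x -> G i x = G' i x) -> tuple_ip F G = tuple_ip F' G'.
Proof. by move=> FF' GG'; apply: eq_bigr => i _; apply: inner_ext => x; auto. Qed.

Lemma ip_ae F F' G G' : in_tuple_L2 F -> in_tuple_L2 F' -> in_tuple_L2 G -> in_tuple_L2 G' ->
  (forall i, {ae mu, forall x, w x -> F i x = F' i x}) ->
  (forall i, {ae mu, forall x, w x -> G i x = G' i x}) -> tuple_ip F G = tuple_ip F' G'.
Proof. by move=> *; apply: eq_bigr => i _; apply: inner_ae. Qed.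

Lemma nm_ae F F' : in_tuple_L2 F -> in_tuple_L2 F' ->
  (forall i, {ae mu, forall x, w x -> F i x = F' i x}) -> tuple_nm F = tuple_nm F'.
Proof. by move=> *; congr Num.sqrt; exact: ip_ae. Qed.

Lemma ipC F G : tuple_ip F G = tuple_ip G F.
Proof. by apply: eq_bigr => i _; rewrite innerC. Qed.

Lemma ipDl F G H : in_tuple_L2 F -> in_tuple_L2 G -> in_tuple_L2 H ->
  tuple_ip (fun i x => F i x + G i x) H = tuple_ip F H + tuple_ip G H.
Proof. by move=> *; rewrite -big_split/=; apply: eq_bigr => i _; rewrite innerDl. Qed.

Lemma ipZl k F G : in_tuple_L2 F -> in_tuple_L2 G -> tuple_ip (fun i x => k * F i x) G = k * tuple_ip F G.
Proof. by move=> *; rewrite mulr_sumr; apply: eq_bigr => i _; rewrite innerZl. Qed.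

Lemma ipBl F G H : in_tuple_L2 F -> in_tuple_L2 G -> in_tuple_L2 H ->
  tuple_ip (fun i x => F i x - G i x) H = tuple_ip F H - tuple_ip G H.
Proof.
move=> LF LG LH; rewrite -(mulN1r (tuple_ip G H)) -ipZl// -ipDl//; last exact: inLtZ.
by apply: ip_ext => // i x _; rewrite mulN1r.
Qed.

Lemma ipBr F G H : in_tuple_L2 F -> in_tuple_L2 G -> in_tuple_L2 H ->
  tuple_ip H (fun i x => F i x - G i x) = tuple_ip H F - tuple_ip H G.
Proof. by move=> *; rewrite ipC ipBl// !(ipC H). Qed.

Lemma ipDr F G H : in_tuple_L2 F -> in_tuple_L2 G -> in_tuple_L2 H ->
  tuple_ip H (fun i x => F i x + G i x) = tuple_ip H F + tuple_ip H G.
Proof. by move=> *; rewrite ipC ipDl// !(ipC H). Qed.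

Lemma ipZr k F G : in_tuple_L2 F -> in_tuple_L2 G -> tuple_ip G (fun i x => k * F i x) = k * tuple_ip G F.
Proof. by move=> *; rewrite ipC ipZl// ipC. Qed.

Lemma ip_ge0 F : 0 <= tuple_ip F F.
Proof. by apply: sumr_ge0 => i _; exact: inner_ge0. Qed.

Lemma nm_ge0 F : 0 <= tuple_nm F. Proof. exact: sqrtr_ge0. Qed.

Lemma nm_sqr F : tuple_nm F ^+ 2 = tuple_ip F F.
Proof. by rewrite sqr_sqrtr// ip_ge0. Qed.

Lemma nmZ k F : in_tuple_L2 F -> tuple_nm (fun i x => k * F i x) = `|k| * tuple_nm F.
Proof.
move=> LF; rewrite /tuple_nm ipZl//; last exact: inLtZ.
by rewrite ipZr// mulrA -expr2 sqrtrM ?sqr_ge0// sqrtr_sqr.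
Qed.

Lemma nm_sub_sqr F G : in_tuple_L2 F -> in_tuple_L2 G ->
  tuple_nm (fun i x => F i x - G i x) ^+ 2 = tuple_nm F ^+ 2 - 2 * tuple_ip F G + tuple_nm G ^+ 2.
Proof.
move=> LF LG; rewrite !nm_sqr ipBl//; last exact: inLtB.
by rewrite !ipBr// (ipC G F); ring.
Qed.

Lemma nm_add_sqr F G : in_tuple_L2 F -> in_tuple_L2 G ->
  tuple_nm (fun i x => F i x + G i x) ^+ 2 = tuple_nm F ^+ 2 + 2 * tuple_ip F G + tuple_nm G ^+ 2.
Proof.
move=> LF LG; rewrite !nm_sqr ipDl//; last exact: inLtD.
by rewrite !ipDr// (ipC G F); ring.
Qed.

Lemma cauchy_schwarz F G : in_tuple_L2 F -> in_tuple_L2 G -> `|tuple_ip F G| <= tuple_nm F * tuple_nm G.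
Proof.
move=> LF LG; rewrite -ler_sqr ?nnegrE ?mulr_ge0 ?nm_ge0//.
rewrite real_normK ?num_real// exprMn.
have key t : 0 <= tuple_nm F ^+ 2 + 2 * t * tuple_ip F G + t ^+ 2 * tuple_nm G ^+ 2.
  have := sqr_ge0 (tuple_nm (fun i x => F i x + t * G i x)).
  rewrite nm_add_sqr//; last exact: inLtZ.
  by rewrite ipZr// nmZ// exprMn real_normK ?num_real// mulrA.
have [G0|G0] := eqVneq (tuple_nm G) 0.
  rewrite G0 expr0n mulr0; have [->|ip0] := eqVneq (tuple_ip F G) 0; first by rewrite expr0n.
  (* When [G] has norm 0 the polynomial in [key] is affine in t, and this t gives it the value
     -1. *)
  have := key (- (tuple_nm F ^+ 2 + 1) / (2 * tuple_ip F G)); rewrite G0 expr0n mulr0 addr0.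
  rewrite (_ : 2 * _ * _ = - (tuple_nm F ^+ 2 + 1)); last by field.
  lra.
have G2 : 0 < tuple_nm G ^+ 2 by rewrite exprn_gt0// lt_neqAle eq_sym G0 nm_ge0.
have := key (- tuple_ip F G / tuple_nm G ^+ 2).
rewrite (_ : _ + _ + _ = (tuple_nm F ^+ 2 * tuple_nm G ^+ 2 - tuple_ip F G ^+ 2) / tuple_nm G ^+ 2); last by field.
by rewrite pmulr_lge0 ?invr_gt0// subr_ge0.
Qed.

Lemma nmD F G : in_tuple_L2 F -> in_tuple_L2 G ->
  tuple_nm (fun i x => F i x + G i x) <= tuple_nm F + tuple_nm G.
Proof.
move=> LF LG; rewrite -ler_sqr ?nnegrE ?addr_ge0 ?nm_ge0// nm_add_sqr// sqrrD.
have := cauchy_schwarz LF LG; rewrite ler_norml => /andP[_].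
by rewrite -mulr_natl; lra.
Qed.

Lemma nmBC F G : tuple_nm (fun i x => F i x - G i x) = tuple_nm (fun i x => G i x - F i x).
Proof.
congr Num.sqrt; apply: eq_bigr => i _; apply: eq_Rintegral => x _; ring.
Qed.

Lemma nmB_trans F G H : in_tuple_L2 F -> in_tuple_L2 G -> in_tuple_L2 H ->
  tuple_nm (fun i x => F i x - H i x) <=
  tuple_nm (fun i x => F i x - G i x) + tuple_nm (fun i x => G i x - H i x).
Proof.
move=> LF LG LH; have := nmD (inLtB LF LG) (inLtB LG LH).
congr (_ <= _); congr Num.sqrt; apply: eq_bigr => i _; apply: eq_Rintegral => x _.
by ring.
Qed.

Lemma nm_le_add F G : in_tuple_L2 F -> in_tuple_L2 G ->
  tuple_nm F <= tuple_nm G + tuple_nm (fun i x => F i x - G i x).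
Proof.
move=> LF LG; have := nmD LG (inLtB LF LG).
congr (_ <= _); congr Num.sqrt; apply: eq_bigr => i _; apply: eq_Rintegral => x _.
by ring.
Qed.

Lemma nm_ge_comp F i : norm0 w (F i) <= tuple_nm F.
Proof.
rewrite ler_sqrt ?ip_ge0// /tuple_ip (bigD1 i)//= lerDl.
by apply: sumr_ge0 => j _; exact: inner_ge0.
Qed.

Lemma nm_le_sum F : tuple_nm F <= \sum_i norm0 w (F i).
Proof.
rewrite -ler_sqr ?nnegrE ?nm_ge0//; last by apply: sumr_ge0 => i _; exact: norm0_ge0.
rewrite nm_sqr expr2 mulr_suml; apply: ler_sum => i _.
rewrite -norm0_sqr expr2 ler_wpM2l ?norm0_ge0// (bigD1 i)//= lerDl.
by apply: sumr_ge0 => j _; exact: norm0_ge0.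
Qed.

Lemma nm_eq0_ae F : in_tuple_L2 F -> tuple_nm F = 0 ->
  forall i, {ae mu, forall x, w x -> F i x = 0}.
Proof.
move=> LF F0 i; apply: norm0_eq0_ae => //; apply/eqP.
by rewrite eq_le norm0_ge0 andbT -F0 nm_ge_comp.
Qed.

Lemma ip_cvg (Fk Gk : nat -> I -> E -> R) F G : (forall k, in_tuple_L2 (Fk k)) ->
  (forall k, in_tuple_L2 (Gk k)) -> in_tuple_L2 F -> in_tuple_L2 G ->
  (fun k => tuple_nm (fun i x => Fk k i x - F i x)) @ \oo --> 0 ->
  (fun k => tuple_nm (fun i x => Gk k i x - G i x)) @ \oo --> 0 ->
  (fun k => tuple_ip (Fk k) (Gk k)) @ \oo --> tuple_ip F G.
Proof.
move=> LFk LGk LF LG cF cG; apply/subr_cvg0/norm_cvg0P; rewrite /=.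
apply: (@squeeze_cvgr _ _ _ _ (fun=> 0) (fun k =>
   tuple_nm (fun i x => Fk k i x - F i x) * tuple_nm (fun i x => Gk k i x - G i x) +
   tuple_nm (fun i x => Fk k i x - F i x) * tuple_nm G + tuple_nm F * tuple_nm (fun i x => Gk k i x - G i x))).
- near=> k; rewrite normr_ge0/=.
  have -> : tuple_ip (Fk k) (Gk k) - tuple_ip F G =
    tuple_ip (fun i x => Fk k i x - F i x) (fun i x => Gk k i x - G i x) +
    tuple_ip (fun i x => Fk k i x - F i x) G + tuple_ip F (fun i x => Gk k i x - G i x).
    rewrite ipBl// ?ipBr// ?ipBl//; last exact: inLtB.
    by ring.
  have c1 := cauchy_schwarz (inLtB (LFk k) LF) (inLtB (LGk k) LG).
  have c2 := cauchy_schwarz (inLtB (LFk k) LF) LG.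
  have c3 := cauchy_schwarz LF (inLtB (LGk k) LG).
  by rewrite (le_trans (ler_normD _ _))// lerD// (le_trans (ler_normD _ _))// lerD.
- exact: cvg_cst.
- rewrite [X in _ --> X](_ : 0 = 0 * 0 + 0 * tuple_nm G + tuple_nm F * 0); last by ring.
  apply: cvgD; [apply: cvgD|]; apply: cvgM => //; exact: cvg_cst.
Unshelve. all: by end_near. Qed.

Lemma nm_cvg (Fk : nat -> I -> E -> R) F : (forall k, in_tuple_L2 (Fk k)) -> in_tuple_L2 F ->
  (fun k => tuple_nm (fun i x => Fk k i x - F i x)) @ \oo --> 0 ->
  (fun k => tuple_nm (Fk k)) @ \oo --> tuple_nm F.
Proof.
move=> LFk LF cF; apply: continuous_cvg; first exact: sqrt_continuous.
exact: ip_cvg.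
Qed.

End Tuples.

Lemma cvg_sumr {R : realType} (I : Type) (s : seq I) (f : I -> nat -> R) (l : I -> R) :
  (forall i, f i @ \oo --> l i) ->
  (fun k => \sum_(i <- s) f i k) @ \oo --> \sum_(i <- s) l i.
Proof.
move=> fl; elim: s => [|i s IH].
  by rewrite big_nil; under eq_fun do rewrite big_nil; exact: cvg_cst.
by rewrite big_cons; under eq_fun do rewrite big_cons; exact: cvgD.
Qed.

(** * Riesz-Fischer theorem *)

Section Completeness.
Context {R : realType} {n : nat}.
Local Notation E := 'rV[R]_n.
Local Notation mu := (lebesgue R n).
Variable w : set E.
Hypothesis mw : measurable w.
Hypothesis woo : (mu w < +oo)%E.
Notation intw f := (mu.-integrable w (EFin \o f)).

Lemma norm1_le_norm0 (u : E -> R) : in_L2 w u ->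
  \int[mu]_(x in w) `|u x| <= norm0 w (fun=> 1) * norm0 w u.
Proof.
move=> Lu; have L1 : in_L2 w (fun=> 1 : R).
  by apply: (@in_L2_bounded _ _ _ mw _ 1) => // x _; rewrite normr1.
have La : in_L2 w (fun x => `|u x|).
  apply: (in_L2_le mw _ Lu); last by move=> x _; rewrite normr_id.
  by apply: measurableT_comp => //; case: Lu.
have := @cauchy_schwarz _ _ w mw unit (fun=> fun=> 1) (fun=> fun x => `|u x|)
  (fun=> L1) (fun=> La).
rewrite /tuple_nm /tuple_ip !(big_pred1 tt)//; try by case.
move=> /(le_trans (ler_norm _)); rewrite -/(norm0 _ _) -/(norm0 _ _).
rewrite (_ : inner w (fun=> 1) _ = \int[mu]_(x in w) `|u x|); last first.
  by apply: eq_Rintegral => x _; rewrite mul1r.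
move=> /le_trans; apply; rewrite ler_wpM2l ?sqrtr_ge0//.
by apply: norm0_le => // x _; rewrite normr_id.
Qed.

Lemma EFin_Rint (f : E -> R) : intw f ->
  (\int[mu]_(x in w) (f x)%:E)%E = (\int[mu]_(x in w) f x)%:E.
Proof. by move=> fi; rewrite fineK//; exact: integrable_fin_num. Qed.

(* The series of increments is integrable, hence finite almost everywhere. *)
Lemma ae_limit_fast (u : nat -> E -> R) : (forall k, in_L2 w (u k)) ->
  (forall k, norm0 w (fun x => u k.+1 x - u k x) <= 2^-1 ^+ k) ->
  exists2 C, measurable C & C `<=` w /\ mu (w `\` C) = 0 /\
    forall x, C x -> cvgn (u ^~ x).
Proof.
move=> Lu uD; pose D k x : \bar R := (`|u k.+1 x - u k x|)%:E.
have mD k : measurable_fun w (D k).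
  apply/measurable_EFinP; apply: measurableT_comp => //.
  by apply: measurable_funB; [case: (Lu k.+1)|case: (Lu k)].
pose S x := (\sum_(0 <= k <oo) D k x)%E.
have D0 k x : (0 <= D k x)%E by rewrite lee_fin.
have mS : measurable_fun w S by apply: ge0_emeasurable_sum.
have Dint k : intw (fun x => `|u k.+1 x - u k x|).
  by apply: intw_norm; apply: in_L2_int1 => //; exact: in_L2B.
have Soo : (\int[mu]_(x in w) S x < +oo)%E.
  rewrite /S integral_nneseries//.
  apply: (@le_lt_trans _ _ (\sum_(0 <= k <oo)
      (norm0 w (fun=> 1%R) * 2^-1 ^+ k)%:E)%E).
    apply: lee_nneseries => [k _ _|k _]; first by apply: integral_ge0.
    rewrite /D EFin_Rint// lee_fin (le_trans (norm1_le_norm0 _))//.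
      exact: in_L2B.
    by rewrite ler_wpM2l ?norm0_ge0.
  have : cvgn (series (fun k => norm0 w (fun=> 1%R) * 2^-1 ^+ k)).
    apply: is_cvg_geometric_series; rewrite ger0_norm; lra.
  move=> /cvg_ex[l ul].
  rewrite (_ : (fun n => _) = EFin \o series (fun k => norm0 w (fun=> 1%R) * 2^-1 ^+ k)).
    by rewrite (cvg_lim _ (cvg_EFin _ ul))// ?ltry//; near=> k.
  by apply/funext => k; rewrite /= sumEFin.
have Sint : mu.-integrable w S.
  apply/integrableP; split => //; rewrite (eq_integral S)// => x _.
  by rewrite gee0_abs// nneseries_ge0.
exists (w `&` [set x | S x \is a fin_num]).
  by have := emeasurable_fin_num mw mS.
split; first by move=> x [].
split.
  apply/negligibleP; first by apply: measurableD => //; exact: emeasurable_fin_num.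
  have := integrable_ae mw Sint; apply: negligibleS => x [wx] /= nSx.
  by move=> /(_ wx) Sx; apply: nSx.
move=> x [wx /= Sx].
have : cvgn (series (telescope (u ^~ x))).
  apply: normed_cvg.
  apply: nondecreasing_is_cvgn.
    by apply: nondecreasing_series => k _ _; exact: normr_ge0.
  exists (fine (S x)) => _ [k _ <-]; rewrite -lee_fin fineK//.
  rewrite /= -sumEFin.
  exact: (@nneseries_lim_ge R (D ^~ x) xpredT 0 k (fun i _ _ => D0 i x)).
rewrite telescopeK => cu.
have -> : u ^~ x = (fun k => (u k x - u 0%N x) + u 0%N x).
  by apply/funext => k; rewrite subrK.
by apply: is_cvgD => //; exact: is_cvg_cst.
Unshelve. all: by end_near. Qed.

(** Fatou's lemma for the squares. It serves the completeness of L^2 as well as the removal of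
    truncations in the bound on cubes. *)
Lemma fatou_L2 (h : nat -> E -> R) U e : (forall k, in_L2 w (h k)) ->
  (forall x, w x -> h ^~ x @ \oo --> U x) ->
  (forall k, norm0 w (h k) <= e) -> in_L2 w U /\ norm0 w U <= e.
Proof.
move=> Lh hU he.
have e0 : 0 <= e by apply: le_trans (he 0%N); exact: norm0_ge0.
have mU : measurable_fun w U.
  by apply: (measurable_fun_cvg (h := h)) => // k; case: (Lh k).
pose g k x : \bar R := (h k x * h k x)%:E.
have mg k : measurable_fun w (g k).
  by apply/measurable_EFinP/measurable_funM; case: (Lh k).
have g0 k x : w x -> (0 <= g k x)%E by rewrite lee_fin -expr2 sqr_ge0.
have gint k : (\int[mu]_(x in w) g k x <= (e ^+ 2)%:E)%E.
  rewrite (EFin_Rint (in_L2_int mw (Lh k) (Lh k))) lee_fin.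
  by rewrite -[leLHS]/(inner w (h k) (h k)) -norm0_sqr lerXn2r ?nnegrE ?norm0_ge0.
have key : (\int[mu]_(x in w) (U x ^+ 2)%:E <= (e ^+ 2)%:E)%E.
  have -> : (\int[mu]_(x in w) (U x ^+ 2)%:E =
      \int[mu]_(x in w) limn_einf (g ^~ x))%E.
    apply: eq_integral => x; rewrite inE => wx; apply/esym.
    apply: (cvg_limn_einf_sup _).1; apply: cvg_EFin; first exact: nearW.
    by rewrite expr2; apply: cvgM; exact: hU.
  apply: (le_trans (fatou mu mw mg g0)).
  rewrite limn_einf_lim; apply: lime_le; first exact: is_cvg_einfs.
  apply: nearW => k; apply: le_trans (gint k); apply: ereal_inf_lbound.
  by exists k => //=.
have LU : in_L2 w U.
  split => //; apply/integrableP; split.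
    exact/measurable_EFinP/measurable_funX.
  rewrite (eq_integral (fun x => (U x ^+ 2)%:E)); last first.
    by move=> x _; rewrite /= ger0_norm// sqr_ge0.
  by apply: le_lt_trans key _; rewrite ltry.
split => //; rewrite -ler_sqr ?nnegrE ?norm0_ge0// norm0_sqr -lee_fin.
rewrite -EFin_Rint; first by under eq_integral do rewrite -expr2.
exact: in_L2_int.
Qed.

Lemma L2_complete (u : nat -> E -> R) : (forall k, in_L2 w (u k)) ->
  (forall e, 0 < e -> exists N, forall m k, (N <= m)%N -> (N <= k)%N ->
     norm0 w (fun x => u m x - u k x) < e) ->
  exists2 U, in_L2 w U & (fun k => norm0 w (fun x => u k x - U x)) @ \oo --> 0.
Proof.
move=> Lu cauchy.
have /choice[N NP] : forall j : nat, exists N, forall m k, (N <= m)%N -> (N <= k)%N ->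
     norm0 w (fun x => u m x - u k x) < 2^-1 ^+ j.
  by move=> j; apply: cauchy; rewrite exprn_gt0// invr_gt0.
(* Summing the thresholds gives [phi k >= N j] for every j <= k at once, although [N] itself need
   not be monotone. *)
pose phi k := (\sum_(j < k.+1) N j)%N.
have phiN j k : (j <= k)%N -> (N j <= phi k)%N.
  by move=> jk; rewrite /phi (bigD1 (Ordinal (jk : (j < k.+1)%N)))//= leq_addr.
have [||C mC [Cw [C0 Ccvg]]] := @ae_limit_fast (fun k => u (phi k)).
- by move=> k; exact: Lu.
- by move=> k; apply/ltW/NP; apply: phiN.
pose U x := if x \in C then limn (fun k => u (phi k) x) else 0.
(* Multiplied by the indicator of the convergence set, the subsequence converges everywhere, and it
   changes only on a null set. *)
pose h k x := \1_C x * u (phi k) x.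
have Lh k : in_L2 w (h k).
  apply: (in_L2_mulb (M := 1) mw (Lu (phi k))); first exact: measurable_indic.
  by move=> x _; rewrite indicE; case: (_ \in _); rewrite ?normr1 ?normr0.
have hU x : h ^~ x @ \oo --> U x.
  rewrite /h /U indicE; case: (boolP (x \in C)) => [xC|_] /=.
    under eq_fun do rewrite mul1r.
    by apply: Ccvg; rewrite inE in xC.
  by under eq_fun do rewrite mul0r; exact: cvg_cst.
have aeh k : {ae mu, forall x, w x -> h k x = u (phi k) x}.
  exists (w `\` C); split => //; first exact: measurableD.
  move=> x /= /not_implyP[wx hx]; split => // Cx; apply: hx.
  by rewrite /h indicE mem_set// mul1r.
(* Every term of the subsequence from index j on is within 2^-j of [u m], and Fatou's lemma hands
   this bound on to the limit; so the whole sequence converges, not just the subsequence. *)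
have close j m : (N j <= m)%N -> in_L2 w (fun x => U x - u m x) /\
    norm0 w (fun x => U x - u m x) <= 2^-1 ^+ j.
  move=> Njm; apply: (@fatou_L2 (fun k x => h (k + j)%N x - u m x)).
  - by move=> k; exact: in_L2B.
  - move=> x _; apply: cvgB; last exact: cvg_cst.
    by have := hU x; rewrite -(cvg_shiftn j).
  - move=> k.
    suff -> : norm0 w (fun x => h (k + j)%N x - u m x) =
        norm0 w (fun x => u (phi (k + j)%N) x - u m x).
      by apply/ltW/NP => //; apply: phiN; exact: leq_addl.
    rewrite /norm0; congr Num.sqrt; apply: inner_ae => //;
      do ?[exact: in_L2B]; by apply: filterS (aeh (k + j)%N) => x /= hx wx; rewrite hx.
have LU : in_L2 w U.
  have [L _] := close 0%N (N 0%N) (leqnn _).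
  apply: (in_L2_ext mw _ (in_L2D mw L (Lu (N 0%N)))) => x _.
  by rewrite subrK.
exists U => //; apply/cvgrPdist_le => e e0.
have [j je] : exists j, 2^-1 ^+ j <= e :> R.
  have /cvgrPdist_le/(_ _ e0)[j _ /(_ j (leqnn _))] :
      (fun j => 2^-1 ^+ j : R) @ \oo --> 0.
    by apply: cvg_expr; rewrite ger0_norm; lra.
  rewrite /= sub0r normrN ger0_norm; first by exists j.
  by rewrite exprn_ge0// invr_ge0.
exists (N j) => // k /= Njk; rewrite sub0r normrN ger0_norm ?norm0_ge0//.
rewrite (le_trans _ je)//; have [_] := close _ _ Njk.
congr (_ <= _); congr Num.sqrt; apply: eq_Rintegral => x _; ring.
Qed.

Lemma L2_completet (I : finType) (u : nat -> I -> E -> R) :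
  (forall k, in_tuple_L2 w (u k)) ->
  (forall e, 0 < e -> exists N, forall m k, (N <= m)%N -> (N <= k)%N ->
     tuple_nm w (fun i x => u m i x - u k i x) < e) ->
  exists2 U, in_tuple_L2 w U & (fun k => tuple_nm w (fun i x => u k i x - U i x)) @ \oo --> 0.
Proof.
move=> Lu cauchy.
have /choice[U UP] : forall i, exists U, in_L2 w U /\
    (fun k => norm0 w (fun x => u k i x - U x)) @ \oo --> 0.
  move=> i; have [|e e0|U LU cU] := @L2_complete (fun k => u k i).
  - by move=> k; exact: Lu.
  - have [N NP] := cauchy _ e0; exists N => m k Nm Nk.
    by apply: le_lt_trans (NP _ _ Nm Nk); exact: (nm_ge_comp _ (fun i x => _) i).
  - by exists U.
exists U => [i|]; first by have [] := UP i.
apply: (@squeeze_cvgr _ _ _ _ (fun=> 0)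
  (fun k => \sum_i norm0 w (fun x => u k i x - U i x))).
- by near=> k; rewrite nm_ge0 nm_le_sum.
- exact: cvg_cst.
- have := @cvg_sumr R I (index_enum I)
    (fun i k => norm0 w (fun x => u k i x - U i x)) (fun=> 0) (fun i => (UP i).2).
  by rewrite big1.
Unshelve. all: by end_near. Qed.

End Completeness.

(** * Smooth functions *)

Section FlatExp.
Context {R : realType}.
Implicit Types t x : R.

(** With the powers of 1/t in front of exp(-1/t) the derivative is a linear combination of members
    of the same family, so smoothness follows by iterating a single derivative formula. *)
Definition flat_exp (n : nat) (t : R) : R :=
  if 0 < t then t^-1 ^+ n * expR (- t^-1) else 0.

Lemma flat_exp_gt0 n t : 0 < t -> 0 < flat_exp n t.
Proof. by move=> t0; rewrite /flat_exp t0 mulr_gt0 ?expR_gt0// exprn_gt0// invr_gt0. Qed.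

Lemma flat_exp_le0 n t : t <= 0 -> flat_exp n t = 0.
Proof. by move=> t0; rewrite /flat_exp ltNge t0. Qed.

Lemma flat_exp_ge0 n t : 0 <= flat_exp n t.
Proof. by case: (ltP 0 t) => [/(flat_exp_gt0 n)/ltW//|/(flat_exp_le0 n) ->]. Qed.

(** From exp(s) >= s^(n+2) / (n+2)! with s = 1/t. Quadratic decay is more than enough for continuity
    at 0. *)
Lemma flat_exp_bound n t : 0 < t -> flat_exp n t <= (n.+2)`!%:R * t ^+ 2.
Proof.
move=> t0; rewrite /flat_exp t0 expRN.
have s0 : 0 <= t^-1 by rewrite invr_ge0 ltW.
rewrite ler_pdivrMr ?expR_gt0//.
have := expR_ge1Dxn n.+1 s0; move/(ler_wpM2l (sqr_ge0 t)).
rewrite mulrDr mulr1 => h.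
have f0 : 0 < (n.+2)`!%:R :> R by rewrite ltr0n fact_gt0.
rewrite -mulrA -ler_pdivrMl//; apply: le_trans h; rewrite -[leLHS]add0r lerD ?sqr_ge0//.
rewrite le_eqVlt; apply/orP; left; apply/eqP.
rewrite !exprS; have tt : t * t^-1 = 1 by rewrite divff// gt_eqF.
transitivity ((t * t^-1) * (t * t^-1) * (t^-1 ^+ n / (n.+2)`!%:R)); last by ring.
by rewrite tt !mul1r mulrC.
Qed.

Lemma flat_expS n t : flat_exp n t = flat_exp n.+1 t * t.
Proof.
rewrite /flat_exp; case: ifP => [t0|_]; last by rewrite mul0r.
have tt : t^-1 * t = 1 by rewrite mulVf// gt_eqF.
transitivity ((t^-1 * t) * (t^-1 ^+ n * expR (- t^-1))); first by rewrite tt mul1r.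
by rewrite exprS; ring.
Qed.

Lemma flat_exp_cont0 n : {for (0 : R), continuous (flat_exp n)}.
Proof.
rewrite /prop_for /continuous_at flat_exp_le0//.
apply: (@squeeze_cvgr _ _ _ _ (fun=> 0) (fun t => (n.+2)`!%:R * t ^+ 2)).
- near=> t; rewrite flat_exp_ge0/=; case: (ltP 0 t) => t0.
    exact: flat_exp_bound.
  by rewrite flat_exp_le0// mulr_ge0 ?sqr_ge0.
- exact: cvg_cst.
- rewrite [X in _ --> X](_ : 0 = (n.+2)`!%:R * 0 ^+ 2); last by rewrite expr0n mulr0.
  by apply: cvgMr; apply: exprn_continuous.
Unshelve. all: by end_near. Qed.

Lemma is_derive_flat_exp n t :
  is_derive t 1 (flat_exp n) (flat_exp n.+2 t - n%:R * flat_exp n.+1 t).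
Proof.
have [t0|t0|->] := ltgtP t 0.
- rewrite !flat_exp_le0 ?(ltW t0)// mulr0 subr0.
  apply: (@near_eq_is_derive _ _ _ (cst 0)).
  by near=> s; rewrite /= flat_exp_le0// ltW//; near: s; exact: lt_nbhsl.
- have -> : flat_exp n.+2 t - n%:R * flat_exp n.+1 t =
    t^-1 ^+ n *: (expR (- t^-1) * t^-1 ^+ 2) +
    expR (- t^-1) *: (n%:R * t^-1 ^+ n.-1 *: (- t^-1 ^+ 2)).
    rewrite /flat_exp t0 /GRing.scale/=; case: n => [|n]; first by rewrite expr0; ring.
    by rewrite !exprS; ring.
  apply: (@near_eq_is_derive R R R (fun s : R => s^-1 ^+ n * expR (- s^-1))).
    by near=> s; rewrite /flat_exp ifT//; near: s; exact: lt_nbhsr.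
  have dV : is_derive t 1 (fun s : R => s^-1) (- t^-1 ^+ 2).
    have := @is_deriveV R id t 1 1 (lt0r_neq0 t0) (is_derive_id _ _).
    by rewrite /GRing.scale/= mulr1 exprVn.
  have dE : is_derive t 1 (fun s : R => expR (- s^-1)) (expR (- t^-1) * t^-1 ^+ 2).
    apply: (@is_derive1_comp R expR (fun s => - s^-1) _ _ _ (is_derive_expR _)).
    by rewrite -[X in is_derive _ _ _ X]opprK; apply: is_deriveN.
  rewrite (_ : (fun s : R => s^-1 ^+ n * expR (- s^-1)) =
    (fun s : R => s^-1) ^+ n * (fun s : R => expR (- s^-1))); last first.
    by apply/funext => s; rewrite mulrfctE exprfctE.
  rewrite -[X in X *: _ + _](_ : ((fun s : R => s^-1) ^+ n) t = _); last first.
    by rewrite exprfctE.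
  exact: (is_deriveM (is_deriveX n dV) dE).
(* At 0 the difference quotient of [flat_exp n] is exactly [flat_exp n.+1], which is continuous
   there with value 0. *)
- rewrite !flat_exp_le0// mulr0 subr0; apply/is_derive1_caratheodory.
  exists (flat_exp n.+1); split; last by rewrite flat_exp_le0.
    by move=> z; rewrite (flat_exp_le0 n (lexx 0)) !subr0 flat_expS.
  exact: flat_exp_cont0.
Unshelve. all: by end_near. Qed.

Lemma continuous_flat_exp n : continuous (flat_exp n).
Proof.
move=> t; apply: differentiable_continuous; apply/derivable1_diffP.
by have [] := is_derive_flat_exp n t.
Qed.

End FlatExp.

(** Both difference quotients are the same function of h, so the one-variable calculus rules apply
    along every line. *)
Lemma is_derive_line {R : realType} {V : normedModType R} (f : V -> R) (x v : V)
    (d : R) :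
  is_derive (0 : R) (1 : R) (fun h : R => f (h *: v + x)) d <-> is_derive x v f d.
Proof.
have E : (fun h : R => h^-1 *: ((f \o shift x) (h *: v) - f x)) =
  (fun h : R => h^-1 *: (((fun k : R => f (k *: v + x)) \o shift 0) (h *: (1 : R)) -
     (fun k : R => f (k *: v + x)) 0)).
  apply/funext => h /=; rewrite scale0r add0r addr0.
  by rewrite [h *: (1 : R)]mulr1.
by split => -[ex val]; split; move: ex val; rewrite /derivable /derive E.
Qed.

(** * Smooth functions, Taylor estimates, cut-off functions *)

Section Smooth.
Context {R : realType} {n : nat}.
Local Notation E := 'rV[R]_n.
Local Notation e_ i := (delta_mx ord0 i : 'rV[R]_n).
Implicit Types (phi psi f g : E -> R).

(** [smooth] speaks of all iterated partial derivatives at once. To prove it, exhibit a class stable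
    under [pderiv] whose members are continuous and partially differentiable. *)
Lemma smooth_coind (S : (E -> R) -> Prop) :
  (forall f, S f -> continuous f) ->
  (forall f i x, S f -> derivable f x (e_ i)) ->
  (forall f i, S f -> S (pderiv i f)) -> forall f, S f -> smooth f.
Proof.
move=> Sc Sd Sp f Sf s; suff Sfs : S (foldr (@pderiv R n) f s).
  by split; [exact: Sc|move=> i x; exact: Sd].
by elim: s => //= i s; exact: Sp.
Qed.

Lemma smooth_continuous f : smooth f -> continuous f.
Proof. by move=> /(_ [::])[]. Qed.

Lemma smooth_derivable f i x : smooth f -> derivable f x (e_ i).
Proof. by move=> /(_ [::])[_]; exact. Qed.

Lemma smooth_pderiv f i : smooth f -> smooth (pderiv i f).
Proof. by move=> sf s; have := sf (rcons s i); rewrite foldr_rcons. Qed.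

Lemma is_derive_comp1 (g : R -> R) f (x v : E) (a d : R) :
  is_derive (f x) 1 g a -> is_derive x v f d -> is_derive x v (g \o f) (a * d).
Proof.
move=> dg /is_derive_line df; apply/is_derive_line.
apply: (@is_derive1_comp R g) => //; by rewrite scale0r add0r.
Qed.

Lemma pderivD f g i : (forall x, derivable f x (e_ i)) ->
  (forall x, derivable g x (e_ i)) ->
  pderiv i (fun x => f x + g x) = fun x => pderiv i f x + pderiv i g x.
Proof. by move=> df dg; apply/funext => x; exact: deriveD. Qed.

Lemma pderivM f g i : (forall x, derivable f x (e_ i)) ->
  (forall x, derivable g x (e_ i)) ->
  pderiv i (fun x => f x * g x) = fun x => pderiv i f x * g x + f x * pderiv i g x.
Proof.
move=> df dg; apply/funext => x; etransitivity; first exact: (deriveM (df x) (dg x)).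
by rewrite /GRing.scale/= /pderiv; ring.
Qed.

Lemma pderiv_cst (c : R) i : pderiv i (fun _ : E => c) = (fun=> 0).
Proof. by apply/funext => x; exact: derive_cst. Qed.

Lemma is_derive_coord i j (x : E) :
  is_derive x (e_ i) (fun y : E => y ord0 j) (i == j)%:R.
Proof.
apply/is_derive_line.
rewrite (_ : (fun h : R => _) = (fun h => h * (i == j)%:R) + cst (x ord0 j)); last first.
  by apply/funext => h; rewrite !mxE eqxx/= eq_sym.
rewrite -[X in is_derive _ _ _ X]addr0; apply: is_deriveD.
have := @is_deriveM R R id (cst (i == j)%:R) 0 1 1 0 (is_derive_id _ _) (is_derive_cst _ _ _).
by rewrite scaler0 add0r /GRing.scale/= mulr1.
Qed.

Lemma pderiv_coord i j : pderiv i (fun y : E => y ord0 j) = fun=> (i == j)%:R.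
Proof. by apply/funext => x; have [] := is_derive_coord i j x. Qed.

(** A class of expressions closed under partial differentiation, to be fed to [smooth_coind]. The
    index in [gen_flat] is there because differentiating [flat_exp k] raises it. *)
Inductive gen : (E -> R) -> Prop :=
| gen_smooth f : smooth f -> gen f
| gen_cst (c : R) : gen (fun=> c)
| gen_coord i : gen (fun x => x ord0 i)
| gen_add f g : gen f -> gen g -> gen (fun x => f x + g x)
| gen_mul f g : gen f -> gen g -> gen (fun x => f x * g x)
| gen_inv f : gen f -> (forall x, f x != 0) -> gen (fun x => (f x)^-1)
| gen_flat k f : gen f -> gen (fun x => flat_exp k (f x)).

Lemma coord_continuous' i : continuous (fun x : E => x ord0 i).
Proof. by move=> x; exact: coord_continuous. Qed.

Lemma gen_spec f : gen f -> continuous f /\ forall i,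
  (forall x, derivable f x (e_ i)) /\ gen (pderiv i f).
Proof.
elim => {f} [f sf|c|j|f g _ [cf df] _ [cg dg]|f g gf [cf df] gg [cg dg]
  |f gf [cf df] f0|k f gf [cf df]].
- split; first exact: smooth_continuous.
  move=> i; split; first by move=> x; exact: smooth_derivable.
  exact/gen_smooth/smooth_pderiv.
- split; first exact: cst_continuous.
  move=> i; split; first by move=> x; exact: derivable_cst.
  by rewrite pderiv_cst; exact: gen_cst.
- split; first exact: coord_continuous'.
  move=> i; split; first by move=> x; have [] := is_derive_coord i j x.
  by rewrite pderiv_coord; exact: gen_cst.
- split; first by move=> x; exact: (cvgD (cf x) (cg x)).
  move=> i; have [df1 df2] := df i; have [dg1 dg2] := dg i.
  split; first by move=> x; exact: derivableD.
  by rewrite pderivD//; exact: gen_add.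
- split; first by move=> x; exact: (cvgM (cf x) (cg x)).
  move=> i; have [df1 df2] := df i; have [dg1 dg2] := dg i.
  split; first by move=> x; exact: derivableM.
  by rewrite pderivM//; apply: gen_add; apply: gen_mul.
- split; first by move=> x; exact: (cvgV (f0 x) (cf x)).
  move=> i; have [df1 df2] := df i; split; first by move=> x; exact: derivableV.
  rewrite (_ : pderiv _ _ = (fun x => -1 * ((f x)^-1 * (f x)^-1) * pderiv i f x)).
    by apply: gen_mul => //; apply: gen_mul; [exact: gen_cst|apply: gen_mul; exact: gen_inv].
  apply/funext => x; by rewrite [LHS](deriveV (f0 x) (df1 x)) /GRing.scale/= mulN1r -invfM -expr2.
- have dk i x : is_derive x (e_ i) (fun y => flat_exp k (f y))
    ((flat_exp k.+2 (f x) - k%:R * flat_exp k.+1 (f x)) * pderiv i f x).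
    apply: (is_derive_comp1 (is_derive_flat_exp k (f x))).
    by apply: derivableP; exact: (df i).1.
  split; first by move=> x; apply: continuous_comp; [exact: cf|exact: continuous_flat_exp].
  move=> i; split; first by move=> x; have [] := dk i x.
  rewrite (_ : pderiv _ _ = (fun x => (flat_exp k.+2 (f x) +
     (- k%:R) * flat_exp k.+1 (f x)) * pderiv i f x)).
    apply: gen_mul; last exact: (df i).2.
    apply: gen_add; first exact: gen_flat.
    by apply: gen_mul; [exact: gen_cst|exact: gen_flat].
  apply/funext => x; etransitivity; first exact: (@derive_val _ _ _ _ _ _ _ (dk i x)).
  by rewrite mulNr.
Qed.

Lemma gen_is_smooth f : gen f -> smooth f.
Proof.
apply: smooth_coind => {}f; first by move=> /gen_spec[].
  by move=> i x /gen_spec[_ /(_ i)[]].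
by move=> i /gen_spec[_ /(_ i)[]].
Qed.

Lemma smoothD f g : smooth f -> smooth g -> smooth (fun x => f x + g x).
Proof. by move=> sf sg; apply/gen_is_smooth/gen_add; exact: gen_smooth. Qed.

Lemma smoothM f g : smooth f -> smooth g -> smooth (fun x => f x * g x).
Proof. by move=> sf sg; apply/gen_is_smooth/gen_mul; exact: gen_smooth. Qed.

Lemma smooth_cst (c : R) : smooth (fun _ : E => c).
Proof. exact/gen_is_smooth/gen_cst. Qed.

Lemma smooth_coord i : smooth (fun x : E => x ord0 i).
Proof. exact/gen_is_smooth/gen_coord. Qed.

Lemma smoothN f : smooth f -> smooth (fun x => - f x).
Proof.
move=> sf; rewrite (_ : (fun x => _) = (fun x => -1 * f x)); last first.
  by apply/funext => x; rewrite mulN1r.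
exact: (smoothM (smooth_cst (-1)) sf).
Qed.

Lemma smoothB f g : smooth f -> smooth g -> smooth (fun x => f x - g x).
Proof. by move=> sf /smoothN; exact: smoothD. Qed.

Lemma smooth_prod (I : Type) (s : seq I) (F : I -> E -> R) :
  (forall i, smooth (F i)) -> smooth (fun x => \prod_(i <- s) F i x).
Proof.
move=> sF; elim: s => [|i s IH].
  by under eq_fun do rewrite big_nil; exact: smooth_cst.
under eq_fun do rewrite big_cons.
exact: (smoothM (sF i) IH).
Qed.

Lemma smooth_sum (I : Type) (s : seq I) (F : I -> E -> R) :
  (forall i, smooth (F i)) -> smooth (fun x => \sum_(i <- s) F i x).
Proof.
move=> sF; elim: s => [|i s IH].
  by under eq_fun do rewrite big_nil; exact: smooth_cst.
under eq_fun do rewrite big_cons.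
exact: (smoothD (sF i) IH).
Qed.

Lemma smooth_pderivD f g i : smooth f -> smooth g ->
  pderiv i (fun x => f x + g x) = fun x => pderiv i f x + pderiv i g x.
Proof. by move=> sf sg; apply: pderivD => x; exact: smooth_derivable. Qed.

Lemma smooth_pderivM f g i : smooth f -> smooth g ->
  pderiv i (fun x => f x * g x) = fun x => pderiv i f x * g x + f x * pderiv i g x.
Proof. by move=> sf sg; apply: pderivM => x; exact: smooth_derivable. Qed.

Lemma smooth_pderivB f g i : smooth f -> smooth g ->
  pderiv i (fun x => f x - g x) = fun x => pderiv i f x - pderiv i g x.
Proof.
move=> sf sg; rewrite (_ : (fun x => f x - g x) = (fun x => f x + (-1) * g x)); last first.
  by apply/funext => x; rewrite mulN1r.
rewrite (smooth_pderivD _ sf (smoothM (smooth_cst (-1)) sg)).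
rewrite (smooth_pderivM _ (smooth_cst (-1)) sg).
by rewrite pderiv_cst; apply/funext => x; ring.
Qed.

Lemma smooth_pderiv_sum (I : Type) (s : seq I) (F : I -> E -> R) i :
  (forall j, smooth (F j)) ->
  pderiv i (fun x => \sum_(j <- s) F j x) = fun x => \sum_(j <- s) pderiv i (F j) x.
Proof.
move=> sF; elim: s => [|j s IH].
  rewrite (_ : (fun x => _) = (fun=> 0)); last by apply/funext => x; rewrite big_nil.
  by rewrite pderiv_cst; apply/funext => x; rewrite big_nil.
rewrite (_ : (fun x => _) = (fun x => F j x + \sum_(j <- s) F j x)); last first.
  by apply/funext => x; rewrite big_cons.
rewrite (smooth_pderivD _ (sF j) (smooth_sum _ sF)) IH.
by apply/funext => x; rewrite big_cons.
Qed.

Lemma line_MVT f (v x : E) (h : R) : (forall y, derivable f y v) ->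
  exists2 k : R, `|k| <= `|h| & f (h *: v + x) - f x = h * 'D_v f (k *: v + x).
Proof.
move=> df; pose F (t : R) := f (t *: v + x).
have dF t : is_derive t (1 : R) F ('D_v f (t *: v + x)).
  apply/is_derive_line; rewrite /F.
  rewrite (_ : (fun k : R => _) = (fun k : R => f (k *: v + (t *: v + x)))); last first.
    by apply/funext => k; rewrite [k *: (1 : R)]mulr1 scalerDl addrA.
  by apply/is_derive_line; exact: derivableP.
have cF : continuous F.
  by move=> t; apply: differentiable_continuous; apply/derivable1_diffP; have [] := dF t.
have [h0|h0] := leP 0 h.
- have [k + E] := @MVT_segment R F _ 0 h h0 (fun t _ => dF t)
    (continuous_subspaceT cF).
  rewrite in_itv/= => /andP[k0 kh]; exists k; first by rewrite !ger0_norm.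
  by move: E; rewrite /F scale0r add0r subr0 => ->; rewrite mulrC.
- have [k + E] := @MVT_segment R F _ h 0 (ltW h0) (fun t _ => dF t)
    (continuous_subspaceT cF).
  rewrite in_itv/= => /andP[k0 kh]; exists k.
    by rewrite !ler0_norm ?lerN2// ltW.
  move: E; rewrite /F scale0r add0r sub0r => E.
  by rewrite -opprB E mulrN opprK mulrC.
Qed.

(** The second difference over the parallelogram with sides h e_i and h e_j is symmetric in i and j.
    Two applications of the mean value theorem turn it into h^2 times the mixed derivative, in
    either order, at a point near x; then continuity as h tends to 0. *)
Lemma schwarz f i j : smooth f -> pderiv i (pderiv j f) = pderiv j (pderiv i f).
Proof.
move=> sf; apply/funext => x.
have half a b (h : R) : exists p q, [/\ `|p| <= `|h|, `|q| <= `|h| &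
    f (h *: e_ a + (h *: e_ b + x)) - f (h *: e_ b + x)
    - (f (h *: e_ a + x) - f x)
    = h * (h * pderiv a (pderiv b f) (p *: e_ a + (q *: e_ b + x)))].
  pose psi z := f (h *: e_ a + z) - f z.
  have dpsi y : is_derive y (e_ b) psi (pderiv b f (h *: e_ a + y) - pderiv b f y).
    apply: is_deriveB; last by apply: derivableP; exact: smooth_derivable.
    apply/is_derive_line.
    rewrite (_ : (fun k : R => _) = (fun k : R => f (k *: e_ b + (h *: e_ a + y)))); last first.
      by apply/funext => k; rewrite addrCA.
    by apply/is_derive_line; apply: derivableP; exact: smooth_derivable.
  have [|q qh Eq] := @line_MVT psi (e_ b) x h; first by move=> y; have [] := dpsi y.
  have [|p ph Ep] := @line_MVT (pderiv b f) (e_ a) (q *: e_ b + x) h.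
    by move=> y; apply: smooth_derivable; exact: smooth_pderiv.
  exists p, q; split => //.
  rewrite -[LHS]/(psi (h *: e_ b + x) - psi x) Eq.
  by have [_ ->] := dpsi (q *: e_ b + x); rewrite Ep.
have cont a b : (fun h : R * R => pderiv a (pderiv b f) (h.1 *: e_ a + (h.2 *: e_ b + x)))
    @ (nbhs (0 : R, 0 : R)) --> pderiv a (pderiv b f) x.
  have -> : pderiv a (pderiv b f) x =
    pderiv a (pderiv b f) (((0 : R, 0 : R).1) *: e_ a + ((0 : R, 0 : R).2 *: e_ b + x)).
    by rewrite /= !scale0r !add0r.
  apply: continuous_comp; last by apply: smooth_continuous; do 2 apply: smooth_pderiv.
  apply: cvgD; first by apply: cvgZr_tmp => //; exact: cvg_fst.
  by apply: cvgD; [apply: cvgZr_tmp; exact: cvg_snd|exact: cvg_cst].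
apply/eqP; rewrite -subr_eq0 -normr_le0; apply/ler_addgt0Pl => e e0; rewrite addr0.
have e2 : 0 < e / 2 by rewrite divr_gt0.
have [[U V] /= [/nbhs_ballP[d1 /= d10 U1] /nbhs_ballP[d1' /= d1'0 V1]] H1] :=
  (cvgrPdist_le _ _).1 (cont i j) _ e2.
have [[U' V'] /= [/nbhs_ballP[d2 /= d20 U2] /nbhs_ballP[d2' /= d2'0 V2]] H2] :=
  (cvgrPdist_le _ _).1 (cont j i) _ e2.
pose m := Num.min (Num.min d1 d1') (Num.min d2 d2').
have m0 : 0 < m by rewrite !lt_min d10 d1'0 d20.
pose h := m / 2.
have h0 : 0 < h by rewrite divr_gt0.
have hm : h < m by rewrite /h; lra.
have [p [q [ph qh E1]]] := half i j h; have [p' [q' [ph' qh' E2]]] := half j i h.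
have hh : `|h| = h by rewrite ger0_norm// ltW.
rewrite hh in ph qh ph' qh'.
have small k d : `|k| <= h -> m <= d -> ball (0 : R) d k.
  by move=> kh md; rewrite -ball_normE/= sub0r normrN; exact: (le_lt_trans kh (lt_le_trans hm md)).
have B1 : `|pderiv i (pderiv j f) x - pderiv i (pderiv j f)
    (p *: e_ i + (q *: e_ j + x))| <= e / 2.
  by apply: (H1 (p, q)); split => /=; [apply: U1|apply: V1]; apply: small => //;
    rewrite /m !ge_min lexx ?orbT.
have B2 : `|pderiv j (pderiv i f) x - pderiv j (pderiv i f)
    (p' *: e_ j + (q' *: e_ i + x))| <= e / 2.
  by apply: (H2 (p', q')); split => /=; [apply: U2|apply: V2]; apply: small => //;
    rewrite /m !ge_min lexx ?orbT.
have E : pderiv i (pderiv j f) (p *: e_ i + (q *: e_ j + x)) =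
  pderiv j (pderiv i f) (p' *: e_ j + (q' *: e_ i + x)).
  have Eg (a b c d : R) : a - b - (c - d) = a - c - (b - d) by ring.
  have A : h *: e_ i + (h *: e_ j + x) = h *: e_ j + (h *: e_ i + x).
    exact: addrCA.
  apply: (mulfI (lt0r_neq0 h0)); apply: (mulfI (lt0r_neq0 h0)).
  etransitivity; first exact: (esym E1); etransitivity; last exact: E2.
  by clear - A Eg; rewrite A Eg.
rewrite (splitr e) -(subrKA (pderiv i (pderiv j f) (p *: e_ i + (q *: e_ j + x)))).
apply: (le_trans (ler_normD _ _)); apply: lerD; first exact: B1.
by rewrite E distrC; exact: B2.
Qed.

(** Only partial derivatives are at hand, so x is joined to y by n segments parallel to the axes,
    whence the factor n. The intermediate points stay in the ball of the maximum norm around x. *)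
Lemma smooth_lip f (x y : E) (M : R) : smooth f ->
  (forall i z, `|z - x| <= `|y - x| -> `|pderiv i f z| <= M) ->
  `|f y - f x| <= n%:R * M * `|y - x|.
Proof.
move=> sf fM.
pose p (k : nat) : E := \row_j (if (j < k)%N then y ord0 j else x ord0 j).
have p0 : p 0%N = x by apply/rowP => j; rewrite mxE.
have pn : p n = y by apply/rowP => j; rewrite mxE ltn_ord.
have -> : f y - f x = \sum_(k < n) (f (p k.+1) - f (p k)).
  by rewrite -(big_mkord xpredT (fun k => f (p k.+1) - f (p k))) telescope_sumr// pn p0.
rewrite (le_trans (ler_norm_sum _ _ _))// -mulrA mulr_natl -[X in _ *+ X](card_ord n).
rewrite -sumr_const; apply: ler_sum => k _ /=.
have pS : p k.+1 = (y ord0 k - x ord0 k) *: e_ k + p k.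
  apply/rowP => j; rewrite !mxE eqxx /= ltnS leq_eqVlt (inj_eq val_inj).
  by case: (eqVneq j k) => [->|]/=; rewrite ?ltnn ?mulr1 ?subrK// mulr0 add0r.
have [s sh] := @line_MVT f (e_ k) (p k) (y ord0 k - x ord0 k)
  (fun z => @smooth_derivable f k z sf).
rewrite -pS => ->; rewrite normrM mulrC ler_pM ?normr_ge0//; last first.
  by have := coord_norm (y - x) k; rewrite !mxE.
apply: fM; apply/norm_coordP => // j; rewrite !mxE eqxx/=.
have yx i : `|y ord0 i - x ord0 i| <= `|y - x|.
  by have := coord_norm (y - x) i; rewrite !mxE.
case: (eqVneq j k) => [->|_].
  by rewrite ltnn mulr1 addrK (le_trans sh).
by rewrite mulr0 add0r; case: ifP => _; rewrite ?subrr ?normr0.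
Qed.

(** [smooth_lip] applied to f minus its linear part L at x; the derivatives of f - L are increments
    of those of f and are bounded by [smooth_lip] once more. *)
Lemma smooth_taylor f (x y : E) (M : R) : smooth f ->
  (forall i j z, `|z - x| <= `|y - x| -> `|pderiv j (pderiv i f) z| <= M) ->
  `|f y - f x - \sum_i (y ord0 i - x ord0 i) * pderiv i f x|
    <= n%:R * (n%:R * M * `|y - x|) * `|y - x|.
Proof.
move=> sf fM.
pose L (z : E) := \sum_i (pderiv i f x) * z ord0 i.
have sL : smooth L.
  by apply: smooth_sum => i; apply: (smoothM (smooth_cst _) (smooth_coord _)).
have dL j : pderiv j L = fun=> pderiv j f x.
  rewrite /L smooth_pderiv_sum; last first.
    by move=> i; apply: (smoothM (smooth_cst _) (smooth_coord _)).
  apply/funext => z; rewrite (bigD1 j)//= big1 ?addr0.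
    rewrite (smooth_pderivM _ (smooth_cst _) (smooth_coord _)) pderiv_cst pderiv_coord.
    by rewrite eqxx mul0r add0r mulr1.
  move=> i /negPf ij.
  rewrite (smooth_pderivM _ (smooth_cst _) (smooth_coord _)) pderiv_cst pderiv_coord.
  by rewrite eq_sym ij mul0r add0r mulr0.
have := @smooth_lip (fun z => f z - L z) x y (n%:R * M * `|y - x|) (smoothB sf sL).
rewrite (_ : f y - L y - (f x - L x) =
    f y - f x - \sum_i (y ord0 i - x ord0 i) * pderiv i f x); last first.
  have -> : \sum_i (y ord0 i - x ord0 i) * pderiv i f x = L y - L x.
    by rewrite /L -sumrB; apply: eq_bigr => i _; ring.
  by ring.
apply => i z zx; rewrite (smooth_pderivB _ sf sL) dL.
have M0 : 0 <= M by apply: (le_trans _ (fM i i z zx)).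
have := @smooth_lip (pderiv i f) x z M (@smooth_pderiv f i sf).
move=> /(_ _)/le_trans; apply; last by rewrite ler_wpM2l// mulr_ge0.
by move=> j t tz; apply: fM; exact: (le_trans tz zx).
Qed.

Lemma test_supp (Om : set E) f : test_function Om f ->
  exists2 r : R, 0 < r & forall x : E, r < `|x| -> f x = 0.
Proof.
move=> [_ [K [cK _ fK]]]; have [r [rr Kr]] := compact_bounded cK.
exists (`|r| + 1); first by rewrite ltr_wpDl.
move=> x xr; apply: fK => Kx; have := Kr (`|r| + 1) _ _ Kx.
rewrite ltr_pwDr//; last by rewrite ler_norm.
by move=> /(_ isT)/(lt_le_trans xr); rewrite ltxx.
Qed.

Lemma test_bounded (Om : set E) f : test_function Om f ->
  exists2 M : R, 0 <= M & forall x, `|f x| <= M.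
Proof.
move=> [sf [K [cK _ fK]]].
have cf := smooth_continuous sf.
have /compact_bounded[M [Mr MP]] :
    compact [set f x | x in K] by apply: continuous_compact => //; exact: continuous_subspaceT.
exists (`|M| + 1); first by rewrite addr_ge0.
move=> x; have [Kx|nKx] := pselect (K x); last by rewrite fK// normr0 addr_ge0.
by apply: MP; [rewrite ltr_pwDr// ler_norm|exists x].
Qed.

Lemma test_pderiv (Om : set E) f i : test_function Om f -> test_function Om (pderiv i f).
Proof.
move=> [sf [K [cK KO fK]]]; split; first exact: smooth_pderiv.
exists K; split => // x nKx; rewrite /pderiv.
rewrite (@near_eq_derive _ _ _ f (cst 0) x); first exact: derive_cst.
have : open (~` K) by apply: closed_openC; exact: compact_closed.
move=> /(_ x nKx); apply: filterS => y nKy; exact: fK.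
Qed.

Lemma test_sub (O1 O2 : set E) f : O1 `<=` O2 -> test_function O1 f -> test_function O2 f.
Proof.
move=> O12 [sf [K [cK KO fK]]]; split => //; exists K; split => //.
exact: subset_trans O12.
Qed.

Lemma test_mull (Om : set E) f g : smooth g -> test_function Om f ->
  test_function Om (fun x => g x * f x).
Proof.
move=> sg [sf [K [cK KO fK]]]; split; first exact: smoothM.
by exists K; split => // x nKx; rewrite fK// mulr0.
Qed.

Lemma testD (Om : set E) f g : test_function Om f -> test_function Om g ->
  test_function Om (fun x => f x + g x).
Proof.
move=> [sf [K [cK KO fK]]] [sg [K' [cK' KO' gK]]]; split; first exact: smoothD.
exists (K `|` K'); split; first exact: compactU.
  by move=> x [/KO|/KO'].
by move=> x /not_orP[nK nK']; rewrite fK// gK// addr0.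
Qed.

(** The standard smooth transition from 0 on t <= 0 to 1 on t >= 1. The denominator is positive
    because t or 1 - t is. *)
Definition step (t : R) : R := flat_exp 0 t / (flat_exp 0 t + flat_exp 0 (1 - t)).

Lemma step_den (t : R) : 0 < flat_exp 0 t + flat_exp 0 (1 - t).
Proof.
have [t0|t0] := ltP 0 t; first by rewrite ltr_wpDr ?flat_exp_ge0// flat_exp_gt0.
by rewrite ltr_wpDl ?flat_exp_ge0// flat_exp_gt0//; lra.
Qed.

Lemma step_le0 (t : R) : t <= 0 -> step t = 0.
Proof. by move=> t0; rewrite /step flat_exp_le0// mul0r. Qed.

Lemma step_ge1 (t : R) : 1 <= t -> step t = 1.
Proof.
move=> t1; rewrite /step (@flat_exp_le0 _ _ (1 - t)) ?subr_le0// addr0 divff//.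
by rewrite gt_eqF// flat_exp_gt0// (lt_le_trans ltr01).
Qed.

Lemma step_ge0 (t : R) : 0 <= step t.
Proof. by rewrite divr_ge0 ?flat_exp_ge0// ltW// step_den. Qed.

Lemma smooth_step f : smooth f -> smooth (fun x => step (f x)).
Proof.
move=> sf; apply: gen_is_smooth; have gf := gen_smooth sf.
have g1 : gen (fun x => flat_exp 0 (1 - f x)).
  apply: gen_flat; apply: gen_add; first exact: gen_cst.
  exact/gen_smooth/smoothN.
apply: gen_mul; first exact: gen_flat.
apply: gen_inv; first by apply: gen_add => //; exact: gen_flat.
by move=> x; rewrite gt_eqF// step_den.
Qed.

(** A bump in product form, adapted to the maximum norm: 1 within distance r of c, and 0 beyond
    distance 2r. *)
Definition plateau (c : E) (r : R) (x : E) : R :=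
  \prod_i (step (2 - (x ord0 i - c ord0 i) / r) * step (2 + (x ord0 i - c ord0 i) / r)).

Lemma smooth_plateau (c : E) (r : R) : smooth (plateau c r).
Proof.
have sa i (a b : R) : smooth (fun x : E => a + b * (x ord0 i - c ord0 i)).
  apply: (smoothD (smooth_cst _)); apply: (smoothM (smooth_cst _)).
  exact: (smoothB (smooth_coord _) (smooth_cst _)).
apply: smooth_prod => i; apply: smoothM; apply: smooth_step.
  have := sa i 2 (- r^-1); congr smooth; apply/funext => x; ring.
by have := sa i 2 r^-1; congr smooth; apply/funext => x; ring.
Qed.

Lemma plateau_ge0 (c : E) (r : R) (x : E) : 0 <= plateau c r x.
Proof. by apply: prodr_ge0 => i _; rewrite mulr_ge0// step_ge0. Qed.

Lemma plateau1 (c : E) (r : R) (x : E) : 0 < r -> `|x - c| <= r -> plateau c r x = 1.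
Proof.
move=> r0 xr; rewrite /plateau big1// => i _.
have := (norm_coordP _ (ltW r0)).1 xr i; rewrite !mxE ler_norml => /andP[h1 h2].
have h3 : (x ord0 i - c ord0 i) / r <= 1 by rewrite ler_pdivrMr// mul1r.
have h4 : -1 <= (x ord0 i - c ord0 i) / r by rewrite ler_pdivlMr// mulN1r.
by rewrite !step_ge1 ?mulr1//; lra.
Qed.

Lemma plateau0 (c : E) (r : R) (x : E) : 0 < r -> 2 * r < `|x - c| -> plateau c r x = 0.
Proof.
move=> r0 xr; have [i xi] : exists i, 2 * r < `|x ord0 i - c ord0 i|.
  apply: contrapT => /forallNP h; move: xr; apply/negP; rewrite -leNgt.
  apply/norm_coordP; first by rewrite mulr_ge0// ltW.
  by move=> i; rewrite !mxE leNgt; apply/negP/h.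
rewrite /plateau (bigD1 i)//= [X in X * _](_ : _ = 0) ?mul0r//.
move: xi; rewrite lter_normr => /orP[h|h].
  rewrite step_le0 ?mul0r// subr_le0 ler_pdivlMr// ltW//.
rewrite [X in _ * X]step_le0 ?mulr0//.
have : (x ord0 i - c ord0 i) / r <= -2 by rewrite ler_pdivrMr//; lra.
by lra.
Qed.

Lemma closed_ball_compact (c : E) (r : R) : compact [set x | `|x - c| <= r].
Proof.
apply: bounded_closed_compact.
  exists (r + `|c|); split; first by rewrite num_real.
  move=> M rM x /= xr; rewrite -(subrK c x) (le_trans (ler_normD _ _))//.
  by rewrite (le_trans _ (ltW rM))// lerD2r.
rewrite (_ : [set x | _] = (fun x => `|x - c|) @^-1` [set t | t <= r])//.
apply: closed_comp; last exact: closed_le.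
move=> x _; apply: continuous_comp; last exact: norm_continuous.
by apply: continuousB => //; exact: cst_continuous.
Qed.

Lemma test_plateau (Om : set E) (c : E) (r : R) : 0 < r ->
  (forall x, `|x - c| <= 2 * r -> Om x) -> test_function Om (plateau c r).
Proof.
move=> r0 cO; split; first exact: smooth_plateau.
exists [set x | `|x - c| <= 2 * r]; split; [exact: closed_ball_compact|exact: cO|].
by move=> x /negP; rewrite -ltNge; exact: plateau0.
Qed.

End Smooth.

(** * Mollification *)

Section Translation.
Context {R : realType} {n : nat}.
Local Notation E := 'rV[R]_n.
Local Notation mu := (lebesgue R n).
Notation intT f := (mu.-integrable setT (EFin \o f)).
Implicit Types (f g h : E -> R).

Lemma L2_dominated (w : set E) (h : nat -> E -> R) g G : measurable w ->
  (forall k, measurable_fun w (h k)) -> measurable_fun w g -> in_L2 w G ->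
  (forall x, w x -> h ^~ x @ \oo --> g x) ->
  (forall k x, w x -> `|h k x| <= G x) ->
  (forall k, in_L2 w (h k)) /\ in_L2 w g /\
  (fun k => norm0 w (fun x => h k x - g x)) @ \oo --> 0.
Proof.
move=> mw mh mg LG hg hG.
have Lh k : in_L2 w (h k).
  by apply: (in_L2_le mw (mh k) LG) => x wx; rewrite (le_trans (hG k x wx)) ?ler_norm.
have gG x : w x -> `|g x| <= G x.
  move=> wx; have : (fun k => `|h k x|) @ \oo --> `|g x| by apply: cvg_norm; exact: hg.
  move=> c; rewrite -(cvg_lim _ c)//; apply: limr_le; first by apply/cvg_ex; exists `|g x|.
  by apply: nearW => k; exact: hG.
have Lg : in_L2 w g.
  by apply: (in_L2_le mw mg LG) => x wx; rewrite (le_trans (gG x wx)) ?ler_norm.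
split => //; split => //.
have c : (fun k => \int[mu]_(x in w) ((h k x - g x) * (h k x - g x))%:E)%E @ \oo --> 0%E.
  rewrite -(integral0 mu w).
  apply: (@dominated_cvg _ _ _ mu w mw _ _ (fun x => ((2 * G x) * (2 * G x))%:E)).
  - move=> k; apply/measurable_EFinP.
    by apply: measurable_funM; apply: measurable_funB.
  - move=> x wx; apply: cvg_EFin; first exact: nearW.
    rewrite [X in _ --> X](_ : 0 = (g x - g x) * (g x - g x)); last by rewrite subrr mul0r.
    by apply: cvgM; (apply: cvgB; [exact: hg|exact: cvg_cst]).
  - by [].
  - by apply: in_L2_int => //; exact: in_L2Z.
  - move=> k x wx; rewrite gee0_abs ?lee_fin -?expr2 ?sqr_ge0//.
    rewrite -[leLHS]real_normK ?num_real// lerXn2r ?nnegrE//.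
      by have := le_trans (normr_ge0 _) (hG k x wx); lra.
    rewrite (le_trans (ler_normB _ _))//.
    by have := hG k x wx; have := gG x wx; lra.
have -> : (fun k => norm0 w (fun x => h k x - g x)) =
  (fun k => Num.sqrt (fine (\int[mu]_(x in w) ((h k x - g x) * (h k x - g x))%:E))).
  by [].
rewrite -[X in _ --> X](@sqrtr0 R); apply: continuous_cvg; first exact: sqrt_continuous.
exact: (fine_cvg c).
Qed.

Lemma in_L2_shift z f : in_L2 setT f -> in_L2 setT (fun x => f (x + z)).
Proof.
move=> [mf If]; split; first exact: (measurableT_comp mf (measurable_shift z)).
exact: (integrable_shift z If).
Qed.

Lemma norm0_shift z f : measurable_fun setT f ->
  norm0 setT (fun x => f (x + z)) = norm0 setT f.
Proof.
move=> mf; congr (Num.sqrt (fine _)).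
apply: (integral_shift z (f := fun x => (f x * f x)%:E)).
by apply/measurable_EFinP; exact: measurable_funM.
Qed.

Let mT : measurable [set: E] := measurableT.

Definition trans_cont f := in_L2 setT f /\ forall e, 0 < e -> exists2 d, 0 < d &
  forall z, `|z| <= d -> norm0 setT (fun x => f (x + z) - f x) <= e.

Let tri f g : in_L2 setT f -> in_L2 setT g ->
  norm0 setT (fun x => f x + g x) <= norm0 setT f + norm0 setT g.
Proof.
move=> Lf Lg; have := @nmD _ _ setT mT unit (fun=> f) (fun=> g) (fun=> Lf) (fun=> Lg).
by rewrite /tuple_nm /tuple_ip !(big_pred1 tt)//; case.
Qed.

Lemma norm0Z k f : in_L2 setT f -> norm0 setT (fun x => k * f x) = `|k| * norm0 setT f.
Proof.
move=> Lf; have := @nmZ _ _ setT mT unit k (fun=> f) (fun=> Lf).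
by rewrite /tuple_nm /tuple_ip !(big_pred1 tt)//; case.
Qed.

Lemma trans_contD f g : trans_cont f -> trans_cont g -> trans_cont (fun x => f x + g x).
Proof.
move=> [Lf cf] [Lg cg]; split; first exact: in_L2D.
move=> e e0; have e2 : 0 < e / 2 by rewrite divr_gt0.
have [d1 d10 H1] := cf _ e2; have [d2 d20 H2] := cg _ e2.
exists (Num.min d1 d2); first by rewrite lt_min d10.
move=> z; rewrite le_min => /andP[/H1 h1 /H2 h2].
rewrite (splitr e); apply: le_trans (lerD h1 h2).
have := @tri (fun x => f (x + z) - f x) (fun x => g (x + z) - g x)
  (in_L2B mT (in_L2_shift z Lf) Lf) (in_L2B mT (in_L2_shift z Lg) Lg).
by apply: le_trans; rewrite le_eqVlt; apply/orP; left; apply/eqP; congr Num.sqrt;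
  apply: eq_Rintegral => x _; ring.
Qed.

Lemma trans_contZ k f : trans_cont f -> trans_cont (fun x => k * f x).
Proof.
move=> [Lf cf]; split; first exact: in_L2Z.
move=> e e0; have k1 : 0 < `|k| + 1 by rewrite ltr_wpDl.
have [d d0 H] := cf _ (divr_gt0 e0 k1); exists d => // z /H h.
rewrite (_ : norm0 _ _ = `|k| * norm0 setT (fun x => f (x + z) - f x)); last first.
  rewrite -norm0Z; last by apply: in_L2B => //; exact: in_L2_shift.
  by congr Num.sqrt; apply: eq_Rintegral => x _; ring.
rewrite (le_trans (ler_wpM2l _ h))// mulrCA ler_piMr ?(ltW e0)//.
by rewrite ler_pdivrMr// mul1r lerDl.
Qed.

Lemma trans_cont_ext f g : f =1 g -> trans_cont f -> trans_cont g.
Proof. by move=> /funext ->. Qed.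

Lemma trans_contB f g : trans_cont f -> trans_cont g -> trans_cont (fun x => f x - g x).
Proof.
move=> tf /(trans_contZ (-1)) tg; apply: trans_cont_ext (trans_contD tf tg).
by move=> x /=; rewrite mulN1r.
Qed.

(** The norm is translation invariant, so the translation error of [f] exceeds that of [h N] by at
    most twice the distance from [h N] to [f]. *)
Lemma trans_cont_lim (h : nat -> E -> R) f : in_L2 setT f -> (forall k, trans_cont (h k)) ->
  (fun k => norm0 setT (fun x => h k x - f x)) @ \oo --> 0 -> trans_cont f.
Proof.
move=> Lf th hf; split => // e e0; have e3 : 0 < e / 3 by rewrite divr_gt0.
have [N _ /(_ N (leqnn _)) hN] := (cvgrPdist_le _ _).1 hf _ e3.
rewrite /= sub0r normrN ger0_norm ?norm0_ge0// in hN.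
have [Lh ch] := th N; have [d d0 H] := ch _ e3; exists d => // z /H hz.
pose F x := h N x - f x; have LF : in_L2 setT F by exact: in_L2B.
have LFs := in_L2_shift z LF.
have L1 := in_L2B mT (in_L2_shift z Lh) Lh.
have L2 := in_L2Z mT (-1) LFs.
have -> : norm0 setT (fun x => f (x + z) - f x) =
   norm0 setT (fun x => ((h N (x + z) - h N x) + (-1) * F (x + z)) + F x).
  by congr Num.sqrt; apply: eq_Rintegral => x _; rewrite /F; ring.
rewrite (le_trans (tri (in_L2D mT L1 L2) LF))//.
have := tri L1 L2; rewrite norm0Z// normrN1 mul1r norm0_shift; last by case: LF.
by move=> h1; rewrite -/F in hN; lra.
Qed.

Lemma in_L2_indic (A : set E) : measurable A -> (mu A < +oo)%E -> in_L2 setT (\1_A : E -> R).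
Proof.
move=> mA Aoo; split; first exact: measurable_indic.
apply: (eq_integrable _ (EFin \o \1_A)) => //.
  by move=> x _ /=; rewrite indicE; case: (_ \in _); rewrite ?expr1n ?expr0n.
apply/integrableP; split; first exact/measurable_EFinP/measurable_indic.
rewrite (eq_integral (EFin \o \1_A)); last by move=> x _; rewrite /= ger0_norm.
by rewrite integral_indic// setIT.
Qed.

Lemma inner_indic (A : set E) : measurable A ->
  inner setT (\1_A : E -> R) \1_A = fine (mu A).
Proof.
move=> mA; rewrite /inner /Rintegral; congr fine.
rewrite -[in RHS](setIT A) -integral_indic//; apply: eq_integral => x _.
by rewrite indicE; case: (_ \in _); rewrite ?mulr1 ?mulr0.
Qed.

Definition thicken (C : set E) (d : R) := [set x | exists2 y, C y & `|x - y| < d].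

Lemma open_thicken C d : 0 < d -> open (thicken C d).
Proof.
move=> d0.
rewrite (_ : thicken C d = \bigcup_(y in C) ball y d); last first.
  apply/seteqP; split => [x [y Cy xy]|x [y Cy]].
    by exists y => //; rewrite -ball_normE/= distrC.
  by rewrite -ball_normE/= distrC; exists y.
by apply: bigcup_open => y _; exact: ball_open.
Qed.

(* For closed bounded C, the sets C - z exceed C at most by the thin shell
   [thicken C d \ C]. *)
Lemma trans_cont_closed (C : set E) : closed C -> bounded_set C -> trans_cont (\1_C : E -> R).
Proof.
move=> cC bC; have mC := closed_measurable_rV cC.
have Coo := bounded_lebesgue bC mC.
have LC := in_L2_indic mC Coo; split => // e e0.
pose D k := thicken C k.+1%:R^-1 `\` C.
have mD k : measurable (D k).
  by apply: measurableD => //; apply: open_measurable_rV; exact: open_thicken.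
have Doo : (mu (D 0%N) < +oo)%E.
  apply: bounded_lebesgue => //; have [r [rr Cr]] := bC.
  exists (`|r| + 2); split; first exact: num_real.
  move=> M rM x [[y Cy xy] _] /=; rewrite -(subrK y x) (le_trans (ler_normD _ _))//.
  rewrite invr1 in xy; have := Cr (`|r| + 1); rewrite ltr_pwDr ?ler_norm// => /(_ isT _ Cy).
  by move=> /= h; lra.
have Dcap : \bigcap_k D k = set0.
  rewrite -subset0 => x Dx; have [_ nCx] := Dx 0%N I; apply: nCx; apply: cC.
  move=> U /nbhs_ballP[d /= d0 dU].
  pose k := Num.bound d^-1.
  have [[y Cy xy] _] := Dx k I; exists y; split => //; apply: dU.
  rewrite -ball_normE/=; apply: (lt_le_trans xy).
  rewrite -[leRHS]invrK lef_pV2 ?posrE ?invr_gt0 ?ltr0n//.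
  rewrite (le_trans (ltW (archi_boundP _))) ?invr_ge0 ?(ltW d0)//.
  by rewrite ler_nat.
have Dcvg : mu (D k) @[k --> \oo] --> (0 : \bar R)%E.
  rewrite -(measure0 mu) -Dcap; apply: nonincreasing_cvg_mu => //.
    by rewrite Dcap.
  move=> k m km; apply/subsetPset => x [[y Cy xy] nCx]; split => //; exists y => //.
  by apply: (lt_le_trans xy); rewrite lef_pV2 ?posrE ?ltr0n// ler_nat ltnS.
have e2 : 0 < e ^+ 2 / 2 by rewrite divr_gt0// exprn_gt0.
have [N _ /(_ N (leqnn _))] := (cvgrPdist_le _ _).1 (fine_cvg Dcvg) _ e2.
rewrite /= sub0r normrN ger0_norm ?fine_ge0// => DN.
have DNoo : (mu (D N) < +oo)%E.
  apply: le_lt_trans Doo; apply: le_measure; rewrite ?inE// => x [[y Cy xy] nCx].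
  split => //; exists y => //; apply: (lt_le_trans xy).
  by rewrite lef_pV2 ?posrE ?ltr0n// ler_nat.
exists (N.+2%:R^-1); first by rewrite invr_gt0.
move=> z zN; have zN' : `|z| < N.+1%:R^-1.
  by apply: (le_lt_trans zN); rewrite ltf_pV2 ?posrE ?ltr0n// ltr_nat.
pose DS := (fun x => x + z) @^-1` D N.
have LD := in_L2_indic (mD N) DNoo.
have LDS := in_L2_shift z LD.
have Lz := in_L2_shift z LC.
rewrite -ler_sqr ?nnegrE ?norm0_ge0 ?(ltW e0)// norm0_sqr.
apply: (@le_trans _ _ (\int[mu]_x ((\1_(D N) x * \1_(D N) x : R) +
     \1_(D N) (x + z) * \1_(D N) (x + z)))).
  apply: le_Rintegral => //.
  - by apply: in_L2_int => //; exact: in_L2B.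
  - by apply: intwD => //; exact: in_L2_int.
  move=> x _; rewrite !indicE.
  have h1 : x \in C -> x + z \notin C -> x + z \in D N.
    rewrite inE notin_setE => Cx nCz; rewrite inE; split => //.
    by exists x => //; rewrite addrC addKr.
  have h2 : x \notin C -> x + z \in C -> x \in D N.
    rewrite inE notin_setE => nCx Cz; rewrite inE; split => //.
    by exists (x + z) => //; rewrite opprD addNKr normrN.
  have [Cx|nCx] := boolP (x \in C); have [Cz|nCz] := boolP (x + z \in C).
  - by rewrite subrr mul0r addr_ge0// mulr_ge0.
  - rewrite (h1 Cx nCz); case: (x \in D N) => /=; lra.
  - rewrite (h2 nCx Cz); case: (x + z \in D N) => /=; lra.
  - by rewrite subrr mul0r addr_ge0// mulr_ge0.
rewrite RintegralD//; [|exact: in_L2_int|exact: in_L2_int].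
rewrite -/(inner setT (\1_(D N) : E -> R) \1_(D N)).
rewrite -[X in _ + X]/(inner setT (fun x => \1_(D N) (x + z) : R) (fun x => \1_(D N) (x + z))).
rewrite -[X in _ + X]norm0_sqr norm0_shift; last by case: LD.
by rewrite norm0_sqr inner_indic//; lra.
Qed.

Lemma indic_setD (A B : set E) x : A `<=` B -> \1_(B `\` A) x = \1_B x - \1_A x :> R.
Proof.
move=> AB; rewrite !indicE in_setD.
have [xA|xA] := boolP (x \in A); have [xB|xB] := boolP (x \in B) => /=; try by [ring].
by exfalso; move: xB xA; rewrite notin_setE inE => nB /AB.
Qed.

Lemma norm0_indic_sub (A B : set E) : measurable A -> measurable B -> A `<=` B ->
  (mu B < +oo)%E ->
  norm0 setT (fun x => \1_A x - \1_B x : R) = Num.sqrt (fine (mu (B `\` A))).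
Proof.
move=> mA mB AB Boo; rewrite -inner_indic; last exact: measurableD.
congr Num.sqrt; apply: eq_Rintegral => x _; rewrite indic_setD//; ring.
Qed.

Lemma closed_cube r : closed (cube n r : set E).
Proof.
rewrite (_ : cube n r = \bigcap_(i in [set: 'I_n]) ((fun x : E => x ord0 i) @^-1` `[- r, r]%classic)).
  apply: closed_bigI => i _; apply: closed_comp; last exact: itv_closed.
  by move=> x _; exact: coord_continuous.
by apply/seteqP; split => [x cx i _|x cx i]; [exact: cx|exact: (cx i I)].
Qed.

Lemma cubeP r (x : E) : 0 <= r -> cube n r x <-> `|x| <= r.
Proof.
move=> r0; rewrite norm_coordP//; split=> h i.
  by have := h i; rewrite /= in_itv/= ler_norml.
by rewrite /= in_itv/= -ler_norml; exact: h.
Qed.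

Lemma measurable_cube r : measurable (cube n r : set E).
Proof. by apply: measurable_rect. Qed.

Lemma bounded_cube r : bounded_set (cube n r : set E).
Proof.
exists `|r|; split; first exact: num_real.
move=> M rM x cx; have M0 : 0 <= M by rewrite (le_trans _ (ltW rM)).
apply/norm_coordP => // i; have := cx i; rewrite /= in_itv/= -ler_norml => /le_trans; apply.
by rewrite ltW// (le_lt_trans _ rM)// ler_norm.
Qed.

(** Differences and increasing unions preserve the property, so the admissible [A] form a
    lambda-system; it contains the pi-system of closed bounded sets, which generates. The cube keeps
    all measures finite. *)
Lemma trans_cont_indic (A : set E) (r : R) : measurable A ->
  trans_cont (\1_(A `&` cube n r) : E -> R).
Proof.
pose G : set (set E) := [set C | closed C /\ bounded_set C].
pose H : set (set E) := [set A | measurable A /\ trans_cont (\1_(A `&` cube n r) : E -> R)].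
have mcube : measurable (cube n r : set E).
  exact: measurable_cube.
have fin B : measurable B -> (mu (B `&` cube n r) < +oo)%E.
  move=> mB; apply: le_lt_trans (lebesgue_cube n r).
  by apply: le_measure; rewrite ?inE//; exact: measurableI.
have GI : setI_closed G.
  move=> B C [cB bB] [cC bC]; split; first exact: closedI.
  have [M [Mr MP]] := bB; exists M; split => // N MN x [Bx _]; exact: MP.
have sG : <<s setT, G >> `<=` H.
  apply: lambda_system_subset => //.
  - split => //.
    + split=> //; rewrite setTI; apply: trans_cont_closed; first exact: closed_cube.
      exact: bounded_cube.
    + move=> B C CB [mB tB] [mC tC]; split; first exact: measurableD.
      rewrite (_ : (B `\` C) `&` cube n r = (B `&` cube n r) `\` (C `&` cube n r)); last first.
        apply/seteqP; split=> [x [[Bx nCx] cx]|x [[Bx cx] nCx]]; first by split=> // -[].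
        by do 2 split => //; move=> Cx; apply: nCx.
      apply: trans_cont_ext (trans_contB tB tC) => x.
      by rewrite indic_setD//; exact: setSI.
    + move=> F ndF HF; have mF k : measurable (F k) by have [] := HF k.
      have mU : measurable (\bigcup_k F k) by exact: bigcupT_measurable.
      split => //; set U := \bigcup_k F k.
      apply: (@trans_cont_lim (fun k => \1_(F k `&` cube n r))).
      * apply: in_L2_indic; [exact: measurableI|exact: fin].
      * by move=> k; have [] := HF k.
      have -> : (fun k => norm0 setT (fun x => \1_(F k `&` cube n r) x - \1_(U `&` cube n r) x : R))
        = (fun k => Num.sqrt (fine (mu ((U `&` cube n r) `\` (F k `&` cube n r))))).
        apply/funext => k; apply: norm0_indic_sub; [exact: measurableI|exact: measurableI| |exact: fin].
        by apply: setSI => x Fx; exists k.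
      rewrite -[X in _ --> X](@sqrtr0 R); apply: continuous_cvg; first exact: sqrt_continuous.
      suff c : mu ((U `&` cube n r) `\` (F k `&` cube n r)) @[k --> \oo] --> 0%E.
        exact: (fine_cvg c).
      rewrite -(measure0 mu).
      rewrite (_ : set0 = \bigcap_k ((U `&` cube n r) `\` (F k `&` cube n r))); last first.
        apply/esym; rewrite -subset0 => x Dx; have [[[k _ Fk] cx] _] := Dx 0%N I.
        by have [_] := Dx k I; apply.
      apply: nonincreasing_cvg_mu.
      * apply: le_lt_trans (fin _ mU); apply: le_measure; last by move=> x [].
          by rewrite inE; apply: measurableD; exact: measurableI.
        by rewrite inE; exact: measurableI.
      * by move=> k; apply: measurableD; exact: measurableI.
      * apply: bigcapT_measurable => k; by apply: measurableD; exact: measurableI.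
      * move=> k m km; apply/subsetPset; apply: setDS; apply: setSI.
        exact/subsetPset/ndF.
  - move=> C [cC bC]; split; first exact: closed_measurable_rV.
    apply: trans_cont_closed; first by apply: closedI => //; exact: closed_cube.
    have [M [Mr MP]] := bC; exists M; split => // N MN x [Cx _]; exact: MP.
move=> mA; suff : H A by case.
apply: sG; move: mA; suff : measurable `<=` <<s setT, G >> by apply.
apply: smallest_sub; first exact: smallest_sigma_algebra.
rewrite -bigcup_seq; apply: bigcup_sub => i _.
have S : sigma_algebra setT [set Y : set R | <<s G >> ((fun x : E => x ord0 i) @^-1` Y)].
  split => /=.
  - by rewrite preimage_set0; exact: sigma_algebra0.
  - by move=> Y /= sY; exact: (sigma_algebraCD sY).
  - by move=> F sF; rewrite preimage_bigcup; exact: sigma_algebra_bigcup.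
have RE : (measurable : set (set R)) = <<s @RGenCInfty.G R >>.
  exact: RGenCInfty.measurableE.
move=> _ [Y mY <-] /=; rewrite setTI; move: Y mY.
rewrite RE; apply: smallest_sub => //.
(* Closed half-spaces are unbounded, so each one is written as the union of its parts in the integer
   cubes. *)
move=> _ [a ->] /=; rewrite [X in <<s _ >> X](_ : _ =
  \bigcup_k ((fun x : E => x ord0 i) @^-1` `[a, +oo[%classic `&` cube n k%:R)).
  apply: sigma_algebra_bigcup => k; apply: sub_sigma_algebra; split.
    apply: closedI; last exact: closed_cube.
    rewrite (_ : _ @^-1` _ = (fun x : E => x ord0 i) @^-1` [set t | a <= t]).
      by apply: closed_comp; [move=> x _; exact: coord_continuous|exact: closed_ge].
    by apply/seteqP; split => x /=; rewrite in_itv/= andbT.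
  have [M [Mr MP]] := bounded_cube k%:R; exists M; split => // N MN x [_ cx]; exact: MP.
apply/seteqP; split=> [x ax|x [k _ []]//]; exists (Num.bound `|x|) => //; split => //.
by apply/cubeP => //; apply/ltW/archi_boundP.
Qed.

Lemma trans_cont_sum (I : Type) (s : seq I) (F : I -> E -> R) :
  (forall i, trans_cont (F i)) -> trans_cont (fun x => \sum_(i <- s) F i x).
Proof.
move=> tF; elim: s => [|i s IH].
  have := trans_cont_indic 0 measurable0; apply: trans_cont_ext => x.
  by rewrite big_nil set0I indic0.
by apply: trans_cont_ext (trans_contD (tF i) IH) => x; rewrite big_cons.
Qed.

Import HBNNSimple.

Lemma trans_cont_ge0 f : in_L2 setT f -> (forall x, 0 <= f x) -> trans_cont f.
Proof.
move=> Lf f0; have [mf _] := Lf.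
have mEf : measurable_fun setT (EFin \o f) by exact/measurable_EFinP.
pose g := nnsfun_approx mT mEf.
(* The cut to a growing cube makes every level set of [g k] bounded, so that [trans_cont_indic]
   applies to it. *)
pose h k x := \1_(cube n k%:R) x * g k x.
have gf x : g ^~ x @ \oo --> f x.
  have := @cvg_nnsfun_approx _ _ _ setT mT (EFin \o f) mEf.
  move=> /(_ (fun x _ => f0 x) x I) c; exact: (fine_cvg c).
have hf x : h ^~ x @ \oo --> f x.
  apply: cvg_trans (gf x); apply: near_eq_cvg.
  exists (Num.bound `|x|) => // k /= xk; rewrite /h indicE mem_set ?mul1r//.
  apply/cubeP => //; apply: (le_trans (ltW (archi_boundP _))) => //.
  by rewrite ler_nat.
have gle k x : g k x <= f x.
  have nd : nondecreasing_seq (g ^~ x).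
    by move=> a b ab; exact/lefP/nd_nnsfun_approx.
  by have := nondecreasing_cvgn_le nd (cvgP _ (gf x)) k; rewrite (cvg_lim _ (gf x)).
have hle k x : `|h k x| <= f x.
  rewrite /h indicE; case: (_ \in _); rewrite ?mul1r ?mul0r ?normr0 ?ger0_norm//.
have [|_ [_ c]] := @L2_dominated setT h f f mT _ mf Lf (fun x _ => hf x) (fun k x _ => hle k x).
  move=> k; apply: measurable_funM; last exact: measurable_funP.
  by apply: measurable_indic; exact: measurable_cube.
apply: (trans_cont_lim Lf _ c) => k.
pose s := fset_set (range (g k)).
apply: (@trans_cont_ext
  (fun x : E => \sum_(r <- s) r * \1_((g k @^-1` [set r]) `&` cube n k%:R) x)); last first.
  apply: trans_cont_sum => r; apply: trans_contZ; apply: trans_cont_indic.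
  have mgk : measurable_fun setT (g k) by exact: measurable_funP.
  by rewrite -[X in measurable X]setTI; exact: mgk.
move=> x; rewrite /h (fimfunE (g k) x) fsbig_finite//= mulr_sumr.
apply: eq_bigr => r _; rewrite mulrCA indicI; congr (_ * _); exact: mulrC.
Qed.

Lemma in_L2_trans_cont f : in_L2 setT f -> trans_cont f.
Proof.
move=> Lf; have [mf _] := Lf.
have mp : measurable_fun setT (fun x => Num.max (f x) 0).
  exact: measurable_maxr.
have mm : measurable_fun setT (fun x => Num.max (- f x) 0).
  by apply: measurable_maxr => //; exact: measurable_funN.
have p0 x : 0 <= Num.max (f x) 0 by rewrite le_max lexx orbT.
have m0 x : 0 <= Num.max (- f x) 0 by rewrite le_max lexx orbT.
have tp : trans_cont (fun x => Num.max (f x) 0).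
  apply: trans_cont_ge0 => //; apply: (in_L2_le mT mp Lf) => x _.
  by rewrite ger0_norm// ge_max ler_norm normr_ge0.
have tm : trans_cont (fun x => Num.max (- f x) 0).
  apply: trans_cont_ge0 => //; apply: (in_L2_le mT mm Lf) => x _.
  by rewrite ger0_norm// ge_max -normrN ler_norm normr_ge0.
apply: trans_cont_ext (trans_contB tp tm) => x; rewrite !maxEle oppr_le0.
by case: (leP (f x) 0) => h; case: (leP 0 (f x)) => h'; lra.
Qed.

Lemma quad_derive (F : E -> R) (x v : E) (d C : R) :
  (forall h : R, `|F (h *: v + x) - F x - h * d| <= C * h ^+ 2) -> is_derive x v F d.
Proof.
move=> Fq; have key : (fun h : R => h^-1 *: (F (h *: v + x) - F x)) @ (0 : R)^' --> d.
  apply/cvgrPdist_le => e e0.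
  have C1 : 0 < `|C| + 1 by rewrite ltr_wpDl.
  near=> h.
  have h0 : h != 0 by near: h; exact: nbhs_dnbhs_neq.
  have -> : d - h^-1 *: (F (h *: v + x) - F x) = - h^-1 * (F (h *: v + x) - F x - h * d).
    by rewrite /GRing.scale/=; field.
  rewrite normrM normrN normfV ler_pdivrMl ?normr_gt0//.
  apply: (le_trans (Fq h)).
  apply: (@le_trans _ _ ((`|C| + 1) * `|h| ^+ 2)).
    rewrite real_normK ?num_real// ler_wpM2r ?sqr_ge0//.
    by rewrite (le_trans (ler_norm _))// lerDl.
  rewrite expr2 mulrA mulrC ler_wpM2l//.
  rewrite -ler_pdivlMl// mulrC.
  near: h; apply: dnbhs0_le; exact: divr_gt0.
split; first by apply/cvg_ex; exists d.
exact: (cvg_lim _ key).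
Unshelve. all: by end_near. Qed.

Lemma lip_continuous (F : E -> R) (C : R) :
  (forall x y, `|F x - F y| <= C * `|x - y|) -> continuous F.
Proof.
move=> FC x.
have FC' y z : `|F y - F z| <= (`|C| + 1) * `|y - z|.
  by rewrite (le_trans (FC y z))// ler_wpM2r// (le_trans (ler_norm _))// lerDl.
have C1 : 0 < `|C| + 1 by rewrite ltr_wpDl.
apply/(@cvgrPdist_le R R E (nbhs (x : E)) _ F (F x)) => e e0.
near=> y; apply: (le_trans (FC' x y)); rewrite -ler_pdivlMl//.
near: y; apply: cvgr_dist_le; first exact: cvg_id.
by rewrite mulrC divr_gt0.
Unshelve. all: by end_near. Qed.

(** Convolution with the reflected kernel: if [k] lives near c, the value at x is an average of f
    near x + c. Differentiation in x therefore falls on [k] with a minus sign. *)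
Definition conv f k (x : E) : R := \int[mu]_y (f y * k (y - x)).

(** The centre may lie off the origin, so that one convolution both translates and mollifies. *)
Definition kernel_at (k : E -> R) (c : E) (r : R) :=
  [/\ test_function setT k, forall z, 0 <= k z, \int[mu]_z k z = 1 &
      forall z, r < `|z - c| -> k z = 0].

Lemma test_in_L2 (Om : set E) k : test_function Om k -> in_L2 setT k /\ intT k.
Proof.
move=> tk; have [sk _] := tk; have [M M0 kM] := test_bounded tk.
have [r r0 kr] := test_supp tk.
have mk := continuous_measurable_rV (smooth_continuous sk).
have mC : measurable (cube n r : set E) by exact: measurable_cube.
have k1 x : `|k x| <= `|M * \1_(cube n r) x|.
  rewrite indicE; case: (boolP (x \in cube n r)) => [_|].
    by rewrite mulr1 (le_trans (kM x))// ler_norm.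
  rewrite notin_setE => nc; rewrite kr ?normr0// ltNge; apply/negP => h; apply: nc.
  by apply/cubeP => //; exact: ltW.
have LC := in_L2_indic mC (lebesgue_cube n r).
split.
  by apply: (in_L2_le mT mk (in_L2Z mT M LC)) => x _; exact: k1.
apply: (@integrable_le _ _ _ mT _ (fun x => `|M * (\1_(cube n r) x * \1_(cube n r) x)|)) => //.
  by apply: intw_norm; apply: intwZ => //; exact: in_L2_int.
move=> x _; apply: (le_trans (k1 x)); rewrite indicE; case: (_ \in _);
  by rewrite /= ?mulr1 ?mulr0 lexx.
Qed.

Lemma test_shift (Om : set E) k x : test_function Om k ->
  test_function [set y | Om (y - x)] (fun y => k (y - x)).
Proof.
move=> [sk [K [cK KO kK]]]; split.
  apply: (@smooth_coind R n (fun g => exists2 k, smooth k & g = (fun y => k (y - x)))).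
  - move=> _ [h sh ->] y; apply: continuous_comp; last exact: smooth_continuous.
    by apply: continuousB => //; exact: cst_continuous.
  - move=> _ i y [h sh ->]; suff : is_derive y (delta_mx ord0 i : E) (fun y => h (y - x))
      (pderiv i h (y - x)) by case.
    apply/is_derive_line; under eq_fun do rewrite -addrA.
    by apply/is_derive_line; apply: derivableP; exact: smooth_derivable.
  - move=> _ i [h sh ->]; exists (pderiv i h); first exact: smooth_pderiv.
    apply/funext => y; suff [] : is_derive y (delta_mx ord0 i : E) (fun y => h (y - x))
      (pderiv i h (y - x)) by [].
    apply/is_derive_line; under eq_fun do rewrite -addrA.
    by apply/is_derive_line; apply: derivableP; exact: smooth_derivable.
  - by exists k.
exists [set y | K (y - x)]; split.
- rewrite (_ : [set y | _] = (fun y => y + x) @` K); last first.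
    apply/seteqP; split => [y Ky|_ [y Ky <-]]; first by exists (y - x); rewrite ?subrK.
    by rewrite /= addrK.
  apply: continuous_compact => //; apply: continuous_subspaceT => y.
  by apply: continuousD => //; exact: cst_continuous.
- by move=> y /KO.
- by move=> y nK; exact: kK.
Qed.

Lemma intT_testM (Om : set E) f k : intT f -> test_function Om k ->
  intT (fun y => f y * k y).
Proof.
move=> fi tk; have [M M0 kM] := test_bounded tk; have [sk _] := tk.
apply: (@integrable_le _ _ _ mT _ (fun x => `|M * f x|)).
- apply: measurable_funM; first exact: (intw_meas fi).
  exact: (continuous_measurable_rV (smooth_continuous sk)).
- by apply: intw_norm; exact: intwZ.
- by move=> x _; rewrite !normrM mulrC ler_wpM2r// (le_trans (kM x))// ler_norm.
Qed.

Lemma test_setT (Om : set E) k : test_function Om k -> test_function setT k.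
Proof. exact: test_sub. Qed.

Lemma intT_conv f k x : intT f -> test_function setT k -> intT (fun y => f y * k (y - x)).
Proof. by move=> fi /(test_shift x) tk; exact: (intT_testM fi tk). Qed.

(** The mean value theorem, used for the kernel and then for its derivative, bounds the second-order
    remainder under the integral by M h^2; this replaces a limit under the integral sign. *)
Lemma conv_quad f k i (x : E) (M : R) : intT f -> test_function setT k ->
  (forall z, `|pderiv i (pderiv i k) z| <= M) ->
  forall h : R, `|conv f k (h *: (delta_mx ord0 i : E) + x) - conv f k x
    - h * conv f (fun z => - pderiv i k z) x|
   <= (M * \int[mu]_y `|f y|) * h ^+ 2.
Proof.
move=> fi tk kM h; set e := (delta_mx ord0 i : E).
have [sk _] := tk; have tdk := test_pderiv i tk.
have i1 := intT_conv (h *: e + x) fi tk; have i2 := intT_conv x fi tk.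
have i3 := intT_conv x fi tdk.
have i12 := intwB mT i1 i2; have i3' := intwZ mT h i3.
have i123 := intwD mT i12 i3'.
have -> : conv f k (h *: e + x) - conv f k x - h * conv f (fun z => - pderiv i k z) x =
  \int[mu]_y (f y * k (y - (h *: e + x)) - f y * k (y - x) + h * (f y * pderiv i k (y - x))).
  rewrite RintegralD// RintegralB// RintegralZl//; congr (_ + _).
  rewrite -mulrN; congr (_ * _).
  rewrite /conv -mulN1r -RintegralZl//; last first.
    apply: (@intw_ext _ _ _ mT (fun y => -1 * (f y * pderiv i k (y - x)))).
      by move=> y _; ring.
    exact: intwZ.
  by apply: eq_Rintegral => y _; ring.
rewrite (le_trans (le_normr_Rintegral _ _))//.
rewrite mulrAC -RintegralZl//; last exact: intw_norm.
apply: le_Rintegral => //; first exact: intw_norm.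
  by apply: intwZ => //; exact: intw_norm.
move=> y _; set z := y - x.
have -> : y - (h *: e + x) = (- h) *: e + z by rewrite scaleNr opprD addrCA.
rewrite (_ : _ + _ = f y * (k ((- h) *: e + z) - k z + h * pderiv i k z)); last by ring.
rewrite normrM mulrC ler_wpM2r//.
have [a ah ->] := @line_MVT _ _ k e z (- h) (fun y => @smooth_derivable _ _ k i y sk).
have [b bh E] := @line_MVT _ _ (pderiv i k) e z a
  (fun y => @smooth_derivable _ _ (pderiv i k) i y (smooth_pderiv i sk)).
rewrite -/(pderiv i k (a *: e + z)) (_ : _ + _ = - h * (pderiv i k (a *: e + z) - pderiv i k z)); last by ring.
rewrite E -/(pderiv i (pderiv i k) (b *: e + z)) mulrA normrM mulrC ler_pM//.
by rewrite normrM normrN expr2 -[leRHS]ger0_norm -?expr2 ?sqr_ge0// normrX expr2 ler_pM// -[leRHS]normrN.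
Qed.

(** The convolutions of [f] with all test functions form a class stable under [pderiv], to which
    [smooth_coind] applies. *)
Lemma smooth_conv f k : intT f -> test_function setT k -> smooth (conv f k) /\
  forall i, pderiv i (conv f k) = conv f (fun z => - pderiv i k z).
Proof.
move=> fi.
have testN h : test_function setT h -> test_function setT (fun z => - h z).
  move=> th; have := test_mull (smooth_cst (-1)) th; congr test_function.
  by apply/funext => z; rewrite mulN1r.
have dconv h i x : test_function setT h ->
    is_derive x (delta_mx ord0 i : E) (conv f h) (conv f (fun z => - pderiv i h z) x).
  move=> th; have [M _ hM] := test_bounded (test_pderiv i (test_pderiv i th)).
  by apply: quad_derive => t; exact: (conv_quad _ fi th hM).
move=> tk; split; last by move=> i; apply/funext => x; have [] := dconv k i x tk.
apply: (@smooth_coind R n (fun g => exists2 h, test_function setT h & g = conv f h)).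
- move=> _ [h th ->] x.
  have [M M0 hM] : exists2 M : R, 0 <= M & forall i z, `|pderiv i h z| <= M.
    have /choice[M MP] : forall i, exists M : R, 0 <= M /\ forall z, `|pderiv i h z| <= M.
      by move=> i; have [M] := test_bounded (test_pderiv i th); exists M.
    exists (\sum_i M i); first by apply: sumr_ge0 => i _; have [] := MP i.
    move=> i z; have [_ /(_ z)] := MP i; move=> /le_trans; apply.
    by rewrite (bigD1 i)//= lerDl sumr_ge0// => j _; have [] := MP j.
  pose I := \int[mu]_y `|f y|.
  suff : continuous (conv f h) by apply.
  apply: (@lip_continuous _ (n%:R * M * I)) => {}x x'.
  rewrite /conv -RintegralB//; [|exact: intT_conv|exact: intT_conv].
  have ii := intwB mT (intT_conv x fi th) (intT_conv x' fi th).
  apply: (le_trans (le_normr_Rintegral _ ii)) => //.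
  rewrite mulrAC -RintegralZl//; last exact: intw_norm.
  apply: le_Rintegral => //; first exact: intw_norm.
    by apply: intwZ => //; exact: intw_norm.
  move=> y _; rewrite -mulrBr normrM mulrC ler_wpM2r//.
  have := @smooth_lip R n h (y - x') (y - x) M th.1 (fun i z _ => hM i z).
  have -> : y - x - (y - x') = x' - x by rewrite opprB addrC addrA subrK.
  by rewrite (distrC x x').
- by move=> _ i x [h th ->]; have [] := dconv h i x th.
- move=> _ i [h th ->]; exists (fun z => - pderiv i h z); first exact/testN/test_pderiv.
  by apply/funext => x; have [] := dconv h i x th.
- by exists k.
Qed.

(** Jensen's inequality for the probability density k(y - x): the second moment about [g x] minus
    the squared distance of [g x] to the mean is the variance, which is nonnegative. *)
Lemma kernel_mean k c r g x : kernel_at k c r -> in_L2 setT g ->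
  (conv g k x - g x) ^+ 2 <= \int[mu]_y ((g y - g x) ^+ 2 * k (y - x)).
Proof.
move=> [tk k0 k1 _] Lg.
have [sk [K [cK KO kK]]] := tk.
have tks := test_shift x tk; have [Lk ik] := test_in_L2 tks.
have [M M0 kM] := test_bounded tks.
have mk := in_L2_meas Lk.
set K0 := fun y => k (y - x).
have i1 : intT (fun y => g y * K0 y) by exact: in_L2_int.
have i2 : intT (fun y => g y ^+ 2 * K0 y).
  apply: (@intw_ext _ _ _ mT (fun y => (K0 y * g y) * g y)); first by move=> y _; ring.
  by apply: in_L2_int => //; apply: (in_L2_mulb mT Lg mk) => y _; exact: kM.
have k1x : \int[mu]_y K0 y = 1.
  rewrite -k1 /K0 /Rintegral; congr fine.
  by rewrite (integral_shift (- x) (f := EFin \o k))//; apply/measurable_EFinP;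
    exact: (continuous_measurable_rV (smooth_continuous sk)).
set a := g x; set t := conv g k x.
have Ic s : \int[mu]_y (s * K0 y) = s by rewrite RintegralZl// k1x mulr1.
have It s : \int[mu]_y (s * (g y * K0 y)) = s * t by rewrite RintegralZl.
have Q s : \int[mu]_y ((g y - s) ^+ 2 * K0 y) =
    \int[mu]_y (g y ^+ 2 * K0 y) - 2 * s * t + s ^+ 2.
  rewrite -[X in _ = _ + X]Ic -[X in _ = _ - X + _]It -RintegralB//; last exact: intwZ.
  rewrite -RintegralD//; [|by apply: intwB => //; exact: intwZ|exact: intwZ].
  by apply: eq_Rintegral => y _; ring.
have : 0 <= \int[mu]_y ((g y - t) ^+ 2 * K0 y).
  by apply: Rintegral_ge0 => y _; rewrite mulr_ge0 ?sqr_ge0// /K0.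
rewrite -/K0 !Q.
move=> h; rewrite -subr_ge0; move: h; congr (0 <= _); ring.
Qed.

(** By [kernel_mean] and Tonelli's theorem the squared error is at most the average, with weight
    [k z], of the squared translation errors by z; only z in the support of [k] count. *)
Lemma conv_close k c r g e : kernel_at k c r -> in_L2 setT g -> intT g -> 0 <= e ->
  (forall z, k z != 0 -> norm0 setT (fun x => g (x + z) - g x) <= e) ->
  in_L2 setT (conv g k) /\ norm0 setT (fun x => conv g k x - g x) <= e.
Proof.
move=> kk Lg ig e0 kg; have [tk k0 k1 _] := kk; have [sk _] := tk.
have [sc _] := smooth_conv ig tk.
have mc := continuous_measurable_rV (smooth_continuous sc).
have [mg _] := Lg; have mk := continuous_measurable_rV (smooth_continuous sk).
have [M M0 kM] := test_bounded tk.
have mD : measurable_fun setT (fun x => conv g k x - g x) by exact: measurable_funB.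
pose F (x z : E) : \bar R := ((g (x + z) - g x) ^+ 2 * k z)%:E.
have mgz : measurable_fun setT (fun p : E * E => g (p.1 + p.2)).
  apply: (measurableT_comp mg); apply: measurable_fun_rV => i.
  under eq_fun do rewrite mxE.
  apply: measurable_funD.
    exact: (measurableT_comp (measurable_coord i) measurable_fst).
  exact: (measurableT_comp (measurable_coord i) measurable_snd).
have mF : measurable_fun setT (fun p : E * E => F p.1 p.2).
  apply/measurable_EFinP; apply: measurable_funM.
    apply: measurable_funX; apply: measurable_funB => //.
    exact: (measurableT_comp mg measurable_fst).
  exact: (measurableT_comp mk measurable_snd).
have F0 p : (0 <= F p.1 p.2)%E by rewrite lee_fin mulr_ge0 ?sqr_ge0.
have key : (\int[mu]_x ((conv g k x - g x) ^+ 2)%:E <= (e ^+ 2)%:E)%E.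
  apply: (@le_trans _ _ (\int[mu]_x \int[mu]_z F x z)%E).
    apply: ge0_le_integral => //.
    - by move=> x _; rewrite lee_fin sqr_ge0.
    - by apply/measurable_EFinP; exact: measurable_funX.
    - exact: (@measurable_fun_fubini_tonelli_F _ _ _ _ R mu (fun p => F p.1 p.2) mF F0).
    move=> x _; have h := kernel_mean x kk Lg.
    have i2 : intT (fun y => (g y - g x) ^+ 2 * k (y - x)).
      have tks := test_shift x tk; have [Lks iks] := test_in_L2 tks.
      have mks := in_L2_meas Lks.
      have b2 : intT (fun y => g y * (k (y - x) * g y)).
        by apply: in_L2_int => //; apply: (in_L2_mulb mT Lg mks) => y _; exact: kM.
      have b1 : intT (fun y => g y * k (y - x)) by exact: in_L2_int.
      apply: (@intw_ext _ _ _ mT (fun y => g y * (k (y - x) * g y)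
         + ((- 2 * g x) * (g y * k (y - x)) + g x ^+ 2 * k (y - x)))).
        by move=> y _; ring.
      by apply: intwD => //; apply: intwD => //; exact: intwZ.
    rewrite -(integral_shift (- x) (f := fun z => F x z)); last first.
      have mxz : measurable_fun setT (fun z : E => x + z).
        rewrite (_ : (fun z => _) = (fun z => z + x)); first exact: measurable_shift.
        by apply/funext => z; rewrite addrC.
      apply/measurable_EFinP; apply: measurable_funM => //; apply: measurable_funX.
      by apply: measurable_funB => //; exact: (measurableT_comp mg mxz).
    rewrite (eq_integral (fun y => ((g y - g x) ^+ 2 * k (y - x))%:E)).
      by rewrite (EFin_Rint mT i2) lee_fin.
    by move=> y _; rewrite /F (addrC x) subrK.
  rewrite (@fubini_tonelli _ _ _ _ R mu mu (fun p => F p.1 p.2) mF F0) /=.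
  have ik := (test_in_L2 tk).2.
  apply: (@le_trans _ _ (\int[mu]_z (e ^+ 2 * k z)%:E)%E).
    apply: ge0_le_integral => //.
    - by move=> z _; apply: integral_ge0 => x _; exact: (F0 (x, z)).
    - exact: (@measurable_fun_fubini_tonelli_G _ _ _ _ R mu (fun p => F p.1 p.2) mF F0).
    - by apply/measurable_EFinP; exact: measurable_funM.
    move=> z _; have Lz := in_L2B mT (in_L2_shift z Lg) Lg.
    rewrite /F; under eq_integral do rewrite mulrC.
    rewrite (EFin_Rint mT); last first.
      by apply: intwZ => //; have := in_L2_int mT Lz Lz; apply: intw_ext => // x _; rewrite expr2.
    rewrite RintegralZl//; last first.
      by have := in_L2_int mT Lz Lz; apply: intw_ext => // x _; rewrite expr2.
    rewrite lee_fin mulrC; have [->|kz] := eqVneq (k z) 0; first by rewrite !mulr0.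
    rewrite ler_wpM2r//.
    rewrite (_ : Rintegral _ _ _ = norm0 setT (fun x => g (x + z) - g x) ^+ 2).
      by rewrite lerXn2r ?nnegrE ?norm0_ge0// kg.
    by rewrite norm0_sqr; apply: eq_Rintegral => x _; rewrite expr2.
  rewrite (EFin_Rint mT); last exact: intwZ.
  by rewrite RintegralZl// k1 mulr1.
have LD : in_L2 setT (fun x => conv g k x - g x).
  split => //; apply/integrableP; split.
    by apply/measurable_EFinP; exact: measurable_funX.
  rewrite (eq_integral (fun x => ((conv g k x - g x) ^+ 2)%:E)); last first.
    by move=> x _; rewrite /= ger0_norm// sqr_ge0.
  by apply: le_lt_trans key _; rewrite ltry.
split; first by apply: (in_L2_ext mT _ (in_L2D mT LD Lg)) => x _; rewrite subrK.
rewrite -ler_sqr ?nnegrE ?norm0_ge0// norm0_sqr -lee_fin.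
rewrite -(EFin_Rint mT); first by under eq_integral do rewrite -expr2.
exact: in_L2_int.
Qed.

Lemma conv_supp k c r g (A : set E) x : kernel_at k c r ->
  (forall y, ~ A y -> g y = 0) -> conv g k x != 0 ->
  exists2 y, A y & `|y - x - c| <= r.
Proof.
move=> [_ _ _ kr] gA; apply: contraNP => /forallPNP H; apply/eqP.
rewrite /conv (@eq_Rintegral _ _ _ _ _ (cst 0)); first by rewrite Rintegral_cst// mul0r.
move=> y _; have [Ay|nAy] := pselect (A y); last by rewrite gA// mul0r.
rewrite kr ?mulr0// ltNge; apply/negP; exact: H.
Qed.

Lemma kernel_exists c r : 0 < r -> exists k, kernel_at k c r.
Proof.
move=> r0; have r2 : 0 < r / 2 by rewrite divr_gt0.
(* Half the radius, because a plateau extends to twice its radius. *)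
pose p := plateau c (r / 2).
have tp : test_function setT p by exact: test_plateau.
have [Lp ip] := test_in_L2 tp.
have p0 x : 0 <= p x by exact: plateau_ge0.
pose C : set E := [set x | `|x - c| < r / 2].
have mC : measurable C.
  apply: open_measurable_rV; rewrite (_ : C = ball c (r / 2)); first exact: ball_open.
  by apply/seteqP; split => x; rewrite -ball_normE/= distrC.
have I0 : 0 < \int[mu]_z p z.
  (* A zero integral would make the open cube C null, since the plateau is 1 there; but C is a box
     with sides of positive length. *)
  rewrite lt_neqAle Rintegral_ge0// andbT eq_sym; apply/negP => /eqP I0.
  have C0 : mu C = 0.
    apply/eqP; rewrite eq_le measure_ge0 andbT.
    rewrite -[X in (_ <= X)%E]/(0%:E) -I0 -(EFin_Rint mT ip).
    have -> : mu C = (\int[mu]_x (\1_C x)%:E)%E by rewrite integral_indic// setIT.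
    apply: ge0_le_integral => //.
    - by apply/measurable_EFinP; exact: measurable_indic.
    - by apply/measurable_EFinP; case: Lp.
    move=> x _; rewrite lee_fin indicE; case: (boolP (x \in C)) => //.
    by rewrite inE => Cx; rewrite /p plateau1// ltW.
  move: C0; rewrite (_ : C = rect (fun i => `](c ord0 i - r / 2), (c ord0 i + r / 2)[%classic)).
    rewrite lebesgue_rect//; apply/eqP; rewrite gt_eqF//.
    elim/big_ind: _ => //; first by move=> a b; exact: mule_gt0.
    move=> i _; rewrite lebesgue_measure_itv/= lte_fin ifT; last by lra.
    by rewrite -EFinD lte_fin; lra.
  apply/seteqP; split => [x /= xc i|x xc].
    rewrite /= in_itv/=; have := le_lt_trans (coord_norm _ i) xc.
    by rewrite !mxE ltr_norml => /andP[h1 h2]; apply/andP; split; lra.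
  apply: norm_coord_lt => // i; have := xc i; rewrite /= in_itv/= !mxE => /andP[h1 h2].
  by rewrite ltr_norml; apply/andP; split; lra.
exists (fun x => (\int[mu]_z p z)^-1 * p x); split.
- exact: (test_mull (smooth_cst _) tp).
- by move=> z; rewrite mulr_ge0// invr_ge0 ltW.
- by rewrite RintegralZl// mulVf// gt_eqF.
- move=> z zc; rewrite /p plateau0 ?mulr0//.
  by rewrite mulrC divfK ?gt_eqF.
Qed.

End Translation.

(** * Weak derivatives and zero traces *)

Section WeakGradient.
Context {R : realType} {n : nat}.
Local Notation E := 'rV[R]_n.
Local Notation mu := (lebesgue R n).
Notation intT f := (mu.-integrable setT (EFin \o f)).
Variable Om : set E.
Hypotheses (oO : open Om) (bO : bounded_set Om).
Implicit Types (f g u v p : E -> R) (G : E -> E).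

Let mT : measurable [set: E] := measurableT.

Lemma mOm : measurable Om. Proof. exact: open_measurable_rV. Qed.
Lemma Omfin : (mu Om < +oo)%E. Proof. by apply: bounded_lebesgue => //; exact: mOm. Qed.
Let mO := mOm.
Let Ofin := Omfin.

Lemma in_L2_subset (w w' : set E) f : measurable w -> measurable w' -> w' `<=` w ->
  in_L2 w f -> in_L2 w' f.
Proof.
move=> mw mw' ww [mf fi]; split; first exact: (measurable_funS mw ww mf).
exact: (integrableS mw mw' ww fi).
Qed.

Lemma restrictE f x : Om x -> (f \_ Om) x = f x.
Proof. by move=> Ox; rewrite patchE mem_set. Qed.

Lemma restrict0 f x : ~ Om x -> (f \_ Om) x = 0.
Proof. by move=> Ox; rewrite patchE memNset. Qed.

Lemma restrictM f g : (fun x => f x * g x) \_ Om = (fun x => (f \_ Om) x * g x).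
Proof. by apply/funext => x; rewrite !patchE; case: ifP => // _; rewrite mul0r. Qed.

Lemma in_L2_restrict f : in_L2 Om f -> in_L2 setT (f \_ Om) /\ intT (f \_ Om).
Proof.
move=> Lf; have [mf fi] := Lf.
have ext (h : E -> R) : mu.-integrable Om (EFin \o h) -> intT (h \_ Om).
  by rewrite integrable_mkcond// restrict_EFin.
split; last by apply: ext; exact: in_L2_int1.
split; first exact: (measurable_restrictT f mO).1 (Lf.1).
apply: (intw_ext mT _ (ext _ fi)) => x _; rewrite !patchE; case: ifP => // _.
by rewrite expr0n.
Qed.

Lemma inner_restrict f g : inner Om f g = inner setT (f \_ Om) g.
Proof. by rewrite /inner Rintegral_mkcond; apply: eq_Rintegral => x _; rewrite restrictM. Qed.

Lemma norm0_subset (w w' : set E) f : measurable w -> measurable w' -> w' `<=` w ->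
  in_L2 w f -> norm0 w' f <= norm0 w f.
Proof.
move=> mw mw' ww Lf; rewrite ler_sqrt ?inner_ge0//.
have Lf' := in_L2_subset mw mw' ww Lf.
rewrite -lee_fin -(EFin_Rint mw' (in_L2_int mw' Lf' Lf')) -(EFin_Rint mw (in_L2_int mw Lf Lf)).
apply: ge0_subset_integral => //; last by move=> x _; rewrite lee_fin -expr2 sqr_ge0.
by apply/measurable_EFinP; apply: measurable_funM; case: Lf.
Qed.

Lemma test_L2 (U : set E) f : test_function U f -> in_L2 Om f.
Proof. by move=> /test_in_L2[Lf _]; exact: (in_L2_subset mT). Qed.

Lemma cball_test (k : E -> R) (x : E) r : smooth k ->
  (forall z, r < `|z| -> k z = 0) -> (forall y, `|y - x| <= r -> Om y) ->
  test_function Om (fun y => k (y - x)).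
Proof.
move=> sk kr xr; split.
  have tk : test_function setT k.
    split => //; exists [set z | `|z - 0| <= r]; split => //.
      exact: closed_ball_compact.
    by move=> z; rewrite /= subr0 => /negP; rewrite -ltNge; exact: kr.
  by have [] := test_shift x tk.
exists [set y | `|y - x| <= r]; split => //; first exact: closed_ball_compact.
by move=> y /negP; rewrite -ltNge; exact: kr.
Qed.

(* Mollifying the extension of g by 0 gives 0 at every point of Om whose
   distance to the complement exceeds the radius of the kernel. *)
Lemma fundamental_lemma g : in_L2 Om g ->
  (forall phi, test_function Om phi -> inner Om g phi = 0) ->
  {ae mu, forall x, Om x -> g x = 0}.
Proof.
move=> Lg g0; have [LG iG] := in_L2_restrict Lg.
have [_ tc] := in_L2_trans_cont LG.
pose D r := ~` thicken (~` Om) r.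
have mD r : 0 < r -> measurable (D r).
  by move=> r0; apply: measurableC; apply: open_measurable_rV; exact: open_thicken.
have small r e : 0 < r -> 0 < e -> norm0 (D r) (g \_ Om) <= e.
  move=> r0 e0; have [d d0 dP] := tc _ e0.
  pose rho := Num.min d (r / 2).
  have rho0 : 0 < rho by rewrite lt_min d0 divr_gt0.
  have rhod : rho <= d by rewrite ge_min lexx.
  have rhor : rho < r.
    by apply: (@le_lt_trans _ _ (r / 2)); [rewrite ge_min lexx orbT|lra].
  have [k kk] := kernel_exists (0 : E) rho0.
  have [tk k0 k1 kr] := kk.
  have [|Lc cle] := @conv_close R n k 0 rho (g \_ Om) e kk LG iG (ltW e0).
    move=> z kz; apply: dP; rewrite leNgt; apply/negP => h.
    by move/negP: kz; apply; apply/eqP/kr; rewrite subr0 (le_lt_trans rhod).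
  have czero x : D r x -> conv (g \_ Om) k x = 0.
    move=> Dx; rewrite -[LHS]/(inner setT (g \_ Om) (fun y => k (y - x))).
    rewrite -inner_restrict; apply: g0; apply: (@cball_test _ _ rho).
    - by case: tk.
    - by move=> z zr; apply: kr; rewrite subr0.
    - move=> y yx; apply: contrapT => nOy; apply: Dx; exists y => //.
      by rewrite distrC (le_lt_trans yx).
  apply: le_trans cle.
  have LD := in_L2B mT Lc LG.
  apply: le_trans (norm0_subset mT (mD _ r0) _ LD) => //.
  rewrite le_eqVlt; apply/orP; left; apply/eqP; congr Num.sqrt.
  by apply: eq_Rintegral => x; rewrite inE => Dx; rewrite czero// sub0r mulrNN.
have ae0 m : {ae mu, forall x, D m.+1%:R^-1 x -> (g \_ Om) x = 0}.
  have r0 : 0 < m.+1%:R^-1 :> R by rewrite invr_gt0.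
  apply: (norm0_eq0_ae (mD _ r0)); first exact: (in_L2_subset mT (mD _ r0)).
  apply/eqP; rewrite eq_le norm0_ge0 andbT; apply/ler_addgt0Pl => e e0.
  by rewrite addr0 small.
move: (ae_foralln ae0); apply: filterS => x xD Ox.
have /nbhs_ballP[r /= r0 rO] : nbhs x Om by exact: open_nbhs_nbhs.
rewrite -(restrictE g Ox); apply: (xD (Num.bound r^-1)) => -[y nOy xy]; apply: nOy.
apply: rO; rewrite -ball_normE/=; apply: (lt_le_trans xy).
rewrite -[leRHS]invrK lef_pV2 ?posrE ?invr_gt0 ?ltr0n//.
rewrite (le_trans (ltW (archi_boundP _))) ?invr_ge0 ?(ltW r0)//.
by rewrite ler_nat.
Qed.

Lemma innerBl' u v f : in_L2 Om u -> in_L2 Om v -> in_L2 Om f ->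
  inner Om (fun x => u x - v x) f = inner Om u f - inner Om v f.
Proof.
move=> Lu Lv Lf; have := innerDl mO Lu (in_L2Z mO (-1) Lv) Lf.
by rewrite innerZl// mulN1r => <-; apply: inner_ext => // x _; rewrite mulN1r.
Qed.

Lemma weak_grad_unique v G G' : is_weak_grad Om v G -> is_weak_grad Om v G' ->
  forall i, {ae mu, forall x, Om x -> G x ord0 i = G' x ord0 i}.
Proof.
move=> [LG HG] [LG' HG'] i.
have := @fundamental_lemma (fun x => G x ord0 i - G' x ord0 i).
move=> /(_ (in_L2B mO (LG i) (LG' i))) H.
have {}H : {ae mu, forall x, Om x -> G x ord0 i - G' x ord0 i = 0}.
  apply: H => phi tphi; rewrite innerBl'//; last exact: (test_L2 tphi).
  by apply/eqP; rewrite subr_eq0 -eqr_opp -HG// -HG'.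
by apply: filterS H => x H Ox; apply/eqP; rewrite -subr_eq0 H.
Qed.

Lemma weak_div_unique (tau : E -> E) D D' : is_weak_div Om tau D -> is_weak_div Om tau D' ->
  {ae mu, forall x, Om x -> D x = D' x}.
Proof.
move=> [LD HD] [LD' HD'].
have := @fundamental_lemma (fun x => D x - D' x) (in_L2B mO LD LD').
move=> H; have {}H : {ae mu, forall x, Om x -> D x - D' x = 0}.
  apply: H => phi tphi; rewrite innerBl'//; last exact: (test_L2 tphi).
  by apply/eqP; rewrite subr_eq0 -eqr_opp -HD// -HD'.
by apply: filterS H => x H Ox; apply/eqP; rewrite -subr_eq0 H.
Qed.

Lemma wgradP v G : is_weak_grad Om v G -> is_weak_grad Om v (wgrad Om v).
Proof. by move=> vG; apply: xgetPex; exists G. Qed.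

Lemma wdivP tau D : is_weak_div Om tau D -> is_weak_div Om tau (wdiv Om tau).
Proof. by move=> vG; apply: xgetPex; exists D. Qed.

Lemma wgrad_ae v G : is_weak_grad Om v G ->
  forall i, {ae mu, forall x, Om x -> wgrad Om v x ord0 i = G x ord0 i}.
Proof. by move=> vG; exact: (weak_grad_unique (wgradP vG) vG). Qed.

Lemma wdiv_ae tau D : is_weak_div Om tau D ->
  {ae mu, forall x, Om x -> wdiv Om tau x = D x}.
Proof. by move=> vG; exact: (weak_div_unique (wdivP vG) vG). Qed.

Lemma weak_gradD u v G H : in_L2 Om u -> in_L2 Om v -> is_weak_grad Om u G ->
  is_weak_grad Om v H -> is_weak_grad Om (fun x => u x + v x) (fun x => G x + H x).
Proof.
move=> Lu Lv [LG HG] [LH HH]; split.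
  by move=> i; apply: in_L2_ext (in_L2D mO (LG i) (LH i)) => // x _; rewrite mxE.
move=> phi tp i; have Lp := test_L2 tp; have Lpd := test_L2 (test_pderiv i tp).
rewrite innerDl// HG// HH// -opprD -innerDl//; congr (- _).
by apply: inner_ext => // x _; rewrite mxE.
Qed.

Lemma weak_gradZ k u G : in_L2 Om u -> is_weak_grad Om u G ->
  is_weak_grad Om (fun x => k * u x) (fun x => k *: G x).
Proof.
move=> Lu [LG HG]; split.
  by move=> i; apply: in_L2_ext (in_L2Z mO k (LG i)) => // x _; rewrite mxE.
move=> phi tp i; have Lp := test_L2 tp; have Lpd := test_L2 (test_pderiv i tp).
rewrite innerZl// HG// mulrN -innerZl//; congr (- _).
by apply: inner_ext => // x _; rewrite mxE.
Qed.

Lemma weak_grad_ext u v G H : (forall x, Om x -> u x = v x) ->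
  (forall x, Om x -> G x = H x) -> is_weak_grad Om u G -> is_weak_grad Om v H.
Proof.
move=> uv GH [LG HG]; split.
  by move=> i; apply: in_L2_ext (LG i) => // x Ox; rewrite GH.
move=> phi tp i.
have -> : inner Om v (pderiv i phi) = inner Om u (pderiv i phi).
  by apply: inner_ext => // x Ox; rewrite uv.
by rewrite HG//; congr (- _); apply: inner_ext => // x Ox; rewrite GH.
Qed.

Lemma weak_gradB u v G H : in_L2 Om u -> in_L2 Om v -> is_weak_grad Om u G ->
  is_weak_grad Om v H -> is_weak_grad Om (fun x => u x - v x) (fun x => G x - H x).
Proof.
move=> Lu Lv wG wH.
apply: weak_grad_ext (weak_gradD Lu (in_L2Z mO (-1) Lv) wG (weak_gradZ (-1) Lv wH)) => x _.
  by rewrite mulN1r.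
by rewrite scaleN1r.
Qed.

(** Translation invariance makes the integral of eta(x + h e) - eta(x) vanish. Hence h times the
    integral of the derivative equals, up to sign, the integral of the Taylor remainder, which is
    O(h^2) on a fixed cube. *)
Lemma int_pderiv_test i (eta : E -> R) : test_function setT eta ->
  \int[mu]_x pderiv i eta x = 0.
Proof.
move=> te; have [se _] := te; have [Le ie] := test_in_L2 te.
have td := test_pderiv i te; have [Ld idd] := test_in_L2 td.
have [M M0 HM] := test_bounded (test_pderiv i td).
have [r r0 er] := test_supp te; have [s s0 ds] := test_supp td.
pose e := (delta_mx ord0 i : E).
(* Outside the cube of radius q the function, its shift and its derivative all vanish: a shift by h
   e with h <= 1 moves a point by at most |e|. *)
pose q := r + s + 1 + `|e|.
have q0 : 0 <= q by rewrite /q !addr_ge0 ?(ltW r0) ?(ltW s0).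
pose C := M * fine (mu (cube n q)).
have C0 : 0 <= C by rewrite mulr_ge0// fine_ge0.
have key h : 0 < h -> h <= 1 -> `|\int[mu]_x pderiv i eta x| <= C * h.
  move=> h0 h1; set J := \int[mu]_x _.
  have ish : intT (fun x => eta (x + h *: e)) by exact: (integrable_shift (h *: e) ie).
  have shE : \int[mu]_x eta (x + h *: e) = \int[mu]_x eta x.
    congr fine; apply: (integral_shift (h *: e) (f := EFin \o eta)).
    by apply/measurable_EFinP; exact: (intw_meas ie).
  have i1 := intwB mT ish ie; have i2 := intwZ mT h idd; have i3 := intwB mT i1 i2.
  have -> : J = - h^-1 * \int[mu]_x (eta (x + h *: e) - eta x - h * pderiv i eta x).
    rewrite RintegralB// RintegralB// shE subrr sub0r RintegralZl// -/J.
    by rewrite mulrNN mulKf// gt_eqF.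
  rewrite normrM normrN (ger0_norm (_ : 0 <= h^-1)) ?invr_ge0 ?(ltW h0)// ler_pdivrMl//.
  have LC := in_L2_indic (measurable_cube q) (lebesgue_cube n q).
  have iC : intT (fun x => M * h ^+ 2 * (\1_(cube n q) x * \1_(cube n q) x)).
    by apply: intwZ => //; exact: in_L2_int.
  apply: (@le_trans _ _ (\int[mu]_x (M * h ^+ 2 * (\1_(cube n q) x * \1_(cube n q) x)))); last first.
    rewrite RintegralZl//; last exact: in_L2_int.
    rewrite -/(inner setT (\1_(cube n q) : E -> R) \1_(cube n q)) inner_indic//.
      by rewrite /C le_eqVlt; apply/orP; left; apply/eqP; ring.
    exact: measurable_cube.
  apply: (le_trans (le_normr_Rintegral mT i3)).
  apply: le_Rintegral => //; first exact: intw_norm.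
  move=> x _; rewrite indicE; case: (boolP (x \in cube n q)) => [_|].
    rewrite !mulr1 [x + h *: e]addrC.
    have [a ah ->] := @line_MVT _ _ eta e x h (fun y => @smooth_derivable _ _ eta i y se).
    have [b bh Eb] := @line_MVT _ _ (pderiv i eta) e x a
      (fun y => @smooth_derivable _ _ (pderiv i eta) i y (smooth_pderiv i se)).
    rewrite -/(pderiv i eta (a *: e + x)) -mulrBr Eb -/(pderiv i (pderiv i eta) (b *: e + x)).
    have ha : `|a| <= h by rewrite (le_trans ah)// ger0_norm ?(ltW h0).
    rewrite !normrM (ger0_norm (ltW h0)).
    have := HM (b *: e + x); have := normr_ge0 a; have := normr_ge0 (pderiv i (pderiv i eta) (b *: e + x)).
    set z := `|pderiv _ _ _|; rewrite (mulrC M) expr2 -mulrA => z0 a0 zM.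
    by rewrite ler_pM2l// ler_pM.
  rewrite notin_setE => nc; rewrite !mulr0.
  have qx : q < `|x| by rewrite ltNge; apply/negP => h2; apply: nc; apply/cubeP.
  rewrite (er x); last first.
    by apply: le_lt_trans qx; rewrite /q -!addrA lerDl !addr_ge0// ltW.
  rewrite (ds x); last first.
    by apply: le_lt_trans qx; rewrite /q -addrA -addrA addrCA lerDl !addr_ge0// ltW.
  rewrite er ?mulr0 ?subrr ?normr0//.
  have : `|x| <= `|x + h *: e| + `|e|.
    rewrite -{1}(addrK (h *: e) x) (le_trans (ler_normB _ _))// lerD2l normrZ.
    by rewrite ger0_norm ?(ltW h0)// ler_piMl.
  by move=> h2; move: (lt_le_trans qx h2); rewrite /q ltrD2r; apply: lt_trans; lra.
apply/eqP; rewrite -normr_le0; apply/ler_addgt0Pl => e' e0; rewrite addr0.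
have C1 : 0 < C + 1 by rewrite ltr_wpDl.
pose h := Num.min 1 (e' / (C + 1)).
have h0 : 0 < h by rewrite lt_min ltr01 divr_gt0.
apply: (le_trans (key h h0 _)); first by rewrite ge_min lexx.
apply: (@le_trans _ _ ((C + 1) * h)); first by rewrite ler_wpM2r ?(ltW h0)// lerDl.
by rewrite mulrC -ler_pdivlMr// ge_min lexx orbT.
Qed.

(** Integration by parts for [phi] that may be nonzero on the boundary of [Om]: the factor [psi]
    confines the product to a compact part of [Om], and the derivative of the product has integral
    0. *)
Lemma test_weak_grad (U : set E) phi : test_function U phi ->
  is_weak_grad Om phi (fun x => \row_i pderiv i phi x).
Proof.
move=> tU; have [sp _] := tU; split.
  move=> i; apply: (in_L2_ext mO _ (test_L2 (test_pderiv i tU))) => x _.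
  by rewrite mxE.
move=> psi tp i; have [ss [K [cK KO psi0]]] := tp.
have Z (h : E -> R) : (forall x, ~ Om x -> h x = 0) -> \int[mu]_(x in Om) h x = \int[mu]_x h x.
  move=> h0; rewrite Rintegral_mkcond; apply: eq_Rintegral => x _; rewrite patchE.
  by case: ifP => // /negbT; rewrite notin_setE => /h0 ->.
have psiO x : ~ Om x -> psi x = 0 by move=> nO; apply: psi0 => /KO.
have tdp := test_pderiv i tp; have [_ [K' [_ KO' dpsi0]]] := tdp.
have dpsiO x : ~ Om x -> pderiv i psi x = 0 by move=> nO; apply: dpsi0 => /KO'.
rewrite /inner Z; last by move=> x /dpsiO ->; rewrite mulr0.
rewrite Z; last by move=> x /psiO ->; rewrite mulr0.
have L1 := (test_in_L2 tU).1; have L2 := (test_in_L2 tp).1.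
have L3 := (test_in_L2 (test_pderiv i tU)).1; have L4 := (test_in_L2 tdp).1.
have := int_pderiv_test i (test_mull sp (test_setT tp)).
rewrite smooth_pderivM// RintegralD//; [|exact: in_L2_int|exact: in_L2_int].
move=> H; apply/eqP; rewrite -addr_eq0 addrC -{}H; apply/eqP; congr (_ + _).
by apply: eq_Rintegral => x _; rewrite mxE.
Qed.

End WeakGradient.

(** * Zero trace implies approximation by test functions *)

Section ZeroTrace.
Context {R : realType} {n : nat}.
Local Notation E := 'rV[R]_n.
Local Notation mu := (lebesgue R n).
Notation intT f := (mu.-integrable setT (EFin \o f)).
Variable Om : set E.
Hypotheses (oO : open Om) (bO : bounded_set Om).
Implicit Types (f g u v p : E -> R) (D : 'I_n -> E -> R).

Let mT : measurable [set: E] := measurableT.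
Let mO := mOm oO.

(* Testing against functions that need not vanish on the boundary encodes a zero trace. *)
Definition zero_trace p D := [/\ in_L2 Om p, forall i, in_L2 Om (D i) &
  forall phi, test_function setT phi -> forall i,
    inner Om p (pderiv i phi) = - inner Om (D i) phi].

Definition test_approx p D := forall e, 0 < e -> exists phi,
  [/\ test_function Om phi, norm0 Om (fun x => p x - phi x) <= e &
      forall i, norm0 Om (fun x => D i x - pderiv i phi x) <= e].

Lemma norm0D f g : in_L2 Om f -> in_L2 Om g ->
  norm0 Om (fun x => f x + g x) <= norm0 Om f + norm0 Om g.
Proof.
move=> Lf Lg; have := @nmD _ _ Om mO unit (fun=> f) (fun=> g) (fun=> Lf) (fun=> Lg).
by rewrite /tuple_nm /norm0 /tuple_ip !big_const !card_unit /= !addr0.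
Qed.

Lemma norm0_ext f g : (forall x, Om x -> f x = g x) -> norm0 Om f = norm0 Om g.
Proof. by move=> fg; rewrite /norm0; congr Num.sqrt; exact: inner_ext. Qed.

Lemma norm0BC f g : norm0 Om (fun x => f x - g x) = norm0 Om (fun x => g x - f x).
Proof. by rewrite /norm0; congr Num.sqrt; apply: eq_Rintegral => x _; ring. Qed.

Lemma pderiv_shift f i x y : smooth f -> pderiv i (fun y => f (y - x)) y = pderiv i f (y - x).
Proof.
move=> sf; suff [] : is_derive y (delta_mx ord0 i : E) (fun y => f (y - x)) (pderiv i f (y - x)) by [].
apply/is_derive_line; under eq_fun do rewrite -addrA.
by apply/is_derive_line; apply: derivableP; exact: smooth_derivable.
Qed.

Lemma pderiv_locally0 f i x : (\forall y \near x, f y = 0) -> pderiv i f x = 0.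
Proof.
by move=> f0; rewrite /pderiv (@near_eq_derive _ _ _ _ (cst 0) _ _ f0) -/(pderiv i (fun=> 0) x) pderiv_cst.
Qed.

Lemma continuous_bounded f : continuous f ->
  exists2 M : R, 0 <= M & forall x, Om x -> `|f x| <= M.
Proof.
move=> cf; have [N [Nr NO]] := bO.
pose N1 := `|N| + 1.
have c1 := @closed_ball_compact R n 0 N1.
have : compact (f @` [set x | `|x - 0| <= N1]).
  by apply: continuous_compact => //; apply: continuous_subspaceT.
move=> /compact_bounded [M [Mr MO]].
exists (`|M| + 1) => [|x Ox]; first by rewrite addr_ge0.
apply: (MO (`|M| + 1)); first by rewrite (le_lt_trans (ler_norm _))// ltrDl.
exists x => //=; rewrite subr0; apply: (NO N1) => //.
by rewrite (le_lt_trans (ler_norm _))// ltrDl.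
Qed.

(** Test with [chi] times the test function and apply the product rule; on the bounded set [Om]
    smooth factors are bounded. *)
Lemma zero_trace_cutoff chi p D : smooth chi -> zero_trace p D ->
  zero_trace (fun x => chi x * p x) (fun i x => chi x * D i x + pderiv i chi x * p x).
Proof.
move=> sc [Lp LD HD].
have msc f : smooth f -> measurable_fun Om f.
  move=> sf; apply: (measurable_funS mT) => //.
  by apply: continuous_measurable_rV; exact: smooth_continuous.
have L f u : smooth f -> in_L2 Om u -> in_L2 Om (fun x => f x * u x).
  move=> sf Lu; have [M _ HM] := continuous_bounded (smooth_continuous sf).
  by apply: (in_L2_mulb mO Lu (msc _ sf) HM).
have spc i := smooth_pderiv i sc.
split; [exact: (L _ _ sc Lp)|by move=> i; exact: (in_L2D mO (L _ _ sc (LD i)) (L _ _ (spc i) Lp))|move=> phi tphi i].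
have [sp _] := tphi.
have tcp := test_mull sc tphi.
have tL h : test_function setT h -> in_L2 Om h by exact: (test_L2 oO).
have := HD _ tcp i; rewrite smooth_pderivM// => H.
have tdp := test_pderiv i tphi.
have Lcdp := tL _ (test_mull sc tdp).
have Ldcp := tL _ (test_mull (spc i) tphi).
move: H; rewrite innerC (innerDl mO Ldcp Lcdp Lp) => H.
have -> : inner Om (fun x => chi x * p x) (pderiv i phi) = inner Om (fun x => chi x * pderiv i phi x) p.
  by apply: eq_Rintegral => x _; ring.
rewrite (innerDl mO (L _ _ sc (LD i)) (L _ _ (spc i) Lp) (tL _ tphi)).
have -> : inner Om (fun x => chi x * D i x) phi = inner Om (D i) (fun x => chi x * phi x).
  by apply: eq_Rintegral => x _; ring.
have -> : inner Om (fun x => pderiv i chi x * p x) phi = inner Om (fun x => pderiv i chi x * phi x) p.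
  by apply: eq_Rintegral => x _; ring.
by move: H; set a := inner _ _ _; set b := inner _ _ _; set c := inner _ _ _; lra.
Qed.

(* e is an inward direction at c: moving by t e from Om leaves a margin kappa t. *)
Definition inward (c : E) (r : R) := exists (e : E) (kappa t0 : R),
  [/\ 0 < kappa, 0 < t0 & forall x, Om x -> `|x - c| <= r -> forall t, 0 < t -> t <= t0 ->
      forall y, `|y - (x + t *: e)| <= kappa * t -> Om y].

(* Translate inwards, then mollify at the scale of the margin. *)
Lemma test_approx_local c r p D : inward c r -> zero_trace p D ->
  (forall x, Om x -> r < `|x - c| -> p x = 0) -> test_approx p D.
Proof.
move=> [e [kappa [t0 [kappa0 t00 inw]]]] [Lp LD HD] p0 eps eps0.
pose P := p \_ Om; pose Q i := D i \_ Om.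
have [LP iP] := in_L2_restrict oO bO Lp.
have LQ i : in_L2 setT (Q i) /\ intT (Q i) := in_L2_restrict oO bO (LD i).
have [d d0 dP] : exists2 d, 0 < d & forall z, `|z| <= d ->
    norm0 setT (fun x => P (x + z) - P x) <= eps /\
    forall i, norm0 setT (fun x => Q i (x + z) - Q i x) <= eps.
  have near f : in_L2 setT f -> \forall d \near (0 : R)^'+,
      forall z, `|z| <= d -> norm0 setT (fun x => f (x + z) - f x) <= eps.
    move=> Lf; have [_ /(_ _ eps0)[d d0 Hd]] := in_L2_trans_cont Lf.
    near=> s; move=> z zs; apply: Hd; rewrite (le_trans zs)//.
    by near: s; exact: nbhs_right_le.
  have H1 := near _ LP.
  have H2 : \forall d \near (0 : R)^'+, forall i,
      forall z, `|z| <= d -> norm0 setT (fun x => Q i (x + z) - Q i x) <= eps.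
    by apply: filter_forall => i; apply: near; have [] := LQ i.
  have H3 : \forall d \near (0 : R)^'+, 0 < d by exact: nbhs_right_gt.
  have H4 : \forall d \near (0 : R)^'+, [/\ 0 < d,
      forall z, `|z| <= d -> norm0 setT (fun x => P (x + z) - P x) <= eps &
      forall i z, `|z| <= d -> norm0 setT (fun x => Q i (x + z) - Q i x) <= eps].
    by near=> s; split; near: s.
  have [d [d0 Hd1 Hd2]] := @filter_ex _ _ _ _ H4.
  by exists d => // z zd; split=> [|i]; [exact: Hd1|exact: Hd2].
pose t := Num.min t0 (d / (`|e| + kappa)).
have ek0 : 0 < `|e| + kappa by rewrite ltr_wpDl.
have t0' : 0 < t by rewrite lt_min t00 divr_gt0.
have tt0 : t <= t0 by rewrite ge_min lexx.
have td : t * (`|e| + kappa) <= d by rewrite -ler_pdivlMr// ge_min lexx orbT.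
have s0 : 0 < kappa * t / 2 by rewrite divr_gt0// mulr_gt0.
(* Centred at - t e, the kernel averages [P] around x - t e, so supports move inwards by t e. One
   half of the margin kappa t is spent on the kernel, the other half on taking the closure of the
   support. *)
have [k kk] := kernel_exists (- (t *: e)) s0.
have [tk _ _ ksupp] := kk.
have kd z : k z != 0 -> `|z| <= d.
  move=> kz; have : `|z - - (t *: e)| <= kappa * t / 2.
    by rewrite leNgt; apply/negP => /ksupp h; move: kz; rewrite h eqxx.
  move=> h; apply: le_trans td; rewrite -[z](subrK (- (t *: e))).
  apply: (le_trans (ler_normD _ _)); rewrite normrN normrZ (gtr0_norm t0').
  have : kappa * t / 2 <= kappa * t by rewrite ler_piMr ?invf_le1 ?ler1n// ltW// mulr_gt0.
  by lra.
have [sphi dphi] := smooth_conv iP tk.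
(* The kernel around x may reach beyond [Om]. The zero trace admits it as a test function all the
   same, so the derivative of the mollified extension is the mollified extension of [D i]. *)
have dE i : pderiv i (conv P k) = conv (Q i) k.
  rewrite dphi; apply/funext => x.
  have tkx : test_function setT (fun y => k (y - x)) by exact: (test_setT (test_shift x tk)).
  have dkx y : pderiv i (fun y => k (y - x)) y = pderiv i k (y - x) by apply: pderiv_shift; case: tk.
  rewrite -[RHS]/(inner setT (Q i) (fun y => k (y - x))) -inner_restrict -[RHS]opprK -HD//.
  rewrite inner_restrict -[X in - X]mul1r -mulNr -innerZl//; last exact: (test_in_L2 (test_pderiv i tkx)).1.
  by apply: eq_Rintegral => y _; rewrite dkx; ring.
exists (conv P k); split.
- split => //.
  pose S := [set x | exists2 y, Om y /\ `|y - c| <= r & `|y - x - - (t *: e)| <= kappa * t / 2].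
  exists (closure S); split.
  + have [N [Nr NO]] := bO.
    pose N1 := `|N| + 1.
    have SB : S `<=` [set x | `|x - 0| <= N1 + d].
      move=> x [y [Oy _] xy]; rewrite /= subr0.
      have yN : `|y| <= N1 by apply: (NO N1) => //; rewrite (le_lt_trans (ler_norm _))// ltrDl.
      have -> : x = y + (t *: e - (y - x - - (t *: e))) by apply/rowP => j; rewrite !mxE; ring.
      apply: (le_trans (ler_normD _ _)); apply: lerD => //; apply: le_trans td.
      apply: (le_trans (ler_normB _ _)); rewrite normrZ (gtr0_norm t0').
      have : kappa * t / 2 <= kappa * t by rewrite ler_piMr ?invf_le1 ?ler1n// ltW// mulr_gt0.
      by lra.
    have cB := @closed_ball_compact R n 0 (N1 + d).
    apply: (subclosed_compact (@closed_closure _ S) cB).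
    have clB : closed [set x : E | `|x - 0| <= N1 + d] by exact: compact_closed.
    by rewrite [X in _ `<=` X](closure_id _).1//; exact: closureS.
  + move=> x Sx; have st0 : 0 < kappa * t / 2 := s0.
    have [x' [[y [Oy yc] x'y] xx']] := Sx _ (nbhsx_ballx x _ st0).
    apply: (inw y Oy yc t t0' tt0).
    rewrite -ball_normE /= in xx'.
    have -> : x - (y + t *: e) = (x - x') - (y - x' - - (t *: e)).
      by apply/rowP => j; rewrite !mxE; ring.
    apply: (le_trans (ler_normB _ _)); have := ltW xx'; lra.
  + move=> x nS; apply/eqP; apply: contra_notT nS => h; apply: subset_closure.
    have pz y : ~ (Om y /\ `|y - c| <= r) -> P y = 0.
      move=> /not_andP[nO|ny]; first by exact: restrict0.
      have [Oy|nO] := pselect (Om y); last exact: restrict0.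
      by rewrite /P restrictE//; apply: p0 => //; rewrite ltNge; apply/negP.
    by have [y yA yx] := conv_supp kk pz h; exists y.
- have [|Lc cle] := @conv_close R n k _ _ P eps kk LP iP (ltW eps0).
    by move=> z /kd /dP[].
  rewrite norm0BC; apply: le_trans cle.
  have LB := in_L2B mT Lc LP.
  apply: le_trans (norm0_subset mT mO _ LB) => //.
  rewrite le_eqVlt; apply/orP; left; apply/eqP; congr Num.sqrt.
  by apply: inner_ext => x Ox; rewrite /P restrictE.
- move=> i; have [LQi iQi] := LQ i.
  have [|Lc cle] := @conv_close R n k _ _ (Q i) eps kk LQi iQi (ltW eps0).
    by move=> z /kd /dP[].
  rewrite norm0BC; apply: le_trans cle.
  have LB := in_L2B mT Lc LQi.
  apply: le_trans (norm0_subset mT mO _ LB) => //.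
  rewrite le_eqVlt; apply/orP; left; apply/eqP.
  by apply: norm0_ext => x Ox; rewrite dE /Q restrictE.
Unshelve. all: by end_near. Qed.

Lemma test_approxD p D p' D' : zero_trace p D -> zero_trace p' D' ->
  test_approx p D -> test_approx p' D' ->
  test_approx (fun x => p x + p' x) (fun i x => D i x + D' i x).
Proof.
move=> [Lp LD _] [Lp' LD' _] H H' e e0; have e2 : 0 < e / 2 by rewrite divr_gt0.
have [f [tf fp fD]] := H _ e2; have [f' [tf' fp' fD']] := H' _ e2.
have tL h : test_function Om h -> in_L2 Om h by exact: (test_L2 oO).
exists (fun x => f x + f' x); split; first exact: testD.
  rewrite [e]splitr; apply: le_trans (lerD fp fp').
  apply: le_trans (norm0D (in_L2B mO Lp (tL _ tf)) (in_L2B mO Lp' (tL _ tf'))).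
  by rewrite le_eqVlt; apply/orP; left; apply/eqP; apply: norm0_ext => x _; rewrite opprD addrACA.
move=> i; rewrite [e]splitr; apply: le_trans (lerD (fD i) (fD' i)).
apply: le_trans (norm0D (in_L2B mO (LD i) (tL _ (test_pderiv i tf)))
  (in_L2B mO (LD' i) (tL _ (test_pderiv i tf')))).
rewrite le_eqVlt; apply/orP; left; apply/eqP; apply: norm0_ext => x _.
have [sf _] := tf; have [sf' _] := tf'.
by rewrite (smooth_pderivD i sf sf') opprD addrACA.
Qed.

Lemma test_approx_ext p D p' D' : (forall x, Om x -> p x = p' x) ->
  (forall i x, Om x -> D i x = D' i x) -> test_approx p D -> test_approx p' D'.
Proof.
move=> pp DD H e e0; have [f [tf fp fD]] := H _ e0; exists f; split => //.
  by rewrite -(norm0_ext (f := fun x => p x - f x))// => x Ox; rewrite pp.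
by move=> i; rewrite -(norm0_ext (f := fun x => D i x - pderiv i f x))// => x Ox; rewrite DD.
Qed.

Lemma test_approx0 p D : (forall x, Om x -> p x = 0) ->
  (forall i x, Om x -> D i x = 0) -> test_approx p D.
Proof.
move=> p0 D0 e e0; exists (fun=> 0); have n0 : norm0 Om (fun=> 0) = 0.
  by rewrite /norm0 /inner; under eq_Rintegral do rewrite mulr0; rewrite Rintegral_cst// mul0r sqrtr0.
have ss : smooth (fun _ : E => 0 : R) := smooth_cst 0.
split; first by split => //; exists set0; split => //; exact: compact0.
  by rewrite (norm0_ext (g := fun=> 0)) ?n0 ?(ltW e0)// => x Ox; rewrite p0 ?subr0.
by move=> i; rewrite (norm0_ext (g := fun=> 0)) ?n0 ?(ltW e0)// => x Ox; rewrite D0// pderiv_cst subr0.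
Qed.

(* Cut off around one centre at a time. *)
Lemma test_approx_peel (cs : seq (E * R)) p D :
  (forall c, c \in cs -> 0 < c.2 /\ inward c.1 (2 * c.2)) -> zero_trace p D ->
  (forall x, Om x -> (forall c, c \in cs -> c.2 <= `|x - c.1|) ->
     p x = 0 /\ forall i, D i x = 0) ->
  test_approx p D.
Proof.
elim: cs p D => [|c cs IH] p D good zpD van.
  by apply: test_approx0 => [x Ox|i x Ox]; have [] := van x Ox.
have [c0 inw] := good c (mem_head _ _).
pose b := plateau c.1 c.2; have sb : smooth b := smooth_plateau _ _.
have sb1 : smooth (fun x => 1 - b x) by exact: (smoothB (smooth_cst 1) sb).
have z1 := zero_trace_cutoff sb zpD; have z2 := zero_trace_cutoff sb1 zpD.
have A1 : test_approx (fun x => b x * p x) (fun i x => b x * D i x + pderiv i b x * p x).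
  apply: (test_approx_local inw z1) => x Ox xc.
  by rewrite /b plateau0// mul0r.
have A2 : test_approx (fun x => (1 - b x) * p x)
    (fun i x => (1 - b x) * D i x + pderiv i (fun x => 1 - b x) x * p x).
  apply: IH => //; first by move=> c' c's; apply: good; rewrite inE c's orbT.
  move=> x Ox xcs; have [xc|xc] := ltP `|x - c.1| c.2; last first.
    have [|p0 D0] := van x Ox.
      by move=> c'; rewrite inE => /orP[/eqP ->//|]; exact: xcs.
    by rewrite p0; split=> [|i]; rewrite ?D0 !mulr0 ?addr0.
  (* Near x the plateau equals 1, so 1 - b vanishes together with its derivatives, and with it both
     parts of the cut-off pair. *)
  have b1 : \forall y \near x, 1 - b y = 0.
    have : nbhs x [set y | `|y - c.1| < c.2].
      have e0 : 0 < c.2 - `|x - c.1| by rewrite subr_gt0.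
      apply: filterS (nbhsx_ballx x _ e0) => y; rewrite -ball_normE /= => xy.
      by rewrite -[y](subrK x) -addrA (le_lt_trans (ler_normD _ _))// distrC; lra.
    by apply: filterS => y /= yc; rewrite /b plateau1 ?subrr// ltW.
  have bx := nbhs_singleton b1.
  by rewrite bx mul0r; split => // i; rewrite mul0r add0r pderiv_locally0 ?mul0r.
apply: (test_approx_ext _ _ (test_approxD z1 z2 A1 A2)) => [x _|i x _]; first by ring.
by rewrite (smooth_pderivB _ (smooth_cst 1) sb) pderiv_cst; ring.
Qed.

Hypothesis lO : lipschitz_boundary Om.

(** [e] is the vertical direction of the graph chart. A step t along it changes the height by t,
    while a perturbation of size kappa t changes the height by at most kappa t N and the graph by at
    most L kappa t N. With kappa = 1 / ((1 + L) N) these sum to t, so the point stays on its side of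
    the graph. [N] bounds the effect of the rotation on the maximum norm. *)
Lemma lipschitz_chart c : closure Om c -> ~ Om c -> exists (e : E) (kappa s : R),
  [/\ 0 < kappa, 0 < s,
     forall x, Om x -> `|x - c| <= s -> forall t, 0 < t -> t <= s ->
       forall y, `|y - (x + t *: e)| <= kappa * t -> Om y &
     forall t, 0 < t -> t <= s -> forall y, `|y - (c - t *: e)| <= kappa * t -> ~ Om y].
Proof.
move=> clc nOc; have [|A [i [gamma [U [AA lipg nU UO]]]]] := lO (p := c).
  by split => //; rewrite (interior_id _).1.
have [L L0 gL] : exists2 L, 0 < L & forall x y, `|gamma x - gamma y| <= L * `|x - y|.
  have [L [L0 HL]] := pinfty_ex_gt0 lipg.
  by exists L => // x y; exact: (HL (x, y)).
have [r /= r0 rU] : exists2 r : R, 0 < r & forall x, `|x - c| < r -> U x.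
  have /nbhs_ballP[r /= r0 rU] := nU; exists r => // x xc; apply: rU.
  by rewrite -ball_normE /= distrC.
pose e : E := delta_mx ord0 i *m A^T.
have eA : e *m A = delta_mx ord0 i by rewrite -mulmxA (mulmx1C AA) mulmx1.
pose N := 1 + \sum_(j < n) \sum_(k < n) `|A j k|.
have N0 : 0 < N by rewrite /N ltr_wpDr// sumr_ge0// => j _; exact: sumr_ge0.
have NA (w : E) j : `|(w *m A) ord0 j| <= `|w| * N.
  rewrite mxE; apply: (le_trans (ler_norm_sum _ _ _)).
  apply: (@le_trans _ _ (\sum_(k < n) `|w| * `|A k j|)).
    apply: ler_sum => k _; rewrite normrM ler_wpM2r//.
    exact: ((norm_coordP w (normr_ge0 w)).1 (lexx _) k).
  rewrite -mulr_sumr ler_wpM2l// /N -[leLHS]add0r; apply: lerD => //.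
  by apply: ler_sum => k _; rewrite (bigD1 j)//= lerDl sumr_ge0.
have colA (w : E) : `|col' i (w *m A)| <= `|w| * N.
  apply/norm_coordP; first by rewrite mulr_ge0// ltW.
  by move=> j; rewrite mxE.
pose kappa := ((1 + L) * N)^-1.
have LN0 : 0 < (1 + L) * N by rewrite mulr_gt0// ltr_wpDl.
have kappa0 : 0 < kappa by rewrite invr_gt0.
have kE : kappa * N + L * (kappa * N) = 1.
  have : kappa * ((1 + L) * N) = 1 by rewrite mulVf// gt_eqF.
  by rewrite mulrDl mul1r mulrDr => <-; congr (_ + _); rewrite mulrCA.
(* All points stay in the ball of radius r where the chart is valid: |x - c| <= r/4, and the
   displacement t (|e| + kappa) is at most r/4. *)
pose s := Num.min (r / 4) (r / 4 / (1 + `|e| + kappa)).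
have ek0 : 0 < 1 + `|e| + kappa by rewrite addr_gt0// ltr_pwDl.
have s0 : 0 < s by rewrite lt_min !divr_gt0.
have sr : s <= r / 4 by rewrite ge_min lexx.
have se : s * (1 + `|e| + kappa) <= r / 4 by rewrite -ler_pdivlMr// ge_min lexx orbT.
have ts t : 0 < t -> t <= s -> t * `|e| + kappa * t <= r / 4.
  move=> t0 tS; apply: (@le_trans _ _ (t * (1 + `|e| + kappa))); first by lra.
  by apply: le_trans se; rewrite ler_wpM2r// ltW.
have colS (w : E) t : col' i (w *m A + t *: delta_mx ord0 i) = col' i (w *m A).
  apply/rowP => j; rewrite !mxE eqxx /= (_ : (lift i j == i) = false) ?mulr0 ?addr0//.
  by apply/negbTE; rewrite eq_sym neq_lift.
have deltaE (a : E) t : (a + t *: delta_mx ord0 i) ord0 i = a ord0 i + t.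
  by rewrite !mxE !eqxx mulr1.
have addE (a b : E) : (a + b) ord0 i = a ord0 i + b ord0 i by rewrite mxE.
exists e, kappa, s; split => //.
- move=> x Ox xc t t0 tS y yx; pose w := y - (x + t *: e).
  have yE : y - c = (x - c) + t *: e + w by rewrite /w; apply/rowP => j; rewrite !mxE; ring.
  have wk : `|w| <= kappa * t by [].
  have Ux : U x by apply: rU; rewrite (le_lt_trans xc)//; lra.
  have Uy : U y.
    apply: rU; rewrite yE; apply: (le_lt_trans (ler_normD _ _)).
    apply: (le_lt_trans (lerD (ler_normD _ _) wk)); rewrite normrZ (gtr0_norm t0).
    by have := ts t t0 tS; lra.
  apply/(UO y Uy); have /(UO x Ux) := Ox.
  have -> : (y - c) *m A = (x - c + w) *m A + t *: delta_mx ord0 i.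
    by rewrite yE !mulmxDl -scalemxAl eA addrAC.
  rewrite colS deltaE; set xi := (x - c) *m A => gx.
  have g1 := gL (col' i ((x - c + w) *m A)) (col' i xi).
  have : `|col' i ((x - c + w) *m A) - col' i xi| <= kappa * t * N.
    have -> : col' i ((x - c + w) *m A) - col' i xi = col' i (w *m A).
      by rewrite mulmxDl /xi; apply/rowP => j; rewrite !mxE; ring.
    by rewrite (le_trans (colA _))// ler_wpM2r// ltW.
  move=> h; have {g1 h} : `|gamma (col' i ((x - c + w) *m A)) - gamma (col' i xi)| <= L * (kappa * t * N).
    by apply: le_trans g1 _; rewrite ler_wpM2l// ltW.
  rewrite ler_norml => /andP[_ h].
  have : `|(w *m A) ord0 i| <= kappa * t * N by rewrite (le_trans (NA _ _))// ler_wpM2r// ltW.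
  rewrite ler_norml => /andP[h2 _].
  rewrite mulmxDl addE -/xi.
  have : t = kappa * t * N + L * (kappa * t * N) by rewrite -[LHS]mulr1 -kE; ring.
  move: h; rewrite mulmxDl; lra.
- move=> t t0 tS y yx; pose w := y - (c - t *: e).
  have yE : y - c = w - t *: e by rewrite /w; apply/rowP => j; rewrite !mxE; ring.
  have wk : `|w| <= kappa * t by [].
  have Uc : U c by apply: rU; rewrite subrr normr0.
  have Uy : U y.
    apply: rU; rewrite yE; apply: (le_lt_trans (ler_normB _ _)).
    rewrite normrZ (gtr0_norm t0).
    by have := ts t t0 tS; lra.
  move=> /(UO y Uy); apply/negP; rewrite -leNgt.
  have : ~ Om c := nOc.
  move=> /(contra_not (UO c Uc).2)/negP; rewrite -leNgt subrr mul0mx [X in X <= _]mxE => gc.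
  have -> : (y - c) *m A = w *m A + (- t) *: delta_mx ord0 i.
    by rewrite yE mulmxBl -scalemxAl eA scaleNr.
  rewrite colS deltaE.
  have g1 := gL (col' i (w *m A)) (col' i 0).
  have : `|col' i (w *m A) - col' i 0| <= kappa * t * N.
    have -> : col' i (w *m A) - col' i 0 = col' i (w *m A).
      by apply/rowP => j; rewrite !mxE subr0.
    by rewrite (le_trans (colA _))// ler_wpM2r// ltW.
  move=> h; have {g1 h} : `|gamma (col' i (w *m A)) - gamma (col' i 0)| <= L * (kappa * t * N).
    by apply: le_trans g1 _; rewrite ler_wpM2l// ltW.
  rewrite ler_norml => /andP[h _].
  have : `|(w *m A) ord0 i| <= kappa * t * N by rewrite (le_trans (NA _ _))// ler_wpM2r// ltW.
  rewrite ler_norml => /andP[_ h2].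
  have : t = kappa * t * N + L * (kappa * t * N) by rewrite -[LHS]mulr1 -kE; ring.
  by move: h; lra.
Qed.

(** A boundary point has, in the outward direction of its chart, arbitrarily close balls that miss
    [Om], so it cannot be interior to the closure. This excludes slits, and it is what places open
    mesh elements inside [Om]. *)
Lemma interior_closure : (closure Om)^° `<=` Om.
Proof.
move=> c ic; apply: contrapT => nOc.
have [e [kappa [s [kappa0 s0 _ out]]]] := lipschitz_chart (interior_subset ic) nOc.
have /nbhs_ballP[r /= r0 rO] : nbhs c (closure Om) := ic.
pose t := Num.min s (r / (1 + `|e|)).
have e0 : 0 < 1 + `|e| by rewrite ltr_pwDl.
have t0 : 0 < t by rewrite lt_min s0 divr_gt0.
have ts : t <= s by rewrite ge_min lexx.
have tr : t * (1 + `|e|) <= r by rewrite -ler_pdivlMr// ge_min lexx orbT.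
have : closure Om (c - t *: e).
  apply: rO; rewrite -ball_normE /= opprB addrCA subrr addr0 normrZ gtr0_norm//; lra.
have kt : 0 < kappa * t by rewrite mulr_gt0.
move=> /(_ _ (nbhsx_ballx _ _ kt))[y [Oy]]; rewrite -ball_normE /= => yt.
by apply: (out t t0 ts y) => //; rewrite distrC ltW.
Qed.

Lemma inward_exists c : closure Om c -> exists2 r, 0 < r & inward c (2 * r).
Proof.
move=> clc; have [Oc|nOc] := pselect (Om c); last first.
  have [e [kappa [s [kappa0 s0 H _]]]] := lipschitz_chart clc nOc.
  exists (s / 2); first by rewrite divr_gt0.
  exists e, kappa, s; split => // x Ox; rewrite mulrC divfK// => xc; exact: H.
have /nbhs_ballP[r /= r0 rO] : nbhs c Om by exact: open_nbhs_nbhs.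
exists (r / 4); first by rewrite divr_gt0.
(* At an interior point the zero direction with kappa = 1 works: the distance to c is at most r/2 +
   r/4 < r. *)
exists 0, 1, (r / 4); split => //; first by rewrite divr_gt0.
move=> x Ox xc t t0 tr y; rewrite scaler0 addr0 mul1r => yx; apply: rO.
rewrite -ball_normE /= distrC -[y](subrK x) -addrA.
by apply: (le_lt_trans (ler_normD _ _)); lra.
Qed.

(** Finitely many balls with inward directions cover the compact closure, and [test_approx_peel]
    removes one of them at a time. *)
Theorem zero_trace_approx p D : zero_trace p D -> test_approx p D.
Proof.
move=> zpD.
have /choice[rad radP] : forall c, exists r, closure Om c -> 0 < r /\ inward c (2 * r).
  move=> c; have [h|h] := pselect (closure Om c); last by exists 0.
  by have [r r0 ri] := inward_exists h; exists r.
have : compact (closure Om).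
  apply: bounded_closed_compact; last exact: closed_closure.
  have [N [Nr NO]] := bO; exists N; split => // M NM x clx.
  apply/ler_addgt0Pl => e e0; have [y [Oy]] := clx _ (nbhsx_ballx x _ e0).
  rewrite -ball_normE /= => xy; rewrite -[x](subrK y) (le_trans (ler_normD _ _))// lerD//.
    exact: ltW.
  exact: (NO M NM).
rewrite compact_cover => /(_ E (closure Om) (fun c => ball c (rad c))) [].
- by move=> c _; exact: ball_open.
- by move=> c clc; exists c => //; apply: ballxx; have [] := radP c clc.
move=> F FO cov.
apply: (@test_approx_peel [seq (c, rad c) | c <- F]) => //.
  by move=> _ /mapP[c cF ->]/=; apply: radP; have := FO c cF; rewrite inE.
move=> x Ox H; have [c cF xc] := cov x (subset_closure Ox).
have := H (c, rad c) (map_f (fun c => (c, rad c)) cF).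
move: xc; rewrite -ball_normE /= distrC => xc /(lt_le_trans xc).
by rewrite ltxx.
Qed.

End ZeroTrace.

(** * Sobolev inequality and the space H^1_0 *)

Section Slices.
Context {R : realType}.
Local Notation mu n := (lebesgue R n).
Local Notation lam := (@lebesgue_measure R).

Lemma ins_line n (i : 'I_n.+1) (k : 'I_n) (r s : R) (y : 'rV[R]_n) :
  ins i (r, s *: delta_mx ord0 k + y) = s *: delta_mx ord0 (lift i k) + ins i (r, y).
Proof.
apply/rowP => j; rewrite !mxE; case: (unliftP i j) => [l|] ->.
  by rewrite !mxE eqxx/= (inj_eq lift_inj).
by rewrite (_ : (i == lift i k) = false) ?mulr0 ?add0r//; apply/negbTE; exact: neq_lift.
Qed.

Lemma ins_self n (i : 'I_n.+1) (s : R) (y : 'rV[R]_n) :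
  ins i (s, y) = s *: delta_mx ord0 i + ins i (0, y).
Proof.
apply/rowP => j; rewrite !mxE; case: (unliftP i j) => [l|] ->.
  by rewrite eqxx/= eq_sym (_ : (i == lift i l) = false) ?mulr0 ?add0r//; apply/negbTE; exact: neq_lift.
by rewrite !eqxx mulr1 addr0.
Qed.

Lemma ins_norm_ge n (i : 'I_n.+1) (r : R) (y : 'rV[R]_n) : `|y| <= `|ins i (r, y)|.
Proof.
apply/norm_coordP => // k; rewrite -(ins_lift i (r, y)); exact: coord_norm.
Qed.

Lemma continuous_line n (f : 'rV[R]_n -> R) (v x : 'rV[R]_n) : continuous f ->
  continuous (fun t : R => f (t *: v + x)).
Proof.
move=> cf t; apply: continuous_comp; last exact: cf.
by apply: cvgD; [apply: cvgZr_tmp; exact: cvg_id|exact: cvg_cst].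
Qed.

Lemma is_derive_along n (f : 'rV[R]_n -> R) i (x : 'rV[R]_n) (t : R) : smooth f ->
  is_derive t (1 : R) (fun t => f (t *: delta_mx ord0 i + x)) (pderiv i f (t *: delta_mx ord0 i + x)).
Proof.
move=> sf; apply/is_derive_line.
rewrite (_ : (fun k : R => _) =
    (fun k : R => f (k *: delta_mx ord0 i + (t *: delta_mx ord0 i + x)))); last first.
  by apply/funext => k; rewrite [k *: (1 : R)]mulr1 scalerDl addrA.
by apply/is_derive_line; apply: derivableP; exact: smooth_derivable.
Qed.

Lemma EFin_le_mul (a b c : R) (A B C : \bar R) : A = a%:E -> B = b%:E -> C = c%:E ->
  (A <= B * C)%E -> a <= b * c.
Proof. by move=> -> -> ->; rewrite -EFinM lee_fin. Qed.

(** The fundamental theorem of calculus on the line, started outside the support. *)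
Lemma line_bound n (psi : 'rV[R]_n -> R) i (x : 'rV[R]_n) (s : R) :
  test_function setT psi ->
  (`|psi (s *: delta_mx ord0 i + x)|%:E <=
   \int[lam]_t (`|pderiv i psi (t *: delta_mx ord0 i + x)|)%:E)%E.
Proof.
move=> tp; have [sp _] := tp; have [r r0 pr] := test_supp tp.
set e := delta_mx ord0 i.
pose F (t : R) := psi (t *: e + x); pose f (t : R) := pderiv i psi (t *: e + x).
have dF t : is_derive t (1 : R) F (f t).
  exact: is_derive_along.
have cf : continuous f by apply: continuous_line; exact/smooth_continuous/smooth_pderiv.
have cF : continuous F by apply: continuous_line; exact/smooth_continuous.
(* Far enough that a < s and that |a| - |x| > r, so a e + x lies outside the support. *)
pose a := - (`|s| + r + `|x| + 1).
have as_ : a < s by have := ler_norm (- s); rewrite normrN /a; have := normr_ge0 x; lra.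
have Fa : F a = 0.
  apply: pr; apply: lt_le_trans (_ : `|a| - `|x| <= _).
    by rewrite /a normrN ger0_norm ?addr_ge0// ?(ltW r0)//; have := normr_ge0 s; lra.
  rewrite lerBlDr; apply: (@le_trans _ _ `|a *: e|).
    by have := coord_norm (a *: e) i; rewrite !mxE !eqxx mulr1.
  by have := ler_normB (a *: e + x) x; rewrite addrK.
have ftc : (\int[lam]_(t in `[a, s]) (f t)%:E = (F s)%:E - (F a)%:E)%E.
  apply: (continuous_FTC2 as_).
  - exact: continuous_subspaceT.
  - split; first by move=> t _; case: (dF t).
    + exact: cvg_at_right_filter (cF a).
    + exact: cvg_at_left_filter (cF s).
  - by move=> t _; rewrite derive1E; case: (dF t).
have mf : measurable_fun setT f by exact: continuous_measurable_fun.
have -> : (`|psi (s *: e + x)|%:E = `|(F s)%:E - (F a)%:E|)%E by rewrite Fa sube0.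
rewrite -ftc; apply: le_trans (le_abse_integral _ _ _) _ => //.
  by apply/measurable_EFinP; exact: measurable_funTS.
apply: ge0_subset_integral => //.
by apply/measurable_EFinP; exact: (measurableT_comp (@normr_measurable _ setT)).
Qed.

Lemma integral_rV0 (f : 'rV[R]_0 -> \bar R) : (\int[mu 0]_x f x = f (0 : 'rV[R]_0)%R)%E.
Proof.
rewrite /= integral_dirac ?diracT ?mul1e//.
move=> _ B mB; rewrite setTI; have [f0|f0] := pselect (B (f 0)).
  suff -> : f @^-1` B = setT by exact: measurableT.
  by apply/seteqP; split => // x _; rewrite /= (_ : x = 0)//; apply/rowP => -[].
suff -> : f @^-1` B = set0 by exact: measurable0.
apply/seteqP; split => // x; rewrite /= (_ : x = 0)//; apply/rowP => -[].
by [].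
Qed.

Lemma ge0_integral_rV1 (f : 'rV[R]_1 -> \bar R) : measurable_fun setT f ->
  (forall x, 0 <= f x)%E ->
  (\int[mu 1]_x f x = \int[lam]_t f (ins ord0 (t, (0 : 'rV[R]_0)%R)))%E.
Proof.
move=> mf f0; rewrite (ge0_integral_ins ord0)//.
have mF : measurable_fun setT (fun p : R * 'rV[R]_0 => f (ins ord0 p)).
  exact: (measurableT_comp mf (measurable_ins ord0)).
rewrite (@fubini_tonelli1 _ _ _ _ R lam (mu 0) (fun p => f (ins ord0 p)) mF (fun p => f0 _)).
apply: eq_integral => t _.
by rewrite /fubini_F integral_rV0.
Qed.

Lemma mEF n (f : 'rV[R]_n -> R) : continuous f -> measurable_fun setT (fun x => (f x)%:E).
Proof. by move=> cf; apply/measurable_EFinP; exact: continuous_measurable_rV. Qed.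

Lemma cont_abs n (f : 'rV[R]_n -> R) : continuous f -> continuous (fun x => `|f x|).
Proof. by move=> cf x; apply: continuous_comp; [exact: cf|exact: norm_continuous]. Qed.

Lemma test_int_abs n (f : 'rV[R]_n -> R) : test_function setT f ->
  (mu n).-integrable setT (EFin \o (fun x => `|f x|)).
Proof. by move=> /test_in_L2[_ i]; exact: (intw_norm i). Qed.

(** [line_bound] in both directions: one bound depends on the second coordinate only, the other on
    the first only, so the integral of their product splits into a product of integrals. *)
Lemma planar_gagliardo (psi : 'rV[R]_2 -> R) : test_function setT psi ->
  \int[mu 2]_x (psi x ^+ 2) <=
  (\int[mu 2]_x `|pderiv ord0 psi x|) * (\int[mu 2]_x `|pderiv (lift ord0 ord0) psi x|).
Proof.
move=> tp; have [sp _] := tp.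
have cp := smooth_continuous sp.
have td i := test_pderiv i tp.
have cd i : continuous (fun x => `|pderiv i psi x|).
  by apply: cont_abs; apply: smooth_continuous; exact: smooth_pderiv.
have [[_ i2] _] := test_in_L2 tp.
apply: (EFin_le_mul (EFin_Rint measurableT i2) (EFin_Rint measurableT (test_int_abs (td ord0)))
  (EFin_Rint measurableT (test_int_abs (td (lift ord0 ord0))))).
pose a p := (`|pderiv ord0 psi (@ins R 1 ord0 p)|)%:E.
pose b p := (`|pderiv (lift ord0 ord0) psi (@ins R 1 ord0 p)|)%:E.
have mi i : measurable_fun setT (fun p => (`|pderiv i psi (@ins R 1 ord0 p)|)%:E).
  exact: (measurableT_comp (mEF (cd i)) (measurable_ins ord0)).
have mp2 : measurable_fun setT (fun x => (psi x ^+ 2)%:E).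
  by apply/measurable_EFinP; apply: measurable_funX; exact: continuous_measurable_rV.
pose A y := (\int[lam]_s a (s, y))%E.
pose B s := (\int[mu 1]_y b (s, y))%E.
have a0 p : (0 <= a p)%E by rewrite lee_fin.
have b0 p : (0 <= b p)%E by rewrite lee_fin.
have A0 y : (0 <= A y)%E by apply: integral_ge0 => s _; exact: a0.
have B0 s : (0 <= B s)%E by apply: integral_ge0 => y _; exact: b0.
have mA : measurable_fun setT A by exact: (@measurable_fun_fubini_tonelli_G _ _ _ _ R lam a (mi _) a0).
have mB : measurable_fun setT B by exact: (@measurable_fun_fubini_tonelli_F _ _ _ _ R (mu 1) b (mi _) b0).
have psiA s y : ((`|psi (ins ord0 (s, y))|)%:E <= A y)%E.
  have := line_bound ord0 (ins ord0 (0, y)) s tp; rewrite -ins_self => /le_trans; apply.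
  by rewrite le_eqVlt; apply/orP; left; apply/eqP; apply: eq_integral => t _; rewrite -ins_self.
have psiB s y : ((`|psi (ins ord0 (s, y))|)%:E <= B s)%E.
  have yE : y = y ord0 ord0 *: delta_mx ord0 ord0 + 0 :> 'rV[R]_1.
    by apply/rowP => j; rewrite !mxE (ord1 j) !eqxx mulr1 addr0.
  have tE t : ins ord0 (t, 0 : 'rV[R]_0) = t *: delta_mx ord0 ord0 + 0 :> 'rV[R]_1.
    by apply/rowP => j; rewrite !mxE (ord1 j) unlift_none !eqxx mulr1 addr0.
  have := line_bound (lift ord0 ord0) (ins ord0 (s, 0 : 'rV[R]_1)) (y ord0 ord0) tp.
  rewrite -ins_line -yE => /le_trans; apply.
  have mbs : measurable_fun setT (fun y => b (s, y)).
    exact: (measurableT_comp (mi _) (measurable_pair1 s)).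
  have -> : B s = (\int[lam]_t b (s, ins ord0 (t, 0%R : 'rV[R]_0)))%E.
    exact: (ge0_integral_rV1 mbs (fun y => b0 (s, y))).
  rewrite le_eqVlt; apply/orP; left; apply/eqP; apply: eq_integral => t _.
  by rewrite /b tE ins_line.
have iE i : (\int[mu 2]_x (`|pderiv i psi x|)%:E = \int[lam \x mu 1]_p (`|pderiv i psi (ins ord0 p)|)%:E)%E.
  by apply: ge0_integral_ins => [|x]; [exact: mEF (cd i)|rewrite lee_fin].
rewrite !iE (ge0_integral_ins ord0 mp2) => [|x]; last by rewrite lee_fin sqr_ge0.
have mpi : measurable_fun setT (fun p => (psi (@ins R 1 ord0 p) ^+ 2)%:E).
  exact: (measurableT_comp mp2 (measurable_ins ord0)).
have sq0 p : (0 <= (psi (@ins R 1 ord0 p) ^+ 2)%:E)%E by rewrite lee_fin sqr_ge0.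
have -> : (\int[lam \x mu 1]_p (`|pderiv ord0 psi (ins ord0 p)|)%:E = \int[mu 1]_y A y)%E.
  exact: (@fubini_tonelli2 _ _ _ _ R lam (mu 1) a (mi _) a0).
have -> : (\int[lam \x mu 1]_p (`|pderiv (lift ord0 ord0) psi (ins ord0 p)|)%:E = \int[lam]_s B s)%E.
  exact: (@fubini_tonelli1 _ _ _ _ R lam (mu 1) b (mi _) b0).
rewrite (@fubini_tonelli1 _ _ _ _ R lam (mu 1) _ mpi sq0)/=.
have IA0 : (0 <= \int[mu 1]_y A y)%E by exact: integral_ge0.
rewrite -ge0_integralZl//.
apply: ge0_le_integral => //.
- by move=> s _; apply: integral_ge0 => y _; rewrite lee_fin sqr_ge0.
- exact: (@measurable_fun_fubini_tonelli_F _ _ _ _ R (mu 1) _ mpi sq0).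
- exact: measurable_funeM.
- move=> s _; rewrite /fubini_F muleC -ge0_integralZl//.
  apply: ge0_le_integral => //.
  + exact: (measurableT_comp mpi (measurable_pair1 s)).
  + exact: measurable_funeM.
  + move=> y _; rewrite -real_normK ?num_real// expr2 EFinM.
    by apply: lee_pmul; rewrite ?lee_fin// ?psiA ?psiB.
Qed.

Lemma inner_le n (w : set 'rV[R]_n) (u v : 'rV[R]_n -> R) : measurable w ->
  in_L2 w u -> in_L2 w v -> inner w u v <= norm0 w u * norm0 w v.
Proof.
move=> mw Lu Lv; have := @cauchy_schwarz _ _ w mw unit (fun=> u) (fun=> v) (fun=> Lu) (fun=> Lv).
rewrite /tuple_nm /norm0 /tuple_ip !big_const !card_unit /= !addr0.
by rewrite ler_norml => /andP[].
Qed.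

Lemma in_L2_abs n (w : set 'rV[R]_n) (u : 'rV[R]_n -> R) : measurable w ->
  in_L2 w u -> in_L2 w (fun x => `|u x|).
Proof.
move=> mw Lu; have [mu_ _] := Lu; apply: (in_L2_le mw _ Lu) => [|x _]; last by rewrite normr_id.
by apply: measurableT_comp => //; exact: normr_measurable.
Qed.

Lemma norm0_abs n (w : set 'rV[R]_n) (u : 'rV[R]_n -> R) :
  norm0 w (fun x => `|u x|) = norm0 w u.
Proof.
rewrite /norm0; congr Num.sqrt; apply: eq_Rintegral => x _.
by rewrite -normrM ger0_norm// -expr2 sqr_ge0.
Qed.

Lemma inner_abs_le n (u v : 'rV[R]_n -> R) : in_L2 setT u -> in_L2 setT v ->
  (\int[mu n]_x (`|u x| * `|v x|)) ^+ 2 <= inner setT u u * inner setT v v.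
Proof.
move=> Lu Lv; have mT := @measurableT _ 'rV[R]_n.
rewrite -!norm0_sqr -exprMn -(norm0_abs _ u) -(norm0_abs _ v).
rewrite lerXn2r ?nnegrE ?mulr_ge0 ?norm0_ge0//.
  by apply: Rintegral_ge0 => x _; rewrite mulr_ge0.
by apply: inner_le => //; exact: in_L2_abs.
Qed.

End Slices.

(** * Sobolev inequality for cubes in dimensions 2 and 3 *)

Section Sobolev.
Context {R : realType}.
Local Notation mu n := (lebesgue R n).
Local Notation lam := (@lebesgue_measure R).
Local Notation sq f := (inner setT f f).

Lemma test_mul n (f g : 'rV[R]_n -> R) : test_function setT f -> test_function setT g ->
  test_function setT (fun x => f x * g x).
Proof. by move=> [sf _] tg; exact: test_mull. Qed.

Lemma test_exp n (f : 'rV[R]_n -> R) k : test_function setT f ->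
  test_function setT (fun x => f x ^+ k.+1).
Proof.
move=> tf; elim: k => [//|k IH].
have -> : (fun x => f x ^+ k.+2) = (fun x => f x * f x ^+ k.+1).
  by apply/funext => x; rewrite exprS.
exact: test_mul.
Qed.

Lemma pderiv_exp n (f : 'rV[R]_n -> R) k i x : test_function setT f ->
  pderiv i (fun x => f x ^+ k.+1) x = k.+1%:R * (f x ^+ k * pderiv i f x).
Proof.
move=> tf; have [sf _] := tf; elim: k => [|k IH]; first by rewrite expr0 !mul1r.
have -> : (fun x => f x ^+ k.+2) = (fun x => f x * f x ^+ k.+1).
  by apply/funext => y; rewrite exprS.
have [sk _] := test_exp k tf.
by rewrite smooth_pderivM// IH [in RHS]exprS -[in RHS]natr1 !exprS; ring.
Qed.

(** The derivative is (k+1) f^k times that of f, and Cauchy-Schwarz separates the factors; for k > 0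
    the power f^k is itself a test function, hence in L^2. *)
Lemma int_pderiv_exp n (f : 'rV[R]_n -> R) k i : test_function setT f -> (0 < k)%N ->
  (\int[mu n]_x `|pderiv i (fun x => f x ^+ k.+1) x|) ^+ 2 <=
  k.+1%:R ^+ 2 * (sq (fun x => f x ^+ k) * sq (pderiv i f)).
Proof.
move=> tf k0; have [L1 _] := test_in_L2 (test_exp k.-1 tf); rewrite prednK// in L1.
have [L2 _] := test_in_L2 (test_pderiv i tf).
have Li := in_L2_int measurableT (in_L2_abs measurableT L1) (in_L2_abs measurableT L2).
rewrite (@eq_Rintegral _ _ _ _ _ (fun x => k.+1%:R * (`|f x ^+ k| * `|pderiv i f x|))); last first.
  by move=> x _; rewrite pderiv_exp// !normrM normr_nat.
by rewrite RintegralZl// exprMn ler_wpM2l ?sqr_ge0// inner_abs_le.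
Qed.

Lemma sq_ge0 n (f : 'rV[R]_n -> R) : 0 <= sq f. Proof. exact: inner_ge0. Qed.

Lemma geometric_mean_le (x y z c n a b : R) : 0 <= y -> 0 <= z -> 0 <= n -> 0 <= a -> 0 <= b ->
  x <= y * z -> y ^+ 2 <= c ^+ 2 * (n * a) -> z ^+ 2 <= c ^+ 2 * (n * b) ->
  x <= c ^+ 2 / 2 * n * (a + b).
Proof.
move=> y0 z0 n0 a0 b0 xyz ya zb; apply: (le_trans xyz).
have h : 2 * (y * z) <= y ^+ 2 + z ^+ 2 by have := sqr_ge0 (y - z); rewrite sqrrB; lra.
by lra.
Qed.

(** [planar_gagliardo] for the power phi^(k+1). It is a ladder: k = 1 gives L^4 from L^2, and k = 2
    gives L^6 from L^4. *)
Lemma planar_sobolev (phi : 'rV[R]_2 -> R) k : test_function setT phi -> (0 < k)%N ->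
  sq (fun x => phi x ^+ k.+1) <= k.+1%:R ^+ 2 / 2 * sq (fun x => phi x ^+ k) *
    (sq (pderiv ord0 phi) + sq (pderiv (lift ord0 ord0) phi)).
Proof.
move=> tp k0; have g := planar_gagliardo (test_exp k tp).
have i0 := int_pderiv_exp ord0 tp k0; have i1 := int_pderiv_exp (lift ord0 ord0) tp k0.
apply: (geometric_mean_le _ _ (sq_ge0 _) (sq_ge0 _) (sq_ge0 _) g i0 i1); exact: Rintegral_ge0.
Qed.

Lemma test_slice n (i : 'I_n.+1) (r : R) (phi : 'rV[R]_n.+1 -> R) : test_function setT phi ->
  test_function setT (fun y => phi (ins i (r, y))) /\
  forall k, pderiv k (fun y => phi (ins i (r, y))) = fun y => pderiv (lift i k) phi (ins i (r, y)).
Proof.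
move=> tp; have [sp _] := tp; have [M M0 phi0] := test_supp tp.
have cins : continuous (fun y : 'rV[R]_n => ins i (r, y)).
  move=> y; apply/(@cvgrPdist_le R 'rV[R]_n.+1 'rV[R]_n (nbhs (y : 'rV[R]_n)) _ _ (ins i (r, y))) => e e0.
  near=> z.
  apply/norm_coordP => [|j]; first exact: ltW.
  rewrite !mxE; case: (unliftP i j) => [l|] _; last by rewrite subrr normr0 ltW.
  have : `|y - z| <= e by near: z; apply: cvgr_dist_le => //; exact: cvg_id.
  by move=> /(norm_coordP _ (ltW e0)).1 /(_ l); rewrite !mxE.
have dk h k y : smooth h -> is_derive y (delta_mx ord0 k : 'rV[R]_n) (fun y => h (ins i (r, y)))
    (pderiv (lift i k) h (ins i (r, y))).
  move=> sh; apply/is_derive_line; under eq_fun do rewrite ins_line.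
  by apply/is_derive_line; apply: derivableP; exact: smooth_derivable.
split; last by move=> k; apply/funext => y; have [] := dk phi k y sp.
split; last first.
  exists [set y | `|y - 0| <= M]; split => //; first exact: closed_ball_compact.
  move=> y; rewrite /= subr0 => /negP; rewrite -ltNge => yM; apply: phi0.
  exact: (lt_le_trans yM (ins_norm_ge _ _ _)).
apply: (@smooth_coind R n (fun g => exists2 h, smooth h & g = (fun y => h (ins i (r, y))))).
- move=> _ [h sh ->] y; apply: continuous_comp; first exact: cins.
  exact: smooth_continuous.
- by move=> _ k y [h sh ->]; case: (dk h k y sh).
- move=> _ k [h sh ->]; exists (pderiv (lift i k) h); first exact: smooth_pderiv.
  by apply/funext => y; have [] := dk h k y sh.
- by exists phi.
Unshelve. all: by end_near. Qed.

Lemma Rint_sqD n (f g : 'rV[R]_n -> R) : in_L2 setT f -> in_L2 setT g ->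
  \int[mu n]_x (f x ^+ 2 + g x ^+ 2) = sq f + sq g.
Proof.
by move=> [_ i1] [_ i2]; rewrite RintegralD.
Qed.

Lemma sum_I2 (F : 'I_2 -> R) : \sum_i F i = F ord0 + F (lift ord0 ord0).
Proof. by rewrite !big_ord_recl big_ord0 addr0. Qed.

Lemma sum_I3 (F : 'I_3 -> R) :
  \sum_i F i = F ord0 + (F (lift ord0 ord0) + F (lift ord0 (lift ord0 ord0))).
Proof. by rewrite !big_ord_recl big_ord0 addr0. Qed.

Lemma EFin_sq n (f : 'rV[R]_n -> R) : test_function setT f ->
  ((sq f)%:E = \int[mu n]_x (f x ^+ 2)%:E)%E.
Proof.
move=> tf; have [[_ i2] _] := test_in_L2 tf.
by rewrite (EFin_Rint measurableT i2); congr EFin; apply: eq_Rintegral => x _; rewrite expr2.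
Qed.

Lemma msq n (f : 'rV[R]_n -> R) : continuous f -> measurable_fun setT (fun x => (f x ^+ 2)%:E).
Proof. by move=> cf; apply/measurable_EFinP; apply: measurable_funX; exact: continuous_measurable_rV. Qed.

Lemma ge0_integral_slices n (f : 'rV[R]_n.+1 -> R) : measurable_fun setT (EFin \o f) ->
  (forall x, 0 <= f x) ->
  (\int[mu n.+1]_x (f x)%:E = \int[lam]_r \int[mu n]_y (f (ins ord0 (r, y)))%:E)%E /\
  (\int[mu n.+1]_x (f x)%:E = \int[mu n]_y \int[lam]_r (f (ins ord0 (r, y)))%:E)%E.
Proof.
move=> mf f0; rewrite (ge0_integral_ins ord0 mf) => [|x]; last by rewrite lee_fin.
have mF : measurable_fun setT (fun p => (f (@ins R n ord0 p))%:E).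
  exact: (measurableT_comp mf (measurable_ins ord0)).
have F0 p : (0 <= (f (@ins R n ord0 p))%:E)%E by rewrite lee_fin.
split; first exact: (@fubini_tonelli1 _ _ _ _ R lam (mu n) _ mF F0).
exact: (@fubini_tonelli2 _ _ _ _ R lam (mu n) _ mF F0).
Qed.

Lemma measurable_slice_integral n (f : 'rV[R]_n.+1 -> R) : measurable_fun setT (EFin \o f) ->
  (forall x, 0 <= f x) ->
  measurable_fun setT (fun r => \int[mu n]_y (f (ins ord0 (r, y)))%:E)%E /\
  measurable_fun setT (fun y => \int[lam]_r (f (ins ord0 (r, y)))%:E)%E.
Proof.
move=> mf f0.
have mF : measurable_fun setT (fun p => (f (@ins R n ord0 p))%:E).
  exact: (measurableT_comp mf (measurable_ins ord0)).
have F0 p : (0 <= (f (@ins R n ord0 p))%:E)%E by rewrite lee_fin.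
split; first exact: (@measurable_fun_fubini_tonelli_F _ _ _ _ R (mu n) _ mF F0).
exact: (@measurable_fun_fubini_tonelli_G _ _ _ _ R lam _ mF F0).
Qed.

(** Integrating [line_bound] over the slice gives a bound that is uniform in the position r of the
    slice. *)
Lemma slice_sup n (psi : 'rV[R]_n.+1 -> R) (r : R) : test_function setT psi ->
  (\int[mu n]_y (`|psi (ins ord0 (r, y))|)%:E <= \int[mu n.+1]_x (`|pderiv ord0 psi x|)%:E)%E.
Proof.
move=> tp; have [sp _] := tp.
have cd : continuous (fun x => `|pderiv ord0 psi x|).
  by apply: cont_abs; apply: smooth_continuous; exact: smooth_pderiv.
have cp : continuous (fun x => `|psi x|) by apply: cont_abs; exact: smooth_continuous.
rewrite (ge0_integral_slices (mEF cd) _).2//.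
apply: ge0_le_integral => //.
- have [ts _] := test_slice ord0 r tp; have [ss _] := ts.
  by apply: mEF; apply: cont_abs; exact: smooth_continuous.
- exact: (measurable_slice_integral (mEF cd) _).2.
- move=> y _; have := line_bound ord0 (ins ord0 (0, y)) r tp; rewrite -ins_self => /le_trans; apply.
  by rewrite le_eqVlt; apply/orP; left; apply/eqP; apply: eq_integral => t _; rewrite -ins_self.
Qed.

(** Eliminate Q: X^2 <= (9/2)^2 (b+c)^2 Q^2 <= (9/2)^2 4^2 (b+c)^2 a X. Divide by X; the constant is
    (9/2 * 4)^2 = 18^2. *)
Lemma spatial_arith (X Q a b c : R) : 0 <= X -> 0 <= Q -> 0 <= a -> 0 <= b -> 0 <= c ->
  Q ^+ 2 <= 4 ^+ 2 * (X * a) -> X <= 9 / 2 * Q * (b + c) ->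
  X <= 18 ^+ 2 * (a + (b + c)) ^+ 3.
Proof.
move=> X0 Q0 a0 b0 c0 Q2 XE.
have bc0 : 0 <= b + c by exact: addr_ge0.
have k0 : 0 <= 9 / 2 * (b + c) by rewrite mulr_ge0.
have {}XE : X ^+ 2 <= (9 / 2 * (b + c)) ^+ 2 * Q ^+ 2.
  rewrite -exprMn lerXn2r ?nnegrE ?(mulr_ge0 k0 Q0)//.
  by apply: (le_trans XE); rewrite le_eqVlt; apply/orP; left; apply/eqP; ring.
have {}XE : X * X <= X * (18 ^+ 2 * (a * (b + c) ^+ 2)).
  rewrite -expr2; apply: (le_trans XE).
  apply: (@le_trans _ _ ((9 / 2 * (b + c)) ^+ 2 * (4 ^+ 2 * (X * a)))).
    by rewrite ler_wpM2l ?sqr_ge0.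
  by rewrite le_eqVlt; apply/orP; left; apply/eqP; field.
have k1 : a * (b + c) ^+ 2 <= (a + (b + c)) ^+ 3.
  rewrite [leRHS]exprS; apply: ler_pM => //; [exact: sqr_ge0|by rewrite lerDl|].
  by rewrite lerXn2r ?nnegrE ?addr_ge0// lerDr.
have [X1|X1] := leP X 0.
  by apply: (le_trans X1); rewrite mulr_ge0 ?sqr_ge0// exprn_ge0// addr_ge0.
rewrite ler_pM2l// in XE; apply: (le_trans XE).
by rewrite ler_wpM2l ?sqr_ge0.
Qed.

(** On each slice the planar inequality bounds the integral of phi^6 by that of phi^4 times the
    tangential Dirichlet integral. The slice integrals of phi^4 are at most Q, uniformly, by
    [slice_sup]. Integrate over the slices, estimate Q by Cauchy-Schwarz, and solve for the integral
    of phi^6. *)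
Lemma spatial_sobolev (phi : 'rV[R]_3 -> R) : test_function setT phi ->
  sq (fun x => phi x ^+ 3) <= 18 ^+ 2 * (\sum_i sq (pderiv i phi)) ^+ 3.
Proof.
move=> tp; have [sp _] := tp.
pose l1 : 'I_3 := lift ord0 ord0; pose l2 : 'I_3 := lift ord0 (lift ord0 ord0).
pose Q := \int[mu 3]_x `|pderiv ord0 (fun x => phi x ^+ 4) x|.
pose X := sq (fun x => phi x ^+ 3).
have Q2 : Q ^+ 2 <= 4 ^+ 2 * (X * sq (pderiv ord0 phi)) := int_pderiv_exp ord0 tp (isT : 0 < 3)%N.
have Q0 : 0 <= Q by exact: Rintegral_ge0.
have t3 := test_exp 2 tp; have t4 := test_exp 3 tp; have t2 := test_exp 1 tp.
have td i := test_pderiv i tp.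
have cont (f : 'rV[R]_3 -> R) : test_function setT f -> continuous f by move=> [sf _]; exact: smooth_continuous.
have slQ r : sq (fun y => phi (ins ord0 (r, y)) ^+ 2) <= Q.
  have [ts _] := test_slice ord0 r t2.
  rewrite -lee_fin (EFin_sq ts) /Q -(EFin_Rint measurableT (test_int_abs (test_pderiv ord0 t4))).
  apply: le_trans (slice_sup r t4); rewrite le_eqVlt; apply/orP; left; apply/eqP.
  apply: eq_integral => y _; rewrite -exprM ger0_norm//.
  by rewrite (_ : 4 = 2 * 2)%N// exprM sqr_ge0.
pose h x := pderiv l1 phi x ^+ 2 + pderiv l2 phi x ^+ 2.
have h0 x : 0 <= h x by rewrite addr_ge0// sqr_ge0.
have mh : measurable_fun setT (EFin \o h).
  apply/measurable_EFinP; apply: measurable_funD; apply: measurable_funX;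
  by apply: continuous_measurable_rV; apply: cont.
have slX r : sq (fun y => phi (ins ord0 (r, y)) ^+ 3) <=
    9 / 2 * Q * (\int[mu 2]_y h (ins ord0 (r, y))).
  have [ts dts] := test_slice ord0 r tp.
  apply: (le_trans (planar_sobolev ts (isT : 0 < 2)%N)).
  have [[_ i1] _] := test_in_L2 (test_pderiv ord0 ts).
  have [[_ i2] _] := test_in_L2 (test_pderiv (lift ord0 ord0) ts).
  have -> : \int[mu 2]_y h (ins ord0 (r, y)) =
      sq (pderiv ord0 (fun y => phi (ins ord0 (r, y)))) +
      sq (pderiv (lift ord0 ord0) (fun y => phi (ins ord0 (r, y)))).
    rewrite -(Rint_sqD (test_in_L2 (test_pderiv ord0 ts)).1
      (test_in_L2 (test_pderiv (lift ord0 ord0) ts)).1).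
    by apply: eq_Rintegral => y _; rewrite !dts.
  rewrite (_ : 3 ^+ 2 / 2 = 9 / 2); last by rewrite expr2 -natrM.
  apply: ler_wpM2r; first by rewrite addr_ge0// sq_ge0.
  by apply: ler_wpM2l => //; exact: slQ.
have XE : X <= 9 / 2 * Q * (sq (pderiv l1 phi) + sq (pderiv l2 phi)).
  have [[_ i1] _] := test_in_L2 (td l1); have [[_ i2] _] := test_in_L2 (td l2).
  have ih : (mu 3).-integrable setT (EFin \o h) by exact: (intwD measurableT i1 i2).
  have -> : sq (pderiv l1 phi) + sq (pderiv l2 phi) = \int[mu 3]_x h x.
    exact/esym/(Rint_sqD (test_in_L2 (td l1)).1 (test_in_L2 (td l2)).1).
  rewrite -lee_fin EFinM (EFin_sq t3) -(EFin_Rint measurableT ih).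
  rewrite (ge0_integral_slices (msq (cont _ t3)) _).1; last by move=> x; exact: sqr_ge0.
  rewrite (ge0_integral_slices mh h0).1.
  have [mhr _] := measurable_slice_integral mh h0.
  have c0 : 0 <= 9 / 2 * Q by rewrite mulr_ge0.
  rewrite -ge0_integralZl_EFin//; last by move=> r _; apply: integral_ge0 => y _; rewrite lee_fin.
  apply: ge0_le_integral => //.
  - by move=> r _; apply: integral_ge0 => y _; rewrite lee_fin sqr_ge0.
  - exact: (measurable_slice_integral (msq (cont _ t3)) (fun x => sqr_ge0 _)).1.
  - exact: measurable_funeM.
  - move=> r _; have [ts dts] := test_slice ord0 r tp.
    rewrite -(EFin_sq (test_exp 2 ts)).
    have [[_ j1] _] := test_in_L2 (test_pderiv ord0 ts).
    have [[_ j2] _] := test_in_L2 (test_pderiv (lift ord0 ord0) ts).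
    have jh : (mu 2).-integrable setT (EFin \o (fun y => h (ins ord0 (r, y)))).
      by rewrite !dts in j1 j2; exact: (intwD measurableT j1 j2).
    by rewrite (EFin_Rint measurableT jh) -EFinM lee_fin; exact: slX.
have -> : \sum_i sq (pderiv i phi) =
    sq (pderiv ord0 phi) + (sq (pderiv l1 phi) + sq (pderiv l2 phi)).
  exact: sum_I3.
exact: (spatial_arith (sq_ge0 _) Q0 (sq_ge0 _) (sq_ge0 _) (sq_ge0 _) Q2 XE).
Qed.

Lemma ler_cube_add (N g : R) : 0 <= N -> 0 <= g -> 18 ^+ 2 * g ^+ 3 <= 18 ^+ 2 * (N + g) ^+ 3.
Proof. by move=> N0 g0; rewrite ler_wpM2l ?sqr_ge0// lerXn2r ?nnegrE ?addr_ge0// lerDr. Qed.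

Lemma planar_arith (x y N g : R) : 0 <= N -> 0 <= g -> x <= 3 ^+ 2 / 2 * y * g ->
  y <= 2 ^+ 2 / 2 * N * g -> x <= 18 ^+ 2 * (N + g) ^+ 3.
Proof.
move=> N0 g0 h1 h2.
have k1 : 3 ^+ 2 / 2 * y * g <= 3 ^+ 2 / 2 * (2 ^+ 2 / 2 * N * g) * g.
  by rewrite ler_wpM2r// ler_wpM2l// divr_ge0// exprn_ge0.
apply: (le_trans h1); apply: (le_trans k1).
have k2 : N * g ^+ 2 <= (N + g) ^+ 3.
  rewrite [leRHS]exprS; apply: ler_pM => //; [exact: sqr_ge0|by rewrite lerDl|].
  by rewrite lerXn2r ?nnegrE ?addr_ge0// lerDr.
have k3 : 0 <= (N + g) ^+ 3 by rewrite exprn_ge0// addr_ge0.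
have -> : 3 ^+ 2 / 2 * (2 ^+ 2 / 2 * N * g) * g = 9 * (N * g ^+ 2) :> R by field.
by lra.
Qed.

(** One constant for both dimensions: in the plane the two steps k = 1, 2 of the ladder give the
    factor 9 only. *)
Lemma sobolev_cube n (phi : 'rV[R]_n -> R) : n = 2%N \/ n = 3%N -> test_function setT phi ->
  sq (fun x => phi x ^+ 3) <= 18 ^+ 2 * (sq phi + \sum_i sq (pderiv i phi)) ^+ 3.
Proof.
move=> hn tp; have G0 : 0 <= \sum_i sq (pderiv i phi) by apply: sumr_ge0 => i _; exact: sq_ge0.
have N0 := sq_ge0 phi.
case: hn => hn; subst n; last first.
  by apply: (le_trans (spatial_sobolev tp)); exact: ler_cube_add.
have h1 := planar_sobolev tp (isT : 0 < 2)%N; have h2 := planar_sobolev tp (isT : 0 < 1)%N.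
have E1 : sq (fun x => phi x ^+ 1) = sq phi by apply: eq_Rintegral => x _; rewrite expr1.
have GE : \sum_i sq (pderiv i phi) = sq (pderiv ord0 phi) + sq (pderiv (lift ord0 ord0) phi).
  exact: sum_I2.
by move: h1 h2; rewrite E1 -GE => h1 h2; exact: (planar_arith N0 G0 h1 h2).
Qed.

End Sobolev.

(** * The space H^1_0 and the cubic nonlinearity *)

Section H1.
Context {R : realType} {n : nat}.
Local Notation E := 'rV[R]_n.
Local Notation mu := (lebesgue R n).
Variable Om : set E.
Hypotheses (oO : open Om) (bO : bounded_set Om).
Implicit Types (f g u v w p : E -> R) (G H : E -> E) (X Y : option 'I_n -> E -> R).

Let mT : measurable [set: E] := measurableT.
Let mO := mOm oO.
Let Ofin := Omfin oO bO.
Local Notation ip := (@tuple_ip R n Om (option 'I_n)).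
Local Notation nm := (@tuple_nm R n Om (option 'I_n)).
Local Notation inLt := (@in_tuple_L2 R n Om (option 'I_n)).

Lemma sum_option (F : option 'I_n -> R) : \sum_o F o = F None + \sum_i F (Some i).
Proof.
rewrite (bigD1 None)//=; congr (_ + _).
rewrite (reindex_omap Some id)/=; last by case.
by apply: eq_bigl => i; rewrite eqxx.
Qed.

(* A function with its gradient, and also (div tau, tau) for a vector field tau, as one
   tuple whose L^2 norm is the H^1 or the H(div) norm. *)
Definition jet v G (o : option 'I_n) x := if o is Some i then G x ord0 i else v x.
Local Notation wjet v := (jet v (wgrad Om v)).
Local Notation tjet phi := (jet phi (fun x => \row_i pderiv i phi x)).

Lemma vinnerE (w : set E) (s t : E -> E) : measurable w -> in_vL2 w s -> in_vL2 w t ->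
  vinner w s t = \sum_i inner w (fun x => s x ord0 i) (fun x => t x ord0 i).
Proof. by move=> mw Ls Lt; apply: (Rint_sum mw) => i; exact: in_L2_int. Qed.

Lemma vnorm0_sqr (w : set E) (t : E -> E) : measurable w -> in_vL2 w t ->
  vnorm0 w t ^+ 2 = \sum_i norm0 w (fun x => t x ord0 i) ^+ 2.
Proof.
move=> mw Lt; rewrite sqr_sqrtr vinnerE//; first by apply: eq_bigr => i _; rewrite norm0_sqr.
by apply: sumr_ge0 => i _; exact: inner_ge0.
Qed.

Lemma jet_L2 v G : in_L2 Om v -> is_weak_grad Om v G -> inLt (jet v G).
Proof. by move=> Lv [LG _] o; case: o => [i|] /=; [exact: LG|]. Qed.

Lemma nm_jet v G : in_L2 Om v -> in_vL2 Om G ->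
  nm (jet v G) ^+ 2 = norm0 Om v ^+ 2 + vnorm0 Om G ^+ 2.
Proof.
move=> Lv LG; rewrite nm_sqr /tuple_ip sum_option vnorm0_sqr// norm0_sqr; congr (_ + _).
by apply: eq_bigr => i _; rewrite norm0_sqr.
Qed.

Lemma norm1E v G : in_L2 Om v -> is_weak_grad Om v G -> norm1 Om v = nm (jet v G).
Proof.
move=> Lv wG; have wG' := wgradP wG; have [LG' _] := wG'.
rewrite /norm1 -nm_jet// sqrtr_sqr ger0_norm ?nm_ge0//.
apply: nm_ae => //; [exact: jet_L2|exact: jet_L2|].
move=> [i|]; last by apply: aeW => x _.
exact: (wgrad_ae oO bO wG).
Qed.

Lemma norm1_wjet v : in_H1 Om v -> norm1 Om v = nm (wjet v).
Proof. by move=> [Lv [G wG]]; apply: (norm1E Lv (wgradP wG)). Qed.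

Lemma H1_grad v : in_H1 Om v -> is_weak_grad Om v (wgrad Om v).
Proof. by move=> [_ [G]]; exact: wgradP. Qed.

Lemma H1_jet v : in_H1 Om v -> inLt (wjet v).
Proof. by move=> [Lv [G wG]]; exact: (jet_L2 Lv (wgradP wG)). Qed.

Lemma H10_H1 v : in_H10 Om v -> in_H1 Om v. Proof. by case. Qed.

Lemma wjetP v G : in_L2 Om v -> is_weak_grad Om v G -> forall o,
  {ae mu, forall x, Om x -> wjet v o x = jet v G o x}.
Proof.
by move=> Lv wG [i|]; [exact: (wgrad_ae oO bO wG)|apply: aeW].
Qed.

Lemma test_jet phi : test_function Om phi ->
  in_L2 Om phi /\ is_weak_grad Om phi (fun x => \row_i pderiv i phi x).
Proof. by move=> tp; split; [exact: (test_L2 oO tp)|exact: (test_weak_grad oO tp)]. Qed.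

Lemma test_jet_L2 phi : test_function Om phi -> inLt (tjet phi).
Proof. by move=> tp; have [L w] := test_jet tp; exact: jet_L2. Qed.

Lemma jetB u v G H o x : jet u G o x - jet v H o x = jet (u \- v) (fun x => G x - H x) o x.
Proof. by case: o => [i|] //=; rewrite !mxE. Qed.

Lemma nm0 : nm (fun _ _ => 0) = 0.
Proof.
apply/eqP; rewrite sqrtr_eq0 /tuple_ip big1// => i _.
by rewrite /inner; under eq_Rintegral do rewrite mulr0; rewrite Rintegral_cst// mul0r.
Qed.

Lemma nm_ext X Y : (forall o x, Om x -> X o x = Y o x) -> nm X = nm Y.
Proof. by move=> XY; congr Num.sqrt; apply: ip_ext => o x Ox; exact: XY. Qed.

Lemma norm1B u v : in_H1 Om u -> in_H1 Om v ->
  norm1 Om (u \- v) = nm (fun o x => wjet u o x - wjet v o x).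
Proof.
move=> Hu Hv; have [Lu _] := Hu; have [Lv _] := Hv.
rewrite (norm1E (in_L2B mO Lu Lv) (weak_gradB oO Lu Lv (H1_grad Hu) (H1_grad Hv))).
by apply: nm_ext => o x _; rewrite -jetB.
Qed.

Lemma wjet_test phi : test_function Om phi -> forall o,
  {ae mu, forall x, Om x -> wjet phi o x = tjet phi o x}.
Proof. by move=> /test_jet[L w]; exact: wjetP. Qed.

Lemma test_H1 phi : test_function Om phi -> in_H1 Om phi.
Proof. by move=> /test_jet[L w]; split => //; exists (fun x => \row_i pderiv i phi x). Qed.

Lemma nmB_test u phi : in_H1 Om u -> test_function Om phi ->
  nm (fun o x => wjet u o x - wjet phi o x) = nm (fun o x => wjet u o x - tjet phi o x).
Proof.
move=> Hu tp; apply: nm_ae => //.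
- exact: (inLtB mO (H1_jet Hu) (H1_jet (test_H1 tp))).
- exact: (inLtB mO (H1_jet Hu) (test_jet_L2 tp)).
- by move=> o; apply: filterS (wjet_test tp o) => x H Ox; rewrite H.
Qed.

Lemma test_H10 phi : test_function Om phi -> in_H10 Om phi.
Proof.
move=> tp; have H1p := test_H1 tp; split => // e e0; exists phi => //.
by rewrite norm1B// -[ltLHS](_ : 0 = _)// -nm0; apply: nm_ext => o x _; rewrite subrr.
Qed.

Lemma H10_approx v e : in_H10 Om v -> 0 < e ->
  exists2 phi, test_function Om phi & nm (fun o x => wjet v o x - tjet phi o x) < e.
Proof.
move=> [H1v /[apply] -[phi tp h]]; exists phi => //.
by rewrite -nmB_test// -norm1B//; exact: test_H1.
Qed.

(** Both the weak derivative identity and the approximation by test functions pass to L^2 limits of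
    jets. [X] is an arbitrary tuple, so the limit gradient is identified rather than assumed. *)
Lemma H10_closed X : inLt X ->
  (forall e, 0 < e -> exists2 v, in_H10 Om v & nm (fun o x => wjet v o x - X o x) < e) ->
  in_H10 Om (X None) /\ is_weak_grad Om (X None) (fun x => \row_i X (Some i) x).
Proof.
move=> LX HX.
have wX : is_weak_grad Om (X None) (fun x => \row_i X (Some i) x).
  split; first by move=> i; apply: (in_L2_ext mO _ (LX (Some i))) => x _; rewrite mxE.
  move=> phi tp i.
  have -> : inner Om (fun x => (\row_j X (Some j) x) ord0 i) phi = inner Om (X (Some i)) phi.
    by apply: inner_ext => // x _; rewrite mxE.
  have Lp := test_L2 oO tp; have Lpd := test_L2 oO (test_pderiv i tp).
  apply/eqP; rewrite -addr_eq0 -normr_le0; apply/ler_addgt0Pl => e e0; rewrite addr0.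
  pose C := norm0 Om (pderiv i phi) + norm0 Om phi + 1.
  have C0 : 0 < C by rewrite ltr_wpDl// addr_ge0// norm0_ge0.
  have [v Hv vX] := HX _ (divr_gt0 e0 C0).
  have H1v := H10_H1 Hv; have [LG HG] := H1_grad H1v; have [Lv _] := H1v.
  have LvX := in_L2B mO Lv (LX None); have LGX := in_L2B mO (LG i) (LX (Some i)).
  have -> : inner Om (X None) (pderiv i phi) + inner Om (X (Some i)) phi =
      - (inner Om (fun x => v x - X None x) (pderiv i phi)
         + inner Om (fun x => wgrad Om v x ord0 i - X (Some i) x) phi).
    rewrite (innerBl' oO Lv (LX None) Lpd) (innerBl' oO (LG i) (LX (Some i)) Lp) HG//.
    by ring.
  have nl f g : in_L2 Om f -> in_L2 Om g -> `|inner Om f g| <= norm0 Om f * norm0 Om g.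
    move=> Lf Lg; rewrite ler_norml inner_le// andbT lerNl -mulN1r -innerZl//.
    apply: (le_trans (inner_le mO (in_L2Z mO (-1) Lf) Lg)).
    rewrite le_eqVlt; apply/orP; left; apply/eqP; congr (_ * _).
    by rewrite /norm0; congr Num.sqrt; apply: eq_Rintegral => x _; ring.
  rewrite normrN; apply: (le_trans (ler_normD _ _)).
  apply: (le_trans (lerD (nl _ _ LvX Lpd) (nl _ _ LGX Lp))).
  have k1 : norm0 Om (fun x => v x - X None x) <= e / C.
    exact: (le_trans (@nm_ge_comp _ _ Om _ (fun o x => wjet v o x - X o x) None) (ltW vX)).
  have k2 : norm0 Om (fun x => wgrad Om v x ord0 i - X (Some i) x) <= e / C.
    exact: (le_trans (@nm_ge_comp _ _ Om _ (fun o x => wjet v o x - X o x) (Some i)) (ltW vX)).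
  apply: (@le_trans _ _ (e / C * C)); last by rewrite divfK// gt_eqF.
  rewrite /C !mulrDr -[leLHS]addr0; apply: lerD; last by rewrite mulr1 divr_ge0// ltW.
  by apply: lerD; rewrite ler_wpM2r// norm0_ge0.
split => //; have LX0 := LX None.
split; first by split => //; exists (fun x => \row_i X (Some i) x).
move=> e e0; have e2 : 0 < e / 2 by rewrite divr_gt0.
have [v Hv vX] := HX _ e2; have [phi tp vp] := H10_approx Hv e2; exists phi => //.
have [Lp wp] := test_jet tp.
rewrite (norm1E (in_L2B mO LX0 Lp) (weak_gradB oO LX0 Lp wX wp)).
rewrite -(nm_ext (X := fun o x => X o x - tjet phi o x)); last first.
  by move=> [i|] x _ //=; rewrite !mxE.
apply: (le_lt_trans (nmB_trans mO LX (H1_jet (H10_H1 Hv)) (test_jet_L2 tp))).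
by rewrite nmBC [e]splitr ltrD.
Qed.

Lemma H10_of_tests X : inLt X ->
  (forall e, 0 < e -> exists2 phi, test_function Om phi & nm (fun o x => X o x - tjet phi o x) < e) ->
  in_H10 Om (X None) /\ is_weak_grad Om (X None) (fun x => \row_i X (Some i) x).
Proof.
move=> LX HX; apply: H10_closed => // e e0; have [phi tp h] := HX e e0.
exists phi; first exact: test_H10.
rewrite nmBC; apply: le_lt_trans h; rewrite le_eqVlt; apply/orP; left; apply/eqP; apply: nm_ae => //.
- exact: (inLtB mO LX (H1_jet (test_H1 tp))).
- exact: (inLtB mO LX (test_jet_L2 tp)).
- by move=> o; apply: filterS (wjet_test tp o) => x H Ox; rewrite H.
Qed.

Lemma testL (a b : R) f g : test_function Om f -> test_function Om g ->
  test_function Om (fun x => a * f x + b * g x).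
Proof. by move=> tf tg; apply: testD; apply: test_mull => //; exact: smooth_cst. Qed.

Lemma tjetL (a b : R) f g o x : test_function Om f -> test_function Om g ->
  tjet (fun x => a * f x + b * g x) o x = a * tjet f o x + b * tjet g o x.
Proof.
move=> [sf _] [sg _]; case: o => [i|] //=; rewrite !mxE.
rewrite smooth_pderivD; [|exact: (smoothM (smooth_cst a) sf)|exact: (smoothM (smooth_cst b) sg)].
by rewrite (smooth_pderivM _ (smooth_cst a) sf) (smooth_pderivM _ (smooth_cst b) sg) !pderiv_cst !mul0r !add0r.
Qed.

Lemma H10_lin (a b : R) u v : in_H10 Om u -> in_H10 Om v ->
  in_H10 Om (fun x => a * u x + b * v x) /\
  is_weak_grad Om (fun x => a * u x + b * v x) (fun x => a *: wgrad Om u x + b *: wgrad Om v x).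
Proof.
move=> Hu Hv; have Ju := H1_jet (H10_H1 Hu); have Jv := H1_jet (H10_H1 Hv).
pose X o x := a * wjet u o x + b * wjet v o x.
have LX : inLt X by apply: (inLtD mO); exact: (inLtZ mO).
have [] := @H10_of_tests X LX.
  move=> e e0; pose C := `|a| + `|b| + 1.
  have C0 : 0 < C by rewrite ltr_wpDl// addr_ge0.
  have e2 : 0 < e / C by rewrite divr_gt0.
  have [f tf fu] := H10_approx Hu e2; have [g tg gv] := H10_approx Hv e2.
  exists (fun x => a * f x + b * g x); first exact: testL.
  have Lf := inLtB mO Ju (test_jet_L2 tf); have Lg := inLtB mO Jv (test_jet_L2 tg).
  rewrite (nm_ext (Y := fun o x => a * (wjet u o x - tjet f o x) + b * (wjet v o x - tjet g o x))); last first.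
    by move=> o x _; rewrite tjetL// /X; ring.
  apply: (le_lt_trans (nmD mO (inLtZ mO a Lf) (inLtZ mO b Lg))).
  rewrite !nmZ//; apply: (@lt_le_trans _ _ (C * (e / C))); last by rewrite mulrC divfK ?gt_eqF.
  rewrite /C !mulrDl mul1r; apply: (@le_lt_trans _ _ (`|a| * (e / C) + `|b| * (e / C))).
    exact: (lerD (ler_wpM2l (normr_ge0 a) (ltW fu)) (ler_wpM2l (normr_ge0 b) (ltW gv))).
  by rewrite ltrDl.
by move=> HX wX; split => //; apply: (weak_grad_ext oO _ _ wX) => // x _; apply/rowP => i; rewrite !mxE.
Qed.

Lemma H10B u v : in_H10 Om u -> in_H10 Om v -> in_H10 Om (fun x => u x - v x).
Proof.
move=> Hu Hv; have [+ _] := H10_lin 1 (-1) Hu Hv.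
by under [X in in_H10 _ X -> _]eq_fun do rewrite mul1r mulN1r.
Qed.

Lemma nm_ge_norm1 u e : in_H10 Om u -> 0 < e ->
  exists2 phi, test_function Om phi & norm0 Om (fun x => u x - phi x) < e /\ nm (tjet phi) < norm1 Om u + e.
Proof.
move=> Hu e0; have [phi tp h] := H10_approx Hu e0; exists phi => //; split.
  exact: (le_lt_trans (@nm_ge_comp _ _ Om _ (fun o x => wjet u o x - tjet phi o x) None) h).
have Ju := H1_jet (H10_H1 Hu); have Jp := test_jet_L2 tp.
rewrite (norm1_wjet (H10_H1 Hu)).
by apply: (le_lt_trans (nm_le_add mO Jp Ju)); rewrite nmBC ltrD2l.
Qed.

Lemma nl_ip X Y : inLt X -> inLt Y -> `|ip X Y| <= nm X * nm Y.
Proof. by move=> LX LY; exact: cauchy_schwarz. Qed.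

Lemma H10_density X : inLt X -> (forall phi, test_function Om phi -> ip X (tjet phi) = 0) ->
  forall v, in_H10 Om v -> ip X (wjet v) = 0.
Proof.
move=> LX HX v Hv; have Jv := H1_jet (H10_H1 Hv).
apply/eqP; rewrite -normr_le0; apply/ler_addgt0Pl => e e0; rewrite addr0.
have C0 : 0 < nm X + 1 by rewrite ltr_wpDl ?nm_ge0.
have [phi tp h] := H10_approx Hv (divr_gt0 e0 C0).
have Jp := test_jet_L2 tp.
have -> : ip X (wjet v) = ip X (fun o x => wjet v o x - tjet phi o x).
  by rewrite ipBr// HX// subr0.
apply: (le_trans (nl_ip LX (inLtB mO Jv Jp))).
apply: (@le_trans _ _ ((nm X + 1) * (e / (nm X + 1)))); last by rewrite mulrC divfK ?gt_eqF.
apply: ler_pM; rewrite ?nm_ge0//; last exact: ltW.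
by rewrite lerDl.
Qed.

(** For test functions this is the definition of the weak divergence; density does the rest. *)
Lemma weak_div_H10 (tau : E -> E) (D : E -> R) v : in_vL2 Om tau -> is_weak_div Om tau D ->
  in_H10 Om v -> vinner Om tau (wgrad Om v) = - inner Om D v.
Proof.
move=> Lt [LD HD] Hv; have wv := H1_grad (H10_H1 Hv); have [Lw _] := wv.
have := @H10_density (jet D tau); rewrite /tuple_ip.
move=> /(_ _ _ v Hv); rewrite sum_option/= vinnerE// addrC => H.
apply/eqP; rewrite -addr_eq0; apply/eqP; apply: H.
  by move=> o; case: o => [i|] /=; [exact: Lt|].
move=> phi tp; have [_ wp] := test_jet tp; have [Lp _] := wp.
rewrite sum_option/= addrC; apply/eqP; rewrite addr_eq0; apply/eqP.
rewrite -HD// vinnerE//; apply: eq_bigr => i _; apply: inner_ext => // x _.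
Qed.

Lemma zero_trace_H10 p (D : 'I_n -> E -> R) : lipschitz_boundary Om -> zero_trace Om p D ->
  in_H10 Om p /\ is_weak_grad Om p (fun x => \row_i D i x).
Proof.
move=> lO zp; have [Lp LD _] := zp.
pose X (o : option 'I_n) := if o is Some i then D i else p.
have LX : inLt X by move=> o; case: o => [i|] /=; [exact: LD|].
have [] // := @H10_of_tests X LX.
move=> e e0; pose C := (#|{: option 'I_n}|%:R + 1) : R.
have C0 : 0 < C by rewrite ltr_wpDl.
have [phi [tp pp pD]] := zero_trace_approx oO bO lO zp (divr_gt0 e0 C0).
exists phi => //; apply: (le_lt_trans (nm_le_sum _ _)).
apply: (@le_lt_trans _ _ (\sum_(o : option 'I_n) e / C)).
  apply: ler_sum => -[i|] _ //=; apply: le_trans (pD i).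
  rewrite le_eqVlt; apply/orP; left; apply/eqP; congr Num.sqrt.
  by apply: inner_ext => // x _; rewrite mxE.
rewrite sumr_const -mulr_natl mulrC -mulrA gtr_pMr// mulrC ltr_pdivrMr// mul1r.
by rewrite ltrDl.
Qed.

Hypothesis hn : n = 2%N \/ n = 3%N.

Lemma inner_test f g : (forall x, ~ Om x -> f x = 0) -> inner Om f g = inner setT f g.
Proof.
move=> f0; rewrite inner_restrict//; apply: inner_ext => // x _.
by rewrite patchE; case: ifP => // /negbT; rewrite notin_setE => /f0 ->.
Qed.

Lemma test_off (U : set E) (phi : E -> R) x : test_function U phi -> ~ U x -> phi x = 0.
Proof. by move=> [_ [K [_ KU K0]]] nU; apply: K0 => /KU. Qed.

Lemma test_cube phi : test_function Om phi ->
  in_L2 Om (fun x => phi x ^+ 3) /\ norm0 Om (fun x => phi x ^+ 3) <= 18 * nm (tjet phi) ^+ 3.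
Proof.
move=> tp; have tT := test_setT tp; have t3 := test_exp 2 tT.
split; first exact: (test_L2 oO t3).
rewrite -ler_sqr ?nnegrE ?norm0_ge0 ?mulr_ge0 ?exprn_ge0 ?nm_ge0//.
rewrite norm0_sqr inner_test; last by move=> x nO; rewrite (test_off tp nO) expr0n.
rewrite exprMn -exprM mulnC exprM nm_sqr /tuple_ip sum_option/=.
have -> : inner Om phi phi = inner setT phi phi by apply: inner_test => x; exact: (test_off tp).
rewrite (eq_bigr (fun i => inner setT (pderiv i phi) (pderiv i phi))); first exact: sobolev_cube.
move=> i _; rewrite -inner_test; last by move=> x; exact: (test_off (test_pderiv i tp)).
by apply: inner_ext => x _; rewrite /= mxE.
Qed.

Definition clip (M t : R) : R := Num.max (- M) (Num.min t M).

Lemma clipP M t : 0 <= M -> [\/ t <= - M /\ clip M t = - M,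
  (- M <= t /\ t <= M) /\ clip M t = t | M <= t /\ clip M t = M].
Proof.
move=> M0; have [h1|h1] := leP t (- M).
  by apply: Or31; split => //; rewrite /clip min_l ?max_l// (le_trans h1)//; lra.
have [h2|h2] := leP t M.
  by apply: Or32; split; [split => //; exact: ltW|rewrite /clip min_l// max_r// ltW].
by apply: Or33; split; [exact: ltW|rewrite /clip min_r ?(ltW h2)// max_r//; lra].
Qed.

Lemma clip_cube M a b : 0 <= M -> `|clip M a ^+ 3 - clip M b ^+ 3| <= 3 * M ^+ 2 * `|a - b|.
Proof.
move=> M0.
have cM t : `|clip M t| <= M.
  by rewrite ler_norml; have [[_ ->]|[[? ?] ->]|[_ ->]] := clipP t M0; apply/andP; split; lra.
have cL : `|clip M a - clip M b| <= `|a - b|.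
  have := ler_norm (a - b); have := ler_norm (b - a); rewrite (distrC b a); have := normr_ge0 (a - b).
  by rewrite ler_norml; have [[? ->]|[[? ?] ->]|[? ->]] := clipP a M0;
    have [[? ->]|[[? ?] ->]|[? ->]] := clipP b M0 => ? ? ?; apply/andP; split; lra.
set x := clip M a; set y := clip M b.
have -> : x ^+ 3 - y ^+ 3 = (x - y) * (x ^+ 2 + x * y + y ^+ 2) by ring.
rewrite normrM mulrC; apply: ler_pM => //.
have := cM a; have := cM b; rewrite -/x -/y => yM xM.
have x2 : `|x ^+ 2| <= M ^+ 2 by rewrite normrX lerXn2r ?nnegrE.
have y2 : `|y ^+ 2| <= M ^+ 2 by rewrite normrX lerXn2r ?nnegrE.
have xy : `|x * y| <= M ^+ 2 by rewrite normrM expr2 ler_pM.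
have := ler_normD (x ^+ 2 + x * y) (y ^+ 2); have := ler_normD (x ^+ 2) (x * y); lra.
Qed.

Lemma clip_le M a : 0 <= M -> `|clip M a ^+ 3| <= `|a ^+ 3|.
Proof.
move=> M0; rewrite !normrX lerXn2r ?nnegrE//.
have := ler_norm a; have := ler_norm (- a); rewrite normrN.
by rewrite ler_norml; have [[? ->]|[[? ?] ->]|[? ->]] := clipP a M0 => ? ?; apply/andP; split; lra.
Qed.

Lemma clip_id M a : `|a| <= M -> clip M a = a.
Proof. by rewrite ler_norml /clip => /andP[h1 h2]; rewrite min_l// max_r. Qed.

Lemma clip_bound M a : 0 <= M -> `|clip M a ^+ 3| <= M ^+ 3.
Proof.
move=> M0; rewrite normrX lerXn2r ?nnegrE//.
by rewrite ler_norml; have [[_ ->]|[[? ?] ->]|[_ ->]] := clipP a M0; apply/andP; split; lra.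
Qed.

Lemma measurable_clip M u : measurable_fun Om u -> measurable_fun Om (fun x => clip M (u x) ^+ 3).
Proof.
move=> mu_; apply: measurable_funX; apply: measurable_maxr => //.
exact: measurable_minr.
Qed.

(* The bound passes from test functions to their H^1-limits by truncation. *)
Lemma H10_cube u (b : R) : in_H10 Om u -> 0 < b -> norm1 Om u <= b ->
  in_L2 Om (fun x => u x ^+ 3) /\ norm0 Om (fun x => u x ^+ 3) <= 13 ^+ 2 * b ^+ 3.
Proof.
move=> Hu b0 ub; have [[Lu _] _] := Hu; have [mu_ _] := Lu.
pose h (k : nat) x := clip k%:R (u x) ^+ 3.
have Lh k : in_L2 Om (h k).
  apply: (in_L2_bounded mO Ofin (measurable_clip _ mu_)) => x _.
  by apply: clip_bound; exact: ler0n.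
apply: (fatou_L2 mO (h := h) Lh).
  move=> x Ox; apply: cvg_near_cst; near=> k; rewrite /h clip_id//.
  by near: k; exact: nbhs_infty_ger.
move=> k; have k0 : 0 <= k%:R :> R by exact: ler0n.
pose c := 3 * k%:R ^+ 2 + 1 : R.
have c0 : 0 < c by rewrite ltr_wpDl// mulr_ge0// sqr_ge0.
(* With this e the jet of [phi] has norm at most 2b and the truncation error is at most b^3; then 18
   (2b)^3 + b^3 = 145 b^3, below 13^2 b^3 = 169 b^3. *)
pose e := Num.min b (b ^+ 3 / c).
have e0 : 0 < e by rewrite lt_min b0 divr_gt0// exprn_gt0.
have eb : e <= b by rewrite ge_min lexx.
have ec : c * e <= b ^+ 3 by rewrite mulrC -ler_pdivlMr// ge_min lexx orbT.
have [phi tp [n1 n2]] := nm_ge_norm1 Hu e0.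
have [L3 b3] := test_cube tp; have Lp := test_L2 oO tp; have [mp _] := Lp.
have Lhp : in_L2 Om (fun x => clip k%:R (phi x) ^+ 3).
  apply: (in_L2_bounded mO Ofin (measurable_clip _ mp)) => x _; exact: clip_bound.
have LB := in_L2B mO (Lh k) Lhp.
have s1 : norm0 Om (h k) <= norm0 Om (fun x => clip k%:R (phi x) ^+ 3)
    + norm0 Om (fun x => h k x - clip k%:R (phi x) ^+ 3).
  apply: le_trans (norm0D oO Lhp LB); rewrite le_eqVlt; apply/orP; left; apply/eqP.
  by apply: norm0_ext => x _; rewrite addrC subrK.
have s2 : norm0 Om (fun x => clip k%:R (phi x) ^+ 3) <= 18 * nm (tjet phi) ^+ 3.
  by apply: le_trans b3; apply: norm0_le => // x _; exact: clip_le.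
have Lup := in_L2B mO Lu Lp.
have s3 : norm0 Om (fun x => h k x - clip k%:R (phi x) ^+ 3) <= c * e.
  apply: (@le_trans _ _ (norm0 Om (fun x => 3 * k%:R ^+ 2 * (u x - phi x)))).
    apply: norm0_le => //; first exact: in_L2Z.
    move=> x _; apply: (le_trans (clip_cube _ _ k0)).
    by rewrite [leRHS]normrM ler_wpM2r// ler_norm.
  have -> : norm0 Om (fun x => 3 * k%:R ^+ 2 * (u x - phi x)) =
      3 * k%:R ^+ 2 * norm0 Om (fun x => u x - phi x).
    have := nmZ mO (I := unit) (3 * k%:R ^+ 2) (F := fun=> (fun x => u x - phi x)) (fun=> Lup).
    rewrite /tuple_nm /tuple_ip /norm0 !big_const !card_unit /= !addr0 => ->.
    by rewrite ger0_norm// mulr_ge0// sqr_ge0.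
  by apply: ler_pM; rewrite ?norm0_ge0 ?mulr_ge0 ?sqr_ge0// ?lerDl// ltW.
have s4 : 18 * nm (tjet phi) ^+ 3 <= 18 * (2 * b) ^+ 3.
  rewrite ler_wpM2l// lerXn2r ?nnegrE ?nm_ge0 ?mulr_ge0 ?(ltW b0)//.
  by apply: (le_trans (ltW n2)); have := ub; lra.
have s5 : 18 * (2 * b) ^+ 3 = 144 * b ^+ 3 by ring.
have s6 : 0 <= b ^+ 3 by rewrite exprn_ge0// ltW.
have s7 : 13 ^+ 2 * b ^+ 3 = 169 * b ^+ 3 by ring.
by apply: (le_trans s1); lra.
Unshelve. all: by end_near. Qed.

(** Young's inequality: with A = s z^2 and B = v^2, A^3 - 3 A B^2 + 2 B^3 = (A - B)^2 (A + 2 B) >=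
    0, divided by 3s. The parameter s is there to be balanced later. *)
Lemma young_cube (s z v : R) : 0 < s -> z ^+ 2 * v ^+ 4 <= s ^+ 2 / 3 * z ^+ 6 + 2 / (3 * s) * v ^+ 6.
Proof.
move=> s0; have h : 0 <= (s * z ^+ 2 - v ^+ 2) ^+ 2 * (s * z ^+ 2 + 2 * v ^+ 2) / (3 * s).
  rewrite divr_ge0//; last by rewrite mulr_ge0// ltW.
  apply: (mulr_ge0 (sqr_ge0 _)).
  exact: (addr_ge0 (mulr_ge0 (ltW s0) (sqr_ge0 z)) (mulr_ge0 (ler0n _ 2) (sqr_ge0 v))).
rewrite -subr_ge0; apply: le_trans h _; rewrite le_eqVlt; apply/orP; left; apply/eqP.
by field; rewrite gt_eqF.
Qed.

Lemma cube_sub_sqr (v w : R) :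
  (v ^+ 3 - w ^+ 3) ^+ 2 <= 9 / 2 * ((v - w) ^+ 2 * v ^+ 4 + (v - w) ^+ 2 * w ^+ 4).
Proof.
have h1 : (v ^+ 2 + v * w + w ^+ 2) ^+ 2 <= 9 / 2 * (v ^+ 4 + w ^+ 4).
  have k0 : 0 <= v ^+ 2 + v * w + w ^+ 2.
    by have := sqr_ge0 (v + w); have := sqr_ge0 v; have := sqr_ge0 w; rewrite sqrrD; lra.
  have k1 : v ^+ 2 + v * w + w ^+ 2 <= 3 / 2 * (v ^+ 2 + w ^+ 2).
    by have := sqr_ge0 (v - w); rewrite sqrrB; lra.
  have k2 : 0 <= 3 / 2 * (v ^+ 2 + w ^+ 2) := le_trans k0 k1.
  have k3 : (v ^+ 2 + v * w + w ^+ 2) ^+ 2 <= (3 / 2 * (v ^+ 2 + w ^+ 2)) ^+ 2 by rewrite lerXn2r.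
  apply: (le_trans k3); rewrite -subr_ge0.
  have -> : 9 / 2 * (v ^+ 4 + w ^+ 4) - (3 / 2 * (v ^+ 2 + w ^+ 2)) ^+ 2 =
    9 / 4 * (v ^+ 2 - w ^+ 2) ^+ 2 by field.
  by rewrite mulr_ge0// sqr_ge0.
have -> : (v ^+ 3 - w ^+ 3) ^+ 2 = (v - w) ^+ 2 * (v ^+ 2 + v * w + w ^+ 2) ^+ 2 by ring.
have -> : 9 / 2 * ((v - w) ^+ 2 * v ^+ 4 + (v - w) ^+ 2 * w ^+ 4) =
  (v - w) ^+ 2 * (9 / 2 * (v ^+ 4 + w ^+ 4)) by ring.
by apply: ler_wpM2l; [exact: sqr_ge0|exact: h1].
Qed.

(** A Holder estimate in L^6 obtained from [cube_sub_sqr] and [young_cube]. The choice s = b^2 / a^2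
    balances the terms: with K = 13^2, the coefficients 3 b^4 / a^4 and twice 3 a^2 / b^2 add up to
    9 K^2 a^2 b^4, the square of the bound. *)
Lemma H10_cubeB v w (a b : R) : in_H10 Om v -> in_H10 Om w -> 0 < a -> 0 < b ->
  norm1 Om (v \- w) <= a -> norm1 Om v <= b -> norm1 Om w <= b ->
  norm0 Om (fun x => v x ^+ 3 - w x ^+ 3) <= 3 * 13 ^+ 2 * a * b ^+ 2.
Proof.
move=> Hv Hw a0 b0 za vb wb.
have [Lz zB] := H10_cube (H10B Hv Hw) a0 za.
have [Lv vB] := H10_cube Hv b0 vb; have [Lw wB] := H10_cube Hw b0 wb.
have K0 : 0 <= 13 ^+ 2 :> R := sqr_ge0 _.
have r0 : 0 <= 3 * 13 ^+ 2 * a * b ^+ 2.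
  exact: (mulr_ge0 (mulr_ge0 (mulr_ge0 (ler0n _ 3) K0) (ltW a0)) (sqr_ge0 b)).
rewrite -ler_sqr ?nnegrE//; last exact: norm0_ge0.
rewrite norm0_sqr; pose s := b ^+ 2 / a ^+ 2.
have s0 : 0 < s by rewrite divr_gt0// exprn_gt0.
pose c1 := 9 / 2 * (2 * (s ^+ 2 / 3)); pose c2 := 9 / 2 * (2 / (3 * s)).
have n0 : 0 <= 9 / 2 :> R by exact: (divr_ge0 (ler0n _ 9) (ler0n _ 2)).
have c10 : 0 <= c1 := mulr_ge0 n0 (mulr_ge0 (ler0n _ 2) (divr_ge0 (sqr_ge0 s) (ler0n _ 3))).
have c20 : 0 <= c2 := mulr_ge0 n0 (divr_ge0 (ler0n _ 2) (mulr_ge0 (ler0n _ 3) (ltW s0))).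
have iz := in_L2_int mO Lz Lz; have iv := in_L2_int mO Lv Lv; have iw := in_L2_int mO Lw Lw.
pose P x := c1 * ((v x - w x) ^+ 3 * (v x - w x) ^+ 3) + (c2 * (v x ^+ 3 * v x ^+ 3)
  + c2 * (w x ^+ 3 * w x ^+ 3)).
have j1 := intwZ mO c1 iz; have j2 := intwZ mO c2 iv; have j3 := intwZ mO c2 iw.
have j23 := intwD mO j2 j3.
have sqE f : norm0 Om f ^+ 2 = \int[mu]_(x in Om) (f x * f x) by rewrite norm0_sqr.
have PE : \int[mu]_(x in Om) P x = c1 * norm0 Om (fun x => (v x - w x) ^+ 3) ^+ 2
    + (c2 * norm0 Om (fun x => v x ^+ 3) ^+ 2 + c2 * norm0 Om (fun x => w x ^+ 3) ^+ 2).
  rewrite !sqE /P (RintegralD mO j1 j23) (RintegralD mO j2 j3).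
  by rewrite !RintegralZl.
apply: (@le_trans _ _ (\int[mu]_(x in Om) P x)).
  apply: le_Rintegral => //; first exact: (in_L2_int mO (in_L2B mO Lv Lw) (in_L2B mO Lv Lw)).
    exact: (intwD mO j1 j23).
  move=> x _; rewrite -expr2; apply: (le_trans (cube_sub_sqr _ _)).
  have y1 := young_cube (v x - w x) (v x) s0; have y2 := young_cube (v x - w x) (w x) s0.
  apply: (@le_trans _ _ (9 / 2 * ((s ^+ 2 / 3 * (v x - w x) ^+ 6 + 2 / (3 * s) * v x ^+ 6)
    + (s ^+ 2 / 3 * (v x - w x) ^+ 6 + 2 / (3 * s) * w x ^+ 6)))).
    by rewrite ler_wpM2l//; exact: lerD.
  rewrite le_eqVlt; apply/orP; left; apply/eqP; rewrite /P /c1 /c2.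
  by field; rewrite gt_eqF.
rewrite PE.
have e1 : norm0 Om (fun x => (v x - w x) ^+ 3) ^+ 2 <= (13 ^+ 2 * a ^+ 3) ^+ 2.
  by apply: lerXn2r; rewrite // nnegrE ?norm0_ge0// (mulr_ge0 K0)// exprn_ge0// ltW.
have e2 : norm0 Om (fun x => v x ^+ 3) ^+ 2 <= (13 ^+ 2 * b ^+ 3) ^+ 2.
  by apply: lerXn2r; rewrite // nnegrE ?norm0_ge0// (mulr_ge0 K0)// exprn_ge0// ltW.
have e3 : norm0 Om (fun x => w x ^+ 3) ^+ 2 <= (13 ^+ 2 * b ^+ 3) ^+ 2.
  by apply: lerXn2r; rewrite // nnegrE ?norm0_ge0// (mulr_ge0 K0)// exprn_ge0// ltW.
apply: (@le_trans _ _ (c1 * (13 ^+ 2 * a ^+ 3) ^+ 2 + (c2 * (13 ^+ 2 * b ^+ 3) ^+ 2 + c2 * (13 ^+ 2 * b ^+ 3) ^+ 2))).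
  by apply: lerD; [exact: ler_wpM2l|apply: lerD; exact: ler_wpM2l].
rewrite le_eqVlt; apply/orP; left; apply/eqP; rewrite /c1 /c2 /s.
by field; rewrite !gt_eqF.
Qed.

End H1.

(** * Lipschitz functions *)

Section SegmentCover.
Context {R : realType}.

Lemma closed_sup_mem (S : set R) : closed S -> has_sup S -> S (sup S).
Proof.
move=> cS hS; apply: cS => B /nbhs_ballP[e /= e0 eB].
have [t St te] := sup_adherent e0 hS; exists t; split => //; apply: eB.
have tS := sup_upper_bound hS St.
by rewrite /ball /= ger0_norm ?subr_ge0//; lra.
Qed.

(* After the last visit to a set of the cover that contains a, one set less is
   needed. *)
Lemma closed_cover_lip (I : eqType) (A : I -> set R) (f : R -> R) (L : R) (s : seq I) (a b : R) :
  0 <= L -> continuous f -> (forall i, i \in s -> closed (A i)) ->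
  (forall i, i \in s -> forall x y, A i x -> A i y -> `|f x - f y| <= L * `|x - y|) ->
  a <= b -> (forall t, a <= t -> t <= b -> exists2 i, i \in s & A i t) ->
  `|f b - f a| <= L * (b - a).
Proof.
move=> L0 cf; move: {-1}(size s) (leqnn (size s)) => n; elim: n s a b => [|n IH] s a b.
  by rewrite leqn0 size_eq0 => /eqP -> _ _ ab /(_ a (lexx _) ab)[].
move=> sn cA lA ab cov; have [i si Ai] := cov a (lexx _) ab.
pose S := [set t | A i t /\ `[a, b]%classic t].
have Sa : S a by split => //=; rewrite in_itv/= lexx.
have hS : has_sup S by split; [exists a|exists b => t [_ /=]; rewrite in_itv/= => /andP[]].
have cS : closed S by apply: closedI; [exact: cA|exact: itv_closed].
have [Aig] := closed_sup_mem cS hS; set g := sup S in Aig *.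
rewrite /= in_itv/= => /andP[ag gb].
have fga : `|f g - f a| <= L * (g - a).
  by have := lA i si g a Aig Ai; rewrite (ger0_norm (_ : 0 <= g - a)) ?subr_ge0.
suff fbg : `|f b - f g| <= L * (b - g).
  rewrite -(subrK (f g) (f b)) -addrA (le_trans (ler_normD _ _))//.
  by apply: (le_trans (lerD fbg fga)); rewrite -mulrDr subrKA.
have later t : g < t -> t <= b -> `|f b - f t| <= L * (b - t).
  move=> gt tb; apply: (IH [seq j <- s | j != i]) => //.
  - rewrite -ltnS; apply: leq_trans sn; rewrite size_filter -(count_predC (predC1 i) s) -addn1.
    rewrite leq_add2l -has_count; apply/hasP; exists i => //=.
    by rewrite negbK.
  - by move=> j; rewrite mem_filter => /andP[_]; exact: cA.
  - by move=> j; rewrite mem_filter => /andP[_]; exact: lA.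
  - move=> r tr rb; have [j js Aj] := cov r (le_trans (le_trans ag (ltW gt)) tr) rb.
    exists j => //; rewrite mem_filter js andbT; apply/eqP => ji; subst j.
    have : S r by split => //=; rewrite in_itv/= rb (le_trans ag)// (le_trans (ltW gt)).
    by move/(sup_upper_bound hS); rewrite leNgt (lt_le_trans gt tr).
have [gb'|gb'] := ltP g b; last first.
  have -> : b = g by apply/eqP; rewrite eq_le gb gb'.
  by rewrite !subrr normr0 mulr0.
(* At g itself the set [A i] still belongs to the cover. The induction hypothesis is used from a t
   slightly beyond g, and continuity of f bridges the gap. *)
apply/ler_addgt0Pr => e e0.
have [d d0 dP] : exists2 d : R, 0 < d & forall t, `|g - t| < d -> `|f g - f t| <= e.
  have /cvgrPdist_le/(_ e e0)/nbhs_ballP[d /= d0 dP] := cf g.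
  by exists d.
pose t := Num.min b (g + d / 2).
have gt : g < t by rewrite lt_min gb' ltrDl divr_gt0.
have tb : t <= b by rewrite ge_min lexx.
have td : t <= g + d / 2 by rewrite ge_min lexx orbT.
have k1 := later t gt tb.
have k2 : `|f g - f t| <= e by apply: dP; rewrite ltr0_norm; lra.
rewrite -(subrK (f t) (f b)) -addrA (le_trans (ler_normD _ _))// (distrC (f t)).
apply: lerD => //; apply: (le_trans k1); apply: ler_wpM2l => //.
by rewrite lerB// ltW.
Qed.

End SegmentCover.

(** * Weak gradient of a Lipschitz function that vanishes outside the domain *)

Section LipschitzGradient.
Context {R : realType} {n : nat}.
Local Notation E := 'rV[R]_n.
Local Notation mu := (lebesgue R n).
Notation intT f := (mu.-integrable setT (EFin \o f)).
Variable Om : set E.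
Hypotheses (oO : open Om) (bO : bounded_set Om).
Implicit Types (f g u v w : E -> R).

Let mT : measurable [set: E] := measurableT.
Let mO := mOm oO.
Let Ofin := Omfin oO bO.

Lemma Rint_dominated (fk : nat -> E -> R) f g : (forall k, measurable_fun setT (fk k)) ->
  measurable_fun setT f -> {ae mu, forall x, fk ^~ x @ \oo --> f x} -> intT g ->
  (forall k x, `|fk k x| <= g x) ->
  (fun k => \int[mu]_x fk k x) @ \oo --> \int[mu]_x f x.
Proof.
move=> mfk mf cf ig fg.
have [] := @dominated_convergence _ _ R mu setT mT (fun k => EFin \o fk k) (EFin \o f) (EFin \o g).
- by move=> k; exact/measurable_EFinP.
- exact/measurable_EFinP.
- apply: filterS cf => x H _; apply: cvg_EFin; last exact: H.
  by near=> k.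
- exact: ig.
- by apply: aeW => x k _; rewrite lee_fin.
move=> iF _ H; rewrite /Rintegral; apply: fine_cvg.
by rewrite -[(fine _)%:E]/((\int[mu]_x f x)%:E) -(EFin_Rint mT iF).
Unshelve. all: by end_near. Qed.

Lemma derive_seq f x (v : E) (d : R) (h : nat -> R) : is_derive x v f d ->
  h @ \oo --> 0 -> (forall k, h k != 0) ->
  (fun k => (h k)^-1 * (f (h k *: v + x) - f x)) @ \oo --> d.
Proof.
move=> [dx dv] h0 hn; rewrite -dv.
have hh : h @ \oo --> (0 : R)^'.
  move=> P P0; have : \forall y \near (0 : R), y != 0 -> P y by exact: P0.
  move=> H; have H' : \forall k \near \oo, h k != 0 -> P (h k) := h0 _ H.
  by change (\forall k \near \oo, P (h k)); apply: filterS H' => k; apply; exact: hn.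
apply: (@cvg_comp _ _ _ h (fun t : R => t^-1 * (f (t *: v + x) - f x)) _ _ _ hh); exact: dx.
Qed.

(** Discrete integration by parts: a translation moves the difference quotient from the test
    function to w. Both sides converge by dominated convergence, the one with w because its
    quotients are bounded by L and converge almost everywhere. *)
Lemma lipschitz_zero_trace w (D : 'I_n -> E -> R) (L : R) : 0 <= L -> continuous w ->
  (forall x, ~ Om x -> w x = 0) -> (forall i, in_L2 Om (D i)) ->
  (forall x i h, `|w (h *: delta_mx ord0 i + x) - w x| <= L * `|h|) ->
  (forall i, {ae mu, forall x, is_derive x (delta_mx ord0 i : E) w ((D i \_ Om) x)}) ->
  zero_trace Om w D.
Proof.
move=> L0 cw w0 LD wL dw.
have mw := continuous_measurable_rV cw.
have [M M0 wM] := continuous_bounded bO cw.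
have Lw : in_L2 Om w.
  exact: (in_L2_bounded mO Ofin (measurable_funTS mw) wM).
have wE : w \_ Om = w.
  by apply/funext => x; rewrite patchE; case: ifP => // /negbT; rewrite notin_setE => /w0 ->.
have [LwT iw] := in_L2_restrict oO bO Lw; rewrite wE in LwT iw.
split => // phi tp i; have [sp _] := tp; have [Lp ip] := test_in_L2 tp.
have [[LDT iD] tdp] := (in_L2_restrict oO bO (LD i), test_pderiv i tp).
have [mD _] := LDT; have mp := continuous_measurable_rV (smooth_continuous sp).
have [N N0 pN] := test_bounded tdp.
set e := (delta_mx ord0 i : E).
pose h (k : nat) : R := k.+1%:R^-1.
have h0 k : 0 < h k by rewrite invr_gt0.
have hc : h @ \oo --> 0 by exact: cvg_harmonic.
pose F k x := w x * ((h k)^-1 * (phi x - phi (x - h k *: e))).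
pose G k x := - ((h k)^-1 * (w (h k *: e + x) - w x)) * phi x.
have FG k : \int[mu]_x F k x = \int[mu]_x G k x.
  have Lws := in_L2_shift (h k *: e) LwT; have Lps := in_L2_shift (- (h k *: e)) Lp.
  have i1 := in_L2_int mT LwT Lp; have i2 := in_L2_int mT LwT Lps; have i3 := in_L2_int mT Lws Lp.
  have E1 : \int[mu]_x F k x = (h k)^-1 * (\int[mu]_x (w x * phi x) - \int[mu]_x (w x * phi (x - h k *: e))).
    rewrite -(RintegralB mT i1 i2) -RintegralZl//; last exact: intwB.
    by apply: eq_Rintegral => x _; rewrite /F; ring.
  have E2 : \int[mu]_x G k x = (h k)^-1 * (\int[mu]_x (w x * phi x) - \int[mu]_x (w (x + h k *: e) * phi x)).
    rewrite -(RintegralB mT i1 i3) -RintegralZl//; last exact: intwB.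
    by apply: eq_Rintegral => x _; rewrite /G [_ + x]addrC; ring.
  rewrite E1 E2; congr (_ * (_ - _)).
  have mws : measurable_fun setT (EFin \o (fun x => w x * phi (x - h k *: e))).
    by apply/measurable_EFinP; exact: (intw_meas i2).
  rewrite /Rintegral -(integral_shift (h k *: e) mws); congr fine.
  by apply: eq_integral => x _ /=; rewrite addrK.
have FE : (fun k => \int[mu]_x F k x) @ \oo --> \int[mu]_x (w x * pderiv i phi x).
  apply: (Rint_dominated (g := fun x => N * `|w x|)).
  - move=> k; apply: measurable_funM => //; apply: measurable_funM => //.
    apply: measurable_funB => //; exact: (in_L2_shift (- (h k *: e)) Lp).1.
  - by apply: measurable_funM => //; case: (test_in_L2 tdp) => -[].
  - apply: aeW => x; apply: cvgM; first exact: cvg_cst.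
    have := @derive_seq phi x e (pderiv i phi x) (fun k => - h k).
    have -> : (fun k => (- h k)^-1 * (phi (- h k *: e + x) - phi x)) =
        (fun k => (h k)^-1 * (phi x - phi (x - h k *: e))).
      by apply/funext => k; rewrite invrN scaleNr [- _ + x]addrC; ring.
    apply; first by apply: derivableP; exact: smooth_derivable.
      by rewrite -oppr0; exact: cvgN.
    by move=> k; rewrite oppr_eq0 gt_eqF.
  - by apply: intwZ => //; exact: intw_norm.
  - move=> k x; rewrite normrM mulrC ler_wpM2r// normrM ger0_norm ?invr_ge0 ?(ltW (h0 k))//.
    have [a ah] := @line_MVT _ _ phi e x (- h k) (fun y => @smooth_derivable _ _ phi i y sp).
    rewrite scaleNr [- _ + x]addrC -opprB => /(congr1 -%R); rewrite opprK => ->.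
    by rewrite mulNr opprK normrM gtr0_norm// mulKf ?gt_eqF//; exact: pN.
have GE : (fun k => \int[mu]_x G k x) @ \oo --> \int[mu]_x (- (D i \_ Om) x * phi x).
  apply: (Rint_dominated (g := fun x => L * `|phi x|)).
  - move=> k; apply: measurable_funM => //; apply: measurable_funN; apply: measurable_funM => //.
    apply: measurable_funB => //.
    rewrite (_ : (fun x => w (h k *: e + x)) = (fun x => w (x + h k *: e))); last first.
      by apply/funext => x; rewrite addrC.
    exact: (in_L2_shift (h k *: e) LwT).1.
  - by apply: measurable_funM => //; apply: measurable_funN.
  - apply: filterS (dw i) => x dx; apply: cvgM; last exact: cvg_cst.
    by apply: cvgN; apply: (derive_seq dx hc) => k; rewrite gt_eqF.
  - by apply: intwZ => //; exact: intw_norm.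
  - move=> k x; rewrite normrM ler_wpM2r// normrN normrM ger0_norm ?invr_ge0 ?(ltW (h0 k))//.
    rewrite ler_pdivrMl// (le_trans (wL _ _ _))// mulrC ler_wpM2r// gtr0_norm ?h0//.
have FGE : (fun k => \int[mu]_x F k x) = (fun k => \int[mu]_x G k x) by apply/funext.
rewrite FGE in FE; have H := cvg_unique (@norm_hausdorff _ R) FE GE.
rewrite inner_restrict// wE -[LHS]/(\int[mu]_x (w x * pderiv i phi x)) H.
rewrite inner_restrict// -mulN1r -(innerZl mT)//.
by apply: eq_Rintegral => x _; rewrite mulNr mulN1r mulNr.
Qed.

End LipschitzGradient.

(** * Simplices and piecewise affine interpolation *)

Section Affine.
Context {R : realType} {n : nat}.
Local Notation E := 'rV[R]_n.

Lemma dotC (x y : E) : dot x y = dot y x.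
Proof. by apply: eq_bigr => i _; rewrite mulrC. Qed.

Lemma dotDr (a x y : E) : dot a (x + y) = dot a x + dot a y.
Proof. by rewrite /dot -big_split; apply: eq_bigr => i _; rewrite mxE mulrDr. Qed.

Lemma dotZr (a x : E) t : dot a (t *: x) = t * dot a x.
Proof. by rewrite /dot mulr_sumr; apply: eq_bigr => i _; rewrite mxE mulrCA. Qed.

Lemma dotBr (a x y : E) : dot a (x - y) = dot a x - dot a y.
Proof. by rewrite -scaleN1r dotDr dotZr mulN1r. Qed.

Lemma dotDl (a b x : E) : dot (a + b) x = dot a x + dot b x.
Proof. by rewrite dotC dotDr !(dotC x). Qed.

Lemma dotZl (a x : E) t : dot (t *: a) x = t * dot a x.
Proof. by rewrite dotC dotZr (dotC x). Qed.

Lemma dot_suml (I : Type) (r : seq I) (P : pred I) (F : I -> E) x :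
  dot (\sum_(i <- r | P i) F i) x = \sum_(i <- r | P i) dot (F i) x.
Proof.
elim/big_rec2: _ => [|i y1 y2 _ <-]; last by rewrite dotDl.
by rewrite /dot big1// => i _; rewrite mxE mul0r.
Qed.

Lemma dot_sumr (I : Type) (r : seq I) (P : pred I) (F : I -> E) x :
  dot x (\sum_(i <- r | P i) F i) = \sum_(i <- r | P i) dot x (F i).
Proof. by rewrite dotC dot_suml; apply: eq_bigr => i _; rewrite dotC. Qed.

Lemma dot_delta (a : E) i : dot a (delta_mx ord0 i) = a ord0 i.
Proof.
rewrite /dot (bigD1 i)//= big1 ?addr0; first by rewrite mxE !eqxx mulr1.
by move=> j ji; rewrite mxE eqxx/= (negbTE ji) mulr0.
Qed.

Definition aff (a : E) (b : R) x := dot a x + b.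

Lemma aff_sub (a : E) b x y : aff a b x - aff a b y = dot a (x - y).
Proof. by rewrite /aff dotBr; ring. Qed.

Lemma aff_comb (a : E) b (I : Type) (r : seq I) (c : I -> R) (y : I -> E) :
  \sum_(i <- r) c i = 1 ->
  aff a b (\sum_(i <- r) c i *: y i) = \sum_(i <- r) c i * aff a b (y i).
Proof.
move=> c1; rewrite /aff dot_sumr -[b in LHS]mul1r -c1 mulr_suml -big_split/=.
by apply: eq_bigr => i _; rewrite dotZr mulrDr.
Qed.

Lemma smooth_aff (a : E) b : smooth (aff a b).
Proof.
apply: smoothD; last exact: smooth_cst.
apply: (@smooth_sum R n _ _ (fun i x => a ord0 i * x ord0 i)) => i.
by apply: smoothM; [exact: smooth_cst|exact: smooth_coord].
Qed.

Lemma pderiv_aff (a : E) b i : pderiv i (aff a b) = fun=> a ord0 i.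
Proof.
apply/funext => x; apply/(derive_val (df := _)).
apply: DeriveDef; first exact: smooth_derivable (smooth_aff a b).
apply: cvg_lim => //; apply: cvg_near_cst; near=> h.
rewrite /= aff_sub addrK dotZr dot_delta.
by rewrite [_ *: _]mulKf//; near: h; exact: nbhs_dnbhs_neq.
Unshelve. all: by end_near. Qed.

Lemma continuous_aff (a : E) b : continuous (aff a b).
Proof. exact/smooth_continuous/smooth_aff. Qed.

End Affine.

Section Hull.
Context {R : realType} {n : nat}.
Local Notation E := 'rV[R]_n.

Lemma hull_comb (s : seq E) (I : finType) (a : I -> R) (y : I -> E) :
  (forall i, 0 <= a i) -> \sum_i a i = 1 -> (forall i, 0 < a i -> hull s (y i)) ->
  hull s (\sum_i a i *: y i).
Proof.
move=> a0 a1 ys.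
have /choice[c cP] : forall i, exists c : nat -> R, 0 < a i ->
    [/\ forall j, 0 <= c j, \sum_(j < size s) c j = 1 & y i = \sum_(j < size s) c j *: s`_j].
  by move=> i; have [ai|ai] := ltP 0 (a i); [have [c ?] := ys i ai; exists c|exists (fun=> 0)].
have ap i : a i != 0 -> 0 < a i by move=> ai; rewrite lt_def ai a0.
exists (fun j => \sum_(i | 0 < a i) a i * c i j); split.
- by move=> j; apply: sumr_ge0 => i ai; rewrite mulr_ge0//; have [] := cP i ai.
- rewrite exchange_big/= -a1 [RHS](bigID (fun i => 0 < a i))/= [X in _ = _ + X]big1 ?addr0.
    by apply: eq_bigr => i ai; rewrite -mulr_sumr; have [_ -> _] := cP i ai; rewrite mulr1.
  by move=> i /negP ai; apply/eqP; apply: contra_notT ai; exact: ap.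
- under [RHS]eq_bigr do rewrite scaler_suml.
  rewrite exchange_big/= [LHS](bigID (fun i => 0 < a i))/= [X in _ + X]big1 ?addr0.
    apply: eq_bigr => i ai; have [_ _ {1}->] := cP i ai.
    by rewrite scaler_sumr; apply: eq_bigr => j _; rewrite scalerA.
  move=> i /negP ai; have -> : a i = 0 by apply/eqP; apply: contra_notT ai; exact: ap.
  by rewrite scale0r.
Qed.

Lemma hull_mem (s : seq E) z : z \in s -> hull s z.
Proof.
move=> zs; exists (fun i => (i == index z s)%:R); split => [i||].
- exact: ler0n.
- have h : (index z s < size s)%N by rewrite index_mem.
  rewrite (bigD1 (Ordinal h))//= eqxx big1 ?addr0// => i ih.
  by rewrite (_ : (i == index z s :> nat) = false)//; apply/negbTE; apply: contra ih => /eqP h'; apply/eqP/val_inj.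
- have h : (index z s < size s)%N by rewrite index_mem.
  rewrite (bigD1 (Ordinal h))//= eqxx scale1r nth_index// big1 ?addr0// => i ih.
  rewrite (_ : (i == index z s :> nat) = false) ?scale0r//.
  by apply/negbTE; apply: contra ih => /eqP h'; apply/eqP/val_inj.
Qed.

Lemma hull_subset (s s' : seq E) : (forall z, z \in s' -> hull s z) -> hull s' `<=` hull s.
Proof.
move=> ss x [c [c0 c1 ->]].
apply: (hull_comb (a := fun i : 'I_(size s') => c i) (y := fun i => s'`_i)) => // i _.
by apply: ss; exact: mem_nth.
Qed.

End Hull.

(** * Barycentric coordinates and nodal interpolation on one simplex *)

Section Simplex.
Context {R : realType} {n : nat}.
Local Notation E := 'rV[R]_n.
Implicit Types (K : simplex R n) (phi : E -> R).

Definition edges K : 'M[R]_n := \matrix_(i < n) (K.1`_i.+1 - K.1`_0).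

(** Gradients of the barycentric coordinates. The columns of the inverse edge matrix are dual to the
    edges leaving vertex 0, and the coordinate of vertex 0 is fixed by the requirement that the
    gradients sum to 0. *)
Definition bgrad K (i : 'I_n.+1) : E :=
  if unlift ord0 i is Some j then (col j (invmx (edges K)))^T
  else - \sum_j (col j (invmx (edges K)))^T.

Definition bary K (i : 'I_n.+1) (x : E) : R := dot (bgrad K i) (x - K.1`_0) + (i == ord0)%:R.

Lemma baryE K i : exists b, bary K i = aff (bgrad K i) b.
Proof.
exists ((i == ord0)%:R - dot (bgrad K i) K.1`_0); apply/funext => x.
by rewrite /bary /aff dotBr; ring.
Qed.

Lemma bary_lift K j x : bary K (lift ord0 j) x = ((x - K.1`_0) *m invmx (edges K)) ord0 j.
Proof.
rewrite /bary /bgrad liftK eq_sym (negbTE (neq_lift _ _)) addr0 mxE.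
by apply: eq_bigr => k _; rewrite !mxE mulrC.
Qed.

Lemma bary0 K x : bary K ord0 x = 1 - \sum_j bary K (lift ord0 j) x.
Proof.
rewrite {1}/bary /bgrad unlift_none eqxx addrC; congr (_ + _).
rewrite -scaleN1r dotZl mulN1r; congr (- _); rewrite dot_suml; apply: eq_bigr => j _.
by rewrite /bary /bgrad liftK eq_sym (negbTE (neq_lift _ _)) addr0.
Qed.

Lemma sum_bary K x : \sum_i bary K i x = 1.
Proof. by rewrite big_ord_recl bary0 subrK. Qed.

Lemma edges_comb K (c : 'I_n -> R) : (\row_j c j) *m edges K =
  \sum_j c j *: (K.1`_(lift ord0 j) - K.1`_0).
Proof.
rewrite mulmx_sum_row; apply: eq_bigr => j _; rewrite mxE; congr (_ *: _).
by rewrite rowK.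
Qed.

Variable K : simplex R n.
Hypothesis ndK : nondegenerate_simplex K.

Lemma edges_unit : edges K \in unitmx.
Proof. by have [_] := ndK; rewrite row_free_unit. Qed.

Lemma size_simplex : size K.1 = n.+1. Proof. by case: ndK. Qed.

Lemma comb_edges (a : 'I_n.+1 -> R) : \sum_i a i = 1 ->
  \sum_i a i *: K.1`_i = K.1`_0 + (\row_j a (lift ord0 j)) *m edges K.
Proof.
move=> a1; rewrite edges_comb big_ord_recl/=.
have -> : a ord0 = 1 - \sum_j a (lift ord0 j) by rewrite -a1 big_ord_recl addrK.
rewrite scalerBl scale1r -addrA; congr (_ + _); rewrite addrC scaler_suml -sumrB.
by apply: eq_bigr => j _; rewrite scalerBr.
Qed.

Lemma bary_comb x : x = \sum_i bary K i x *: K.1`_i.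
Proof.
rewrite comb_edges ?sum_bary//.
have -> : (\row_j bary K (lift ord0 j) x) = (x - K.1`_0) *m invmx (edges K).
  by apply/rowP => j; rewrite mxE bary_lift.
by rewrite mulmxKV ?edges_unit// addrC subrK.
Qed.

Lemma bary_unique (a : 'I_n.+1 -> R) x : \sum_i a i = 1 -> x = \sum_i a i *: K.1`_i ->
  forall i, bary K i x = a i.
Proof.
move=> a1 xa; have al j : bary K (lift ord0 j) x = a (lift ord0 j).
  by rewrite bary_lift xa comb_edges// addrC addKr mulmxK ?edges_unit// mxE.
move=> i; case: (unliftP ord0 i) => [j|] ->; first exact: al.
by rewrite bary0 (eq_bigr (fun j => a (lift ord0 j)))// -a1 big_ord_recl addrK.
Qed.

Lemma bary_vertex (i j : 'I_n.+1) : bary K i K.1`_j = (i == j)%:R.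
Proof.
apply: (bary_unique (a := fun i => (i == j)%:R)).
  rewrite (bigD1 j)//= eqxx big1 ?addr0// => k kj; by rewrite (negbTE kj).
rewrite (bigD1 j)//= eqxx scale1r big1 ?addr0// => k kj; by rewrite (negbTE kj) scale0r.
Qed.

Lemma hullP x : hull K.1 x <-> forall i, 0 <= bary K i x.
Proof.
split=> [[c [c0 c1 xc]] i|x0].
  rewrite size_simplex in c1 xc.
  by rewrite (bary_unique (a := fun i : 'I_n.+1 => c i) c1 xc).
rewrite [x]bary_comb; apply: (hull_comb (a := fun i => bary K i x)) => //; first exact: sum_bary.
by move=> i _; apply/hull_mem/mem_nth; rewrite size_simplex.
Qed.

Definition core : set E := [set x | forall i, 0 < bary K i x].

Lemma core_hull : core `<=` hull K.1.
Proof. by move=> x x0; apply/hullP => i; exact: ltW. Qed.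

Lemma continuous_bary i : continuous (bary K i).
Proof. by have [b ->] := baryE K i; exact: continuous_aff. Qed.

Lemma open_core : open core.
Proof.
rewrite openE => x cx; suff : \forall y \near x, forall i, 0 < bary K i y by [].
apply: (@filter_forall E 'I_n.+1 (fun i y => 0 < bary K i y) (nbhs (x : E)) _) => i.
have o : open (bary K i @^-1` [set t | 0 < t]).
  by apply: open_comp; [move=> y _; exact: continuous_bary|exact: open_gt].
exact: (open_nbhs_nbhs (conj o (cx i))).
Qed.

Lemma closed_hull : closed (hull K.1).
Proof.
have -> : hull K.1 = \bigcap_(i in [set: 'I_n.+1]) (bary K i @^-1` [set t | 0 <= t]).
  by apply/seteqP; split => x h; [move=> i _; exact: (hullP x).1|apply/hullP => i; exact: h].
apply: closed_bigI => i _; apply: closed_comp; last exact: closed_ge.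
by move=> x _; exact: continuous_bary.
Qed.

Lemma vertex_hull (i : 'I_n.+1) : hull K.1 K.1`_i.
Proof. by apply/hull_mem/mem_nth; rewrite size_simplex. Qed.

Lemma vertexP z : z \in K.1 -> exists i : 'I_n.+1, z = K.1`_i.
Proof.
move=> zK; have h : (index z K.1 < n.+1)%N by rewrite -size_simplex index_mem.
by exists (Ordinal h); rewrite /= nth_index.
Qed.

Lemma bary_le1 x i : hull K.1 x -> bary K i x <= 1.
Proof.
move/hullP => x0; rewrite -(sum_bary K x) (bigD1 i)//= lerDl.
by apply: sumr_ge0 => j _.
Qed.

(** Coordinate i vanishes at all vertices but the i-th, so it vanishes on the hull of any set of
    vertices that omits that one. *)
Lemma face_vertex (s : seq E) x i : {subset s <= K.1} -> hull s x -> 0 < bary K i x ->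
  K.1`_i \in s.
Proof.
move=> sK [c [c0 c1 ->]]; have [b bE] := baryE K i.
rewrite bE aff_comb// -bE => h; apply: contraPT h => nis; apply/negP; rewrite -leNgt.
apply: sumr_le0 => j _; have sj : s`_j \in s by exact: mem_nth.
have [k jk] := vertexP (sK _ sj).
rewrite jk bary_vertex (_ : (i == k) = false) ?mulr0//.
by apply/negbTE; apply: contraNneq nis => ->; rewrite -jk.
Qed.

Definition interp phi x := \sum_(i < n.+1) bary K i x * phi K.1`_i.
Definition igrad phi : E := \sum_(i < n.+1) phi K.1`_i *: bgrad K i.

Lemma interpE phi : exists b, interp phi = aff (igrad phi) b.
Proof.
have /choice[b bE] := baryE K.
exists (\sum_(i < n.+1) b i * phi K.1`_i); apply/funext => x.
rewrite /interp /aff /igrad dot_suml -big_split/=; apply: eq_bigr => i _.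
by rewrite bE /aff dotZl; ring.
Qed.

Lemma interp_vertex phi z : z \in K.1 -> interp phi z = phi z.
Proof.
move=> /vertexP[j ->]; rewrite /interp (bigD1 j)//= bary_vertex eqxx mul1r big1 ?addr0//.
by move=> i ij; rewrite bary_vertex (negbTE ij) mul0r.
Qed.

(** On a face only the nodal values of that face enter. This makes interpolants on neighbouring
    elements agree. *)
Lemma interp_face phi (s : seq E) (c : nat -> R) : {subset s <= K.1} ->
  \sum_(i < size s) c i = 1 ->
  interp phi (\sum_(i < size s) c i *: s`_i) = \sum_(i < size s) c i * phi s`_i.
Proof.
move=> sK c1; have [b iE] := interpE phi; rewrite iE aff_comb// -iE.
by apply: eq_bigr => i _; rewrite interp_vertex// sK// mem_nth.
Qed.

End Simplex.

(** * Measure estimates by slicing *)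

Section SliceMeasure.
Context {R : realType}.
Local Notation mu n := (lebesgue R n).
Local Notation lam := (@lebesgue_measure R).

(** Tonelli's theorem in coordinate i: lines parallel to that axis meet X in length at most c, and
    only above B. *)
Lemma lebesgue_slices_le n (i : 'I_n.+1) (X : set 'rV[R]_n.+1) (B : set 'rV[R]_n) (c : R) :
  measurable X -> measurable B -> 0 <= c ->
  (forall y, lam [set t | X (ins i (t, y))] <= c%:E * (\1_B y)%:E)%E ->
  (mu n.+1 X <= c%:E * mu n B)%E.
Proof.
move=> mX mB c0 XB.
have mI : measurable_fun setT (fun x : 'rV[R]_n.+1 => (\1_X x : R)%:E).
  by apply/measurable_EFinP; exact: measurable_indic.
have XE : mu n.+1 X = (\int[mu n.+1]_x (\1_X x)%:E)%E by rewrite integral_indic// setIT.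
have BE : mu n B = (\int[mu n]_x (\1_B x)%:E)%E by rewrite integral_indic// setIT.
rewrite XE BE.
rewrite (ge0_integral_ins i mI) => [|x]; last by rewrite lee_fin.
have mF : measurable_fun setT (fun p => (\1_X (@ins R n i p) : R)%:E).
  exact: (measurableT_comp mI (measurable_ins i)).
have F0 p : (0 <= (\1_X (@ins R n i p) : R)%:E)%E by rewrite lee_fin.
rewrite (@fubini_tonelli2 _ _ _ _ R lam (mu n) _ mF F0).
have mIB : measurable_fun setT (fun y => (\1_B y : R)%:E).
  by apply/measurable_EFinP; exact: measurable_indic.
rewrite -ge0_integralZl_EFin//.
apply: ge0_le_integral => //.
- by move=> y _; apply: integral_ge0 => t _; exact: F0.
- exact: (@measurable_fun_fubini_tonelli_G _ _ _ _ R lam _ mF F0).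
- exact: measurable_funeM.
- move=> y _; rewrite /fubini_G; apply: le_trans (XB y).
  have -> : (\int[lam]_t (\1_X (ins i (t, y)))%:E)%E = (\int[lam]_t (\1_[set t | X (ins i (t, y))] t)%:E)%E.
    apply: eq_integral => t _; rewrite !indicE; congr (_%:R%:E).
  rewrite integral_indic ?setIT//.
  rewrite -[X in measurable X]setTI.
  have ms : measurable_fun setT (fun t : R => ins i (t, y)).
    exact: (measurableT_comp (measurable_ins i) (measurable_pair2 y)).
  exact: ms.
Qed.

(** Along an axis with a_i nonzero each line meets the hyperplane in a single point, so the slicing
    bound holds with c = 0. *)
Lemma hyperplane_null n (a : 'rV[R]_n) b : a != 0 -> mu n [set x | aff a b x = 0] = 0%E.
Proof.
case: n a => [|n] a a0; first by case/eqP: a0; apply/rowP => -[].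
have [i ai] : exists i, a ord0 i != 0.
  apply: contrapT => /forallNP h; case/eqP: a0; apply/rowP => i; rewrite mxE.
  by apply/eqP; move: (h i) => /negP; rewrite negbK.
have cX : closed [set x | aff a b x = 0].
  apply: (@closed_comp _ _ (aff a b) [set 0]); last exact: closed_eq.
  by move=> x _; exact: continuous_aff.
have mX := closed_measurable_rV cX.
apply/eqP; rewrite -measure_le0; have := lebesgue_slices_le (i := i) mX (@measurableT _ _) (lexx 0).
rewrite mul0e; apply => y; rewrite mul0e.
pose c := aff a b (ins i (0, y)).
have E t : aff a b (ins i (t, y)) = t * a ord0 i + c.
  by rewrite ins_self /aff dotDr dotZr dot_delta addrA.
rewrite (_ : [set t | _] = [set - c / a ord0 i]) ?lebesgue_measure_set1//.
apply/seteqP; split => t; rewrite /= E => h.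
  by apply: (canRL (mulfK ai)); apply/eqP; rewrite -addr_eq0 h.
by rewrite h divfK// addNr.
Qed.

End SliceMeasure.

(** * Conforming meshes and piecewise affine functions *)

Section Mesh.
Context {R : realType} {n : nat}.
Local Notation E := 'rV[R]_n.
Local Notation mu := (lebesgue R n).
Variable Om : set E.
Hypotheses (oO : open Om) (bO : bounded_set Om) (lO : lipschitz_boundary Om).
Variable T : mesh R n.
Hypothesis cT : conforming_triangulation Om T.
Implicit Types (K : simplex R n) (phi psi : E -> R).

Let mO := mOm oO.
Let Ofin := Omfin oO bO.

Lemma mesh_nd K : K \in T -> nondegenerate_simplex K. Proof. by case: cT => + _ _; apply. Qed.

Lemma mesh_cover x : closure Om x <-> exists2 K, K \in T & hull K.1 x.
Proof. by case: cT => _ -> _; split => -[K KT Kx]; exists K. Qed.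

Lemma mesh_face K K' x : K \in T -> K' \in T -> hull K.1 x -> hull K'.1 x ->
  K = K' \/ hull [seq z <- K.1 | z \in K'.1] x.
Proof.
move=> KT KT' Kx Kx'; have [->|KK] := eqVneq K K'; [by left|right].
by case: cT => _ _ /(_ _ _ KT KT' KK)[_ <-].
Qed.

Lemma interp_consistent K K' phi x : K \in T -> K' \in T -> hull K.1 x -> hull K'.1 x ->
  interp K phi x = interp K' phi x.
Proof.
move=> KT KT' Kx Kx'; have [-> //|[c [_ c1 ->]]] := mesh_face KT KT' Kx Kx'.
rewrite (interp_face (mesh_nd KT)) ?(interp_face (mesh_nd KT'))//.
  by move=> z; rewrite mem_filter => /andP[].
by move=> z; rewrite mem_filter => /andP[].
Qed.

Lemma simplex_uniq K : nondegenerate_simplex K -> uniq K.1.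
Proof.
move=> nd; apply/(uniqP 0) => i j; rewrite !inE (size_simplex nd) => hi hj ij.
have := bary_vertex nd (Ordinal hi) (Ordinal hj).
have := bary_vertex nd (Ordinal hi) (Ordinal hi); rewrite /= ij => ->.
rewrite eqxx; case: eqVneq => [/(congr1 val)//|_ /eqP].
by rewrite oner_eq0.
Qed.

(** By conformity x lies in the hull of the shared vertices. All its barycentric coordinates in K
    are positive, so every vertex of K is shared, and distinct elements never have the same
    vertices. *)
Lemma core_unique K K' x : K \in T -> K' \in T -> core K x -> hull K'.1 x -> K = K'.
Proof.
move=> KT KT' cx Kx'; have nd := mesh_nd KT; have nd' := mesh_nd KT'.
have [//|Fx] := mesh_face KT KT' (core_hull nd cx) Kx'.
apply/eqP; apply: contraT => KK.
case: cT => _ _ /(_ _ _ KT KT' KK)[/negP + _]; case.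
have sub : {subset K.1 <= K'.1}.
  move=> z /(vertexP nd)[i ->].
  have := face_vertex nd _ Fx (cx i); rewrite mem_filter => /(_ _)/andP[] //.
  by move=> y; rewrite mem_filter => /andP[].
apply: uniq_perm; [exact: simplex_uniq|exact: simplex_uniq|].
by apply: (uniq_min_size (simplex_uniq nd) sub _).2; rewrite !size_simplex.
Qed.

(** The core is open and lies in the closure of [Om], hence in the interior of the closure, which
    [interior_closure] identifies. *)
Lemma core_Om K : K \in T -> core K `<=` Om.
Proof.
move=> KT; have nd := mesh_nd KT.
apply: (subset_trans _ (interior_closure oO lO)).
rewrite -(open_subsetE _ (@open_core _ _ K)) => x /(core_hull nd) Kx.
by apply/mesh_cover; exists K.
Qed.

Lemma bgrad_neq0 K i : nondegenerate_simplex K -> (0 < n)%N -> bgrad K i != 0.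
Proof.
move=> nd n0; apply/eqP => g0; have [b bE] := baryE K i.
have C x : bary K i x = b by rewrite bE g0 /aff /dot big1 ?add0r// => k _; rewrite mxE mul0r.
have [j ji] : exists j : 'I_n.+1, j != i.
  have [->|i0] := eqVneq i ord0; last by exists ord0; rewrite eq_sym.
  by exists (inord 1); apply/eqP => /(congr1 val); rewrite /= inordK.
have := bary_vertex nd i j; have := bary_vertex nd i i; rewrite !C eqxx eq_sym (negbTE ji) => ->.
by move/eqP; rewrite oner_eq0.
Qed.

(** Points of an element outside its core lie on zero sets of barycentric coordinates: finitely many
    hyperplanes, all null. *)
Lemma mesh_core_ae : {ae mu, forall x, closure Om x -> exists2 K, K \in T & core K x}.
Proof.
have H (K : T) : {ae mu, forall x, hull (val K).1 x -> core (val K) x}.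
  have nd := mesh_nd (valP K).
  have n0 : (0 < n)%N := leq_ltn_trans (leq0n _) (ltn_ord (val K).2).
  have Hi i : {ae mu, forall x, bary (val K) i x <> 0}.
    have [b bE] := baryE (val K) i.
    have nul := hyperplane_null b (bgrad_neq0 i nd n0).
    have mz : measurable [set x | aff (bgrad (val K) i) b x = 0].
      apply: closed_measurable_rV.
      apply: (@closed_comp _ _ (aff (bgrad (val K) i) b) [set 0]); last exact: closed_eq.
      by move=> x _; exact: continuous_aff.
    exists [set x | aff (bgrad (val K) i) b x = 0]; split => //.
    by move=> x /= /contrapT; rewrite bE.
  have Hall : {ae mu, forall x, forall i, bary (val K) i x <> 0}.
    by apply: filter_forall => i; exact: Hi.
  apply: filterS Hall => x xi /(hullP nd) x0 i.
  by rewrite lt_def x0 andbT; apply/eqP/xi.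
have Hall : {ae mu, forall x, forall K : T, hull (val K).1 x -> core (val K) x}.
  by apply: filter_forall => K; exact: H.
apply: filterS Hall => x xK /mesh_cover[K KT Kx].
by exists K => //; exact: (xK (FSetSub KT)).
Qed.

(** The element is chosen arbitrarily among those containing x; [interp_consistent] makes the value
    independent of the choice. *)
Definition mesh_interp phi x : R :=
  if pselect (exists K, K \in T /\ hull K.1 x) is left e then interp (projT1 (cid e)) phi x else 0.

Lemma mesh_interpE phi K x : K \in T -> hull K.1 x -> mesh_interp phi x = interp K phi x.
Proof.
move=> KT Kx; rewrite /mesh_interp; case: pselect => [e|[]]; last by exists K.
by case: cid => K' /= [KT' Kx']; exact: interp_consistent.
Qed.

Lemma mesh_interp0 phi x : ~ closure Om x -> mesh_interp phi x = 0.
Proof.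
move=> nx; rewrite /mesh_interp; case: pselect => // -[K [KT Kx]].
by case: nx; apply/mesh_cover; exists K.
Qed.

(** For elementwise data that may jump across faces, such as gradients. The value on the skeleton is
    0, which affects a null set only. *)
Definition mesh_sum (F : simplex R n -> E -> R) x : R := \sum_(K <- T) F K x * \1_(core K) x.

Lemma mesh_sumE F K x : K \in T -> core K x -> mesh_sum F x = F K x.
Proof.
move=> KT cx; transitivity (F K x * \1_(core K) x + \sum_(i <- T | i != K) F i x * \1_(core i) x).
  by rewrite /mesh_sum (bigD1_seq K KT (fset_uniq T)).
rewrite indicE mem_set// mulr1.
rewrite big_seq_cond big1 ?addr0// => K' /andP[KT' KK].
rewrite indicE memNset ?mulr0// => cx'.
by move/eqP: KK; apply; exact: (core_unique KT' KT cx' (core_hull (mesh_nd KT) cx)).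
Qed.

Lemma measurable_mesh_sum F : (forall K, K \in T -> continuous (F K)) ->
  measurable_fun setT (mesh_sum F).
Proof.
move=> cF; rewrite /mesh_sum.
have : {subset enum_fset T <= T} by [].
elim: (enum_fset T) => [_|K s IH sT].
  by under eq_fun do rewrite big_nil; exact: measurable_cst.
under eq_fun do rewrite big_cons.
apply: measurable_funD; last by apply: IH => K' K's; apply: sT; rewrite inE K's orbT.
have KT : K \in T by apply: sT; exact: mem_head.
apply: measurable_funM; first exact: (continuous_measurable_rV (cF K KT)).
apply: measurable_indic; apply: open_measurable_rV; apply: open_core; exact: mesh_nd.
Qed.

Lemma mesh_sum_bounded F : (forall K, K \in T -> continuous (F K)) ->
  exists2 M : R, 0 <= M & forall x, Om x -> `|mesh_sum F x| <= M.
Proof.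
move=> cF; rewrite /mesh_sum.
have : {subset enum_fset T <= T} by [].
elim: (enum_fset T) => [_|K s IH sT].
  by exists 0 => // x _; rewrite big_nil normr0.
have [|M M0 HM] := IH; first by move=> K' K's; apply: sT; rewrite inE K's orbT.
have [N N0 HN] := continuous_bounded bO (cF K (sT K (mem_head _ _))).
exists (N + M); first exact: addr_ge0.
move=> x Ox; rewrite big_cons (le_trans (ler_normD _ _))// lerD ?HM//.
rewrite normrM (le_trans _ (HN x Ox))// ler_piMr//.
by rewrite indicE; case: (_ \in _); rewrite ?normr1 ?normr0.
Qed.

Lemma in_L2_mesh_sum F : (forall K, K \in T -> continuous (F K)) -> in_L2 Om (mesh_sum F).
Proof.
move=> cF; have [M _ HM] := mesh_sum_bounded cF.
apply: (in_L2_bounded mO Ofin _ HM).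
by apply: measurable_funTS; exact: measurable_mesh_sum.
Qed.

Lemma test_lip psi (U : set E) : test_function U psi -> exists2 L : R, 0 <= L &
  forall x y, `|psi y - psi x| <= L * `|y - x|.
Proof.
move=> tp; have [sp _] := tp.
have /choice[M MP] : forall i, exists M : R, 0 <= M /\ forall x, `|pderiv i psi x| <= M.
  by move=> i; have [M M0 HM] := test_bounded (test_pderiv i tp); exists M; split => //; exact: ltW.
exists (n%:R * \sum_i M i).
  by rewrite mulr_ge0// sumr_ge0// => i _; have [] := MP i.
move=> x y; apply: smooth_lip => // i z _; have [_ HM] := MP i.
apply: (le_trans (HM z)); rewrite (bigD1 i)//= lerDl sumr_ge0// => j _.
by have [] := MP j.
Qed.

Lemma smooth_interp K phi : smooth (interp K phi).
Proof. by have [b ->] := interpE K phi; exact: smooth_aff. Qed.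

(** The product is smooth on each closed element and vanishes outside [Om], hence is Lipschitz along
    axis lines, and its derivative is known on the cores. The boundary condition can come from the
    interpolant or from [psi], and both cases are used later. *)
Lemma mesh_interp_zero_trace phi psi : test_function setT psi ->
  (forall x, closure Om x -> ~ Om x -> mesh_interp phi x * psi x = 0) ->
  zero_trace Om (fun x => mesh_interp phi x * psi x)
    (fun i => mesh_sum (fun K x => igrad K phi ord0 i * psi x + interp K phi x * pderiv i psi x)).
Proof.
move=> tp bd; have [sp _] := tp.
pose f K x := interp K phi x * psi x.
have tf K : test_function setT (f K) := test_mull (smooth_interp K phi) tp.
have cf K : continuous (f K) by have [sf _] := tf K; exact: smooth_continuous.
set W := fun x => mesh_interp phi x * psi x.
have WK K x : K \in T -> hull K.1 x -> W x = f K x.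
  by move=> KT Kx; rewrite /W (mesh_interpE _ KT Kx).
have W0 x : ~ Om x -> W x = 0.
  move=> nx; have [cx|ncx] := pselect (closure Om x); first exact: bd.
  by rewrite /W mesh_interp0// mul0r.
have [L L0 fL] : exists2 L : R, 0 <= L & forall K, K \in T -> forall x y, `|f K y - f K x| <= L * `|y - x|.
  have /choice[Lf LfP] : forall K, exists L : R, 0 <= L /\ forall x y, `|f K y - f K x| <= L * `|y - x|.
    by move=> K; have [L L0 HL] := test_lip (tf K); exists L.
  exists (\sum_(K <- T) Lf K); first by apply: sumr_ge0 => K _; have [] := LfP K.
  move=> K KT x y; have [_ HL] := LfP K; apply: (le_trans (HL x y)); rewrite ler_wpM2r//.
  rewrite (bigD1_seq K KT (fset_uniq T))/= lerDl; apply: sumr_ge0 => K' _.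
  by have [] := LfP K'.
(* Near x only elements that contain x occur, and there W agrees with functions of Lipschitz
   constant L; at points near x outside the closure, W is 0 at both points. *)
have cW : continuous W.
  move=> x; have H1 : \forall y \near x, forall K : T, hull (val K).1 y -> hull (val K).1 x.
    apply: (@filter_forall E _ (fun (K : T) y => hull (val K).1 y -> hull (val K).1 x) (nbhs (x : E)) _) => K.
    have [Kx|nKx] := pselect (hull (val K).1 x); first exact: nearW.
    have o : open (~` hull (val K).1) := closed_openC (closed_hull (mesh_nd (valP K))).
    by apply: filterS (open_nbhs_nbhs (conj o nKx)) => y.
  have H2 : \forall y \near x, Om x -> Om y.
    have [Ox|nOx] := pselect (Om x); last by apply: (@nearW _ (nbhs (x : E))) => y /nOx.
    by apply: filterS (open_nbhs_nbhs (conj oO Ox)) => y.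
  apply/(@cvgrPdist_le R R E (nbhs (x : E)) _ W (W x)) => e e0.
  have H3 : \forall y \near x, L * `|x - y| <= e.
    have L1 : 0 < L + 1 by rewrite ltr_wpDl.
    apply: filterS (nbhsx_ballx x _ (divr_gt0 e0 L1)) => y; rewrite -ball_normE /= => xy.
    apply: (@le_trans _ _ ((L + 1) * `|x - y|)); first by rewrite ler_wpM2r// lerDl.
    by rewrite mulrC -ler_pdivlMr// ltW.
  near=> y.
  have h1 : forall K : T, hull (val K).1 y -> hull (val K).1 x by near: y.
  have h2 : Om x -> Om y by near: y.
  have h3 : L * `|x - y| <= e by near: y.
  have [/mesh_cover[K KT Ky]|ncy] := pselect (closure Om y).
    rewrite (WK K y)// (WK K x)//; last exact: (h1 (FSetSub KT)).
    exact: (le_trans (fL K KT y x)).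
  have nOy : ~ Om y by move=> /subset_closure.
  by rewrite (W0 y nOy) W0 ?subrr ?normr0 ?(ltW e0)// => /h2.
have eL : forall i (s t : R) x, `|(s *: delta_mx ord0 i + x : E) - (t *: delta_mx ord0 i + x)| <= `|s - t|.
  move=> i s t x; rewrite opprD addrACA subrr addr0 -scalerBl normrZ ler_piMr//.
  by apply/norm_coordP => // j; rewrite mxE eqxx/=; case: (_ == _); rewrite ?normr1 ?normr0.
apply: (lipschitz_zero_trace oO bO L0 cW W0).
- move=> i; apply: in_L2_mesh_sum => K KT.
  exact: (smooth_continuous (smoothD (smoothM (smooth_cst (igrad K phi ord0 i)) sp)
    (smoothM (smooth_interp K phi) (smooth_pderiv i sp)))).
- move=> x i h.
  pose e := (delta_mx ord0 i : E); pose F (t : R) := W (t *: e + x).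
  have cF : continuous F by exact: continuous_line.
  (* [None] stands for the complement of [Om], where W vanishes. Together with the elements it
     covers every line by finitely many closed sets. *)
  pose A (o : option (simplex R n)) : set R :=
    if o is Some K then [set t | hull K.1 (t *: e + x)] else [set t | ~ Om (t *: e + x)].
  have cl : continuous (fun t : R => t *: e + x).
    move=> t; apply: cvgD; [apply: cvgZr_tmp; exact: cvg_id|exact: cvg_cst].
  have seg a b : a <= b -> `|F b - F a| <= L * (b - a).
    move=> ab; apply: (@closed_cover_lip R _ A F L (None :: [seq Some K | K <- T]) a b) => //.
    + move=> [K|]; rewrite inE => /orP[/eqP//|].
      * move=> /mapP[K' KT [->]]; apply: (@closed_comp _ _ (fun t : R => t *: e + x) (hull K'.1)).
          by move=> t _; exact: cl.
        exact: closed_hull (mesh_nd KT).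
      * move=> _; apply: (@closed_comp _ _ (fun t : R => t *: e + x) (~` Om)).
          by move=> t _; exact: cl.
        exact: open_closedC.
      * by move=> _; apply: (@closed_comp _ _ (fun t : R => t *: e + x) (~` Om)) => [t _|];
          [exact: cl|exact: open_closedC].
    + move=> [K|] io s t /= As At; last by rewrite /F !W0// subrr normr0 mulr_ge0.
      move: io; rewrite inE => /orP[/eqP//|/mapP[K' KT [KK]]]; subst K'.
      rewrite /F !(WK K)//; apply: (le_trans (fL K KT _ _)); rewrite ler_wpM2l//; exact: eL.
    + move=> t _ _; have [Ot|nOt] := pselect (Om (t *: e + x)); last first.
        by exists None => //; rewrite inE eqxx.
      have /mesh_cover[K KT Kt] := subset_closure Ot.
      by exists (Some K) => //; rewrite inE; apply/orP; right; apply: map_f.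
  have F0 : F 0 = W x by rewrite /F scale0r add0r.
  have [h0|h0] := leP 0 h.
    by have := seg 0 h h0; rewrite F0 subr0 (ger0_norm h0).
  have := seg h 0 (ltW h0); by rewrite F0 sub0r distrC (ltr0_norm h0).
- move=> i; apply: filterS mesh_core_ae => x xc.
  set Dx := _ \_ Om.
  have near_der (g : E -> R) : smooth g -> (\forall y \near x, g y = W y) -> Dx x = pderiv i g x ->
      is_derive x (delta_mx ord0 i : E) W (Dx x).
    move=> sg gW ->; apply: DeriveDef.
      by apply: (near_eq_derivable gW); exact: smooth_derivable.
    by rewrite -(@near_eq_derive _ _ _ g W _ _ gW).
  have [cx|ncx] := pselect (closure Om x); last first.
    apply: (near_der (fun=> 0) (smooth_cst 0)).
      have o : open (~` closure Om) := closed_openC (@closed_closure _ Om).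
      apply: filterS (open_nbhs_nbhs (conj o ncx)) => y ncy.
      by rewrite /W mesh_interp0// mul0r.
    rewrite pderiv_cst /Dx patchE memNset// => /subset_closure; exact: ncx.
  have [K KT Kx] := xc cx.
  apply: (near_der (f K)); first by case: (tf K).
    apply: filterS (open_nbhs_nbhs (conj (@open_core _ _ K) Kx)) => y Ky.
    by rewrite (WK K)//; exact: (core_hull (mesh_nd KT)).
  rewrite /Dx patchE mem_set; last exact: (core_Om KT).
  rewrite (mesh_sumE _ KT Kx) /f (smooth_pderivM _ (smooth_interp K phi) sp).
  by have [b ->] := interpE K phi; rewrite pderiv_aff.
Unshelve. all: by end_near. Qed.

End Mesh.

(** * Diameter, volume and gradients of barycentric coordinates *)

Section Shape.
Context {R : realType} {n : nat}.
Local Notation E := 'rV[R]_n.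
Local Notation mu := (lebesgue R n).
Variable K : simplex R n.
Hypothesis ndK : nondegenerate_simplex K.

Lemma bgrad_sum0 : \sum_i bgrad K i = 0.
Proof.
apply/rowP => k; rewrite summxE mxE.
have : \sum_i bary K i (delta_mx ord0 k) = \sum_i bary K i 0 by rewrite !sum_bary.
move=> /eqP; rewrite -subr_eq0 -sumrB => /eqP H; rewrite -[RHS]H; apply: eq_bigr => i _.
by have [b ->] := baryE K i; rewrite aff_sub subr0 dot_delta.
Qed.

(** Differentiate the expansion of x as the barycentric combination of the vertices in direction
    k. *)
Lemma bgrad_vertices (k l : 'I_n) :
  \sum_(i < n.+1) bgrad K i ord0 k * K.1`_i ord0 l = (k == l)%:R.
Proof.
have e : delta_mx ord0 k - 0 = \sum_(i < n.+1) bgrad K i ord0 k *: K.1`_i.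
  rewrite {1}[delta_mx ord0 k](bary_comb ndK) [X in _ - X](bary_comb ndK) -sumrB.
  apply: eq_bigr => i _; rewrite -scalerBl.
  by have [b ->] := baryE K i; rewrite aff_sub subr0 dot_delta.
have /rowP/(_ l) := e; rewrite subr0 !mxE eqxx/= eq_sym summxE => ->.
by apply: eq_bigr => i _; rewrite mxE.
Qed.

Lemma norm_le_enorm (x : E) : `|x| <= enorm x.
Proof.
apply/norm_coordP; first exact: sqrtr_ge0.
move=> i; rewrite -sqrtr_sqr /enorm ler_wsqrtr// /dot (bigD1 i)//= -expr2 lerDl.
by apply: sumr_ge0 => j _; rewrite -expr2 sqr_ge0.
Qed.

Lemma hull_bounded : exists2 B : R, 0 <= B & forall x, hull K.1 x -> `|x| <= B.
Proof.
exists (\sum_(i < n.+1) `|K.1`_i|); first exact: sumr_ge0.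
move=> x Kx; rewrite [x](bary_comb ndK) (le_trans (ler_norm_sum _ _ _))//.
apply: ler_sum => i _; rewrite normrZ ler_piMl// ger0_norm ?(hullP ndK x).1//.
exact: bary_le1.
Qed.

Lemma hull_diam x y : hull K.1 x -> hull K.1 y -> `|x - y| <= diam (hull K.1).
Proof.
move=> Kx Ky; apply: (le_trans (norm_le_enorm _)).
have [B B0 HB] := hull_bounded.
apply: ub_le_sup; last by exists x, y.
exists (Num.sqrt (\sum_(i < n) (2 * B) ^+ 2)) => _ [a [b [Ka Kb ->]]].
apply: ler_wsqrtr; apply: ler_sum => i _; rewrite -expr2 -real_normK ?num_real//.
rewrite lerXn2r ?nnegrE ?mulr_ge0//; apply: (le_trans (coord_norm _ _)).
by apply: (le_trans (ler_normB _ _)); have := HB a Ka; have := HB b Kb; lra.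
Qed.

Lemma measurable_hull : measurable (hull K.1).
Proof. exact: (closed_measurable_rV (closed_hull ndK)). Qed.

Lemma hull_fin : (mu (hull K.1) < +oo)%E.
Proof.
apply: bounded_lebesgue; last exact: measurable_hull.
have [B B0 HB] := hull_bounded; exists B; split; first exact: num_real.
by move=> M BM x Kx; exact: (le_trans (HB x Kx) (ltW BM)).
Qed.

Lemma volumeE : (volume K)%:E = mu (hull K.1).
Proof. by rewrite /volume fineK// ge0_fin_numE// hull_fin. Qed.

Lemma volume_ge0 : 0 <= volume K. Proof. exact: fine_ge0. Qed.

End Shape.

(* The hull lies in a box of side 2h, and in the slab between two level sets of
   the barycentric coordinate, of width 1 / |g| in direction k. *)
Lemma bgrad_volume {R : realType} {n : nat} (K : simplex R n) (i : 'I_n.+1) (k : 'I_n) :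
  nondegenerate_simplex K ->
  `|bgrad K i ord0 k| * volume K <= (2 * diam (hull K.1)) ^+ n.-1.
Proof.
case: n K i k => [|n] K i k nd; first by case: k.
set h := diam _; set g := bgrad K i ord0 k.
have h0 : 0 <= h.
  by have := hull_diam nd (vertex_hull nd ord0) (vertex_hull nd ord0); rewrite subrr normr0.
have [g0|g0] := eqVneq g 0; first by rewrite g0 normr0 mul0r exprn_ge0// mulr_ge0.
rewrite -ler_pdivlMl ?normr_gt0// -lee_fin volumeE//.
pose z : 'rV[R]_n.+1 := K.1`_(ord0 : 'I_n.+2).
pose I (l : 'I_n) : set R := `[z ord0 (lift k l) - h, z ord0 (lift k l) + h]%classic.
have mI l : measurable (I l) by exact: measurable_itv.
have lI l : lebesgue_measure (I l) = (2 * h)%:E.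
  rewrite /I lebesgue_measure_itv/= lte_fin.
  case: ifPn => [_|]; first by rewrite -EFinB; congr EFin; ring.
  by rewrite -leNgt => h1; congr EFin; lra.
have BE : lebesgue R n (rect I) = ((2 * h) ^+ n)%:E.
  rewrite lebesgue_rect//; under eq_bigr do rewrite lI.
  by rewrite prodEFin prodr_const card_ord.
rewrite EFinM -BE; apply: (lebesgue_slices_le (i := k)).
- exact: measurable_hull.
- exact: measurable_rect.
- by rewrite invr_ge0.
move=> y; have [b bE] := baryE K i.
pose c := aff (bgrad K i) b (ins k (0, y)).
have E t : bary K i (ins k (t, y)) = t * g + c.
  by rewrite bE ins_self /aff dotDr dotZr dot_delta -/g addrA.
have [By|nBy] := pselect (rect I y); last first.
  rewrite (_ : [set t | _] = set0) ?measure0.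
    by rewrite indicE memNset// mule0.
  rewrite -subset0 => t /= Kt; apply: nBy => l.
  have := le_trans (coord_norm _ (lift k l)) (hull_diam nd Kt (vertex_hull nd ord0)).
  rewrite !mxE liftK /= ler_norml -/h -/z => /andP[h1 h2].
  by rewrite /I /= in_itv/=; apply/andP; split; lra.
rewrite indicE mem_set// mule1.
(* On this line the barycentric coordinate is t g + c and lies in [0, 1], so t lies between -c/g and
   (1-c)/g. The boolean factors put 1/|g| on the side that fits the sign of g. *)
pose J : set R := `[(- c) / g - `|g|^-1 * (g < 0)%R%:R, (- c) / g + `|g|^-1 * (0 < g)%R%:R]%classic.
have lJ : (lebesgue_measure J <= (`|g|^-1)%:E)%E.
  rewrite lebesgue_measure_itv/= lte_fin; case: ifPn => [_|_]; last by rewrite lee_fin invr_ge0.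
  rewrite -EFinB lee_fin; have [gp|gn] := ltP 0 g.
    by rewrite ltNge (ltW gp)/= mulr0 subr0 mulr1 addrC addKr.
  have {}gn : g < 0 by rewrite lt_def eq_sym g0.
  by rewrite gn mulr1 mulr0 addr0 opprB addrC subrK.
apply: (le_trans _ lJ); apply: le_measure; rewrite ?inE; [|exact: measurable_itv|].
  have -> : [set t | hull K.1 (ins k (t, y))] = (fun t => ins k (t, y)) @^-1` (hull K.1) by [].
  rewrite -[X in measurable X]setTI.
  exact: (measurableT_comp (measurable_ins k) (measurable_pair2 y) measurableT (measurable_hull nd)).
move=> t /= Kt; have := (hullP nd _).1 Kt i; have := bary_le1 nd i Kt; rewrite E => h1 h2.
  rewrite /J /= in_itv/=; have [gp|gn] := ltP 0 g.
    rewrite ltNge (ltW gp)/= mulr0 subr0 mulr1 gtr0_norm//.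
    rewrite ler_pdivrMr// (_ : - c / g + g^-1 = (1 - c) / g); last by rewrite mulrBl mul1r addrC mulNr.
    by rewrite ler_pdivlMr//; apply/andP; split; lra.
  have {}gn : g < 0 by rewrite lt_def eq_sym g0.
  rewrite gn mulr1 mulr0 addr0 ltr0_norm// invrN opprK.
  rewrite (_ : - c / g + g^-1 = (1 - c) / g); last by rewrite mulrBl mul1r addrC mulNr.
  by rewrite ler_ndivrMr// ler_ndivlMr//; apply/andP; split; lra.
Qed.

(** * Interpolation errors on a shape regular simplex *)

Section InterpolationError.
Context {R : realType} {n : nat}.
Local Notation E := 'rV[R]_n.
Variables (K : simplex R n) (kappa : R).
Hypothesis ndK : nondegenerate_simplex K.
Hypothesis shK : diam (hull K.1) ^+ n <= kappa * volume K.
Hypothesis kappa0 : 0 <= kappa.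
Local Notation h := (diam (hull K.1)).

Lemma diam_ge0 : 0 <= h.
Proof. by have := hull_diam ndK (vertex_hull ndK ord0) (vertex_hull ndK ord0); rewrite subrr normr0. Qed.

(** Shape regularity and [bgrad_volume] give |g| h^n <= kappa |g| |K| <= kappa (2h)^(n-1); cancel
    h^(n-1). So gradients of barycentric coordinates are O(1/h). *)
Lemma bgrad_diam i k : `|bgrad K i ord0 k| * h <= kappa * 2 ^+ n.-1.
Proof.
have h0 := diam_ge0; have n0 : (0 < n)%N := leq_ltn_trans (leq0n _) (ltn_ord k).
have [hp|hn] := ltP 0 h; last first.
  have -> : h = 0 by apply/eqP; rewrite eq_le hn h0.
  by rewrite mulr0 mulr_ge0// exprn_ge0.
have hn0 : 0 < h ^+ n.-1 by rewrite exprn_gt0.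
rewrite -(ler_pM2r hn0) -mulrA -exprS prednK//.
apply: (@le_trans _ _ (`|bgrad K i ord0 k| * (kappa * volume K))); first by rewrite ler_wpM2l.
rewrite mulrCA -mulrA -exprMn; apply: ler_wpM2l => //; exact: bgrad_volume.
Qed.

(** The gradients of the barycentric coordinates sum to 0 and reproduce linear functions, so the
    first-order Taylor polynomial of [phi] at x drops out. The remainder is O(h^2) at the vertices,
    and the gradients are O(1/h). *)
Lemma interp_grad_error (phi : E -> R) (M : R) k x : smooth phi -> 0 <= M ->
  (forall i j z, `|pderiv j (pderiv i phi) z| <= M) -> hull K.1 x ->
  `|igrad K phi ord0 k - pderiv k phi x| <= n.+1%:R * (kappa * 2 ^+ n.-1) * (n%:R * n%:R * M) * h.
Proof.
move=> sp M0 pM Kx; have h0 := diam_ge0.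
have -> : igrad K phi ord0 k - pderiv k phi x = \sum_(i < n.+1) bgrad K i ord0 k *
    (phi K.1`_i - phi x - \sum_(l < n) (K.1`_i ord0 l - x ord0 l) * pderiv l phi x).
  have s0 : \sum_i bgrad K i ord0 k = 0.
    by have := congr1 (fun u : E => u ord0 k) (bgrad_sum0 K); rewrite summxE mxE.
  under [RHS]eq_bigr do rewrite !mulrBr.
  rewrite !sumrB -[X in _ - X - _]mulr_suml s0 mul0r subr0; congr (_ - _).
    by rewrite summxE; apply: eq_bigr => i _; rewrite mxE mulrC.
  under [RHS]eq_bigr do rewrite mulr_sumr.
  rewrite exchange_big/= (bigD1 k)//= [X in _ = _ + X]big1 ?addr0.
    under eq_bigr do rewrite mulrA mulrBr.
    rewrite -mulr_suml sumrB (bgrad_vertices ndK) eqxx -mulr_suml s0 mul0r subr0.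
    by rewrite mul1r.
  move=> l lk; under eq_bigr do rewrite mulrA mulrBr.
  rewrite -mulr_suml sumrB (bgrad_vertices ndK) eq_sym (negbTE lk) -mulr_suml s0 mul0r subr0.
  by rewrite mul0r.
apply: (le_trans (ler_norm_sum _ _ _)).
apply: (@le_trans _ _ (\sum_(i < n.+1) (kappa * 2 ^+ n.-1) * (n%:R * n%:R * M) * h)); last first.
  by rewrite sumr_const card_ord -[_ *+ n.+1]mulr_natl le_eqVlt; apply/orP; left; apply/eqP; ring.
apply: ler_sum => i _; rewrite normrM.
have d : `|K.1`_i - x| <= h by exact: (hull_diam ndK (vertex_hull ndK i) Kx).
have ty : `|phi K.1`_i - phi x - \sum_(l < n) (K.1`_i ord0 l - x ord0 l) * pderiv l phi x| <= n%:R * n%:R * M * h * h.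
  have := @smooth_taylor _ _ phi x K.1`_i M sp (fun i j z _ => pM i j z) => /le_trans; apply.
  rewrite mulrA -!mulrA; do 2 (apply: ler_wpM2l; first exact: ler0n).
  by rewrite ler_wpM2l// ler_pM.
apply: (le_trans (ler_wpM2l (normr_ge0 _) ty)).
have -> : `|bgrad K i ord0 k| * (n%:R * n%:R * M * h * h) = (`|bgrad K i ord0 k| * h) * (n%:R * n%:R * M * h) by ring.
rewrite -[leRHS]mulrA; apply: ler_wpM2r; last exact: bgrad_diam.
by rewrite !mulr_ge0.
Qed.

Lemma interp_error (phi : E -> R) (M : R) x : smooth phi -> 0 <= M ->
  (forall i z, `|pderiv i phi z| <= M) -> hull K.1 x ->
  `|interp K phi x - phi x| <= n%:R * M * h.
Proof.
move=> sp M0 pM Kx.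
have -> : interp K phi x - phi x = \sum_(i < n.+1) bary K i x * (phi K.1`_i - phi x).
  under [RHS]eq_bigr do rewrite mulrBr.
  by rewrite sumrB -mulr_suml sum_bary mul1r.
apply: (le_trans (ler_norm_sum _ _ _)).
have -> : n%:R * M * h = \sum_i bary K i x * (n%:R * M * h) by rewrite -mulr_suml sum_bary mul1r.
apply: ler_sum => i _.
have b0 := (hullP ndK x).1 Kx i.
rewrite normrM (ger0_norm b0) ler_wpM2l//.
apply: (le_trans (smooth_lip sp (fun i z _ => pM i z))).
by rewrite ler_wpM2l ?mulr_ge0//; exact: (hull_diam ndK (vertex_hull ndK i) Kx).
Qed.

End InterpolationError.

(** * Interpolation into the space of continuous piecewise affine functions *)

Section MeshSpaces.
Context {R : realType} {n : nat}.
Local Notation E := 'rV[R]_n.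
Variable Om : set E.
Hypotheses (oO : open Om) (bO : bounded_set Om) (lO : lipschitz_boundary Om).
Implicit Types (K : simplex R n) (phi psi : E -> R) (T : mesh R n).

Let mO := mOm oO.

Lemma aff_segment (a : E) b (x y : E) t :
  aff a b (x + t *: (y - x)) = aff a b x + t * (aff a b y - aff a b x).
Proof. by rewrite /aff dotDr dotZr dotBr; ring. Qed.

Lemma bary_segment K i (x y : E) t :
  bary K i (x + t *: (y - x)) = bary K i x + t * (bary K i y - bary K i x).
Proof. by have [b ->] := baryE K i; exact: aff_segment. Qed.

(* Move from x towards the vertex z until inside Om: the elements met near that
   point contain z, and scaling back by 1 / t from z shows that they cover a
   neighbourhood of x. *)
Lemma star_interior T K (i : 'I_n.+1) x : conforming_triangulation Om T -> K \in T -> hull K.1 x ->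
  Om K.1`_i -> 0 < bary K i x -> Om x.
Proof.
move=> cT KT Kx; set z := K.1`_i => Oz xi; apply: (interior_closure oO lO).
have nd := mesh_nd cT KT.
have /nbhs_ballP[r /= r0 rO] : nbhs z Om by exact: open_nbhs_nbhs.
pose t := Num.min 1 (r / (1 + `|x - z|)).
have e0 : 0 < 1 + `|x - z| by rewrite ltr_pwDl.
have t0 : 0 < t by rewrite lt_min ltr01 divr_gt0.
have t1 : t <= 1 by rewrite ge_min lexx.
have tr : t * (1 + `|x - z|) <= r by rewrite -ler_pdivlMr// ge_min lexx orbT.
pose g (y : E) := z + t *: (y - z).
have cg : continuous g.
  move=> y; apply/(@cvgrPdist_le R E E (nbhs (y : E)) _ g (g y)) => e e'0.
  apply: filterS (nbhsx_ballx y _ e'0) => u; rewrite -ball_normE /= => yu.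
  rewrite (_ : g y - g u = t *: (y - u)); last by apply/rowP => j; rewrite !mxE; ring.
  by rewrite normrZ gtr0_norm// (le_trans _ (ltW yu))// ler_piMl.
have Ow : Om (g x).
  apply: rO; rewrite -ball_normE /= /g opprD addrA subrr sub0r normrN normrZ gtr0_norm//.
  by move: tr; rewrite mulrDr mulr1; lra.
have preim (A : set E) : open A -> A (g x) -> \forall y \near x, A (g y).
  by move=> oA Ax; apply: cg; exact: open_nbhs_nbhs.
have near K' : K' \in T -> \forall y \near x, hull K'.1 (g y) -> hull K'.1 y.
  move=> KT'; have nd' := mesh_nd cT KT'.
  have [Kw|nKw] := pselect (hull K'.1 (g x)); last first.
    have o : open (~` hull K'.1) := closed_openC (closed_hull nd').
    by apply: filterS (preim _ o nKw) => y.
  have wK : hull K.1 (g x).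
    apply/(hullP nd) => j; rewrite bary_segment.
    have h1 := (hullP nd _).1 (vertex_hull nd i) j; have h2 := (hullP nd _).1 Kx j.
    have -> : bary K j z + t * (bary K j x - bary K j z) = (1 - t) * bary K j z + t * bary K j x by ring.
    by rewrite addr_ge0// mulr_ge0// ?subr_ge0// ltW.
  have vert j : 0 < bary K j (g x) -> exists j' : 'I_n.+1, K.1`_j = K'.1`_j'.
    move=> wj; have [<-|Fw] := mesh_face cT KT KT' wK Kw; first by exists j.
    have := face_vertex nd _ Fw wj; rewrite mem_filter => /(_ _)/andP[].
      by move=> y; rewrite mem_filter => /andP[].
    by move=> /(vertexP nd')[j' ->]; exists j'.
  have wpos j : 0 < bary K j x -> 0 < bary K j (g x).
    move=> xj; rewrite bary_segment bary_vertex//.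
    have -> : forall u v : R, u + t * (v - u) = (1 - t) * u + t * v by move=> u v; ring.
    by rewrite ltr_wpDl ?mulr_gt0// mulr_ge0 ?subr_ge0.
  have [i' zi'] := vert i (wpos i xi).
  have xi' : 0 < bary K' i' x.
    have [b bE] := baryE K' i'.
    rewrite [x](bary_comb nd) bE aff_comb ?sum_bary// -bE (bigD1 i)//= zi' bary_vertex// eqxx mulr1.
    rewrite ltr_pwDl// sumr_ge0// => j _.
    have := (hullP nd _).1 Kx j; rewrite le_eqVlt => /orP[/eqP <-|xj]; first by rewrite mul0r.
    have [j' ->] := vert j (wpos j xj); rewrite bary_vertex// mulr_ge0// ?(ltW xj)//.
  have o : open (bary K' i' @^-1` [set s | 0 < s]).
    by apply: open_comp; [move=> y _; exact: continuous_bary|exact: open_gt].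
  apply: filterS (open_nbhs_nbhs (conj o xi')) => y /= yi' gy.
  apply/(hullP nd') => m; have [->|mi'] := eqVneq m i'; first exact: ltW.
  have := (hullP nd' _).1 gy m; rewrite bary_segment /z zi' bary_vertex// (negbTE mi') subr0 add0r.
  by rewrite pmulr_rge0.
have H1 : \forall y \near x, forall K' : T, hull (val K').1 (g y) -> hull (val K').1 y.
  apply: (@filter_forall E _ (fun (K' : T) y => hull (val K').1 (g y) -> hull (val K').1 y) (nbhs (x : E)) _) => K'.
  exact: near (valP K').
have H2 := preim _ oO Ow.
suff : \forall y \near x, closure Om y by [].
near=> y.
have h1 : forall K' : T, hull (val K').1 (g y) -> hull (val K').1 y by near: y.
have h2 : Om (g y) by near: y.
have /(mesh_cover cT)[K' KT' Ky] := subset_closure h2.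
by apply/(mesh_cover cT); exists K' => //; exact: (h1 (FSetSub KT')).
Unshelve. all: by end_near. Qed.

(** By [star_interior], a vertex with positive weight at a boundary point lies outside [Om]; so all
    contributing nodal values are 0. *)
Lemma mesh_interp_boundary T phi x : conforming_triangulation Om T ->
  (forall z, ~ Om z -> phi z = 0) -> closure Om x -> ~ Om x -> mesh_interp T phi x = 0.
Proof.
move=> cT phi0 /(mesh_cover cT)[K KT Kx] nOx; rewrite (mesh_interpE cT _ KT Kx).
apply: big1 => i _; have [Oz|nOz] := pselect (Om K.1`_i); last by rewrite phi0// mulr0.
have := (hullP (mesh_nd cT KT) _).1 Kx i; rewrite le_eqVlt => /orP[/eqP <-|xi]; first by rewrite mul0r.
by case: nOx; exact: (star_interior cT KT Kx Oz xi).
Qed.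

(** Lets the constant 1 act as a test function on the bounded set [Om]. *)
Lemma cutoff_exists : exists2 chi : E -> R, test_function setT chi &
  forall x, Om x -> chi x = 1 /\ forall i, pderiv i chi x = 0.
Proof.
have [N [Nr NO]] := bO; pose rho := `|N| + 1.
have rho0 : 0 < rho by rewrite ltr_wpDl.
have O1 x : Om x -> plateau 0 rho x = 1.
  move=> Ox; apply: plateau1 => //; rewrite subr0; apply: (NO rho) => //.
  by rewrite (le_lt_trans (ler_norm _))// ltrDl.
exists (plateau 0 rho); first exact: test_plateau.
move=> x Ox; split=> [|i]; first exact: O1.
have loc : \forall y \near x, plateau 0 rho y = 1.
  by apply: filterS (open_nbhs_nbhs (conj oO Ox)) => y; exact: O1.
by rewrite /pderiv (@near_eq_derive R E R _ (fun _ : E => 1 : R) _ _ loc) -/(pderiv i (fun _ : E => 1 : R) x) pderiv_cst.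
Qed.

Definition mesh_grad T phi (i : 'I_n) : E -> R := mesh_sum T (fun K _ => igrad K phi ord0 i).
Definition mesh_val T phi : E -> R := mesh_sum T (fun K => interp K phi).

Lemma in_L2_mesh_grad T phi i : conforming_triangulation Om T -> in_L2 Om (mesh_grad T phi i).
Proof.
move=> cT; apply: in_L2_mesh_sum => // K KT; exact: cst_continuous.
Qed.

Lemma in_L2_mesh_val T phi : conforming_triangulation Om T -> in_L2 Om (mesh_val T phi).
Proof.
move=> cT; apply: in_L2_mesh_sum => // K KT.
exact: (smooth_continuous (smooth_interp K phi)).
Qed.

Lemma mesh_sum_split T phi psi i x :
  mesh_sum T (fun K x => igrad K phi ord0 i * psi x + interp K phi x * pderiv i psi x) x =
  mesh_grad T phi i x * psi x + mesh_val T phi x * pderiv i psi x.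
Proof.
rewrite /mesh_grad /mesh_val /mesh_sum !mulr_suml -big_split/=.
by apply: eq_bigr => K _; ring.
Qed.

(** Here the nodal values on the boundary are arbitrary, so zero trace is applied to the product
    with [psi]. Tested with a cut-off equal to 1 on [Om], it says that the derivative of the product
    has integral 0, which is the integration by parts wanted. *)
Lemma mesh_val_grad T phi : conforming_triangulation Om T ->
  is_weak_grad Om (mesh_val T phi) (fun x => \row_i mesh_grad T phi i x).
Proof.
move=> cT; split.
  by move=> i; apply: (in_L2_ext mO _ (in_L2_mesh_grad phi i cT)) => x _; rewrite mxE.
move=> psi tpsi i; have [chi tchi chi1] := cutoff_exists.
have [_ LD] := mesh_interp_zero_trace oO bO lO cT (phi := phi) (test_setT tpsi)
  (fun x _ nO => ltac:(by rewrite (test_off tpsi nO) mulr0)).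
move=> /(_ chi tchi i).
have -> : inner Om (fun x => mesh_interp T phi x * psi x) (pderiv i chi) = 0.
  rewrite (inner_ext (u' := fun x => mesh_interp T phi x * psi x) (v' := fun=> 0)).
  - by rewrite /inner; under eq_Rintegral do rewrite mulr0; rewrite Rintegral_cst// mul0r.
  - by [].
  - by move=> x Ox; rewrite (chi1 x Ox).2.
set D := mesh_sum _ _ => /eqP; rewrite eq_sym oppr_eq0 => /eqP D0.
have Lg := in_L2_mesh_grad phi i cT; have Lv := in_L2_mesh_val phi cT.
have Lp := test_L2 oO tpsi; have Ldp := test_L2 oO (test_pderiv i tpsi).
have -> : inner Om (fun x => (\row_j mesh_grad T phi j x) ord0 i) psi = inner Om (mesh_grad T phi i) psi.
  by apply: inner_ext => x _ //; rewrite mxE.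
apply/eqP; rewrite -addr_eq0 addrC -[X in _ == X]D0; apply/eqP.
rewrite /inner -RintegralD//; [|exact: in_L2_int|exact: in_L2_int].
apply: eq_Rintegral => x; rewrite inE => Ox.
by rewrite /D mesh_sum_split (chi1 x Ox).1 mulr1.
Qed.

(** Zero boundary values come from [mesh_interp_boundary]; the factor [chi], equal to 1 on [Om],
    brings the interpolant into the form of [mesh_interp_zero_trace]. *)
Lemma P1_interp T phi : conforming_triangulation Om T -> test_function Om phi ->
  exists v, [/\ P1_space Om T v, is_weak_grad Om v (fun x => \row_i mesh_grad T phi i x) &
    forall K x, K \in T -> core K x -> v x = interp K phi x].
Proof.
move=> cT tphi; have [chi tchi chi1] := cutoff_exists.
have phi0 z : ~ Om z -> phi z = 0 := @test_off _ _ Om phi z tphi.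
have zt := mesh_interp_zero_trace oO bO lO cT (phi := phi) tchi
  (fun x cx nO => ltac:(by rewrite (mesh_interp_boundary cT phi0 cx nO) mul0r)).
have [Hv wv] := zero_trace_H10 oO bO lO zt.
exists (fun x => mesh_interp T phi x * chi x); split.
- split => // K KT; have [b bE] := interpE K phi.
  exists (igrad K phi), b; apply: aeW => x [Kx Ox].
  by rewrite (mesh_interpE cT _ KT Kx) (chi1 x Ox).1 mulr1 bE.
- apply: (weak_grad_ext oO _ _ wv) => // x Ox; apply/rowP => i; rewrite !mxE.
  by rewrite mesh_sum_split (chi1 x Ox).1 (chi1 x Ox).2 mulr1 mulr0 addr0.
- move=> K x KT cx; have Ox := core_Om oO lO cT KT cx.
  by rewrite (mesh_interpE cT _ KT (core_hull (mesh_nd cT KT) cx)) (chi1 x Ox).1 mulr1.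
Qed.

Lemma meshsizeE T K x : conforming_triangulation Om T -> K \in T -> core K x ->
  meshsize T x = volume K `^ (n%:R^-1).
Proof.
move=> cT KT cx; have nd := mesh_nd cT KT.
transitivity ((volume K `^ (n%:R^-1)) * \1_((hull K.1)^°) x
   + \sum_(K' <- T | K' != K) (volume K' `^ (n%:R^-1)) * \1_((hull K'.1)^°) x).
  by rewrite /meshsize (bigD1_seq K KT (fset_uniq T)).
have iK : (hull K.1)^° x.
  by apply: (interiorS (core_hull nd)); rewrite (interior_id _).1//; exact: open_core.
rewrite indicE mem_set// mulr1 big_seq_cond big1 ?addr0// => K' /andP[KT' KK].
rewrite indicE memNset ?mulr0// => /interior_subset Kx'.
by move/eqP: KK; apply; rewrite (core_unique cT KT KT' cx Kx').
Qed.

Variable kappa : R.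
Hypothesis kappa0 : 0 <= kappa.

Definition shape_regular T := forall K, K \in T -> diam (hull K.1) ^+ n <= kappa * volume K.

Lemma diam_meshsize T K x : conforming_triangulation Om T -> shape_regular T -> K \in T -> core K x ->
  diam (hull K.1) <= kappa `^ (n%:R^-1) * meshsize T x.
Proof.
move=> cT sT KT cx; have nd := mesh_nd cT KT; rewrite (meshsizeE cT KT cx).
have n0 : (0 < n)%N := leq_ltn_trans (leq0n _) (ltn_ord K.2).
have nr : n%:R != 0 :> R by rewrite pnatr_eq0 -lt0n.
have h0 := diam_ge0 nd.
rewrite -powRM ?volume_ge0//.
have -> : diam (hull K.1) = (diam (hull K.1) ^+ n) `^ (n%:R^-1).
  by rewrite -powR_mulrn// -powRrM mulfV// powRr1.
apply: ge0_ler_powR; rewrite ?nnegrE ?invr_ge0 ?exprn_ge0 ?mulr_ge0 ?volume_ge0//.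
exact: sT.
Qed.

(** The order of quantifiers matters: C is chosen before the mesh and the element, from global
    derivative bounds of [phi] and from [kappa]. *)
Lemma interp_errors phi : test_function setT phi -> exists2 C : R, 0 <= C &
  forall T K x, conforming_triangulation Om T -> shape_regular T -> K \in T -> core K x ->
    `|interp K phi x - phi x| <= C * meshsize T x /\
    forall i, `|igrad K phi ord0 i - pderiv i phi x| <= C * meshsize T x.
Proof.
move=> tp; have [sp _] := tp.
have /choice[M1 M1P] : forall i, exists M : R, 0 <= M /\ forall x, `|pderiv i phi x| <= M.
  by move=> i; have [M M0 HM] := test_bounded (test_pderiv i tp); exists M; split => //; exact: ltW.
have /choice[M2 M2P] : forall ij : 'I_n * 'I_n, exists M : R, 0 <= M /\
    forall x, `|pderiv ij.2 (pderiv ij.1 phi) x| <= M.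
  move=> ij; have [M M0 HM] := test_bounded (test_pderiv ij.2 (test_pderiv ij.1 tp)).
  by exists M; split => //; exact: ltW.
pose A := \sum_i M1 i; pose B := \sum_ij M2 ij.
have A0 : 0 <= A by apply: sumr_ge0 => i _; have [] := M1P i.
have B0 : 0 <= B by apply: sumr_ge0 => i _; have [] := M2P i.
have HA i x : `|pderiv i phi x| <= A.
  have [_ HM] := M1P i; apply: (le_trans (HM x)).
  by rewrite /A (bigD1 i)//= lerDl; apply: sumr_ge0 => j _; have [] := M1P j.
have HB i j x : `|pderiv j (pderiv i phi) x| <= B.
  have [_ HM] := M2P (i, j); apply: (le_trans (HM x)).
  by rewrite /B (bigD1 (i, j))//= lerDl; apply: sumr_ge0 => k _; have [] := M2P k.
pose c1 := n%:R * A; pose c2 := n.+1%:R * (kappa * 2 ^+ n.-1) * (n%:R * n%:R * B).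
have c10 : 0 <= c1 by rewrite mulr_ge0.
have c20 : 0 <= c2.
  apply: mulr_ge0; last by rewrite !mulr_ge0.
  by apply: mulr_ge0 => //; rewrite mulr_ge0// exprn_ge0.
have k0 : 0 <= kappa `^ (n%:R^-1) by exact: powR_ge0.
exists ((c1 + c2) * kappa `^ (n%:R^-1)); first by rewrite mulr_ge0// addr_ge0.
move=> T K x cT sT KT cx; have nd := mesh_nd cT KT.
have dh := diam_meshsize cT sT KT cx; have Kx := core_hull nd cx; have h0 := diam_ge0 nd.
have le c : 0 <= c -> c <= c1 + c2 -> c * diam (hull K.1) <= (c1 + c2) * kappa `^ (n%:R^-1) * meshsize T x.
  by move=> c0 cc; rewrite -mulrA; apply: ler_pM.
split=> [|i].
  apply: (le_trans (interp_error nd sp A0 HA Kx)); apply: le => //; by rewrite lerDl.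
apply: (le_trans (interp_grad_error nd (sT K KT) kappa0 i sp B0 HB Kx)); apply: le => //.
by rewrite lerDr.
Qed.

End MeshSpaces.

(** * Raviart-Thomas interpolation and refinement *)

Section RaviartThomas.
Context {R : realType} {n : nat}.
Local Notation E := 'rV[R]_n.
Variable Om : set E.
Hypotheses (oO : open Om) (bO : bounded_set Om) (lO : lipschitz_boundary Om).
Implicit Types (K : simplex R n) (phi psi : E -> R) (T : mesh R n).

Let mO := mOm oO.
Local Notation "<[ u , v ]>" := (inner Om u v).

(* With D = grad a and B j = grad b_j: for a = phi and b_j = x_j phi this is phi e_m,
   and it is piecewise in RT0 if a and the b_j are piecewise affine. *)
Definition rt_field (a : E -> R) (D : 'I_n -> E -> R) (B : 'I_n -> 'I_n -> E -> R) (m : 'I_n) (x : E) : E :=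
  \row_i (n%:R^-1 * (D m x * x ord0 i
    + ((i == m)%:R * (a x - \sum_l x ord0 l * D l x)
       + ((i == m)%:R * (\sum_j B j j x) - B i m x)))).

Lemma coord_bounded l : exists2 M : R, 0 <= M & forall x, Om x -> `|x ord0 l| <= M.
Proof. exact: (continuous_bounded bO (smooth_continuous (smooth_coord l))). Qed.

Lemma in_L2_coord l (f : E -> R) : in_L2 Om f -> in_L2 Om (fun x => x ord0 l * f x).
Proof.
move=> Lf; have [M _ HM] := coord_bounded l; apply: (in_L2_mulb mO Lf _ HM).
exact: (measurable_funTS (continuous_measurable_rV (smooth_continuous (smooth_coord l)))).
Qed.

Lemma test_coord l psi : test_function Om psi -> test_function Om (fun x => x ord0 l * psi x).
Proof. by apply: test_mull; exact: smooth_coord. Qed.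

Section Field.
Variables (a : E -> R) (D : 'I_n -> E -> R) (b : 'I_n -> E -> R) (B : 'I_n -> 'I_n -> E -> R).
Hypotheses (La : in_L2 Om a) (wa : is_weak_grad Om a (fun x => \row_i D i x)).
Hypothesis wb : forall j, is_weak_grad Om (b j) (fun x => \row_i B j i x).

Lemma LD i : in_L2 Om (D i).
Proof. by apply: (in_L2_ext mO _ (wa.1 i)) => x _; rewrite mxE. Qed.

Lemma LB j i : in_L2 Om (B j i).
Proof. by apply: (in_L2_ext mO _ ((wb j).1 i)) => x _; rewrite mxE. Qed.

Lemma wD psi i : test_function Om psi -> <[ D i, psi ]> = - <[ a, pderiv i psi ]>.
Proof.
move=> tp; have [_ ->] := wa => //; rewrite opprK; apply: inner_ext => // x _.
by rewrite mxE.
Qed.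

Lemma wB j psi i : test_function Om psi -> <[ B j i, psi ]> = - <[ b j, pderiv i psi ]>.
Proof.
move=> tp; have [_ ->] := wb j => //; rewrite opprK; apply: inner_ext => // x _.
by rewrite mxE.
Qed.

Lemma innerDr' (u v w : E -> R) : in_L2 Om u -> in_L2 Om v -> in_L2 Om w ->
  <[ u, fun x => v x + w x ]> = <[ u, v ]> + <[ u, w ]>.
Proof. by move=> Lu Lv Lw; rewrite innerC (innerDl mO Lv Lw Lu) !(innerC _ u). Qed.

Lemma innerZr' (k : R) (u v : E -> R) : in_L2 Om u -> in_L2 Om v ->
  <[ u, fun x => k * v x ]> = k * <[ u, v ]>.
Proof. by move=> Lu Lv; rewrite innerC (innerZl mO k Lv Lu) innerC. Qed.

Lemma inner_suml (I : finType) (F : I -> E -> R) v : (forall i, in_L2 Om (F i)) -> in_L2 Om v ->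
  <[ fun x => \sum_i F i x, v ]> = \sum_i <[ F i, v ]>.
Proof.
move=> LF Lv; rewrite -(Rint_sum mO); last by move=> i; exact: in_L2_int.
by apply: eq_Rintegral => x _; rewrite mulr_suml.
Qed.

Lemma in_L2_rt m i : in_L2 Om (fun x => rt_field a D B m x ord0 i).
Proof.
have L1 := in_L2_coord i (LD m).
have L2 : in_L2 Om (fun x => \sum_l x ord0 l * D l x).
  by apply: (in_L2_sum mO) => l; exact: in_L2_coord (LD l).
have L3 : in_L2 Om (fun x => \sum_j B j j x) by apply: (in_L2_sum mO) => j; exact: LB.
have L4 := in_L2Z mO n%:R^-1 (in_L2D mO L1 (in_L2D mO (in_L2Z mO (i == m)%:R (in_L2B mO La L2))
  (in_L2B mO (in_L2Z mO (i == m)%:R L3) (LB i m)))).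
by apply: (in_L2_ext mO _ L4) => x _; rewrite mxE; congr (_ * (_ + _)); rewrite mulrC.
Qed.

Lemma sum_delta (m : 'I_n) (F : 'I_n -> R) : \sum_i (m == i)%:R * F i = F m.
Proof.
by rewrite (bigD1 m)//= eqxx mul1r big1 ?addr0// => i im; rewrite eq_sym (negbTE im) mul0r.
Qed.

Lemma sum_const (F G H : 'I_n -> R) c : (forall l, F l = - (c + G l)) -> (forall l, G l = H l) ->
  \sum_l F l = - (n%:R * c + \sum_l H l).
Proof.
move=> FG GH; rewrite (eq_bigr _ (fun i _ => FG i)) sumrN big_split/= sumr_const card_ord mulr_natl.
by congr (- (_ + _)); apply: eq_bigr => i _; exact: GH.
Qed.

(** Here t is the integral of a d_m psi and v collects the terms with second derivatives of psi. The
    v cancel and n t remains, which accounts for the factor 1/n in [rt_field]. *)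
Lemma rt_identity (m : 'I_n) (s1 s3 s4 s5 t v e : R) : s1 = - (t + v) -> s3 = - (n%:R * t + v) ->
  s4 = s5 -> e = - t -> n%:R^-1 * (s1 + (t - s3 + (s4 - s5))) = - e.
Proof.
move=> -> -> -> ->; field.
by rewrite pnatr_eq0 -lt0n; exact: (leq_ltn_trans (leq0n m) (ltn_ord m)).
Qed.

(* Each term is integrated by parts against grad psi; second derivatives of psi
   cancel by symmetry. *)
Lemma rt_weak_div m : is_weak_div Om (rt_field a D B m) (D m).
Proof.
split; first exact: LD.
move=> psi tp; have [sp _] := tp.
have tpd i := test_pderiv i tp.
have tpdd i j := test_pderiv i (tpd j).
have tL f : test_function Om f -> in_L2 Om f by exact: (test_L2 oO).
have Lrt : in_vL2 Om (rt_field a D B m) by move=> i; exact: in_L2_rt.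
have Lg : in_vL2 Om (fun x => \row_i pderiv i psi x).
  by move=> i; apply: (in_L2_ext mO _ (tL _ (tpd i))) => x _; rewrite mxE.
rewrite (vinnerE mO Lrt Lg).
have LS : in_L2 Om (fun x => \sum_l x ord0 l * D l x).
  by apply: (in_L2_sum mO) => l; exact: in_L2_coord (LD l).
have LSB : in_L2 Om (fun x => \sum_j B j j x) by apply: (in_L2_sum mO) => j; exact: LB.
pose t1 i := <[ fun x => x ord0 i * D m x, pderiv i psi ]>.
pose t2 := <[ a, pderiv m psi ]>.
pose t3 l := <[ fun x => x ord0 l * D l x, pderiv m psi ]>.
pose t4 j := <[ B j j, pderiv m psi ]>.
pose t5 i := <[ B i m, pderiv i psi ]>.
have term i : <[ fun x => rt_field a D B m x ord0 i, fun x => (\row_j pderiv j psi x) ord0 i ]> =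
    n%:R^-1 * (t1 i + ((i == m)%:R * (t2 - \sum_l t3 l) + ((i == m)%:R * (\sum_j t4 j) - t5 i))).
  have L1 := in_L2_coord i (LD m); have Lp := tL _ (tpd i).
  have La' := in_L2Z mO (i == m)%:R (in_L2B mO La LS).
  have Lb' := in_L2B mO (in_L2Z mO (i == m)%:R LSB) (LB i m).
  have -> : <[ fun x => rt_field a D B m x ord0 i, fun x => (\row_j pderiv j psi x) ord0 i ]> =
    <[ fun x => n%:R^-1 * (x ord0 i * D m x + ((i == m)%:R * (a x - \sum_l x ord0 l * D l x)
       + ((i == m)%:R * (\sum_j B j j x) - B i m x))), pderiv i psi ]>.
    by apply: inner_ext => x _; rewrite mxE// [D m x * _]mulrC.
  rewrite (innerZl mO _ (in_L2D mO L1 (in_L2D mO La' Lb')) Lp) (innerDl mO L1 (in_L2D mO La' Lb') Lp).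
  rewrite (innerDl mO La' Lb' Lp) (innerBl' oO (in_L2Z mO _ LSB) (LB i m) Lp).
  rewrite (innerZl mO _ (in_L2B mO La LS) Lp) (innerZl mO _ LSB Lp).
  rewrite (innerBl' oO La LS Lp).
  rewrite (inner_suml (F := fun l x => x ord0 l * D l x) (fun l => in_L2_coord l (LD l)) Lp).
  rewrite (inner_suml (F := fun j => B j j) (fun j => LB j j) Lp).
  have sw (F : 'I_n -> R) : (i == m)%:R * F i = (i == m)%:R * F m by case: eqVneq => [->|]; rewrite ?mul0r.
  rewrite /t1 /t2 /t3 /t4 /t5.
  have e1 : (i == m)%:R * (<[ a, pderiv i psi ]> - \sum_l <[ fun x => x ord0 l * D l x, pderiv i psi ]>) =
    (i == m)%:R * (<[ a, pderiv m psi ]> - \sum_l <[ fun x => x ord0 l * D l x, pderiv m psi ]>).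
    exact: (sw (fun i => <[ a, pderiv i psi ]> - \sum_l <[ fun x => x ord0 l * D l x, pderiv i psi ]>)).
  have e2 : (i == m)%:R * (\sum_j <[ B j j, pderiv i psi ]>) = (i == m)%:R * (\sum_j <[ B j j, pderiv m psi ]>).
    exact: (sw (fun i => \sum_j <[ B j j, pderiv i psi ]>)).
  have sb (c x A A' B0 B' w : R) : A = A' -> B0 = B' -> c * (x + (A + (B0 - w))) = c * (x + (A' + (B' - w))).
    by move=> -> ->.
  exact: (sb _ _ _ _ _ _ _ e1 e2).
rewrite (eq_bigr _ (fun i _ => term i)) -mulr_sumr !big_split/= sumrN.
have pick (c : R) : \sum_(i < n) (i == m)%:R * c = c.
  rewrite (bigD1 m)//= eqxx mul1r big1 ?addr0// => i im; by rewrite (negbTE im) mul0r.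
rewrite !pick.
have T45 : \sum_j t4 j = \sum_j t5 j.
  apply: eq_bigr => j _; rewrite /t4 /t5 (wB j j (tpd m)) (wB j m (tpd j)) (schwarz j m sp); reflexivity.
have pc l f : smooth f -> forall k, pderiv k (fun x : E => x ord0 l * f x) =
    fun x => (k == l)%:R * f x + x ord0 l * pderiv k f x.
  by move=> sf k; rewrite (smooth_pderivM _ (smooth_coord l) sf) pderiv_coord.
have swap l f g : <[ fun x => x ord0 l * f x, g ]> = <[ f, fun x => x ord0 l * g x ]>.
  by apply: eq_Rintegral => x _; ring.
have T1 i : t1 i = - ((m == i)%:R * <[ a, pderiv i psi ]> + <[ a, fun x => x ord0 i * pderiv m (pderiv i psi) x ]>).
  rewrite /t1 swap (wD _ (test_coord i (tpd i))) (pc _ _ (smooth_pderiv i sp)).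
  rewrite (innerDr' La (in_L2Z mO _ (tL _ (tpd i))) (in_L2_coord i (tL _ (tpdd m i)))).
  by rewrite (innerZr' _ La (tL _ (tpd i))).
have T3 l : t3 l = - (<[ a, pderiv m psi ]> + <[ a, fun x => x ord0 l * pderiv l (pderiv m psi) x ]>).
  rewrite /t3 swap (wD _ (test_coord l (tpd m))) (pc _ _ (smooth_pderiv m sp)).
  rewrite (innerDr' La (in_L2Z mO _ (tL _ (tpd m))) (in_L2_coord l (tL _ (tpdd l m)))).
  by rewrite (innerZr' _ La (tL _ (tpd m))) eqxx mul1r.
have S1 : \sum_i t1 i = - (<[ a, pderiv m psi ]> + \sum_i <[ a, fun x => x ord0 i * pderiv m (pderiv i psi) x ]>).
  rewrite (eq_bigr _ (fun i _ => T1 i)) sumrN big_split/=; congr (- (_ + _)).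
  exact: (sum_delta m (fun i => <[ a, pderiv i psi ]>)).
have S3 : \sum_l t3 l = - (n%:R * <[ a, pderiv m psi ]> + \sum_i <[ a, fun x => x ord0 i * pderiv m (pderiv i psi) x ]>).
  apply: (sum_const T3) => i; rewrite (schwarz m i sp); reflexivity.
exact: (rt_identity m S1 S3 T45 (wD m tp)).
Qed.

End Field.

Definition mesh_rt T phi (m : 'I_n) : E -> E :=
  rt_field (mesh_val T phi) (mesh_grad T phi)
    (fun j => mesh_grad T (fun x => x ord0 j * phi x)) m.

Lemma mesh_sum_ext T F K x : conforming_triangulation Om T -> K \in T -> core K x ->
  mesh_sum T F x = F K x.
Proof. by move=> cT; exact: (mesh_sumE cT). Qed.

Lemma mesh_rt_space T phi m : conforming_triangulation Om T ->
  RT0_space Om T (mesh_rt T phi m) /\ is_weak_div Om (mesh_rt T phi m) (mesh_grad T phi m).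
Proof.
move=> cT; have La := in_L2_mesh_val oO bO phi cT; have wa := mesh_val_grad oO bO lO phi cT.
have wb j := mesh_val_grad oO bO lO (fun x => x ord0 j * phi x) cT.
have wdv := rt_weak_div La wa wb m; split => //.
have Lrt := in_L2_rt La wa wb m.
split; first by split => //; exists (mesh_grad T phi m).
move=> K KT; have [b0 bE] := interpE K phi.
pose G := igrad K phi; pose H j := igrad K (fun x => x ord0 j * phi x).
(* On K the interpolant minus x times its gradient is the constant [b0], and all gradients are
   constant, so the only term that varies is the m-th derivative times x. *)
exists (\row_i (n%:R^-1 * ((i == m)%:R * b0 + ((i == m)%:R * (\sum_j H j ord0 j) - H i ord0 m)))), (n%:R^-1 * G ord0 m).
apply: filterS (mesh_core_ae cT) => x xc [Kx Ox].
have [K' KT' cx] := xc (subset_closure Ox).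
have KK : K' = K := core_unique cT KT' KT cx Kx; subst K'.
apply/rowP => i; rewrite !mxE /mesh_val /mesh_grad !(mesh_sum_ext _ cT KT cx) -/G.
have -> : \sum_l x ord0 l * mesh_sum T (fun K _ => igrad K phi ord0 l) x = dot G x.
  by apply: eq_bigr => l _; rewrite (mesh_sum_ext _ cT KT cx) mulrC.
have -> : \sum_j mesh_sum T (fun K _ => igrad K (fun x => x ord0 j * phi x) ord0 j) x = \sum_j H j ord0 j.
  by apply: eq_bigr => j _; rewrite (mesh_sum_ext _ cT KT cx).
rewrite bE /aff -/(H i); set s := \sum_j _; ring.
Qed.

Variable kappa : R.
Hypothesis kappa0 : 0 <= kappa.

(** With exact functions the formula gives [phi e_m], so the error is linear in the interpolation
    errors of [phi] and of the [x_j phi]; the coordinates are bounded on [Om]. *)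
Lemma mesh_rt_errors phi m : test_function setT phi -> exists2 C : R, 0 <= C &
  forall T K x, conforming_triangulation Om T -> shape_regular kappa T -> K \in T -> core K x ->
    `|mesh_grad T phi m x - pderiv m phi x| <= C * meshsize T x /\
    forall i, `|mesh_rt T phi m x ord0 i - (i == m)%:R * phi x| <= C * meshsize T x.
Proof.
move=> tp; have [sp _] := tp.
have [C1 C10 H1] := interp_errors Om kappa0 tp.
have tpc j : test_function setT (fun x => x ord0 j * phi x) by exact: (test_mull (smooth_coord j) tp).
have /choice[C2 H2] : forall j, exists C : R, 0 <= C /\ forall T K x, conforming_triangulation Om T ->
    shape_regular kappa T -> K \in T -> core K x ->
    forall i, `|igrad K (fun x => x ord0 j * phi x) ord0 i - pderiv i (fun x => x ord0 j * phi x) x| <= C * meshsize T x.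
  move=> j; have [C C0 HC] := interp_errors Om kappa0 (tpc j); exists C; split => //.
  by move=> T K x cT sT KT cx; exact: (HC T K x cT sT KT cx).2.
have /choice[N HN] : forall l, exists M : R, 0 <= M /\ forall x, Om x -> `|x ord0 l| <= M.
  by move=> l; have [M M0 HM] := coord_bounded l; exists M.
pose c2 := \sum_j C2 j; pose c3 := \sum_l N l.
have c20 : 0 <= c2 by apply: sumr_ge0 => j _; have [] := H2 j.
have c30 : 0 <= c3 by apply: sumr_ge0 => j _; have [] := HN j.
have C2c j : C2 j <= c2.
  by rewrite /c2 (bigD1 j)//= lerDl; apply: sumr_ge0 => k _; have [] := H2 k.
have Nc j : N j <= c3.
  by rewrite /c3 (bigD1 j)//= lerDl; apply: sumr_ge0 => k _; have [] := HN k.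
pose C := c3 * C1 + (C1 + c3 * C1 + (c2 + c2)) + C1.
have c31 : 0 <= c3 * C1 by exact: mulr_ge0.
have C0 : 0 <= C by rewrite /C; lra.
exists C => // T K x cT sT KT cx.
have Ox := core_Om oO lO cT KT cx.
have [e0 e1] := H1 T K x cT sT KT cx.
have e2 j i := (H2 j).2 T K x cT sT KT cx i.
set ms := meshsize T x in e0 e1 e2 *.
have ms0 : 0 <= ms by rewrite /ms (meshsizeE cT KT cx) powR_ge0.
split; first by rewrite /mesh_grad (mesh_sum_ext _ cT KT cx) (le_trans (e1 m))// ler_wpM2r// /C; lra.
move=> i; rewrite mxE /mesh_val /mesh_grad !(mesh_sum_ext _ cT KT cx).
have -> : \sum_l x ord0 l * mesh_sum T (fun K _ => igrad K phi ord0 l) x = \sum_l x ord0 l * igrad K phi ord0 l.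
  by apply: eq_bigr => l _; rewrite (mesh_sum_ext _ cT KT cx).
have -> : \sum_j mesh_sum T (fun K _ => igrad K (fun x => x ord0 j * phi x) ord0 j) x =
    \sum_j igrad K (fun x => x ord0 j * phi x) ord0 j.
  by apply: eq_bigr => j _; rewrite (mesh_sum_ext _ cT KT cx).
pose g l := igrad K phi ord0 l - pderiv l phi x.
pose f j k := igrad K (fun x => x ord0 j * phi x) ord0 k - pderiv k (fun x => x ord0 j * phi x) x.
have pc j k : pderiv k (fun x : E => x ord0 j * phi x) x = (k == j)%:R * phi x + x ord0 j * pderiv k phi x.
  by rewrite (smooth_pderivM _ (smooth_coord j) sp) pderiv_coord.
have n0 : n%:R != 0 :> R by rewrite pnatr_eq0 -lt0n; exact: (leq_ltn_trans (leq0n m) (ltn_ord m)).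
have -> : n%:R^-1 * (igrad K phi ord0 m * x ord0 i + ((i == m)%:R * (interp K phi x - \sum_l x ord0 l * igrad K phi ord0 l)
     + ((i == m)%:R * (\sum_j igrad K (fun x => x ord0 j * phi x) ord0 j) - igrad K (fun x => x ord0 i * phi x) ord0 m)))
   - (i == m)%:R * phi x =
  n%:R^-1 * (x ord0 i * g m + ((i == m)%:R * (interp K phi x - phi x) - (i == m)%:R * (\sum_l x ord0 l * g l)
     + ((i == m)%:R * (\sum_j f j j) - f i m))).
  have s1 : \sum_l x ord0 l * igrad K phi ord0 l = \sum_l x ord0 l * g l + \sum_l x ord0 l * pderiv l phi x.
    by rewrite -big_split/=; apply: eq_bigr => l _; rewrite /g; ring.
  have s2 : \sum_j igrad K (fun x => x ord0 j * phi x) ord0 j =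
      \sum_j f j j + (n%:R * phi x + \sum_l x ord0 l * pderiv l phi x).
    rewrite mulr_natl -[n in _ *+ n]card_ord -sumr_const -!big_split/=; apply: eq_bigr => j _.
    by rewrite /f pc eqxx mul1r; ring.
  have s3 : igrad K (fun x => x ord0 i * phi x) ord0 m = f i m + ((m == i)%:R * phi x + x ord0 i * pderiv m phi x).
    by rewrite /f pc; ring.
  have s4 : igrad K phi ord0 m = g m + pderiv m phi x by rewrite /g subrK.
  rewrite s1 s2 s3 s4 (eq_sym m i); set u := \sum_l _; set v := \sum_l _; set w := \sum_j _.
  by field.
have bi : `|(i == m)%:R| <= 1 :> R by case: (_ == _); rewrite ?normr1 ?normr0.
have gl l : `|x ord0 l * g l| <= N l * (C1 * ms).
  by rewrite normrM; apply: ler_pM => //; [exact: (HN l).2|exact: e1].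
have gs : `|\sum_l x ord0 l * g l| <= c3 * (C1 * ms).
  by rewrite (le_trans (ler_norm_sum _ _ _))// /c3 mulr_suml; apply: ler_sum => l _; exact: gl.
have fs : `|\sum_j f j j| <= c2 * ms.
  by rewrite (le_trans (ler_norm_sum _ _ _))// /c2 mulr_suml; apply: ler_sum => l _; exact: e2.
have ni : n%:R^-1 <= 1 :> R by rewrite invf_le1 ?ler1n ?ltr0n; exact: (leq_ltn_trans (leq0n m) (ltn_ord m)).
have C1m : 0 <= C1 * ms by exact: mulr_ge0.
have b1 (y : R) : `|(i == m)%:R * y| <= `|y|.
  by case: (i == m); rewrite ?mul1r ?mul0r ?normr0.
have k1 : `|x ord0 i * g m| <= c3 * (C1 * ms).
  rewrite normrM; apply: ler_pM => //; last exact: e1.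
  by apply: le_trans (Nc i); exact: (HN i).2.
have k2 : `|(i == m)%:R * (interp K phi x - phi x)| <= C1 * ms by exact: le_trans (b1 _) e0.
have k3 : `|(i == m)%:R * (\sum_l x ord0 l * g l)| <= c3 * (C1 * ms) by exact: le_trans (b1 _) gs.
have k4 : `|(i == m)%:R * (\sum_j f j j)| <= c2 * ms by exact: le_trans (b1 _) fs.
have k5 : `|f i m| <= c2 * ms by rewrite (le_trans (e2 i m))// ler_wpM2r.
rewrite normrM ger0_norm ?invr_ge0//.
apply: (@le_trans _ _ (1 * (c3 * (C1 * ms) + ((C1 * ms + c3 * (C1 * ms)) + (c2 * ms + c2 * ms))))).
  apply: ler_pM => //.
  apply: (le_trans (ler_normD _ _)); apply: lerD => //.
  apply: (le_trans (ler_normD _ _)); apply: lerD.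
    by apply: (le_trans (ler_normB _ _)); exact: lerD.
  by apply: (le_trans (ler_normB _ _)); exact: lerD.
rewrite /C; have -> : (c3 * C1 + (C1 + c3 * C1 + (c2 + c2)) + C1) * ms =
  1 * (c3 * (C1 * ms) + ((C1 * ms + c3 * (C1 * ms)) + (c2 * ms + c2 * ms))) + C1 * ms by ring.
by rewrite lerDl.
Qed.

End RaviartThomas.

(** * Nested discrete spaces under bisection *)

Section Refinement.
Context {R : realType} {n : nat}.
Local Notation E := 'rV[R]_n.
Implicit Types (K : simplex R n) (T : mesh R n).

Lemma bisect_vertices K K' : K.1 != [::] -> K' \in bisect K ->
  K'.1 != [::] /\ hull K'.1 `<=` hull K.1.
Proof.
case: K => -[//|z s] g _; rewrite /bisect /= => K'b.
pose L := z :: s; pose mid := take n.-1 s.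
pose m := 2^-1 *: (z + last z s) : E.
have zL : z \in L by exact: mem_head.
have lL : last z s \in L by exact: mem_last.
have mL : {subset mid <= L} by move=> y /mem_take ys; rewrite inE ys orbT.
have hm : hull L m.
  have := @hull_comb R n L bool (fun _ => 2^-1) (fun b => if b then z else last z s).
  rewrite !big_bool/= => H; rewrite /m scalerDr; apply: H.
  - by move=> _; rewrite invr_ge0.
  - by rewrite -mulr2n -[_ *+ 2]mulr_natl mulfV.
  - by case=> _; exact: hull_mem.
have sub (v : E) (t : seq E) : v \in L -> {subset t <= mid} ->
    (v :: m :: t != [::]) /\ hull (v :: m :: t) `<=` hull L.
  move=> vL tm; split => //; apply: hull_subset => y; rewrite !inE => /orP[/eqP ->|/orP[/eqP ->//|yt]].
    exact: hull_mem.
  by apply: hull_mem; exact/mL/tm.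
move: K'b; rewrite !inE => /orP[]/eqP -> /=; first by apply: sub.
apply: sub => // y; rewrite mem_cat mem_rev => /orP[/mem_take//|/mem_drop//].
Qed.

(** Intermediate meshes need not be conforming, so the induction carries only that vertex lists are
    nonempty; this excludes the default values of [head] and [last] in [bisect]. *)
Lemma nvb_ancestor T T' : (forall K, K \in T -> K.1 != [::]) -> nvb_refines T T' ->
  forall K', K' \in T' -> K'.1 != [::] /\ exists2 K, K \in T & hull K'.1 `<=` hull K.1.
Proof.
move=> T0; elim => [K' KT'|T1 T2 _ IH [K KT1 ->] K'].
  by split; [exact: T0|exists K'].
rewrite in_fsetU => /orP[|].
  by rewrite in_fsetD1 => /andP[_]; exact: IH.
have [K0 [K1 K1T KK1]] := IH K KT1.
rewrite seq_fsetE => /(bisect_vertices K0)[h1 h2]; split => //.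
by exists K1 => //; exact: subset_trans KK1.
Qed.

Lemma nvb_cell Om T T' : conforming_triangulation Om T -> nvb_refines T T' ->
  forall K', K' \in T' -> exists2 K, K \in T & cell Om K' `<=` cell Om K.
Proof.
move=> [nd _ _] TT' K' KT'.
have [|_ [K KT KK]] := nvb_ancestor _ TT' KT'.
  by move=> K /nd[sK _]; rewrite -size_eq0 sK.
by exists K => // x [Kx Ox]; split => //; exact: KK.
Qed.

Lemma P1_nested Om T T' v : conforming_triangulation Om T -> nvb_refines T T' ->
  P1_space Om T v -> P1_space Om T' v.
Proof.
move=> cT TT' [Hv vK]; split => // K' KT'.
have [K KT KK] := nvb_cell cT TT' KT'; have [a [b vE]] := vK K KT.
by exists a, b; apply: filterS vE => x H /KK; exact: H.
Qed.

Lemma RT0_nested Om T T' tau : conforming_triangulation Om T -> nvb_refines T T' ->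
  RT0_space Om T tau -> RT0_space Om T' tau.
Proof.
move=> cT TT' [Hv vK]; split => // K' KT'.
have [K KT KK] := nvb_cell cT TT' KT'; have [a [b vE]] := vK K KT.
by exists a, b; apply: filterS vE => x H /KK; exact: H.
Qed.

End Refinement.

(** Choose N where [a] comes within eps/2 of the supremum of its tail: later increments are below
    eps/2, and the error term takes the other half. *)
Lemma quasi_cauchy {R : realType} (a : nat -> R) (D e : nat -> nat -> R) B :
  (forall l, a l <= B) -> (forall l L, (l <= L)%N -> D l L <= a L - a l + e l L) ->
  (forall eps : R, 0 < eps -> exists N, forall l L, (N <= l)%N -> (l <= L)%N -> e l L <= eps) ->
  forall eps : R, 0 < eps -> exists N, forall L, (N <= L)%N -> D N L <= eps.
Proof.
move=> aB De e0 eps eps0.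
have [N HN] := e0 (eps / 2) ltac:(lra).
pose A := [set a l | l in [set l | (N <= l)%N]].
have supA : has_sup A by split; [exists (a N), N => //=|exists B => _ [l _ <-]].
have [_ [l /= Nl <-] sl] := sup_adherent (divr_gt0 eps0 (ltr0n R 2)) supA.
exists l => L lL.
have aL : a L <= sup A.
  by apply: sup_upper_bound => //; exists L => //=; exact: leq_trans Nl lL.
have := De l L lL; have := HN l L Nl lL; lra.
Qed.

(** * Convergence of the adaptive algorithm *)

Section Galerkin.
Context {R : realType} {n : nat}.
Local Notation E := 'rV[R]_n.
Local Notation mu := (lebesgue R n).
Variable w : set E.
Hypothesis mw : measurable w.
Hypothesis woo : (mu w < +oo)%E.
Variable I : finType.
Implicit Types X Y F : nat -> I -> E -> R.
Notation intw f := (mu.-integrable w (EFin \o f)).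
Local Notation nm := (@tuple_nm R n w I).
Local Notation ip := (@tuple_ip R n w I).
Local Notation inLt := (@in_tuple_L2 R n w I).
Local Notation "X ~~> Z" := ((fun k => nm (fun i x => X k i x - Z i x)) @ \oo --> 0) (at level 70).

Lemma tail_complete X : (forall k, inLt (X k)) ->
  (forall eps : R, 0 < eps -> exists N, forall L, (N <= L)%N ->
    nm (fun i x => X N i x - X L i x) ^+ 2 <= eps) ->
  exists2 Z, inLt Z & X ~~> Z.
Proof.
move=> LX HX; apply: (L2_completet mw woo LX) => e e0.
have e3 : 0 < e / 3 by lra.
have [N HN] := HX ((e / 3) ^+ 2) (exprn_gt0 2 e3).
have H L : (N <= L)%N -> nm (fun i x => X N i x - X L i x) <= e / 3.
  move=> NL; rewrite -(@ler_pXn2r _ 2)// ?nnegrE; [exact: HN|exact: nm_ge0|lra].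
exists N => m k Nm Nk.
have := nmB_trans mw (LX m) (LX N) (LX k); rewrite (nmBC _ (X m) (X N)).
have := H m Nm; have := H k Nk; lra.
Qed.

Lemma nm_cauchy X Z : (forall k, inLt (X k)) -> inLt Z -> X ~~> Z -> forall e : R, 0 < e ->
  exists N, forall l L, (N <= l)%N -> (N <= L)%N -> nm (fun i x => X l i x - X L i x) <= e.
Proof.
move=> LX LZ /cvgrPdist_le/(_ _ _)H e e0.
have [N _ HN] := H (e / 2) ltac:(lra); exists N => l L Nl NL.
have := nmB_trans mw (LX l) LZ (LX L); rewrite (nmBC _ Z).
have := HN l Nl; have := HN L NL; rewrite /= !sub0r !normrN !ger0_norm ?nm_ge0//; lra.
Qed.

(* Testing the equation at level L with X l makes the norms of X l quasi-increasing. *)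
Lemma galerkin_cvg X F (F0 : I -> E -> R) : (forall k, inLt (X k)) -> (forall k, inLt (F k)) ->
  inLt F0 -> F ~~> F0 ->
  (forall l L, (l <= L)%N -> ip (X L) (X l) = ip (F L) (X l)) ->
  exists2 Z, inLt Z & X ~~> Z.
Proof.
move=> LX LF LF0 FF XF; apply: tail_complete => //.
have XleF l : nm (X l) <= nm (F l).
  have := XF l l (leqnn l); rewrite -nm_sqr => E1.
  have := cauchy_schwarz mw (LF l) (LX l); rewrite -E1 ger0_norm ?sqr_ge0// expr2.
  have := nm_ge0 w (X l); rewrite le_eqVlt => /orP[/eqP<- _|X0]; first exact: nm_ge0.
  by rewrite ler_pM2r.
have [B HB] : exists B, forall l, nm (F l) <= B.
  have /cvg_seq_bounded[M [Mr HM]] : cvgn (fun l => nm (F l)).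
    by apply/cvg_ex; exists (nm F0); exact: (nm_cvg mw LF LF0 FF).
  exists (M + 1) => l; have /= := HM (M + 1) ltac:(lra) l Logic.I.
  by rewrite ger0_norm ?nm_ge0.
have B0 : 0 <= B by rewrite (le_trans _ (HB 0%N))// nm_ge0.
have XB l : nm (X l) <= B by exact: le_trans (XleF l) (HB l).
pose e l L := 2 * (nm (fun i x => F L i x - F l i x) * B).
apply: (@quasi_cauchy R (fun l => nm (X l) ^+ 2) (fun l L => nm (fun i x => X l i x - X L i x) ^+ 2)
  e (B ^+ 2)).
- by move=> l; rewrite ler_pXn2r// ?nnegrE ?nm_ge0.
- move=> l L lL; rewrite nm_sub_sqr// ipC XF//.
  have -> : ip (F L) (X l) = ip (fun i x => F L i x - F l i x) (X l) + nm (X l) ^+ 2.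
    by rewrite ipBl// -(XF l l)// -nm_sqr subrK.
  have := cauchy_schwarz mw (inLtB mw (LF L) (LF l)) (LX l) => c1.
  have c2 : nm (fun i x => F L i x - F l i x) * nm (X l) <= nm (fun i x => F L i x - F l i x) * B.
    by rewrite ler_wpM2l ?nm_ge0.
  have := le_trans c1 c2; rewrite ler_norml => /andP[c3 _]; rewrite /e; lra.
- move=> eps eps0; have [N HN] := nm_cauchy LF LF0 FF (e := eps / (2 * (B + 1))) ltac:(apply: divr_gt0; lra).
  exists N => l L Nl lL; have H := HN L l (leq_trans Nl lL) Nl.
  rewrite /e; apply: (le_trans (y := 2 * (eps / (2 * (B + 1)) * (B + 1)))).
    rewrite ler_pM2l//; apply: ler_pM => //; [exact: nm_ge0|lra].
  suff -> : 2 * (eps / (2 * (B + 1)) * (B + 1)) = eps by [].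
  by field; apply/eqP; lra.
Qed.

Lemma nm_cvgB X F Z (F0 : I -> E -> R) : (forall k, inLt (X k)) -> (forall k, inLt (F k)) -> inLt Z -> inLt F0 ->
  X ~~> Z -> F ~~> F0 ->
  (fun k i x => X k i x - F k i x) ~~> (fun i x => Z i x - F0 i x).
Proof.
move=> LX LF LZ LF0 XZ FF; apply: (@squeeze_cvgr _ _ _ _ (fun=> 0)
    (fun k => nm (fun i x => X k i x - Z i x) + nm (fun i x => F k i x - F0 i x))).
- apply: nearW => k; rewrite nm_ge0/=.
  have L1 := inLtB mw (LX k) LZ; have L2 := inLtB mw LF0 (LF k).
  rewrite (nmBC _ (F k)); apply: le_trans (nmD mw L1 L2).
  rewrite le_eqVlt; apply/orP; left; apply/eqP; congr Num.sqrt.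
  by apply: ip_ext => i x _; ring.
- exact: cvg_cst.
- by rewrite -(addr0 0); apply: cvgD.
Qed.

Lemma ip_limit0 X Z (Y : I -> E -> R) : (forall k, inLt (X k)) -> inLt Z -> inLt Y -> X ~~> Z ->
  (forall k, ip (X k) Y = 0) -> ip Z Y = 0.
Proof.
move=> LX LZ LY XZ X0.
have Y0 : (fun k => nm (fun i x => (fun=> Y) k i x - Y i x)) @ \oo --> (0 : R).
  have -> : (fun k : nat => nm (fun i x => Y i x - Y i x)) = fun=> 0; last exact: cvg_cst.
  by apply/funext => k; have := nm_sub_sqr mw LY LY; rewrite -nm_sqr => H;
    apply/eqP; rewrite -sqrf_eq0 H; apply/eqP; ring.
have := ip_cvg mw LX (fun=> LY) LZ LY XZ Y0.
have -> : (fun k => ip (X k) Y) = fun=> 0 by apply/funext => k; exact: X0.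
by move=> /cvg_unique; apply => //; exact: cvg_cst.
Qed.

Lemma Rint_ae_le (f g : E -> R) : intw f -> intw g -> {ae mu, forall x, w x -> f x <= g x} ->
  \int[mu]_(x in w) f x <= \int[mu]_(x in w) g x.
Proof.
move=> If Ig fg; rewrite -subr_ge0 -RintegralB//.
have -> : \int[mu]_(x in w) (g x - f x) = \int[mu]_(x in w) `|g x - f x|.
  rewrite /Rintegral; congr fine; apply: ae_eq_integral => //.
  - by apply/measurable_EFinP; exact: (intw_meas (intwB mw Ig If)).
  - by apply/measurable_EFinP; apply: measurableT_comp => //; exact: (intw_meas (intwB mw Ig If)).
  - by apply: filterS fg => x H wx; rewrite ger0_norm// subr_ge0 H.
exact: Rintegral_ge0.
Qed.

Lemma norm0_ae_le (u v : E -> R) : in_L2 w u -> in_L2 w v ->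
  {ae mu, forall x, w x -> `|u x| <= `|v x|} -> norm0 w u <= norm0 w v.
Proof.
move=> Lu Lv uv; apply: ler_wsqrtr; apply: Rint_ae_le; [exact: in_L2_int|exact: in_L2_int|].
by apply: filterS uv => x H wx; rewrite -!expr2 -(real_normK (num_real (u x))) -(real_normK (num_real (v x)))
  ler_pXn2r ?nnegrE ?normr_ge0// H.
Qed.

(** Write (Z, Y) = - (X_k - Z, Y_k) - (Z, Y_k - Y). The first term vanishes because the [Yl k] stay
    bounded. They need not converge to Y, but their distance is at most C [h k], and this weight
    integrated against |Z| tends to 0. *)
Lemma orthogonal_limit X Z (Yl : nat -> I -> E -> R) (Y : I -> E -> R) (h : nat -> E -> R) (C H : R) :
  (forall k, inLt (X k)) -> inLt Z -> X ~~> Z -> (forall k, inLt (Yl k)) -> inLt Y ->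
  (forall k, ip (X k) (Yl k) = 0) -> 0 <= C ->
  (forall k, in_L2 w (h k)) -> (forall k x, w x -> 0 <= h k x) ->
  (forall k, {ae mu, forall x, w x -> h k x <= H}) ->
  (forall k, {ae mu, forall x, w x -> forall i, `|Yl k i x - Y i x| <= C * h k x}) ->
  (forall i, (fun k => \int[mu]_(x in w) (`|Z i x| * h k x)) @ \oo --> 0) ->
  ip Z Y = 0.
Proof.
move=> LX LZ XZ LYl LY XY0 C0 Lh h0 hH YlY Zh.
have LdY k i := in_L2B mw (LYl k i) (LY i).
have Lcst : in_L2 w (fun=> C * H).
  by apply: (in_L2_bounded mw (M := `|C * H|)).
pose B := nm Y + \sum_(i : I) norm0 w (fun=> C * H).
have YB k : nm (Yl k) <= B.
  apply: (le_trans (nm_le_add mw (LYl k) LY)); rewrite lerD2l.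
  apply: (le_trans (nm_le_sum _ _)) => //; apply: ler_sum => i _; apply: norm0_ae_le => //.
  apply: filterS2 (hH k) (YlY k) => x hx yx wx; rewrite (le_trans (yx wx i))//.
  by rewrite (le_trans _ (ler_norm _))// ler_wpM2l// hx.
have Zk k i : `|inner w (Z i) (fun x => Yl k i x - Y i x)| <= C * \int[mu]_(x in w) (`|Z i x| * h k x).
  have LaZ : in_L2 w (fun x => `|Z i x|).
    apply: (in_L2_le mw _ (LZ i)); last by move=> x _; rewrite normr_id.
    by apply: measurableT_comp => //; case: (LZ i).
  have I1 := in_L2_int mw LaZ (Lh k); have I2 := in_L2_int mw (LZ i) (LdY k i).
  apply: (le_trans (le_normr_Rintegral mw I2)); rewrite -RintegralZl//.
  apply: Rint_ae_le; [exact: intw_norm|exact: intwZ|].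
  apply: filterS (YlY k) => x yx wx; rewrite normrM mulrCA ler_wpM2l//; exact: yx.
have key k : `|ip Z Y| <= nm (fun i x => X k i x - Z i x) * B + \sum_i C * \int[mu]_(x in w) (`|Z i x| * h k x).
  have -> : ip Z Y = - ip (fun i x => X k i x - Z i x) (Yl k) - ip Z (fun i x => Yl k i x - Y i x).
    by rewrite ipBl// ipBr// XY0; ring.
  rewrite -opprD normrN; apply: (le_trans (ler_normD _ _)); apply: lerD.
    apply: (le_trans (cauchy_schwarz mw (inLtB mw (LX k) LZ) (LYl k))).
    by rewrite ler_wpM2l ?nm_ge0.
  by apply: (le_trans (ler_norm_sum _ _ _)); apply: ler_sum => i _; exact: Zk.
apply/normr0_eq0/le_anti; rewrite normr_ge0 andbT.
have lim0 : (fun k => nm (fun i x => X k i x - Z i x) * B + \sum_i C * \int[mu]_(x in w) (`|Z i x| * h k x)) @ \oo --> (0 : R).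
  rewrite [X in _ --> X](_ : 0 = 0 * B + \sum_(i : I) C * 0); last first.
    by rewrite mul0r big1 ?addr0// => i _; rewrite mulr0.
  apply: cvgD; first by apply: cvgM => //; exact: cvg_cst.
  by apply: cvg_sumr => i; apply: cvgM; [exact: cvg_cst|exact: Zh].
by rewrite -(cvg_lim _ lim0)//; apply: limr_ge; [apply/cvg_ex; exists 0|exact: nearW].
Qed.

End Galerkin.

(** * The limit residual on refined and on settled elements *)

Section MeshLimit.
Context {R : realType} {n : nat}.
Local Notation E := 'rV[R]_n.
Local Notation mu := (lebesgue R n).
Variable Om : set E.
Hypotheses (oO : open Om) (bO : bounded_set Om) (lO : lipschitz_boundary Om).
Let mT : measurable [set: E] := measurableT.
Let mO := mOm oO.
Let Ofin := Omfin oO bO.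
Variable I : finType.
Local Notation nm := (@tuple_nm R n).
Local Notation inLt := (@in_tuple_L2 R n Om I).
Notation intO f := (mu.-integrable Om (EFin \o f)).

Lemma cell_core T K : conforming_triangulation Om T -> K \in T ->
  {ae mu, forall x, Om x -> (cell Om K x <-> core K x)}.
Proof.
move=> cT KT; apply: filterS (mesh_core_ae cT) => x H Ox; split=> [[Kx _]|cx].
  have [K' KT' cx] := H (subset_closure Ox).
  by rewrite -(core_unique cT KT' KT cx Kx).
by split => //; exact: (core_hull (mesh_nd cT KT)).
Qed.

Lemma measurable_cell T K : conforming_triangulation Om T -> K \in T -> measurable (cell Om K).
Proof. by move=> cT KT; apply: measurableI => //; exact: (measurable_hull (mesh_nd cT KT)). Qed.

(** Almost every point of an element lies in some core, and cores are contained in [Om]. *)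
Lemma volume_cell T K : conforming_triangulation Om T -> K \in T -> (volume K)%:E = mu (cell Om K).
Proof.
move=> cT KT; have nd := mesh_nd cT KT; have mh := measurable_hull nd.
rewrite (volumeE nd) (measureDI mu mh mO).
rewrite -[RHS]add0e; congr (_ + _)%E.
apply: measure_negligible; first exact: measurableD.
apply: (negligibleS _ (mesh_core_ae cT)) => x [Kx nO] /= H; apply: nO.
have [|K' KT' cx] := H; first by apply/(mesh_cover cT); exists K.
exact: (core_Om oO lO cT KT' cx).
Qed.

Lemma inner_cell T K (f : E -> R) : conforming_triangulation Om T -> K \in T -> in_L2 Om f ->
  inner (cell Om K) f f = \int[mu]_(x in Om) (\1_(core K) x * (f x * f x)).
Proof.
move=> cT KT Lf; have nd := mesh_nd cT KT.
have mc : measurable (core K) by apply: open_measurable_rV; exact: open_core.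
rewrite /inner /cell Rintegral_mkcondl /Rintegral; congr fine; apply: ae_eq_integral => //.
- apply/measurable_EFinP; have := measurable_cell cT KT => mcell.
  have -> : (fun y => f y * f y) \_ (hull K.1) = (fun x => \1_(hull K.1) x * (f x * f x)).
    by apply/funext => x; rewrite patchE indicE; case: ifP; rewrite ?mul1r ?mul0r.
  apply: measurable_funM; first by apply: measurable_indic; exact: measurable_hull.
  by apply: measurable_funM; case: Lf.
- apply/measurable_EFinP/measurable_funM; first exact: measurable_indic.
  by apply: measurable_funM; case: Lf.
apply: filterS (cell_core cT KT) => x H Ox; have := H Ox; rewrite patchE indicE.
case: (pselect (core K x)) => cx [h1 h2].
  by rewrite (mem_set cx) mem_set ?mul1r//; exact: (h2 cx).1.
rewrite (memNset cx) memNset ?mul0r// => Kx; apply: cx; exact: h1.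
Qed.

(** Almost every point of [Om] lies in exactly one core, so the indicators of the cores sum to 1
    there. *)
Lemma mesh_nm_le T X : conforming_triangulation Om T -> inLt X ->
  \sum_(K <- T) nm (cell Om K) X ^+ 2 <= nm Om X ^+ 2.
Proof.
move=> cT LX; under eq_bigr do rewrite nm_sqr.
rewrite nm_sqr /tuple_ip exchange_big/=; apply: ler_sum => o _.
have Lf := LX o; set f := X o in Lf *; rewrite big_seq_fsetE/=.
have I2 := in_L2_int mO Lf Lf.
have mc (K : T) : measurable (core (val K)) by apply: open_measurable_rV; exact: open_core.
have Ik (K : T) : intO (fun x => \1_(core (val K)) x * (f x * f x)).
  apply: (integrable_le mO _ I2) => [|x _].
    by apply: measurable_funM; [exact: measurable_indic|exact: (intw_meas I2)].
  rewrite normrM (ger0_norm (_ : 0 <= f x * f x)) -?expr2 ?sqr_ge0//.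
  by rewrite ler_piMl ?sqr_ge0// indicE; case: (_ \in _); rewrite ?normr1 ?normr0.
rewrite (eq_bigr (fun K : T => \int[mu]_(x in Om) (\1_(core (val K)) x * (f x * f x)))); last first.
  by move=> K _; rewrite (inner_cell cT (valP K) Lf).
rewrite -(Rint_sum mO)//; apply: (Rint_ae_le mO) => //.
  by apply: (intw_sum mO).
apply: filterS (mesh_core_ae cT) => x H Ox; have [K KT cx] := H (subset_closure Ox).
rewrite -mulr_suml -[leRHS]mul1r ler_wpM2r// -?expr2 ?sqr_ge0//.
have -> : \sum_(K' : T) \1_(core (val K')) x = mesh_sum T (fun _ _ => 1) x :> R.
  by rewrite /mesh_sum big_seq_fsetE/=; apply: eq_bigr => K' _; rewrite mul1r.
by rewrite (mesh_sumE cT _ KT cx).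
Qed.

(** Absolute continuity of the integral of |X|^2; the threshold depends on X and e only and serves
    all meshes at once. *)
Lemma cell_abs_cont X : inLt X -> forall e : R, 0 < e -> exists2 d : R, 0 < d &
  forall T K, conforming_triangulation Om T -> K \in T -> volume K < d -> nm (cell Om K) X <= e.
Proof.
move=> LX e e0; pose f x := \sum_o X o x * X o x.
have If : intO f by apply: (intw_sum mO) => o; exact: in_L2_int.
have IF : mu.-integrable setT (EFin \o (f \_ Om)).
  by move: If; rewrite (integrable_mkcond _ mO) restrict_EFin.
have [d [d0 Hd]] := integral_normr_continuous IF (exprn_gt0 2 e0).
exists d => // T K cT KT vd; have mc := measurable_cell cT KT.
have vd' : (mu (cell Om K) < d%:E)%E by rewrite -(volume_cell cT KT) lte_fin.
have /ltW H := Hd _ mc vd'.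
rewrite -(@ler_pXn2r _ 2)// ?nnegrE ?nm_ge0 ?(ltW e0)//; apply: le_trans H.
rewrite nm_sqr /tuple_ip -(Rint_sum mc); last first.
  move=> o; have Lo : in_L2 (cell Om K) (X o) by apply: (in_L2_subset mO mc _ (LX o)) => x [].
  exact: in_L2_int.
rewrite le_eqVlt; apply/orP; left; apply/eqP; apply: eq_Rintegral => x /[!inE] -[_ Ox].
rewrite restrictE// ger0_norm//; apply: sumr_ge0 => o _; exact: sqr_ge0.
Qed.

Lemma meshsize_ge0 (T : mesh R n) (x : E) : 0 <= meshsize T x.
Proof. by apply: sumr_ge0 => K _; rewrite mulr_ge0 ?powR_ge0. Qed.

Lemma meshsize_bounded (T : mesh R n) : exists M, forall x : E, meshsize T x <= M.
Proof.
exists (\sum_(K <- T) (volume K `^ (n%:R^-1))) => x; apply: ler_sum => K _.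
by rewrite ler_piMr ?powR_ge0// indicE; case: (_ \in _).
Qed.

Lemma measurable_meshsize T : measurable_fun setT (@meshsize R n T).
Proof.
apply: measurable_sum => K; apply: measurable_funM => //.
by apply: measurable_indic; apply: open_measurable_rV; exact: open_interior.
Qed.

Lemma in_L2_meshsize T : in_L2 Om (@meshsize R n T).
Proof.
have [M HM] := meshsize_bounded T.
apply: (in_L2_bounded mO (M := M)) => //; first exact: (measurable_funS mT _ (measurable_meshsize T)).
by move=> x _; rewrite ger0_norm ?meshsize_ge0//.
Qed.

Variable T : nat -> mesh R n.
Hypothesis cT : forall l, conforming_triangulation Om (T l).
Variable q : R.
Hypotheses (q0 : 0 < q) (q1 : q < 1).
Hypothesis decr : forall l, {ae mu, forall x, Om x -> meshsize (T l.+1) x <= meshsize (T l) x}.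
Hypothesis refined : forall l K, K \in T l -> K \notin T l.+1 ->
  {ae mu, forall x, hull K.1 x -> meshsize (T l.+1) x <= q * meshsize (T l) x}.
Local Notation h l := (meshsize (T l)).

Let Ih l : intO (h l). Proof. exact: (in_L2_int1 mO Ofin (in_L2_meshsize (T l))). Qed.

(* On a refined element K the mesh size drops by (1 - q) |K|^(1/n), while the
   integrals of the mesh sizes form a convergent sequence. *)
Lemma refined_volume (e : R) : 0 < e -> exists N, forall l K, (N <= l)%N ->
  K \in T l -> K \notin T l.+1 -> volume K < e.
Proof.
move=> e0; pose s l := \int[mu]_(x in Om) h l x.
have sdecr l : s l.+1 <= s l by exact: (Rint_ae_le mO (Ih _) (Ih _) (decr l)).
have cs : cvgn s.
  apply: nonincreasing_is_cvgn; first exact/nonincreasing_seqP.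
  by exists 0 => _ [l _ <-]; apply: Rintegral_ge0 => x _; exact: meshsize_ge0.
have ds : (fun l => s l - s l.+1) @ \oo --> (0 : R).
  rewrite -(subrr (limn s)); apply: cvgB => //.
  by rewrite (cvg_shiftS s).
pose c := (1 - q) * (e `^ (n%:R^-1) * e).
have c0 : 0 < c by rewrite !mulr_gt0 ?powR_gt0 ?subr_gt0.
have /cvgrPdist_lt/(_ _ c0)[N _ HN] := ds.
exists N => l K Nl KT KT'; rewrite ltNge; apply/negP => eK.
have := HN l Nl; rewrite /= sub0r normrN ger0_norm ?subr_ge0// ltNge => /negP; apply.
have mc := measurable_cell (cT l) KT.
have k0 : 0 <= (1 - q) * (volume K `^ (n%:R^-1)) by rewrite mulr_ge0 ?powR_ge0// subr_ge0 ltW.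
apply: (@le_trans _ _ ((1 - q) * (volume K `^ (n%:R^-1) * volume K))).
  rewrite ler_pM2l ?subr_gt0//; apply: ler_pM => //; [exact: powR_ge0|exact: ltW|].
  by apply: ge0_ler_powR; rewrite ?nnegrE ?invr_ge0 ?ler0n// ?(ltW e0)// (le_trans (ltW e0)).
have Ic : intO (\1_(cell Om K)).
  by apply: (intw_bounded mO (M := 1)) => // x _; rewrite indicE; case: (_ \in _); rewrite ?normr1 ?normr0.
have -> : (1 - q) * (volume K `^ (n%:R^-1) * volume K) =
    \int[mu]_(x in Om) ((1 - q) * (volume K `^ (n%:R^-1)) * \1_(cell Om K) x).
  rewrite RintegralZl// mulrA; congr (_ * _).
  rewrite /Rintegral integral_indic// setIidl; last by move=> x [].
  exact: (congr1 fine (volume_cell (cT l) KT)).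
rewrite -RintegralB//; apply: (Rint_ae_le mO).
- exact: (intwZ mO _ Ic).
- exact: intwB.
have H1 := refined KT KT'; have H2 := cell_core (cT l) KT.
apply: filterS3 (decr l) H1 H2 => x dx rx cx Ox.
rewrite indicE; case: (pselect (cell Om K x)) => cellx; last by rewrite memNset// mulr0 subr_ge0 dx.
rewrite mem_set// mulr1 -(meshsizeE (cT l) KT ((cx Ox).1 cellx)).
by have := rx cellx.1; rewrite mulrBl mul1r lerD2l lerN2.
Qed.

(** If no element around x is kept for ever, then from every level on the current element is
    eventually refined, which multiplies the mesh size at x by at most q. The monotone limit L then
    satisfies L <= q L, so L = 0. *)
Lemma settled_or_small : {ae mu, forall x, Om x ->
  (exists K l, (forall k, (l <= k)%N -> K \in T k) /\ cell Om K x) \/ (fun l => h l x) @ \oo --> (0 : R)}.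
Proof.
have H1 : {ae mu, forall x, forall l, Om x -> h l.+1 x <= h l x} by apply: ae_foralln => l; exact: decr.
have H2 : {ae mu, forall x, forall l, closure Om x -> exists2 K, K \in T l & core K x}.
  by apply: ae_foralln => l; exact: (mesh_core_ae (cT l)).
have H3 : {ae mu, forall x, forall l, forall K : T l, val K \notin T l.+1 -> hull (val K).1 x ->
    h l.+1 x <= q * h l x}.
  apply: ae_foralln => l; apply: filter_forall => K.
  case: (boolP (val K \in T l.+1)) => KT'; first by apply: aeW => x.
  by apply: filterS (refined (valP K) KT') => x H _; exact: H.
apply: filterS3 H1 H2 H3 => x dx cx rx Ox.
have dec k l : (l <= k)%N -> h k x <= h l x.
  elim: k => [|k IH]; first by rewrite leqn0 => /eqP->.
  by rewrite leq_eqVlt => /predU1P[->//|]; rewrite ltnS => /IH; exact: le_trans (dx k Ox).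
case: (pselect (exists K l, (forall k, (l <= k)%N -> K \in T k) /\ cell Om K x)) => [|nset]; [by left|right].
have step l : exists k, h k x <= q * h l x.
  have [K KT cKx] := cx l (subset_closure Ox).
  have Kx := core_hull (mesh_nd (cT l) KT) cKx.
  have : exists k, K \notin T (l + k)%N.
    apply: contrapT => /forallNP nK; apply: nset; exists K, l; split; last by split.
    by move=> k lk; have := nK (k - l)%N; rewrite subnKC// => /negP; rewrite negbK.
  (* The least level at which K is gone: K is still present one level earlier, and the reduction by
     q takes place between the two. *)
  case/ex_minnP => -[|k]; first by rewrite addn0 KT.
  move=> nk mink; exists (l + k.+1)%N.
  have KTk : K \in T (l + k)%N by apply: contraT => /mink; rewrite ltnn.
  rewrite addnS in nk *.
  apply: (le_trans (rx (l + k)%N (FSetSub KTk) nk Kx)).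
  by rewrite ler_pM2l// dec// leq_addr.
have cvh : cvgn (fun l => h l x).
  apply: nonincreasing_is_cvgn; first by move=> k l kl; exact: dec.
  by exists 0 => _ [l _ <-]; exact: meshsize_ge0.
set L := limn (fun l => h l x) in cvh *.
have Lh l : L <= h l x by apply: (nonincreasing_cvgn_ge (u_ := fun l => h l x)) => // k m km; exact: dec.
have L0 : 0 <= L by apply: limr_ge => //; apply: nearW => l; exact: meshsize_ge0.
suff -> : 0 = L by exact: cvh.
have qL : L <= q * L.
  have cq : (fun l => q * h l x) @ \oo --> q * L by apply: cvgM; [exact: cvg_cst|exact: cvh].
  rewrite -(cvg_lim _ cq)//; apply: limr_ge; first by apply/cvg_ex; exists (q * L).
  by apply: nearW => l; have [k Hk] := step l; exact: le_trans (Lh k) Hk.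
apply/le_anti/andP; split => //.
have : (1 - q) * L <= 0 by rewrite mulrBl mul1r subr_le0.
by rewrite pmulr_rle0// subr_gt0.
Qed.

Variables (M : nat -> mesh R n) (g : R -> R) (X : nat -> I -> E -> R) (Z : I -> E -> R).
Hypotheses (MT : forall l, (M l `<=` T l)%fset) (MT' : forall l K, K \in M l -> K \notin T l.+1).
Hypothesis hg : marking_function g.
Hypotheses (LX : forall l, inLt (X l)) (LZ : inLt Z).
Hypothesis XZ : (fun l => nm Om (fun i x => X l i x - Z i x)) @ \oo --> (0 : R).
Hypothesis mark : forall l, \big[Num.max/0]_(K <- (T l `\` M l)%fset) nm (cell Om K) (X l) <=
  g (\big[Num.max/0]_(K <- M l) nm (cell Om K) (X l)).

Lemma nm_cell_le l K (Y : I -> E -> R) : K \in T l -> inLt Y -> nm (cell Om K) Y <= nm Om Y.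
Proof.
move=> KT LY; rewrite -(@ler_pXn2r _ 2)// ?nnegrE ?nm_ge0//.
apply: le_trans (mesh_nm_le (cT l) LY); rewrite (big_fsetD1 K KT)/= lerDl.
by apply: sumr_ge0 => K' _; exact: sqr_ge0.
Qed.

Lemma inLt_cell l K (Y : I -> E -> R) : K \in T l -> inLt Y -> in_tuple_L2 (cell Om K) Y.
Proof.
by move=> KT LY i; apply: (in_L2_subset mO (measurable_cell (cT l) KT) _ (LY i)) => x [].
Qed.

(** Marked elements are refined, hence of small volume at late levels; Z is small on them by
    absolute continuity, and X l is close to Z in norm. *)
Lemma marked_small (e : R) : 0 < e -> exists N, forall l K, (N <= l)%N -> K \in M l ->
  nm (cell Om K) (X l) <= e.
Proof.
move=> e0; have e2 : 0 < e / 2 by lra.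
have [d d0 Hd] := cell_abs_cont LZ e2.
have [N1 HN1] := refined_volume d0.
have /cvgrPdist_le/(_ _ e2)[N2 _ HN2] := XZ.
exists (maxn N1 N2) => l K; rewrite geq_max => /andP[l1 l2] KM.
have KT := fsubsetP (MT l) K KM.
have mc := measurable_cell (cT l) KT.
apply: (le_trans (nm_le_add mc (inLt_cell KT (LX l)) (inLt_cell KT LZ))).
have -> : e = e / 2 + e / 2 by field.
apply: lerD; first exact: (Hd (T l) K (cT l) KT (HN1 l K l1 KT (MT' KM))).
apply: (le_trans (nm_cell_le KT (inLtB mO (LX l) LZ))).
by have := HN2 l l2; rewrite /= sub0r normrN ger0_norm ?nm_ge0.
Qed.

(** A kept element is never marked, so the marking assumption bounds its indicator by g of the
    largest marked one. That one tends to 0, and g is continuous at 0 with g 0 = 0. *)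
Lemma settled_residual0 K l : (forall k, (l <= k)%N -> K \in T k) -> nm (cell Om K) Z = 0.
Proof.
move=> HK; apply/le_anti; rewrite nm_ge0 andbT; apply/ler_addgt0Pr => e e0; rewrite add0r.
have KT := HK l (leqnn l); have mc := measurable_cell (cT l) KT.
have e2 : 0 < e / 2 by lra.
have [g0 gc gz] := hg.
have /cvgrPdist_le/(_ _ e2) := gc; rewrite near_withinE => /nbhs_ballP[d /= d0 Hd].
have d2 : 0 < d / 2 by lra.
have [N1 HN1] := marked_small d2.
have /cvgrPdist_le/(_ _ e2)[N2 _ HN2] := XZ.
pose k := maxn l (maxn N1 N2).
have [lk k1 k2] : [/\ (l <= k)%N, (N1 <= k)%N & (N2 <= k)%N].
  by split; rewrite /k ?leq_maxl// (leq_trans _ (leq_maxr _ _))// ?leq_maxl ?leq_maxr.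
have KTk := HK k lk.
have KM : K \notin M k by apply/negP => /MT'; rewrite HK// (leq_trans lk).
have b1 : nm (cell Om K) (X k) <= e / 2.
  apply: (@le_trans _ _ (\big[Num.max/0]_(K <- (T k `\` M k)%fset) nm (cell Om K) (X k))).
    by apply: (@unstable.le_bigmax_seq _ _ _ _ _ K xpredT) => //; rewrite !inE KM.
  apply: (le_trans (mark k)); set y := \big[_/_]_(_ <- _) _.
  have y0 : 0 <= y by rewrite /y; apply: bigmax_ge_id.
  have yd : y <= d / 2.
    rewrite /y big_seq_cond; apply: bigmax_le; first exact: ltW.
    by move=> K' /andP[KM' _]; exact: HN1.
  have := Hd y; rewrite /ball/= sub0r normrN ger0_norm// => /(_ _ y0).
  by rewrite gz sub0r normrN ger0_norm ?g0//; apply; lra.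
apply: (le_trans (nm_le_add mc (inLt_cell KT LZ) (inLt_cell KT (LX k)))).
have -> : e = e / 2 + e / 2 by field.
apply: lerD => //; apply: (le_trans (nm_cell_le KT (inLtB mO LZ (LX k)))).
by have := HN2 k k2; rewrite /= sub0r normrN ger0_norm ?nm_ge0// nmBC.
Qed.

(** Dominated convergence: almost everywhere either Z vanishes, on settled elements, or the mesh
    size tends to 0. The dominating function is |Z| times a bound for the initial mesh size. *)
Lemma residual_meshsize o : (fun l => \int[mu]_(x in Om) (`|Z o x| * h l x)) @ \oo --> (0 : R).
Proof.
have Iz : intO (Z o) by exact: in_L2_int1.
have [M0 HM0] := meshsize_bounded (T 0).
have mZ : measurable_fun Om (Z o) by case: (LZ o).
have mZh l : measurable_fun Om (fun x => `|Z o x| * h l x).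
  by apply: measurable_funM; [exact: measurableT_comp|case: (in_L2_meshsize (T l))].
have settled : {ae mu, forall x, Om x -> forall l K, (forall k, (l <= k)%N -> K \in T k) -> cell Om K x -> Z o x = 0}.
  have H : {ae mu, forall x, forall l, forall K : T l, (forall k, (l <= k)%N -> val K \in T k) ->
      cell Om (val K) x -> Z o x = 0}.
    apply: ae_foralln => l; apply: filter_forall => K.
    case: (pselect (forall k, (l <= k)%N -> val K \in T k)) => HK; last by apply: aeW => x.
    have LZc := inLt_cell (valP K) LZ.
    have := nm_eq0_ae (measurable_cell (cT l) (valP K)) LZc (settled_residual0 HK) o.
    by apply: filterS => x.
  apply: filterS H => x Hx Ox l K HK; exact: (Hx l (FSetSub (HK l (leqnn l)))).
have lim0 : {ae mu, forall x, Om x -> (fun l => `|Z o x| * h l x) @ \oo --> (0 : R)}.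
  apply: filterS2 settled settled_or_small => x sx Hx Ox.
  case: (Hx Ox) => [[K [l [HK Kx]]]|hx].
    rewrite (sx Ox l K HK Kx) normr0.
    have -> : (fun l => 0 * h l x) = fun=> 0 by apply/funext => k; rewrite mul0r.
    exact: cvg_cst.
  by rewrite -(mulr0 `|Z o x|); apply: cvgM => //; exact: cvg_cst.
have bnd : {ae mu, forall x, forall l, Om x -> `| `|Z o x| * h l x | <= M0 * `|Z o x|}.
  have : {ae mu, forall x, forall l, Om x -> h l.+1 x <= h l x} by apply: ae_foralln => l; exact: decr.
  apply: filterS => x dx l Ox; rewrite normrM normr_id mulrC ler_wpM2r// ger0_norm ?meshsize_ge0//.
  by elim: l => [|l IH]; [exact: HM0|exact: le_trans (dx l Ox) IH].
have Ig : intO (fun x => M0 * `|Z o x|) by exact: (intwZ mO _ (intw_norm Iz)).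
have [] := @dominated_convergence _ _ R mu Om mO (fun l x => (`|Z o x| * h l x)%:E) (fun=> 0%E)
  (fun x => (M0 * `|Z o x|)%:E).
- by move=> l; exact/measurable_EFinP.
- exact: measurable_cst.
- by apply: filterS lim0 => x H Ox; apply: cvg_EFin; [exact: nearW|exact: H].
- exact: Ig.
- by apply: filterS bnd => x H l Ox; rewrite lee_fin; exact: H.
move=> _ _; rewrite integral0 => /fine_cvg; exact.
Qed.

End MeshLimit.

(** * Energy, Galerkin solutions and flux data *)

Section Nonlinear.
Context {R : realType} {n : nat}.
Local Notation E := 'rV[R]_n.
Variable Om : set E.
Hypotheses (oO : open Om) (bO : bounded_set Om) (hn : n = 2%N \/ n = 3%N).
Let mO := mOm oO.
Let Ofin := Omfin oO bO.
Variable f : E -> R.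
Hypothesis Lf : in_L2 Om f.
Local Notation ip := (@tuple_ip R n Om (option 'I_n)).
Local Notation nm := (@tuple_nm R n Om (option 'I_n)).
Local Notation inLt := (@in_tuple_L2 R n Om (option 'I_n)).
Local Notation wjet v := (jet v (wgrad Om v)).
Implicit Types (u v w : E -> R) (tau sigma : E -> E).

Lemma ip_jet v w G H : in_vL2 Om G -> in_vL2 Om H ->
  ip (jet v G) (jet w H) = inner Om v w + vinner Om G H.
Proof. by move=> LG LH; rewrite /tuple_ip sum_option (vinnerE mO LG LH). Qed.

Lemma H10_L2 v : in_H10 Om v -> in_L2 Om v. Proof. by case=> -[]. Qed.

Lemma H10_grad_L2 v : in_H10 Om v -> in_vL2 Om (wgrad Om v).
Proof. by move=> /H10_H1 /H1_grad[]. Qed.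

Lemma cube_L2 v : in_H10 Om v -> in_L2 Om (fun x => v x ^+ 3).
Proof.
move=> Hv; have n0 : 0 <= norm1 Om v by exact: sqrtr_ge0.
by have [] := H10_cube oO bO hn Hv (b := norm1 Om v + 1) ltac:(lra) ltac:(lra).
Qed.

Lemma H10_wjet v : in_H10 Om v -> inLt (wjet v).
Proof. by move=> /H10_H1; exact: H1_jet. Qed.

Lemma a_nlE w v : in_H10 Om w -> in_H10 Om v ->
  a_nl Om w v = ip (wjet w) (wjet v) + inner Om (fun x => w x ^+ 3) v.
Proof.
by move=> Hw Hv; rewrite /a_nl (ip_jet _ _ (H10_grad_L2 Hw) (H10_grad_L2 Hv)) [_ + inner _ w v]addrC.
Qed.

Lemma inner_cube_ge0 v : 0 <= inner Om (fun x => v x ^+ 3) v.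
Proof. by apply: Rintegral_ge0 => x _; rewrite -exprSr (_ : 4 = 2 * 2)%N// exprM sqr_ge0. Qed.

(** Equal to -2 times the convex energy |v|^2 / 2 + (v^3, v) / 4 - (f, v), with |v| the H^1 norm.
    With this sign Galerkin values increase along nested spaces, and the scaling makes the gap
    dominate the squared distance with constant 1. *)
Definition energy v := - nm (wjet v) ^+ 2 - 2^-1 * inner Om (fun x => v x ^+ 3) v + 2 * inner Om f v.

(** The tangent inequality for t^4, from w^4 - 4 v^3 w + 3 v^4 = (w - v)^2 ((w + v)^2 + 2 v^2). *)
Lemma quartic_convex v w : in_H10 Om v -> in_H10 Om w ->
  4 * inner Om (fun x => v x ^+ 3) w <=
  inner Om (fun x => w x ^+ 3) w + 3 * inner Om (fun x => v x ^+ 3) v.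
Proof.
move=> Hv Hw; have Iww := in_L2_int mO (cube_L2 Hw) (H10_L2 Hw).
have Ivv := in_L2_int mO (cube_L2 Hv) (H10_L2 Hv); have Ivw := in_L2_int mO (cube_L2 Hv) (H10_L2 Hw).
rewrite /inner -!RintegralZl// -RintegralD//; last exact: (intwZ mO).
apply: (Rint_ae_le mO); [exact: (intwZ mO)|exact: (intwD mO Iww (intwZ mO _ Ivv))|apply: aeW => x _].
rewrite -subr_ge0.
have -> : w x ^+ 3 * w x + 3 * (v x ^+ 3 * v x) - 4 * (v x ^+ 3 * w x) =
  (w x - v x) ^+ 2 * ((w x + v x) ^+ 2 + 2 * v x ^+ 2) by ring.
by apply: mulr_ge0; [|apply: addr_ge0; [|apply: mulr_ge0 => //]]; exact: sqr_ge0.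
Qed.

(** The equation for v, tested with w and with v, eliminates f. The quadratic terms leave the
    squared distance, and the quartic ones are nonnegative by [quartic_convex]. *)
Lemma energy_gap v w : in_H10 Om v -> in_H10 Om w ->
  a_nl Om v w = inner Om f w -> a_nl Om v v = inner Om f v ->
  nm (fun o x => wjet w o x - wjet v o x) ^+ 2 <= energy v - energy w.
Proof.
move=> Hv Hw; rewrite !a_nlE// => avw avv.
have := quartic_convex Hv Hw; rewrite (nm_sub_sqr mO (H10_wjet Hw) (H10_wjet Hv)) /energy -avw -avv.
rewrite -(nm_sqr Om (wjet v)) (ipC Om (wjet v)).
move: (nm _ ^+ 2) (nm _ ^+ 2) (ip _ _) (inner _ _ _) (inner _ _ _) (inner _ _ _) => a b c d e k; lra.
Qed.

Section Galerkin.
Variables (V : (E -> R) -> Prop).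
Hypothesis VH : forall v, V v -> in_H10 Om v.

Lemma galerkin_bound u : solves_nl Om f V u -> norm1 Om u <= norm0 Om f.
Proof.
move=> [Vu su]; have Hu := VH Vu; have := su u Vu; rewrite a_nlE// -nm_sqr => uu.
have E1 := norm1_wjet oO bO (H10_H1 Hu); rewrite -E1 in uu.
have c1 := inner_cube_ge0 u.
have c2 : inner Om f u <= norm0 Om f * norm1 Om u.
  apply: (le_trans (inner_le mO Lf (H10_L2 Hu))).
  rewrite ler_wpM2l ?norm0_ge0// E1; exact: (nm_ge_comp Om (wjet u) None).
have : 0 <= norm1 Om u by exact: sqrtr_ge0.
rewrite le_eqVlt => /orP[/eqP<-|u0]; first exact: norm0_ge0.
rewrite -(ler_pM2r u0) -expr2; lra.
Qed.

End Galerkin.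

Lemma nl_unique v w : solves_nl Om f (in_H10 Om) v -> solves_nl Om f (in_H10 Om) w ->
  nm (fun o x => wjet v o x - wjet w o x) = 0.
Proof.
move=> [Hv sv] [Hw sw].
have g1 := energy_gap Hv Hw (sv w Hw) (sv v Hv); have g2 := energy_gap Hw Hv (sw v Hv) (sw w Hw).
rewrite nmBC in g1; apply/eqP; rewrite -sqrf_eq0; apply/eqP/le_anti; rewrite sqr_ge0 andbT.
move: g1 g2; set a := _ ^+ 2; lra.
Qed.

(** For l <= L the function [u l] is admissible in the equation of [u L], so [energy_gap] bounds
    their squared distance by the increase of [energy], which is bounded above. *)
Lemma galerkin_nl_cvg (V : nat -> (E -> R) -> Prop) (u : nat -> E -> R) :
  (forall l v, V l v -> in_H10 Om v) -> (forall l L v, (l <= L)%N -> V l v -> V L v) ->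
  (forall l, solves_nl Om f (V l) (u l)) ->
  exists2 U, in_H10 Om U & (fun l => nm (fun o x => wjet (u l) o x - wjet U o x)) @ \oo --> (0 : R).
Proof.
move=> VH Vsub su; have Hu l : in_H10 Om (u l) by apply: (VH l); exact: (su l).1.
have Lu l := H10_wjet (Hu l).
have [X LX uX] : exists2 X, inLt X & (fun l => nm (fun o x => wjet (u l) o x - X o x)) @ \oo --> (0 : R).
  apply: (tail_complete mO Ofin Lu) => e e0.
  apply: (@quasi_cauchy R (fun l => energy (u l)) (fun l L => nm (fun o x => wjet (u l) o x - wjet (u L) o x) ^+ 2)
    (fun _ _ => 0) (2 * (norm0 Om f * norm0 Om f))) => //; last by move=> k k0; exists 0%N => ? ? _ _; exact: ltW.
  - move=> l; have b := galerkin_bound (VH l) (su l); have c1 := inner_cube_ge0 (u l).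
    have c2 : inner Om f (u l) <= norm0 Om f * norm0 Om f.
      apply: (le_trans (inner_le mO Lf (H10_L2 (Hu l)))).
      rewrite ler_wpM2l ?norm0_ge0//; apply: le_trans b; rewrite (norm1_wjet oO bO (H10_H1 (Hu l))).
      exact: (nm_ge_comp Om (wjet (u l)) None).
    have := sqr_ge0 (nm (wjet (u l))); rewrite /energy; lra.
  - move=> l L lL; rewrite addr0; apply: energy_gap => //; last exact: (su L).2 _ (su L).1.
    exact: (su L).2 _ (Vsub l L _ lL (su l).1).
have [HU wU] : in_H10 Om (X None) /\ is_weak_grad Om (X None) (fun x => \row_i X (Some i) x).
  apply: (H10_closed oO bO LX) => e e0; have /cvgrPdist_lt/(_ _ e0)[N _ HN] := uX.
  exists (u N) => //; have := HN N (leqnn N); by rewrite /= sub0r normrN ger0_norm ?nm_ge0.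
exists (X None) => //; have LU := H10_wjet HU.
have -> : (fun l => nm (fun o x => wjet (u l) o x - wjet (X None) o x)) =
    (fun l => nm (fun o x => wjet (u l) o x - X o x)); last exact: uX.
apply/funext => l; apply: (nm_ae mO); [exact: (inLtB mO)|exact: (inLtB mO)|move=> o].
apply: filterS (wjetP oO bO (H10_L2 HU) wU o) => x H Ox; rewrite H//; congr (_ - _).
by case: o {H} => [i|] /=; rewrite ?mxE.
Qed.

(** The target of the flux step: (div sigma, sigma) is the L^2 projection of this pair onto the
    pairs (div tau, tau) with tau in RT0. *)
Definition flux_data u := jet (fun x => f x - u x - u x ^+ 3) (fun x => - wgrad Om u x).

Lemma flux_data_L2 u : in_H10 Om u -> inLt (flux_data u).
Proof.
move=> Hu o; case: o => [i|] /=.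
  by apply: (in_L2_ext mO _ (in_L2N mO (H10_grad_L2 Hu i))) => x _; rewrite /flux_data /jet mxE.
exact: (in_L2B mO (in_L2B mO Lf (H10_L2 Hu)) (cube_L2 Hu)).
Qed.

Lemma vinnerN tau sigma : in_vL2 Om tau -> in_vL2 Om sigma ->
  vinner Om (fun x => - tau x) sigma = - vinner Om tau sigma.
Proof.
move=> Lt Ls; have Ltn : in_vL2 Om (fun x => - tau x).
  by move=> i; apply: (in_L2_ext mO _ (in_L2N mO (Lt i))) => x _; rewrite mxE.
rewrite !(vinnerE mO)// -sumrN; apply: eq_bigr => i _.
rewrite -mulN1r -(innerZl mO)//; apply: inner_ext => // x _; by rewrite mxE mulN1r.
Qed.

Lemma flux_data_ip u v : in_H10 Om u -> in_H10 Om v ->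
  ip (flux_data u) (wjet v) = inner Om f v - a_nl Om u v.
Proof.
move=> Hu Hv; have LG : in_vL2 Om (fun x => - wgrad Om u x).
  by move=> i; exact: (flux_data_L2 Hu (Some i)).
rewrite (ip_jet _ _ LG (H10_grad_L2 Hv)) (vinnerN (H10_grad_L2 Hu) (H10_grad_L2 Hv)) /a_nl.
have Lu := H10_L2 Hu; have Lv := H10_L2 Hv; have Lc := cube_L2 Hu.
by rewrite (innerBl' oO (in_L2B mO Lf Lu) Lc Lv) (innerBl' oO Lf Lu Lv); ring.
Qed.

Lemma flux_data_cvg (u : nat -> E -> R) U b : (forall l, in_H10 Om (u l)) -> in_H10 Om U ->
  (forall l, norm1 Om (u l) <= b) -> norm1 Om U <= b -> 0 < b ->
  (fun l => nm (fun o x => wjet (u l) o x - wjet U o x)) @ \oo --> (0 : R) ->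
  (fun l => nm (fun o x => flux_data (u l) o x - flux_data U o x)) @ \oo --> (0 : R).
Proof.
move=> Hu HU ub Ub b0 uU; set d := fun l => nm _ in uU *.
have d0 l : 0 <= d l by exact: nm_ge0.
pose C : R := 3 * 13 ^+ 2 * b ^+ 2.
have C0 : 0 <= C by rewrite /C; apply: mulr_ge0; [apply: mulr_ge0; [exact: ler0n|exact: sqr_ge0]|exact: sqr_ge0].
have cube l : norm0 Om (fun x => u l x ^+ 3 - U x ^+ 3) <= C * d l.
  have E1 : norm1 Om (u l \- U) = d l by rewrite (norm1B oO bO (H10_H1 (Hu l)) (H10_H1 HU)).
  (* [H10_cubeB] asks for a positive bound on the distance, and [d l] may be 0; so it is used with d
     l + 1/(k+1), and k tends to infinity. *)
  have lim : (fun k : nat => 3 * 13 ^+ 2 * (d l + k.+1%:R^-1) * b ^+ 2) @ \oo --> 3 * 13 ^+ 2 * (d l + 0) * b ^+ 2.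
    apply: cvgM; last exact: cvg_cst.
    apply: cvgM; first exact: cvg_cst.
    by apply: cvgD; [exact: cvg_cst|exact: cvg_harmonic].
  rewrite (_ : C * d l = 3 * 13 ^+ 2 * (d l + 0) * b ^+ 2); last by rewrite /C addr0 mulrAC.
  rewrite -(cvg_lim _ lim)//; apply: limr_ge; first by apply/cvg_ex; exists (3 * 13 ^+ 2 * (d l + 0) * b ^+ 2).
  apply: nearW => k.
  have k0 : 0 < k.+1%:R^-1 :> R by rewrite invr_gt0 ltr0n.
  have dk : 0 < d l + k.+1%:R^-1 by exact: (ltr_wpDl (d0 l) k0).
  apply: (H10_cubeB oO bO hn (Hu l) HU dk b0 _ (ub l) Ub).
  by rewrite E1 lerDl ltW.
have comp l o : norm0 Om (fun x => flux_data (u l) o x - flux_data U o x) <= (1 + C) * d l.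
  have LuU := inLtB mO (H10_wjet (Hu l)) (H10_wjet HU).
  case: o => [i|] /=.
    rewrite (norm0_ext (g := fun x => wgrad Om U x ord0 i - wgrad Om (u l) x ord0 i)); last first.
      by move=> x _; rewrite !mxE opprK addrC.
    rewrite norm0BC; apply: (le_trans (nm_ge_comp Om (fun o x => wjet (u l) o x - wjet U o x) (Some i))).
    by rewrite -/(d l) mulrDl mul1r lerDl mulr_ge0.
  have L1 := LuU None; have L2 := in_L2B mO (cube_L2 (Hu l)) (cube_L2 HU).
  rewrite norm0BC (norm0_ext (g := fun x => (u l x - U x) + (u l x ^+ 3 - U x ^+ 3))); last first.
    by move=> x _; ring.
  apply: (le_trans (norm0D oO L1 L2)); rewrite mulrDl mul1r lerD//.
  exact: (nm_ge_comp Om (fun o x => wjet (u l) o x - wjet U o x) None).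
apply: (@squeeze_cvgr _ _ _ _ (fun=> 0) (fun l => (\sum_(o : option 'I_n) (1 + C)) * d l)).
- apply: nearW => l; rewrite nm_ge0/= (le_trans (nm_le_sum _ _))// mulr_suml.
  by apply: ler_sum => o _; exact: comp.
- exact: cvg_cst.
- move: (\sum_(o : option 'I_n) (1 + C)) => c; rewrite -(mulr0 c).
  by apply: (cvgM _ uU); exact: cvg_cst.
Qed.

End Nonlinear.

(** * The residual and its orthogonality relations *)

Section Residual.
Context {R : realType} {n : nat}.
Local Notation E := 'rV[R]_n.
Variable Om : set E.
Hypotheses (oO : open Om) (bO : bounded_set Om) (lO : lipschitz_boundary Om).
Hypothesis hn : n = 2%N \/ n = 3%N.
Let mO := mOm oO.
Variable f : E -> R.
Hypothesis Lf : in_L2 Om f.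
Local Notation ip := (@tuple_ip R n Om (option 'I_n)).
Local Notation nm := (@tuple_nm R n).
Local Notation inLt := (@in_tuple_L2 R n Om (option 'I_n)).
Local Notation wjet v := (jet v (wgrad Om v)).
Local Notation djet s := (jet (wdiv Om s) s).
Local Notation tjet phi := (jet phi (fun x => \row_i pderiv i phi x)).
Local Notation data u := (flux_data Om f u).
Implicit Types (u v : E -> R) (tau sigma : E -> E).

Lemma Hdiv_wdiv sigma : in_Hdiv Om sigma -> is_weak_div Om sigma (wdiv Om sigma).
Proof. by case=> _ [D]; exact: wdivP. Qed.

Lemma Hdiv_jet sigma : in_Hdiv Om sigma -> inLt (djet sigma).
Proof.
move=> Hs o; case: o => [i|] /=; last exact: (Hdiv_wdiv Hs).1.
exact: (Hs.1 i).
Qed.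

Lemma weak_divB s t D D' : in_vL2 Om s -> in_vL2 Om t -> is_weak_div Om s D -> is_weak_div Om t D' ->
  is_weak_div Om (fun x => s x - t x) (fun x => D x - D' x).
Proof.
move=> Ls Lt [LD ws] [LD' wt]; split=> [|phi tp]; first exact: in_L2B.
have Lg i := test_jet_L2 oO tp (Some i).
have Lst : in_vL2 Om (fun x => s x - t x).
  by move=> i; apply: (in_L2_ext mO _ (in_L2B mO (Ls i) (Lt i))) => x _; rewrite !mxE.
rewrite (innerBl' oO LD LD' (test_L2 oO tp)) opprB -(opprK (inner Om D' phi)) -wt// addrC -ws//.
rewrite (vinnerE mO Lst Lg) (vinnerE mO Ls Lg) (vinnerE mO Lt Lg) -sumrB; apply: eq_bigr => i _.
by rewrite -(innerBl' oO (Ls i) (Lt i) (Lg i)); apply: inner_ext => // x _; rewrite !mxE.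
Qed.

Definition residual sigma u o x := djet sigma o x - data u o x.

Lemma residual_L2 sigma u : in_Hdiv Om sigma -> in_H10 Om u -> inLt (residual sigma u).
Proof. by move=> Hs Hu; apply: (inLtB mO); [exact: Hdiv_jet|exact: (flux_data_L2 oO bO hn Lf)]. Qed.

Lemma eta_elem_nm T K sigma u : conforming_triangulation Om T -> K \in T ->
  in_Hdiv Om sigma -> in_H10 Om u -> eta_elem Om f K sigma u = nm (cell Om K) (residual sigma u).
Proof.
move=> cT KT Hs Hu; have mc := measurable_cell oO cT KT.
have Lr o : in_L2 (cell Om K) (residual sigma u o).
  by apply: (in_L2_subset mO mc _ (residual_L2 Hs Hu o)) => x [].
have Lv : in_vL2 (cell Om K) (fun x => sigma x + wgrad Om u x).
  move=> i; apply: (in_L2_ext mc _ (Lr (Some i))) => x _.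
  by rewrite /residual /flux_data /jet !mxE opprK.
rewrite /eta_elem /tuple_nm (vnorm0_sqr mc Lv) norm0_sqr /tuple_ip sum_option addrC; congr (Num.sqrt (_ + _)).
  by apply: inner_ext => x _; rewrite /residual /flux_data /jet; ring.
apply: eq_bigr => i _; rewrite norm0_sqr; apply: inner_ext => x _;
  by rewrite /residual /flux_data /jet !mxE opprK.
Qed.

Lemma eta_le_nm T sigma u : conforming_triangulation Om T -> in_Hdiv Om sigma -> in_H10 Om u ->
  eta Om f T sigma u <= nm Om (residual sigma u).
Proof.
move=> cT Hs Hu; rewrite -[leRHS](ger0_norm (nm_ge0 Om _)) -sqrtr_sqr; apply: ler_wsqrtr.
apply: le_trans (mesh_nm_le oO cT (residual_L2 Hs Hu)).
rewrite le_eqVlt; apply/orP; left; apply/eqP; apply: eq_big_seq => K KT.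
by rewrite (eta_elem_nm cT KT Hs Hu).
Qed.

Lemma nr_ip T u sigma tau : in_H10 Om u -> solves_nr Om f T u sigma -> RT0_space Om T tau ->
  ip (djet sigma) (djet tau) = ip (data u) (djet tau).
Proof.
move=> Hu [Ws ss] Wt; have Hs := Ws.1; have Ht := Wt.1.
have Ld : in_vL2 Om (fun x => - wgrad Om u x).
  by move=> i; exact: (flux_data_L2 oO bO hn Lf Hu (Some i)).
by rewrite (ip_jet oO _ _ Hs.1 Ht.1) (ip_jet oO _ _ Ld Ht.1) addrC ss// addrC.
Qed.

Lemma residual_RT0 T u sigma tau : in_H10 Om u -> solves_nr Om f T u sigma -> RT0_space Om T tau ->
  ip (residual sigma u) (djet tau) = 0.
Proof.
move=> Hu ss Wt; rewrite (ipBl mO); [by rewrite (nr_ip Hu ss Wt) subrr|exact: (Hdiv_jet ss.1.1)| |exact: (Hdiv_jet Wt.1)].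
exact: (flux_data_L2 oO bO hn Lf Hu).
Qed.

(** Green's formula. Against (v, grad v) the flux part of the residual is invisible, and only the
    Galerkin equation is left. *)
Lemma djet_H10 sigma v : in_Hdiv Om sigma -> in_H10 Om v -> ip (djet sigma) (wjet v) = 0.
Proof.
move=> Hs Hv; rewrite (ip_jet oO _ _ Hs.1 (H10_grad_L2 Hv)).
by rewrite (weak_div_H10 oO bO Hs.1 (Hdiv_wdiv Hs) Hv) subrr.
Qed.

Lemma residual_P1 (V : (E -> R) -> Prop) u sigma v : (forall v, V v -> in_H10 Om v) ->
  solves_nl Om f V u -> in_Hdiv Om sigma -> V v -> ip (residual sigma u) (wjet v) = 0.
Proof.
move=> VH [Vu su] Hs Vv; have Hu := VH u Vu; have Hv := VH v Vv.
rewrite (ipBl mO); [|exact: Hdiv_jet|exact: (flux_data_L2 oO bO hn Lf Hu)|exact: (H10_wjet Hv)].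
by rewrite (djet_H10 Hs Hv) (flux_data_ip oO bO hn Lf Hu Hv) su// subrr subr0.
Qed.

(* For a residual orthogonal to all test fields phi e_m, the identity says that p = R None
   has gradient R (Some i) and zero trace; p itself is then an admissible test function. *)
Lemma residual_eq0 X : inLt X ->
  (forall phi, test_function Om phi -> ip X (tjet phi) = 0) ->
  (forall phi m, test_function setT phi ->
     ip X (jet (pderiv m phi) (fun x => \row_i ((i == m)%:R * phi x))) = 0) ->
  nm Om X = 0.
Proof.
move=> LX X1 X2.
have zt : zero_trace Om (X None) (fun i => X (Some i)).
  split=> [|i|phi tp i]; [exact: LX|exact: LX|].
  have := X2 phi i tp; rewrite /tuple_ip sum_option /= (bigD1 i)//= big1 ?addr0; last first.
    move=> j ji; rewrite -[RHS](mul0r (inner Om (X (Some j)) phi)) innerC.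
    have Lp := test_L2 oO tp.
    rewrite -(innerZl mO _ (LX (Some j)) Lp) innerC; apply: eq_Rintegral => x _.
    by rewrite /jet mxE (negbTE ji) !mul0r mulr0.
  rewrite (_ : inner Om (X (Some i)) _ = inner Om (X (Some i)) phi); last first.
    by apply: inner_ext => // x _; rewrite /jet mxE eqxx mul1r.
  by move/eqP; rewrite addr_eq0 => /eqP.
have [Hp wp] := zero_trace_H10 oO bO lO zt.
have := H10_density oO bO LX X1 Hp.
rewrite (ip_ae mO (F' := X) (G' := X) LX LX (H10_wjet Hp) LX).
- by rewrite -nm_sqr => /eqP; rewrite sqrf_eq0 => /eqP.
- by move=> o; apply: aeW.
move=> o; apply: filterS (wjetP oO bO (H10_L2 Hp) wp o) => x H Ox; rewrite H//.
by case: o {H} => [i|] //=; rewrite mxE.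
Qed.

End Residual.

(** * Assembling the convergence proof *)

Section AdaptiveConvergence.
Context {R : realType} {n : nat}.
Local Notation E := 'rV[R]_n.
Local Notation mu := (lebesgue R n).
Variable Om : set E.
Hypotheses (oO : open Om) (bO : bounded_set Om) (lO : lipschitz_boundary Om).
Hypothesis hn : n = 2%N \/ n = 3%N.
Let mO := mOm oO.
Let Ofin := Omfin oO bO.
Variable f : E -> R.
Hypothesis Lf : in_L2 Om f.
Local Notation ip := (@tuple_ip R n Om (option 'I_n)).
Local Notation nm := (@tuple_nm R n).
Local Notation inLt := (@in_tuple_L2 R n Om (option 'I_n)).
Local Notation wjet v := (jet v (wgrad Om v)).
Local Notation djet s := (jet (wdiv Om s) s).
Local Notation tjet phi := (jet phi (fun x => \row_i pderiv i phi x)).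
Local Notation data u := (flux_data Om f u).
Local Notation "X ~~> Z" := ((fun k => nm Om (fun i x => X k i x - Z i x)) @ \oo --> 0) (at level 70).

Variables (T M : nat -> mesh R n) (u : nat -> E -> R) (sigma : nat -> E -> E).
Variables (kappa q : R) (g : R -> R).
Hypothesis cT : forall l, conforming_triangulation Om (T l).
Hypothesis nvbT : forall l, nvb_refines (T l) (T l.+1).
Hypotheses (kappa0 : 0 <= kappa) (sT : forall l, shape_regular kappa (T l)).
Hypotheses (MT : forall l, (M l `<=` T l)%fset) (MT' : forall l K, K \in M l -> K \notin T l.+1).
Hypotheses (q0 : 0 < q) (q1 : q < 1).
Hypothesis decr : forall l, {ae mu, forall x, Om x -> meshsize (T l.+1) x <= meshsize (T l) x}.
Hypothesis refined : forall l K, K \in T l -> K \notin T l.+1 ->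
  {ae mu, forall x, hull K.1 x -> meshsize (T l.+1) x <= q * meshsize (T l) x}.
Hypothesis hg : marking_function g.
Hypothesis mark : forall l, marking Om f g (T l) (M l) (sigma l) (u l).
Hypothesis hu : forall l, solves_nl Om f (P1_space Om (T l)) (u l).
Hypothesis hs : forall l, solves_nr Om f (T l) (u l) (sigma l).

Let Hu l : in_H10 Om (u l). Proof. exact: (hu l).1.1. Qed.
Let Hs l : in_Hdiv Om (sigma l). Proof. exact: (hs l).1.1. Qed.

Lemma P1_nested_le l L v : (l <= L)%N -> P1_space Om (T l) v -> P1_space Om (T L) v.
Proof.
elim: L => [|L IH]; first by rewrite leqn0 => /eqP->.
rewrite leq_eqVlt => /predU1P[->//|]; rewrite ltnS => lL /(IH lL).
exact: (P1_nested (cT L) (nvbT L)).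
Qed.

Lemma RT0_nested_le l L tau : (l <= L)%N -> RT0_space Om (T l) tau -> RT0_space Om (T L) tau.
Proof.
elim: L => [|L IH]; first by rewrite leqn0 => /eqP->.
rewrite leq_eqVlt => /predU1P[->//|]; rewrite ltnS => lL /(IH lL).
exact: (RT0_nested (cT L) (nvbT L)).
Qed.

Lemma residual_mark l :
  \big[Num.max/0]_(K <- (T l `\` M l)%fset) nm (cell Om K) (residual Om f (sigma l) (u l)) <=
  g (\big[Num.max/0]_(K <- M l) nm (cell Om K) (residual Om f (sigma l) (u l))).
Proof.
have := mark l; rewrite /marking.
rewrite (eq_big_seq (fun K => nm (cell Om K) (residual Om f (sigma l) (u l)))); last first.
  by move=> K; rewrite inE => /andP[_ KT]; exact: (eta_elem_nm oO bO hn Lf (cT l) KT (Hs l) (Hu l)).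
rewrite [X in g X](eq_big_seq (fun K => nm (cell Om K) (residual Om f (sigma l) (u l))))//.
by move=> K /(fsubsetP (MT l)) KT; exact: (eta_elem_nm oO bO hn Lf (cT l) KT (Hs l) (Hu l)).
Qed.

Let LX l : inLt (residual Om f (sigma l) (u l)).
Proof. exact: (residual_L2 oO bO hn Lf (Hs l) (Hu l)). Qed.

Section Limit.
Variable Z : option 'I_n -> E -> R.
Hypothesis LZ : inLt Z.
Hypothesis XZ : (fun l => residual Om f (sigma l) (u l)) ~~> Z.

Let Zh o := residual_meshsize oO bO lO cT q0 q1 decr refined MT MT' hg LX LZ XZ residual_mark o.

Let hbound : exists H, forall l, {ae mu, forall x, Om x -> meshsize (T l) x <= H}.
Proof.
have [H HH] := meshsize_bounded (T 0); exists H; elim=> [|l IH]; first by apply: aeW => x _.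
by apply: filterS2 IH (decr l) => x h1 h2 Ox; exact: le_trans (h2 Ox) (h1 Ox).
Qed.

(** The discrete functions are the nodal interpolants of [phi], admissible because they belong to
    H^1_0. *)
Lemma limit_test phi : test_function Om phi -> ip Z (tjet phi) = 0.
Proof.
move=> tp; have tpT : test_function setT phi.
  by case: tp => sp [K [cK _ K0]]; split => //; exists K; split.
have [C C0 HC] := interp_errors Om kappa0 tpT.
have /choice[v Hv] l := P1_interp oO bO lO (cT l) tp.
have [H hH] := hbound.
apply: (orthogonal_limit mO Ofin (Yl := fun l => wjet (v l)) (h := fun l => meshsize (T l)) (C := C) (H := H) LX LZ XZ) => //.
- by move=> l; have [[Hvl _] _ _] := Hv l; exact: (H10_wjet Hvl).
- exact: (test_jet_L2 oO tp).
- by move=> l; have [Vv _ _] := Hv l; apply: (residual_P1 oO bO hn Lf _ (hu l) (Hs l) Vv) => w [].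
- by move=> l; exact: (in_L2_meshsize oO bO).
- by move=> l x _; exact: meshsize_ge0.
move=> l; have [[Hvl _] wv vE] := Hv l.
have wE : {ae mu, forall x, forall o, Om x -> wjet (v l) o x = jet (v l) (fun x => \row_i mesh_grad (T l) phi i x) o x}.
  by apply: filter_forall => o; exact: (wjetP oO bO (H10_L2 Hvl) wv o).
apply: filterS2 wE (mesh_core_ae (cT l)) => x Hx cx Ox o; rewrite Hx//.
have [K KT cKx] := cx (subset_closure Ox).
have [e0 e1] := HC (T l) K x (cT l) (@sT l) KT cKx.
case: o {Hx} => [i|] /=; last by rewrite (vE K x KT cKx).
by rewrite !mxE /mesh_grad (mesh_sum_ext _ (cT l) KT cKx).
Qed.

(** The discrete fields are the [mesh_rt] interpolants of [phi e_m]; [phi] may be nonzero on the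
    boundary since RT0 imposes no boundary values. *)
Lemma limit_field phi m : test_function setT phi ->
  ip Z (jet (pderiv m phi) (fun x => \row_i ((i == m)%:R * phi x))) = 0.
Proof.
move=> tp; have [C C0 HC] := mesh_rt_errors oO bO lO kappa0 m tp.
have Wt l := mesh_rt_space oO bO lO phi m (cT l).
have [H hH] := hbound.
apply: (orthogonal_limit mO Ofin (Yl := fun l => djet (mesh_rt (T l) phi m)) (h := fun l => meshsize (T l)) (C := C) (H := H) LX LZ XZ) => //.
- by move=> l; exact: (Hdiv_jet (Wt l).1.1).
- move=> o; case: o => [i|] /=; last exact: (test_L2 oO (test_pderiv m tp)).
  by apply: (in_L2_ext mO _ (in_L2Z mO (i == m)%:R (test_L2 oO tp))) => x _; rewrite /jet mxE.
- by move=> l; exact: (residual_RT0 oO bO hn Lf (Hu l) (hs l) (Wt l).1).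
- by move=> l; exact: (in_L2_meshsize oO bO).
- by move=> l x _; exact: meshsize_ge0.
move=> l; apply: filterS2 (wdiv_ae oO bO (Wt l).2) (mesh_core_ae (cT l)) => x Hx cx Ox o.
have [K KT cKx] := cx (subset_closure Ox).
have [e0 e1] := HC (T l) K x (cT l) (@sT l) KT cKx.
by case: o => [i|] /=; [rewrite mxE; exact: e1|rewrite Hx].
Qed.

Lemma limit_residual0 : nm Om Z = 0.
Proof. exact: (residual_eq0 oO bO lO LZ (fun phi tp => limit_test tp) (fun phi m tp => limit_field m tp)). Qed.

End Limit.

Lemma adaptive_cvg u_nl : solves_nl Om f (in_H10 Om) u_nl ->
  (fun l => norm1 Om (fun x => u_nl x - u l x)
    + norm_Hdiv Om (fun x => - wgrad Om u_nl x - sigma l x)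
    + eta Om f (T l) (sigma l) (u l)) @ \oo --> (0 : R).
Proof.
move=> hnl; have Hnl := hnl.1.
have [U HU uU] := galerkin_nl_cvg oO bO hn Lf (V := fun l => P1_space Om (T l))
  (fun l v Vv => Vv.1) (fun l L v lL Vv => P1_nested_le lL Vv) hu.
pose b := norm0 Om f + norm1 Om U + 1.
have f0 := norm0_ge0 Om f; have U0 : 0 <= norm1 Om U by exact: sqrtr_ge0.
have ub l : norm1 Om (u l) <= b.
  apply: (le_trans (galerkin_bound oO bO Lf (V := P1_space Om (T l)) (fun v Vv => Vv.1) (hu l))).
  by rewrite /b -addrA lerDl; apply: addr_ge0.
have b0 : 0 < b by apply: ltr_wpDl; [exact: addr_ge0|exact: ltr01].
have Ub : norm1 Om U <= b by rewrite /b (addrC (norm0 Om f)) -addrA lerDl; apply: addr_ge0.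
have FF := flux_data_cvg oO bO hn f Hu HU ub Ub b0 uU.
have LF l := flux_data_L2 oO bO hn Lf (Hu l); have LF0 := flux_data_L2 oO bO hn Lf HU.
have Ld l := Hdiv_jet (Hs l).
have [S LS XS] : exists2 S, inLt S & (fun l => djet (sigma l)) ~~> S.
  apply: (galerkin_cvg mO Ofin Ld LF LF0 FF) => l L lL.
  exact: (nr_ip oO bO hn Lf (Hu L) (hs L) (RT0_nested_le lL (hs l).1)).
have LZ := inLtB mO LS LF0; have XZ := nm_cvgB mO Ld LF LS LF0 XS FF.
have Z0 := limit_residual0 LZ XZ.
(* Each pair (div sigma_l, sigma_l) is orthogonal to the jets of test functions by the definition of
   the weak divergence, and S is their limit. *)
have Stest phi : test_function Om phi -> ip S (tjet phi) = 0.
  move=> tp; apply: (ip_limit0 mO Ld LS (test_jet_L2 oO tp) XS) => l.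
  have Lg : in_vL2 Om (fun x => \row_i pderiv i phi x) by move=> i; exact: (test_jet_L2 oO tp (Some i)).
  by rewrite (ip_jet oO _ _ (Hs l).1 Lg) ((Hdiv_wdiv (Hs l)).2 _ tp) subrr.
(* Both the limit residual and S are orthogonal to test jets, hence so is their difference
   [flux_data U]; this orthogonality is the weak equation for U. *)
have sU : solves_nl Om f (in_H10 Om) U.
  split=> // v Hv; apply/esym/eqP; rewrite -subr_eq0 -(flux_data_ip oO bO hn Lf HU Hv); apply/eqP.
  apply: (H10_density oO bO LF0 _ Hv) => phi tp; have := limit_test LZ XZ tp.
  by rewrite (ipBl mO LS LF0 (test_jet_L2 oO tp)) (Stest _ tp) sub0r => /eqP; rewrite oppr_eq0 => /eqP.
have uniq := nl_unique oO bO hn hnl sU.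
have LuU := inLtB mO (H10_wjet Hnl) (H10_wjet HU).
have e1 l : norm1 Om (fun x => u_nl x - u l x) <= nm Om (fun o x => wjet (u l) o x - wjet U o x).
  have -> : norm1 Om (fun x => u_nl x - u l x) = nm Om (fun o x => wjet u_nl o x - wjet (u l) o x).
    exact: (norm1B oO bO (H10_H1 Hnl) (H10_H1 (Hu l))).
  by apply: (le_trans (nmB_trans mO (H10_wjet Hnl) (H10_wjet HU) (H10_wjet (Hu l)))); rewrite uniq add0r nmBC.
have e3 l := eta_le_nm oO bO hn Lf (cT l) (Hs l) (Hu l).
(* The limit residual is 0, so the vector part of S is - grad U, and U agrees with [u_nl] by
   uniqueness. *)
have Sflux i : {ae mu, forall x, Om x -> S (Some i) x = - wgrad Om u_nl x ord0 i}.
  apply: filterS2 (nm_eq0_ae mO LZ Z0 (Some i)) (nm_eq0_ae mO LuU uniq (Some i)) => x h1 h2 Ox.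
  have /eqP := h1 Ox; rewrite subr_eq0 => /eqP ->; have /eqP := h2 Ox; rewrite subr_eq0 /= => /eqP ->.
  by rewrite /flux_data /jet mxE.
have Lnl : in_vL2 Om (fun x => - wgrad Om u_nl x).
  by move=> i; exact: (flux_data_L2 oO bO hn Lf Hnl (Some i)).
(* [Stest] makes the limit of the divergences the weak divergence of the limit flux, so S is exactly
   the H(div) pair of the exact flux. *)
have wnl : is_weak_div Om (fun x => - wgrad Om u_nl x) (S None).
  split=> [|phi tp]; first exact: LS.
  have Lg i := test_jet_L2 oO tp (Some i).
  have Lv : in_vL2 Om (fun x => \row_i pderiv i phi x) by move=> i; exact: Lg.
  have S1 := Stest phi tp; rewrite /tuple_ip sum_option in S1.
  apply/eqP; rewrite -addr_eq0 addrC (vinnerE mO Lnl Lv); apply/eqP; rewrite -[RHS]S1; congr (_ + _); apply: eq_bigr => i _.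
  apply: (inner_ae mO (Lnl i) (LS (Some i)) (Lg i) (Lg i)); last by apply: aeW.
  by apply: filterS (Sflux i) => x h Ox; rewrite h// mxE.
have e2 l : norm_Hdiv Om (fun x => - wgrad Om u_nl x - sigma l x) =
    nm Om (fun o x => djet (sigma l) o x - S o x).
  set s := fun x => _ - _; have Lsg : in_vL2 Om s.
    by move=> i; apply: (in_L2_ext mO _ (in_L2B mO (Lnl i) ((Hs l).1 i))) => x _; rewrite !mxE.
  have ws := weak_divB oO Lnl (Hs l).1 wnl (Hdiv_wdiv (Hs l)).
  have wss := wdivP ws.
  rewrite (_ : norm_Hdiv Om s = nm Om (djet s)); last first.
    by rewrite /norm_Hdiv addrC -(nm_jet oO wss.1 Lsg) sqrtr_sqr ger0_norm ?nm_ge0.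
  rewrite nmBC; apply: (nm_ae mO); [|exact: inLtB|].
    by move=> o; case: o => [i|]; [exact: Lsg|exact: wss.1].
  move=> o; case: o => [i|] /=; last exact: (wdiv_ae oO bO ws).
  by apply: filterS (Sflux i) => x h Ox; rewrite h// !mxE.
rewrite [X in _ --> X](_ : 0 = 0 + 0 + 0); last by rewrite !addr0.
apply: cvgD; [apply: cvgD|].
- apply: (squeeze_cvgr _ (cvg_cst 0) uU); apply: nearW => l; rewrite e1 andbT; exact: sqrtr_ge0.
- by rewrite (_ : (fun l => norm_Hdiv _ _) = (fun l => nm Om (fun o x => djet (sigma l) o x - S o x)))//;
    apply/funext => l; exact: e2.
- have c := nm_cvg mO LX LZ XZ; rewrite Z0 in c.
  by apply: (squeeze_cvgr _ (cvg_cst 0) c); apply: nearW => l; rewrite e3 andbT; exact: sqrtr_ge0.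
Qed.

End AdaptiveConvergence.

Theorem theorem10p4 (R : realType) (d : nat) (hd : d = 2%N \/ d = 3%N)
  (Omega : set 'rV[R]_d) (hOmega : lipschitz_domain Omega)
  (f : 'rV[R]_d -> R) (hf : in_L2 Omega f)
  (u_nl : 'rV[R]_d -> R) (hu_nl : solves_nl Omega f (in_H10 Omega) u_nl)
  (* initial triangulation, newest vertex bisection, mesh assumptions *)
  (T0 : mesh R d) (hT0 : conforming_triangulation Omega T0)
  (refine : mesh R d -> mesh R d -> mesh R d)
  (hrefine : is_nvb Omega refine T0)
  (q : R) (hq : 0 < q < 1) (hR1 : R1 Omega refine T0 q)
  (kappa : R) (hkappa : 0 < kappa) (hR2 : R2 refine T0 kappa)
  (hR3 : R3 refine T0)
  (* sequences generated by the adaptive algorithm *)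
  (g : R -> R) (hg : marking_function g)
  (T M : nat -> mesh R d)
  (u : nat -> 'rV[R]_d -> R) (sigma : nat -> 'rV[R]_d -> 'rV[R]_d)
  (hT_init : T 0%N = T0)
  (hu : forall l, solves_nl Omega f (P1_space Omega (T l)) (u l))
  (hsigma : forall l, solves_nr Omega f (T l) (u l) (sigma l))
  (hM : forall l, (M l `<=` T l)%fset)
  (hmark : forall l, marking Omega f g (T l) (M l) (sigma l) (u l))
  (hT_next : forall l, T l.+1 = refine (T l) (M l)) :
  let sigma_nl := fun x => - wgrad Omega u_nl x in
  (fun l => norm1 Omega (fun x => u_nl x - u l x)
            + norm_Hdiv Omega (fun x => sigma_nl x - sigma l x)
            + eta Omega f (T l) (sigma l) (u l)) @ \oo --> (0 : R).
Proof.
have [bO oO _ lO] := hOmega; have /andP[q0 q1] := hq.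
have refT l : refinements refine T0 (T l).
  elim: l => [|l IH]; first by rewrite hT_init; exact: refinements_refl.
  by rewrite hT_next; apply: refinements_step.
have admT l : [/\ nvb_refines (T l) (T l.+1), conforming_triangulation Omega (T l.+1)
    & (M l `&` T l.+1 = fset0)%fset].
  by rewrite hT_next; have [] := hrefine _ _ (refT l) (hM l).
have cT l : conforming_triangulation Omega (T l).
  by case: l => [|l]; [rewrite hT_init|have [] := admT l].
have next l : refinements refine (T l) (T l.+1).
  by rewrite hT_next; apply: refinements_step; [exact: refinements_refl|].
apply: (adaptive_cvg (kappa := kappa) (q := q) (g := g) (M := M) oO bO lO hd hf cT) => //.
- by move=> l; have [] := admT l.
- exact: ltW.
- by move=> l K; exact: hR2.
- move=> l K KM; have := hR3 _ _ (refT l) (hM l); rewrite -hT_next => /fsetP/(_ K).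
  by rewrite in_fsetI KM in_fset0 => /= ->.
- by move=> l; have [] := hR1 _ _ (refT l) (next l).
- by move=> l K KT KT'; have [_] := hR1 _ _ (refT l) (next l); apply.
Qed.
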